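(* Let $R$ be a (commutative) smooth $\mathbb{Z}$-algebra, let $\mathfrak{a}$ be an ideal of $R$, and let $k$ be a nonnegative integer. Then the set $\operatorname{Ass}_R H^k_{\mathfrak{a}}(R)$ of associated primes of the local cohomology module $H^k_{\mathfrak{a}}(R)$ is finite.
   Context: A commutative algebra $R$ over a commutative ring $A$ is called smooth over $A$ if $R$ is a finitely presented and flat $A$-algebra such that for each prime ideal $\mathfrak{p}$ of $A$, the fiber $R_{\mathfrak{p}}/\mathfrak{p}R_{\mathfrak{p}}$ is geometrically regular over the field $A_{\mathfrak{p}}/\mathfrak{p}A_{\mathfrak{p}}$. Here $H^k_{\mathfrak{a}}(R)$ denotes the $k$-th local cohomology module of $R$ with support in $\mathfrak{a}$. *)

(* Defs.v *)
(* Conventions.  Rings are commutative with 1, possibly zero (comPzRingType), and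
   an A-algebra is a ring R together with a morphism phi : A -> R.  Ideals and
   other subsets are classical sets.  Objects defined up to unique isomorphism
   (quotients, localizations, tensor products, fibers, local cohomology) are
   described by predicates rather than by a chosen construction. *)
From HB Require Import structures.
From mathcomp Require Import all_boot all_order all_algebra all_field.
From mathcomp Require Import boolp classical_sets cardinality.
From mathcomp Require Import mpoly.

Set Implicit Arguments.
Unset Strict Implicit.
Unset Printing Implicit Defensive.
Import GRing.Theory.
Local Open Scope classical_set_scope.
Local Open Scope ring_scope.

(* ** Ideals *)

Definition is_ideal (R : comPzRingType) (I : set R) : Prop :=
  [/\ I 0, forall x y, I x -> I y -> I (x + y) & forall r x, I x -> I (r * x)].

Definition prime_ideal (R : comPzRingType) (P : set R) : Prop :=
  [/\ is_ideal P, ~ P 1 & forall x y, P (x * y) -> P x \/ P y].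

Definition maximal_ideal (R : comPzRingType) (m : set R) : Prop :=
  [/\ is_ideal m, ~ m 1 &
      forall I : set R, is_ideal I -> ~ I 1 -> m `<=` I -> I = m].

Definition ideal_gen (R : comPzRingType) (S : set R) : set R :=
  smallest (@is_ideal R) S.

Fixpoint ideal_pow (R : comPzRingType) (a : set R) (n : nat) : set R :=
  if n is m.+1 then
    ideal_gen [set z | exists x y, [/\ a x, ideal_pow a m y & z = x * y]]
  else setT.

Definition fg_ideal (R : comPzRingType) (I : set R) : Prop :=
  exists s : seq R, I = ideal_gen [set` s].

Definition noetherian (R : comPzRingType) : Prop :=
  forall I : set R, is_ideal I -> fg_ideal I.

(* ** Quotients and localizations *)

Definition is_quotient (R S : comPzRingType) (I : set R)
    (f : {rmorphism R -> S}) : Prop :=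
  (forall y, exists x, f x = y) /\ (forall x, f x = 0 <-> I x).

Definition is_unit (R : comPzRingType) (x : R) : Prop := exists y, x * y = 1.

(* S = M^-1 R, for M a multiplicative subset of R. *)
Definition is_localization (R S : comPzRingType) (M : set R)
    (f : {rmorphism R -> S}) : Prop :=
  [/\ forall m, M m -> is_unit (f m),
      forall y, exists x m, M m /\ y * f m = f x &
      forall x, f x = 0 <-> exists2 m, M m & m * x = 0].

(* ** Regular rings *)

Definition prime_chain (R : comPzRingType) (n : nat) (p : nat -> set R) : Prop :=
  (forall i, (i <= n)%N -> prime_ideal (p i)) /\
  (forall i, (i < n)%N -> p i `<` p i.+1).

Definition krull_dim_eq (R : comPzRingType) (d : nat) : Prop :=
  (exists p : nat -> set R, prime_chain d p) /\
  (forall n (p : nat -> set R), prime_chain n p -> (n <= d)%N).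

Definition min_generators_eq (R : comPzRingType) (I : set R) (d : nat) : Prop :=
  (exists2 s : seq R, size s = d & I = ideal_gen [set` s]) /\
  (forall s : seq R, I = ideal_gen [set` s] -> (d <= size s)%N).

Definition regular_local_ring (R : comPzRingType) : Prop :=
  noetherian R /\
  exists m : set R,
    [/\ maximal_ideal m,
        forall m' : set R, maximal_ideal m' -> m' = m &
        exists2 d, krull_dim_eq R d & min_generators_eq m d].

Definition regular_ring (R : comPzRingType) : Prop :=
  noetherian R /\
  forall (q : set R) (Rq : comPzRingType) (f : {rmorphism R -> Rq}),
    prime_ideal q -> is_localization (~` q) f -> regular_local_ring Rq.

(* ** Geometric regularity *)

(* S = R1 (x)_A R2, as the coproduct of R1 and R2 among commutative A-algebras. *)
Definition is_algebra_tensor (A R1 R2 S : comPzRingType)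
    (f1 : {rmorphism A -> R1}) (f2 : {rmorphism A -> R2})
    (g1 : {rmorphism R1 -> S}) (g2 : {rmorphism R2 -> S}) : Prop :=
  (forall x, g1 (f1 x) = g2 (f2 x)) /\
  forall (T : comPzRingType)
      (h1 : {rmorphism R1 -> T}) (h2 : {rmorphism R2 -> T}),
    (forall x, h1 (f1 x) = h2 (f2 x)) ->
    exists h : {rmorphism S -> T},
      [/\ forall x, h (g1 x) = h1 x, forall x, h (g2 x) = h2 x &
          forall h' : {rmorphism S -> T},
            (forall x, h' (g1 x) = h1 x) -> (forall x, h' (g2 x) = h2 x) ->
            forall y, h' y = h y].

(* F (x)_k K is regular for every finite field extension K of k. *)
Definition geometrically_regular (k : fieldType) (F : comPzRingType)
    (psi : {rmorphism k -> F}) : Prop :=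
  forall (K : fieldExtType k) (S : comPzRingType)
      (g1 : {rmorphism F -> S}) (g2 : {rmorphism K -> S}),
    is_algebra_tensor psi (GRing.in_alg K) g1 g2 -> regular_ring S.

(* ** Smooth algebras *)

Definition finitely_presented (A : comNzRingType) (R : comPzRingType)
    (phi : {rmorphism A -> R}) : Prop :=
  exists (n : nat) (f : {rmorphism {mpoly A[n]} -> R}),
    [/\ forall c, f c%:MP = phi c,
        forall y, exists x, f x = y &
        fg_ideal [set x | f x = 0]].

(* For A-modules M and P, A-bilinear maps M x R -> P, where R is an A-module
   through phi. *)
Definition is_bilinear (A R : comPzRingType) (phi : {rmorphism A -> R})
    (M P : lmodType A) (b : M -> R -> P) : Prop :=
  (forall (c : A) x y r, b (c *: x + y) r = c *: b x r + b y r) /\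
  (forall (c : A) x r s, b x (phi c * r + s) = c *: b x r + b x s).

(* T = M (x)_A R, with universal bilinear map b. *)
Definition is_tensor (A R : comPzRingType) (phi : {rmorphism A -> R})
    (M T : lmodType A) (b : M -> R -> T) : Prop :=
  is_bilinear phi b /\
  forall (P : lmodType A) (c : M -> R -> P), is_bilinear phi c ->
    exists2 h : {linear T -> P}, (forall x r, h (b x r) = c x r) &
      forall h' : {linear T -> P},
        (forall x r, h' (b x r) = c x r) -> forall t, h' t = h t.

Definition flat (A R : comPzRingType) (phi : {rmorphism A -> R}) : Prop :=
  forall (M N : lmodType A) (f : {linear M -> N}), injective f ->
  forall (TM TN : lmodType A) (bM : M -> R -> TM) (bN : N -> R -> TN)
      (g : {linear TM -> TN}),
    is_tensor phi bM -> is_tensor phi bN ->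
    (forall x r, g (bM x r) = bN (f x) r) ->
    injective g.

(* psi : k -> F is the map A_p / p A_p -> R_p / p R_p induced by phi. *)
Definition is_fiber (A R : comPzRingType) (phi : {rmorphism A -> R}) (p : set A)
    (k : fieldType) (F : comPzRingType) (psi : {rmorphism k -> F}) : Prop :=
  exists (Ap Rp : comPzRingType)
      (lA : {rmorphism A -> Ap}) (lR : {rmorphism R -> Rp})
      (phip : {rmorphism Ap -> Rp})
      (qA : {rmorphism Ap -> k}) (qR : {rmorphism Rp -> F}),
    [/\ is_localization (~` p) lA,
        is_localization (phi @` (~` p)) lR,
        is_quotient (ideal_gen (lA @` p)) qA,
        is_quotient (ideal_gen ((lR \o phi) @` p)) qR &
        (forall x, phip (lA x) = lR (phi x)) /\
        (forall y, psi (qA y) = qR (phip y))].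

Definition smooth (A : comNzRingType) (R : comPzRingType)
    (phi : {rmorphism A -> R}) : Prop :=
  [/\ finitely_presented phi,
      flat phi &
      forall p : set A, prime_ideal p ->
      forall (k : fieldType) (F : comPzRingType) (psi : {rmorphism k -> F}),
        is_fiber phi p psi -> geometrically_regular psi].

(* ** Local cohomology, as the right derived functors of the a-torsion functor *)

Definition is_injective_module (R : comPzRingType) (I : lmodType R) : Prop :=
  forall (M N : lmodType R) (f : {linear M -> N}) (g : {linear M -> I}),
    injective f -> exists h : {linear N -> I}, forall x, h (f x) = g x.

Definition is_injective_resolution (R : comPzRingType) (M : lmodType R)
    (I : nat -> lmodType R) (e : {linear M -> I 0%N})
    (d : forall n, {linear I n -> I n.+1}) : Prop :=
  [/\ forall n, is_injective_module (I n),
      injective e,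
      forall x, d 0%N x = 0 <-> exists y, e y = x &
      forall n x, d n.+1 x = 0 <-> exists y, d n y = x].

Definition torsion (R : comPzRingType) (a : set R) (M : lmodType R) : set M :=
  [set x | exists n, forall r, ideal_pow a n r -> r *: x = 0].

Definition torsion_cocycles (R : comPzRingType) (a : set R)
    (I : nat -> lmodType R) (d : forall n, {linear I n -> I n.+1}) (k : nat) :
    set (I k) :=
  [set x | @torsion R a (I k) x /\ d k x = 0].

Definition torsion_coboundaries (R : comPzRingType) (a : set R)
    (I : nat -> lmodType R) (d : forall n, {linear I n -> I n.+1}) (k : nat) :
    set (I k) :=
  match k return set (I k) with
  | 0 => [set 0]
  | j.+1 => d j @` @torsion R a (I j)
  end.

Arguments torsion_cocycles {R} a {I} d k _.
Arguments torsion_coboundaries {R} a {I} d k _.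

(* H = Z / B through pi; the values of pi outside Z are irrelevant. *)
Definition is_subquotient (R : comPzRingType) (M H : lmodType R) (Z B : set M)
    (pi : M -> H) : Prop :=
  [/\ forall (c : R) x y, Z x -> Z y -> pi (c *: x + y) = c *: pi x + pi y,
      forall h, exists2 x, Z x & pi x = h &
      forall x, Z x -> (pi x = 0 <-> B x)].

(* H is (isomorphic to) the k-th local cohomology module of M with support in a. *)
Definition is_local_cohomology (R : comPzRingType) (a : set R) (k : nat)
    (M H : lmodType R) : Prop :=
  exists (I : nat -> lmodType R) (e : {linear M -> I 0%N})
      (d : forall n, {linear I n -> I n.+1}),
    is_injective_resolution e d /\
    exists pi : I k -> H,
      is_subquotient (torsion_cocycles a d k) (torsion_coboundaries a d k) pi.

(* ** Associated primes *)

Definition Ass (R : comPzRingType) (M : lmodType R) : set (set R) :=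
  [set P | prime_ideal P /\ exists x : M, P = [set r | r *: x = 0]].

(* Main.v *)
(** Write R = S / I with S = Z[x_1, ..., x_n].  Smoothness enters through charts only: R is
    Z-flat with geometrically regular fibers, so near any prime P a maximal family
    h_1, ..., h_c in I whose gradients are independent at a geometric point over P generates
    I, is regular, and has an invertible Jacobian minor, all after inverting some g not in P;
    Nakayama's lemma carries this from the fiber to S.  By the ascending chain condition
    finitely many such g suffice for all P.

    Local cohomology is the colimit of the Koszul cohomologies of the powers of generators F
    of the ideal, so an associated prime is the annihilator of a Koszul class.  On a chart,
    y g - 1, h_1, ..., h_c is a regular sequence in Z[y, x], and Newton iteration on the
    Jacobian matrix gives ring endomorphisms that are sections modulo powers of its terms.
    They embed the cohomology of a hypersurface, up to annihilators, into that of the ambient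
    ring with the equation as one more generator; removing the equations one by one reduces
    the chart to the polynomial ring Z[y, x].

    Over a field, the Čech modules of a polynomial ring have finite length over the divided
    differential operators, in every characteristic.  This bounds the primes that meet Z in
    0 (over Q) and, for each prime number p, those that contain p (over F_p).  If p divides
    no F_i and the cokernel of the first Koszul differential has no p-torsion, then no P
    contains p: cocycles modulo p with poles of order one lift to Z, and by finite length
    Frobenius and the divided operators produce all cocycles from these. *)
From HB Require Import structures.
Require Import Defs.
From mathcomp Require Import all_boot all_order all_fingroup all_algebra all_field.
From mathcomp Require Import boolp classical_sets cardinality.
From mathcomp Require Import mpoly ring zify.

Set Implicit Arguments.
Unset Strict Implicit.
Unset Printing Implicit Defensive.
Import Order.TTheory GRing.Theory Num.Theory.
Local Open Scope classical_set_scope.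
Local Open Scope ring_scope.
(** * Ideals and chain conditions *)

(** Over Z, finite length fails (already Z[1/p]/Z has infinite length over Z), and the danger is
    p-torsion classes for infinitely many p. A class killed by p comes, by a Bockstein argument,
    from a cocycle modulo p that does not lift to Z. The liftable cocycles are stable under the
    divided operators, because a divided derivative of an integral cocycle is again an integral
    cocycle. Hence Frobenius descent applies to them and leaves only poles of order one. There the
    obstruction is p-torsion in the cokernel of one Koszul differential, a finitely generated module
    over Z[x]: the condition on p does not depend on the class, and it excludes finitely many p.

    A chart carries no divided operators of its own here; it is only compared with the ambient
    polynomial ring. A genuine retraction onto a hypersurface need not exist, but a relation between
    Koszul classes involves a bounded power of the equation, so sections modulo each power are
    enough. Annihilators of single classes are transported throughout, rather than cohomology
    modules. *)

Definition is_submod (R : comPzRingType) (M : lmodType R) (N : set M) : Prop :=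
  [/\ N 0, forall x y, N x -> N y -> N (x + y) & forall r x, N x -> N (r *: x)].

Definition accm (R : comPzRingType) (M : lmodType R) : Prop :=
  forall N : nat -> set M, (forall n, is_submod (N n)) ->
    (forall n, N n `<=` N n.+1) ->
    exists m, forall n, (m <= n)%N -> N n `<=` N m.

Definition acc (R : comPzRingType) : Prop :=
  forall I : nat -> set R, (forall n, is_ideal (I n)) ->
    (forall n, I n `<=` I n.+1) ->
    exists m, forall n, (m <= n)%N -> I n `<=` I m.

(** The generators are the first [n] terms of a sequence defined everywhere, so that truncating,
    shifting and extending a family never changes its type. *)
Definition nspan (R : comPzRingType) (h : nat -> R) (n : nat) : set R :=
  [set x | exists c : nat -> R, x = \sum_(l < n) c l * h l].

Section Ideals.
Variable R : comPzRingType.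
Implicit Types (I J : set R) (h : nat -> R).

Lemma idealN I x : is_ideal I -> I x -> I (- x).
Proof. by move=> [_ _ hM] /(hM (-1)); rewrite mulN1r. Qed.

Lemma idealB I x y : is_ideal I -> I x -> I y -> I (x - y).
Proof. by move=> hI hx /(idealN hI); case: hI => _ + _; apply. Qed.

Lemma idealMr I x r : is_ideal I -> I x -> I (x * r).
Proof. by move=> [_ _ hM] /(hM r); rewrite mulrC. Qed.

Lemma ideal_sum I (T : Type) (s : seq T) (P : pred T) (F : T -> R) :
  is_ideal I -> (forall i, P i -> I (F i)) -> I (\sum_(i <- s | P i) F i).
Proof. by move=> [h0 hD _] hF; elim/big_ind: _. Qed.

Lemma nspan_ideal h n : is_ideal (nspan h n).
Proof.
split.
- by exists (fun=> 0); rewrite big1 // => i _; rewrite mul0r.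
- move=> x y [c ->] [d ->]; exists (fun i => c i + d i).
  by rewrite -big_split; apply: eq_bigr => i _; rewrite mulrDl.
- move=> r x [c ->]; exists (fun i => r * c i).
  by rewrite mulr_sumr; apply: eq_bigr => i _; rewrite mulrA.
Qed.

Lemma nspan_mem h n i : (i < n)%N -> nspan h n (h i).
Proof.
move=> lin; exists (fun j => (j == i)%:R).
rewrite (bigD1 (Ordinal lin)) //= eqxx mul1r big1 ?addr0 // => j.
by rewrite -val_eqE /= => /negbTE ->; rewrite mul0r.
Qed.

Lemma nspan_sub h n I :
  is_ideal I -> (forall i, (i < n)%N -> I (h i)) -> nspan h n `<=` I.
Proof.
move=> hI hh x [c ->]; apply: ideal_sum => // i _.
by case: hI => _ _; apply; apply: hh.
Qed.

Lemma nspanS h n x : nspan h n.+1 x <-> exists c, nspan h n (x - c * h n).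
Proof.
split=> [[c ->]|[c [d e]]].
  by exists (c n); rewrite big_ord_recr /= addrK; exists c.
exists (fun i => if i == n then c else d i).
rewrite big_ord_recr /= eqxx -[LHS](subrK (c * h n)) e; congr (_ + _).
by apply: eq_bigr => i _; rewrite ltn_eqF.
Qed.

Lemma nspan_le h n m : (n <= m)%N -> nspan h n `<=` nspan h m.
Proof.
move=> le; apply: nspan_sub; first exact: nspan_ideal.
by move=> i lin; apply: nspan_mem; apply: leq_trans le.
Qed.

Lemma ideal_genP (X : set R) : is_ideal (ideal_gen X).
Proof.
split; first by move=> I [[]].
  by move=> x y hx hy I hI; case: (hI) => -[_ + _ _]; apply; [apply: hx|apply: hy].
by move=> r x hx I hI; case: (hI) => -[_ _ + _]; apply; apply: hx.
Qed.

Lemma ideal_gen_min (X : set R) I :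
  is_ideal I -> X `<=` I -> ideal_gen X `<=` I.
Proof. by move=> hI hX; apply: smallest_sub. Qed.

Lemma ideal_gen_mem (X : set R) : X `<=` ideal_gen X.
Proof. exact: sub_gen_smallest. Qed.

Lemma ideal_gen_seq (s : seq R) :
  ideal_gen [set` s] = nspan (nth 0 s) (size s).
Proof.
apply/seteqP; split.
  apply: ideal_gen_min; first exact: nspan_ideal.
  by move=> x /= /(nthP 0) [i li <-]; apply: nspan_mem.
apply: nspan_sub; first exact: ideal_genP.
by move=> i li; apply: ideal_gen_mem; apply: mem_nth.
Qed.

Lemma chain_le (T : Type) (N : nat -> set T) :
  (forall n, N n `<=` N n.+1) -> forall m n, (m <= n)%N -> N m `<=` N n.
Proof.
move=> hN m n /subnKC <-; elim: (n - m)%N => [|k IH]; first by rewrite addn0.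
by rewrite addnS => x /IH /hN.
Qed.

(** Were no finite list enough, adjoining an element outside the current span again and again would
    give a strictly increasing chain. [X] need not be an ideal and contains its generators; the
    family of charts is handled in this way. *)
Lemma acc_fg (hR : acc R) (X : set R) :
  exists n h, (forall i, (i < n)%N -> X (h i)) /\ X `<=` nspan h n.
Proof.
apply: contrapT => hno.
have {}hno (s : seq R) : exists x, (forall y, y \in s -> X y) ->
    X x /\ ~ nspan (nth 0 s) (size s) x.
  have [hs|hs] := pselect (forall y, y \in s -> X y); last by exists 0.
  apply: contrapT => hx; apply: hno; exists (size s), (nth 0 s); split.
    by move=> i li; apply/hs/mem_nth.
  by move=> x Xx; apply: contrapT => hn; apply: hx; exists x.
have [g hg] := choice hno.
pose sq n := iter n (fun s => rcons s (g s)) [::].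
have hsq n : forall y, y \in sq n -> X y.
  elim: n => [//|n IH] y; rewrite /= mem_rcons inE => /orP[/eqP ->|]; last exact: IH.
  by have [] := hg _ IH.
have ssq n : size (sq n) = n by elim: n => //= n IH; rewrite size_rcons IH.
have hin n : nspan (nth 0 (sq n.+1)) n.+1 (g (sq n)).
  have := @ideal_gen_mem [set` sq n.+1] (g (sq n)).
  by rewrite ideal_gen_seq ssq; apply; rewrite /= mem_rcons inE eqxx.
have [||m /(_ m.+1 (leqnSn m))] := hR (fun n => nspan (nth 0 (sq n)) n).
- by move=> n; apply: nspan_ideal.
- move=> n; apply: nspan_sub; first exact: nspan_ideal.
  move=> i li; have -> : nth 0 (sq n) i = nth 0 (sq n.+1) i.
    by rewrite /= nth_rcons ssq li.
  by apply: nspan_mem; apply: ltnW.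
- by move=> /(_ _ (hin m)); have [_] := hg _ (hsq m); rewrite ssq.
Qed.

Lemma acc_max (hR : acc R) (F : set (set R)) :
  (forall I, F I -> is_ideal I) -> (exists I, F I) ->
  exists2 I, F I & forall I', F I' -> I `<=` I' -> I' `<=` I.
Proof.
move=> hF [I0 FI0]; apply: contrapT => hno.
have {}hno I : exists I', F I -> [/\ F I', I `<=` I' & ~ I' `<=` I].
  have [FI|FI] := pselect (F I); last by exists I.
  apply: contrapT => hx; apply: hno; exists I => // I' FI' sub.
  by apply: contrapT => hn; apply: hx; exists I'.
have [g hg] := choice hno.
pose sq n := iter n g I0.
have hsq n : F (sq n) by elim: n => //= n IH; have [] := hg _ IH.
have [||m /(_ m.+1 (leqnSn m))] := hR sq.
- by move=> n; apply: hF.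
- by move=> n; have [] := hg _ (hsq n).
- by have [] := hg _ (hsq m).
Qed.

Lemma max_ideal_ex (hR : acc R) I : is_ideal I -> ~ I 1 ->
  exists2 m, maximal_ideal m & I `<=` m.
Proof.
move=> hI hI1.
have [||m [hm hm1 Im] mmax] :=
  @acc_max hR [set J | [/\ is_ideal J, ~ J 1 & I `<=` J]].
- by move=> J [].
- by exists I; split.
exists m => //; split=> // J hJ J1 mJ; apply/seteqP; split=> //.
by apply: mmax => //; split=> //; apply: subset_trans mJ.
Qed.

End Ideals.

Lemma acc_surj (R R' : comPzRingType) (f : {rmorphism R -> R'}) :
  (forall y, exists x, f x = y) -> acc R -> acc R'.
Proof.
move=> surj hR I hI sI.
have [||m hm] := hR (fun n => f @^-1` I n).
- move=> n; have [h0 hD hM] := hI n; split.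
  + by rewrite /preimage /= rmorph0.
  + by move=> x y; rewrite /preimage /= rmorphD; apply: hD.
  + by move=> r x; rewrite /preimage /= rmorphM; apply: hM.
- by move=> n x; apply: sI.
- by exists m => n lmn y; have [x <-] := surj y; apply: hm.
Qed.

Lemma acc_of_field (R : comPzRingType) :
  (forall x : R, x <> 0 -> exists y, y * x = 1) -> acc R.
Proof.
move=> inv I hI sI.
have [[m [x [Im nx]]]|hno] := pselect (exists m x, I m x /\ x <> 0).
  exists m => n _ y _; have [z zx] := inv _ nx.
  have [_ _ hM] := hI m; have := hM y _ (hM z _ Im).
  by rewrite zx mulr1.
exists 0%N => n _ x Ix; have -> : x = 0.
  by apply: contrapT => nx; apply: hno; exists n, x.
by have [] := hI 0%N.
Qed.

Lemma acc_int : acc int.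
Proof.
move=> I hI sI.
have [[m [x [Im nx]]]|hno] := pselect (exists m x, I m x /\ x <> 0); last first.
  exists 0%N => n _ x Ix; have -> : x = 0.
    by apply: contrapT => nx; apply: hno; exists n, x.
  by have [] := hI 0%N.
(* The least positive integer [d] in any of the ideals: once [d] is present, division with remainder
   makes every element of the later ideals a multiple of [d]. *)
have hex : exists d : nat, `[< (0 < d)%N /\ exists n, I n d%:Z >].
  exists `|x|%N; apply/asboolP; split; first by rewrite absz_gt0; apply/eqP.
  exists m; rewrite abszE; case: (ger0P x) => _; first exact: Im.
  by apply: idealN.
have [d /asboolP[d0 [n0 Id]] dmin] := ex_minnP hex.
exists n0 => n le y Iy.
have Ind : I n d%:Z by apply: chain_le le _ Id.
have Ir : I n ((y %% d%:Z)%Z).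
  rewrite /modz; apply: idealB => //; have [_ _] := hI n; apply; exact: Ind.
have r0 : (y %% d%:Z)%Z = 0.
  have rge : 0 <= (y %% d%:Z)%Z by apply: modz_ge0; rewrite -lt0n.
  have rlt : (y %% d%:Z)%Z < d%:Z by apply: ltz_pmod.
  case: (y %% d%:Z)%Z rge rlt Ir => // r _ lt Ir.
  have [->//|r0] := posnP r.
  have := dmin r; rewrite (_ : `[< _ >] = true); last first.
    by apply/asboolP; split=> //; exists n.
  by move=> /(_ isT); rewrite leqNgt; move: lt; rewrite ltz_nat => ->.
rewrite (divz_eq y d%:Z) r0 addr0; have [_ _] := hI n0; apply; exact: Id.
Qed.

(** * Hilbert's basis theorem *)

Section HilbertBasis.
Variable R : comNzRingType.

Let lc (I : set {poly R}) d : set R :=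
  [set a | exists p, [/\ I p, (size p <= d.+1)%N & p`_d = a]].

Let lc_ideal I d : is_ideal I -> is_ideal (lc I d).
Proof.
move=> [h0 hD hM]; split.
- by exists 0; rewrite size_poly0 coef0.
- move=> a b [p [Ip sp <-]] [q [Iq sq <-]]; exists (p + q); split.
  + exact: hD.
  + by apply: leq_trans (size_polyD _ _) _; rewrite geq_max sp.
  + by rewrite coefD.
- move=> r a [p [Ip sp <-]]; exists (r%:P * p); split; first exact: hM.
  + by rewrite mul_polyC; apply: leq_trans (size_scale_leq _ _) _.
  + by rewrite coefCM.
Qed.

Let lc_shift I d : is_ideal I -> lc I d `<=` lc I d.+1.
Proof.
move=> [h0 hD hM] a [p [Ip sp <-]]; exists ('X * p); split; first exact: hM.
  have [->|p0] := eqVneq p 0; first by rewrite mulr0 size_poly0.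
  by rewrite mulrC size_mulX.
by rewrite coefXM.
Qed.

Let lc_le I d d' : is_ideal I -> (d <= d')%N -> lc I d `<=` lc I d'.
Proof. by move=> hI; apply: chain_le => n; apply: lc_shift. Qed.

(** The ideals [lc (I j) d] grow in both indices. Their diagonal is constant from [m] on, which
    settles all [d >= m] at once; the finitely many smaller [d] stabilize one by one. An element of
    a later ideal then loses its top coefficient by subtracting an element of [I M]. *)
Lemma acc_poly : acc R -> acc {poly R}.
Proof.
move=> hR I hI sI.
have lcI j j' d : (j <= j')%N -> lc (I j) d `<=` lc (I j') d.
  by move=> le a [p [Ip sp e]]; exists p; split=> //; apply: chain_le le _ Ip.
have [||m hm] := hR (fun j => lc (I j) j).
- by move=> n; apply: lc_ideal.
- by move=> n a /(lc_shift (hI n)); apply: lcI.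
have hcol d : exists M, forall n, (M <= n)%N -> lc (I n) d `<=` lc (I M) d.
  by apply: hR => n; [apply: lc_ideal|apply: lcI].
have [g hg] := choice hcol.
pose M := (m + \sum_(d < m) g d)%N.
have hM n d : (M <= n)%N -> lc (I n) d `<=` lc (I M) d.
  move=> leMn a ha; have [ledm|lemd] := ltnP d m.
    have gM : (g d <= M)%N.
      by rewrite /M (bigD1 (Ordinal ledm)) //= addnA addnAC leq_addl.
    by apply: (lcI _ _ _ gM); apply: hg ha; apply: leq_trans gM _.
  have lemM : (m <= M)%N by apply: leq_addr.
  have : lc (I (maxn n d)) (maxn n d) a.
    apply: (lc_le (hI _) (leq_maxr n d)); exact: lcI (leq_maxl n d) _ ha.
  move=> /hm; rewrite (leq_trans lemM (leq_trans leMn (leq_maxl _ _))) => /(_ isT).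
  move=> /(lc_le (hI m) lemd); exact: lcI.
exists M => n leMn.
suff main k (p : {poly R}) : (size p <= k)%N -> I n p -> I M p by move=> p; apply: main (leqnn _).
elim: k p => [|k IH] p.
  by rewrite leqn0 size_poly_eq0 => /eqP -> _; have [] := hI M.
move=> sp Ip; have : lc (I M) k p`_k by apply: hM leMn _ _; exists p.
move=> [q [Iq sq eq]].
have Ipq : I n (p - q).
  by apply: (idealB (hI n)) => //; apply: chain_le leMn _ Iq.
rewrite -(subrK q p); have [_ + _] := hI M; apply=> //; apply: IH Ipq.
apply/leq_sizeP => j; rewrite leq_eqVlt => /predU1P[<-|lt].
  by rewrite coefB eq subrr.
by rewrite coefB !nth_default ?subrr //; [apply: leq_trans sq _|apply: leq_trans sp _].
Qed.

End HilbertBasis.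

Lemma mpoly_subring_ind (R : comNzRingType) n (Q : {mpoly R[n]} -> Prop) :
  (forall c, Q c%:MP) -> (forall i, Q 'X_i) ->
  (forall p q, Q p -> Q q -> Q (p + q)) -> (forall p q, Q p -> Q q -> Q (p * q)) ->
  forall p, Q p.
Proof.
move=> hC hX hD hM p; rewrite [p]mpolyE; elim/big_ind: _ => //.
  by rewrite -(mpolyC0 n R).
move=> m _; rewrite -mul_mpolyC; apply: (hM); first exact: hC.
rewrite mpolyXE_id; apply: (big_ind Q); [by rewrite -(mpolyC1 n R)|exact: hM|].
move=> i _; move: (m i) => k; elim: k => [|k IH]; first by rewrite expr0 -(mpolyC1 n R).
by rewrite exprS; apply: hM.
Qed.

Lemma mpoly_rmorph_eq (R : comNzRingType) n (T : comPzRingType)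
    (f g : {rmorphism {mpoly R[n]} -> T}) :
  (forall c, f c%:MP = g c%:MP) -> (forall i, f 'X_i = g 'X_i) -> f =1 g.
Proof.
move=> hC hX; apply: mpoly_subring_ind => //.
  by move=> p q; rewrite !rmorphD => -> ->.
by move=> p q; rewrite !rmorphM => -> ->.
Qed.

Lemma acc_mpoly (R : comNzRingType) n : acc R -> acc {mpoly R[n]}.
Proof.
move=> hR; elim: n => [|n IH].
  apply: (@acc_surj _ _ (@mpolyC 0 R)) hR => p; exists p@_0.
  apply/mpolyP => m; rewrite mcoeffC; have -> : m = 0%MM by apply/mnmP => -[].
  by rewrite eqxx mulr1.
have cm : commr_rmorph (@mwiden n R) ('X_ord_max : {mpoly R[n.+1]}).
  by move=> x; apply: mulrC.
apply: (@acc_surj _ _ (horner_morph cm)) (acc_poly IH).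
apply: mpoly_subring_ind.
- by move=> c; exists (c%:MP)%:P; rewrite /= horner_morphC /=; apply: mwidenC.
- move=> i; have [lt|ge] := ltnP i n.
    exists ('X_(Ordinal lt))%:P; rewrite /= horner_morphC /= [LHS]mwidenX mnmwiden1.
    by congr 'X_[_]; congr U_(_)%MM; apply: val_inj.
  exists 'X; rewrite /= horner_morphX; congr 'X_[_]; congr U_(_)%MM.
  by apply: val_inj; apply/eqP; rewrite eqn_leq ge -ltnS ltn_ord.
- by move=> p q [x <-] [y <-]; exists (x + y); rewrite rmorphD.
- by move=> p q [x <-] [y <-]; exists (x * y); rewrite rmorphM.
Qed.

(** The determinant trick. *)
Lemma nakayama (R : comNzRingType) (J b : set R) (w : R) (N : nat) (u : nat -> R) :
  is_ideal J -> is_ideal b ->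
  (forall j, (j < N)%N -> exists c : nat -> R,
     (forall l, b (c l)) /\ J (w * u j - \sum_(l < N) c l * u l)) ->
  exists2 e, b e & forall j, (j < N)%N -> J ((w ^+ N + e) * u j).
Proof.
move=> hJ hb hu.
have {}hu (j : 'I_N) : exists c : nat -> R,
    (forall l, b (c l)) /\ J (w * u j - \sum_(l < N) c l * u l) by apply: hu.
have [c hc] := choice hu.
pose A : 'M[R]_N := \matrix_(i, j) (w *+ (i == j) - c i j).
exists (\det A - w ^+ N); last first.
  move=> j lj; rewrite addrC subrK.
  have e : \det A * u j =
      \sum_i (\adj A) (Ordinal lj) i * (w * u i - \sum_(l < N) c i l * u l).
    transitivity (((\adj A *m A) *m \col_i u i) (Ordinal lj) 0).
      by rewrite mul_adj_mx mul_scalar_mx !mxE.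
    rewrite -mulmxA mxE; apply: eq_bigr => i _; congr (_ * _); rewrite mxE.
    under eq_bigr => l _ do rewrite !mxE mulrBl.
    rewrite sumrB; congr (_ - _); rewrite (bigD1 i) //= eqxx mulr1n big1 ?addr0 //.
    by move=> l /negbTE; rewrite eq_sym => ->; rewrite mulr0n mul0r.
  rewrite e; apply: ideal_sum => // i _; have [_ _] := hJ; apply.
  by have [] := hc i.
have [b0 bD bM] := hb.
have key (s : 'S_N) : b (\prod_i A i (s i) - \prod_i (w *+ (i == s i))).
  apply: (big_rec2 (fun x y => b (x - y))); first by rewrite subrr.
  move=> i x y _ bxy; rewrite mxE.
  have -> : (w *+ (i == s i) - c i (s i)) * x - w *+ (i == s i) * y =
    w *+ (i == s i) * (x - y) - x * c i (s i) by ring.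
  by apply: (idealB hb); apply: bM => //; have [] := hc i.
have -> : w ^+ N = \det (w%:M : 'M[R]_N) by rewrite det_scalar.
rewrite /determinant -sumrB; apply: ideal_sum => // s _.
under [X in _ - _ * X]eq_bigr => i _ do rewrite mxE.
by rewrite -mulrBr; apply: bM; apply: key.
Qed.

(** The hypothesis on [X] holds when [X] is the intersection of the [J + q ^ M], with [q]
    generated by the [g i]. *)
Lemma krull_intersection (R : comNzRingType) (hR : acc R) (J X : set R)
    (n : nat) (g : nat -> R) :
  is_ideal J -> is_ideal X ->
  (forall U : set R, is_ideal U -> J `<=` U ->
     (forall i, (i < n)%N -> exists m, U (g i ^+ m)) -> X `<=` U) ->
  exists2 e, nspan g n e & forall x, X x -> J ((1 + e) * x).
Proof.
move=> hJ hX hU.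
have [N [u [uX Xu]]] := acc_fg hR X.
pose q := nspan g n; have hq : is_ideal q by apply: nspan_ideal.
pose Y : set R := [set y | exists c : nat -> R,
  (forall l, q (c l)) /\ J (y - \sum_(l < N) c l * u l)].
have [J0 JD JM] := hJ; have [q0 qD qM] := hq; have [X0 XD XM] := hX.
have hY : is_ideal Y.
  split.
  - exists (fun=> 0); split=> //; rewrite sub0r big1 ?oppr0 // => l _.
    by rewrite mul0r.
  - move=> x y [c [hc Jc]] [d [hd Jd]]; exists (fun l => c l + d l); split.
      by move=> l; apply: qD.
    rewrite (_ : _ - _ = (x - \sum_(l < N) c l * u l) +
                         (y - \sum_(l < N) d l * u l)); first exact: JD.
    under eq_bigr => l _ do rewrite mulrDl.
    by rewrite big_split /=; ring.
  - move=> r x [c [hc Jc]]; exists (fun l => r * c l); split.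
      by move=> l; apply: qM.
    under eq_bigr => l _ do rewrite -mulrA.
    by rewrite -mulr_sumr -mulrBr; apply: JM.
have JY : J `<=` Y.
  move=> x Jx; exists (fun=> 0); split=> //; rewrite big1 ?subr0 // => l _.
  by rewrite mul0r.
have qXY a x : q a -> X x -> Y (a * x).
  move=> qa /Xu [c ->]; exists (fun l => a * c l); split.
    by move=> l; rewrite mulrC; apply: qM.
  under [X in _ - X]eq_bigr => l _ do rewrite -mulrA.
  by rewrite -mulr_sumr subrr.
(* [Y] is J + q X. [U] is maximal among the ideals above [Y] that meet [X] inside [Y]. When the
   ideals (U : g^k) are constant from k = m on, U + (g^m) still meets [X] inside [Y], so g^m lies in
   [U]. By [hU] then [X] lies in [U], hence in J + q X, and the determinant trick applies. *)
have [||U [hUi YU UXY] Umax] :=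
  @acc_max _ hR [set U | [/\ is_ideal U, Y `<=` U & U `&` X `<=` Y]].
- by move=> U [].
- by exists Y; split=> // x [].
have XU : X `<=` U.
  apply: hU => //; first exact: subset_trans YU.
  move=> i lin; have qg : q (g i) by apply: nspan_mem.
  have [U0 UD UM] := hUi.
  have [||m hm] := hR (fun k => [set x | U (g i ^+ k * x)]).
  - move=> k; split; first by rewrite /= mulr0.
      by move=> x y /= ? ?; rewrite mulrDr; apply: UD.
    by move=> r x /= ?; rewrite mulrCA; apply: UM.
  - by move=> k x /= ?; rewrite exprS -mulrA; apply: UM.
  exists m; apply: (Umax [set z | exists v r, U v /\ z = v + g i ^+ m * r]).
  - split.
    + split.
      * by exists 0, 0; rewrite mulr0 addr0.
      * move=> x y [v [r [Uv ->]]] [v' [r' [Uv' ->]]]; exists (v + v'), (r + r').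
        by split; [apply: UD|ring].
      * move=> a x [v [r [Uv ->]]]; exists (a * v), (a * r).
        by split; [apply: UM|ring].
    + by move=> y /YU Uy; exists y, 0; rewrite mulr0 addr0.
    + move=> z [[v [r [Uv ez]]] Xz]; apply: UXY; split=> //.
      rewrite ez; apply: UD => //; apply: (hm m.+1 (leqnSn m)) => /=.
      have := YU _ (qXY _ _ qg Xz); rewrite ez => h.
      have -> : g i ^+ m.+1 * r = g i * (v + g i ^+ m * r) - g i * v by rewrite exprS; ring.
      by apply: (idealB hUi) => //; apply: UM.
  - by move=> v Uv; exists v, 0; rewrite mulr0 addr0.
  - by exists 0, 1; rewrite mulr1 add0r.
have [|e qe he] := @nakayama R J q 1 N u hJ hq.
  move=> j lj; have [c [hc Jc]] : Y (u j) by apply: UXY; split; [apply: XU|]; apply: uX.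
  by exists c; rewrite mul1r.
exists e => // x /Xu [c ->]; rewrite mulr_sumr; apply: ideal_sum => // l _.
by rewrite mulrCA; apply: JM; rewrite -{1}(expr1n R N); apply: he.
Qed.

(** * Quotients, localizations, fields *)

Definition subgroup (V : zmodType) (N : set V) : Prop :=
  N 0 /\ forall x y, N x -> N y -> N (x - y).

Section ZQuot.
Variables (V : zmodType) (N : set V).
Hypothesis hN : subgroup N.

Let E (x y : V) : bool := `[< N (x - y) >].
Let rep (x : V) : V := choose (E x) x.

Let Nopp x : N x -> N (- x).
Proof. by move=> Nx; rewrite -sub0r; apply: (proj2 hN) => //; case: hN. Qed.

Let Nadd x y : N x -> N y -> N (x + y).
Proof. by move=> Nx Ny; rewrite -[y]opprK; apply: (proj2 hN) => //; apply: Nopp. Qed.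

Let Exx x : E x x.
Proof. by apply/asboolP; rewrite subrr; case: hN. Qed.

Let repP x : N (x - rep x).
Proof. by have /asboolP := chooseP (Exx x). Qed.

Let rep_eq x y : N (x - y) -> rep x = rep y.
Proof.
move=> Nxy; have eE : E x =1 E y.
  move=> z; apply/asboolP/asboolP => h.
    by rewrite -(subrKA x) -opprB; apply: Nadd => //; apply: Nopp.
  by rewrite -(subrKA y); apply: Nadd.
rewrite /rep (eq_choose eE); apply: choose_id; last exact: Exx.
by rewrite -eE.
Qed.

(** [choose] gives the same element for equal predicates, so each coset has one representative, and
    these form the quotient. The proof is an argument of the type so that the structures depending
    on it can be attached. *)
Definition zquot (_ : subgroup N) : Type := {x : V | rep x == x}.

HB.instance Definition _ := Choice.on (zquot hN).

Let rep_id x : rep (rep x) == rep x.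
Proof. by apply/eqP/esym/rep_eq/repP. Qed.

Definition zproj (x : V) : zquot hN := exist _ (rep x) (rep_id x).

Lemma zprojP x y : zproj x = zproj y <-> N (x - y).
Proof.
split=> [[e]|h]; last by apply: val_inj; apply: rep_eq.
by rewrite -(subrKA (rep x)) {2}e -[rep y - y]opprB; apply: Nadd; last apply: Nopp.
Qed.

Lemma zproj_surj (z : zquot hN) : exists x, zproj x = z.
Proof. by exists (val z); apply: val_inj => /=; apply/eqP; apply: (valP z). Qed.

Let add (z w : zquot hN) := zproj (val z + val w).
Let opp (z : zquot hN) := zproj (- val z).

Let addE x y : add (zproj x) (zproj y) = zproj (x + y).
Proof.
apply/zprojP => /=; rewrite opprD addrACA; apply: Nadd; rewrite -opprB;
  exact/Nopp/repP.
Qed.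

Let oppE x : opp (zproj x) = zproj (- x).
Proof. by apply/zprojP => /=; rewrite opprK addrC; apply: repP. Qed.

Let addA : associative add.
Proof.
move=> a b c; have [x <-] := zproj_surj a; have [y <-] := zproj_surj b.
by have [z <-] := zproj_surj c; rewrite !addE addrA.
Qed.

Let addC : commutative add.
Proof.
move=> a b; have [x <-] := zproj_surj a; have [y <-] := zproj_surj b.
by rewrite !addE addrC.
Qed.

Let add0 : left_id (zproj 0) add.
Proof. by move=> a; have [x <-] := zproj_surj a; rewrite addE add0r. Qed.

Let addN : left_inverse (zproj 0) opp add.
Proof. by move=> a; have [x <-] := zproj_surj a; rewrite oppE addE addNr. Qed.

HB.instance Definition _ := GRing.isZmodule.Build (zquot hN) addA addC add0 addN.

Lemma zprojD x y : zproj (x + y) = zproj x + zproj y.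
Proof. by rewrite -addE. Qed.

End ZQuot.

Lemma submod_subgroup (R : comPzRingType) (M : lmodType R) (N : set M) :
  is_submod N -> subgroup N.
Proof.
move=> [h0 hD hM]; split=> // x y hx hy.
by rewrite -[y]scale1r -scaleNr; apply: hD => //; apply: hM.
Qed.

Lemma ideal_subgroup (R : comPzRingType) (I : set R) : is_ideal I -> subgroup I.
Proof. by move=> hI; split; [case: hI|move=> x y; apply: idealB]. Qed.

Section MQuot.
Variables (R : comPzRingType) (M : lmodType R) (N : set M).
Hypothesis hN : is_submod N.

Definition mquot : Type := zquot (submod_subgroup hN).
HB.instance Definition _ := GRing.Zmodule.on mquot.

Definition mproj (x : M) : mquot := zproj (submod_subgroup hN) x.

Lemma mprojP x y : mproj x = mproj y <-> N (x - y).
Proof. exact: zprojP. Qed.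

Lemma mproj_surj (z : mquot) : exists x, mproj x = z.
Proof. exact: zproj_surj. Qed.

Let scale (r : R) (z : mquot) : mquot := mproj (r *: val z).

Let scaleE r x : scale r (mproj x) = mproj (r *: x).
Proof.
apply/mprojP; rewrite -scalerBr; have [_ _] := hN; apply.
by rewrite -mprojP; have [y yx] := mproj_surj (mproj x); apply: val_inj; apply/eqP;
  apply: (valP (mproj x)).
Qed.

Let scaleA a b v : scale a (scale b v) = scale (a * b) v.
Proof. by have [x <-] := mproj_surj v; rewrite !scaleE scalerA. Qed.

Let scale1 : left_id 1 scale.
Proof. by move=> v; have [x <-] := mproj_surj v; rewrite !scaleE scale1r. Qed.

Let scaleDr : right_distributive scale +%R.
Proof.
move=> a v w; have [x <-] := mproj_surj v; have [y <-] := mproj_surj w.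
by rewrite -zprojD !scaleE scalerDr; apply: zprojD.
Qed.

Let scaleDl v : {morph scale^~ v: a b / a + b}.
Proof.
by move=> a b /=; have [x <-] := mproj_surj v; rewrite !scaleE scalerDl; apply: zprojD.
Qed.

HB.instance Definition _ :=
  GRing.Zmodule_isLmodule.Build R mquot scaleA scale1 scaleDr scaleDl.

Let mproj_lin : linear mproj.
Proof. by move=> a x y; rewrite [LHS]zprojD; congr (_ + _); rewrite -[LHS]scaleE. Qed.

HB.instance Definition _ := GRing.isLinear.Build R M mquot *:%R mproj mproj_lin.

Lemma mproj0 x : mproj x = 0 <-> N x.
Proof. by rewrite -(raddf0 mproj) mprojP subr0. Qed.

End MQuot.

Lemma mquot_lift (R : comPzRingType) (M P : lmodType R) (N : set M) (hN : is_submod N)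
    (g : M -> P) : linear g -> (forall x, N x -> g x = 0) ->
  exists h : {linear mquot hN -> P}, forall x, h (mproj hN x) = g x.
Proof.
move=> gl gN.
have g0 : g 0 = 0 by have := gl (-1) 0 0; rewrite scaler0 addr0 scaleN1r addNr.
pose h (z : mquot hN) := g (val z).
have hE x : h (mproj hN x) = g x.
  have Nd : N (val (mproj hN x) - x).
    rewrite -(mprojP hN); apply: val_inj; apply/eqP; exact: (valP (mproj hN x)).
  by rewrite /h -(subrK x (val _)) -(scale1r (_ - x)) gl (gN _ Nd) scaler0 add0r.
have hl : linear h.
  move=> a v w; have [x <-] := mproj_surj v; have [y <-] := mproj_surj w.
  by rewrite -linearP !hE gl.
pose hb := GRing.isLinear.Build R (mquot hN) P *:%R h hl.
by exists (HB.pack h hb : {linear mquot hN -> P}).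
Qed.

Section RQuot.
Variables (R : comPzRingType) (I : set R).
Hypothesis hI : is_ideal I.

Definition rquot : Type := zquot (ideal_subgroup hI).
HB.instance Definition _ := GRing.Zmodule.on rquot.

Definition rproj (x : R) : rquot := zproj (ideal_subgroup hI) x.

Lemma rprojP x y : rproj x = rproj y <-> I (x - y).
Proof. exact: zprojP. Qed.

Lemma rproj_surj (z : rquot) : exists x, rproj x = z.
Proof. exact: zproj_surj. Qed.

Let mul (z w : rquot) : rquot := rproj (val z * val w).

Let val_rproj x : I (val (rproj x) - x).
Proof.
by rewrite -rprojP; apply: val_inj; apply/eqP; apply: (valP (rproj x)).
Qed.

Let mulE x y : mul (rproj x) (rproj y) = rproj (x * y).
Proof.
apply/rprojP; set a := val _; set b := val _.
have -> : a * b - x * y = a * (b - y) + y * (a - x) by ring.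
by have [_ hD hM] := hI; apply: hD; apply: hM; apply: val_rproj.
Qed.

Let mulA : associative mul.
Proof.
move=> a b c; have [x <-] := rproj_surj a; have [y <-] := rproj_surj b.
by have [z <-] := rproj_surj c; rewrite !mulE mulrA.
Qed.

Let mulC : commutative mul.
Proof.
move=> a b; have [x <-] := rproj_surj a; have [y <-] := rproj_surj b.
by rewrite !mulE mulrC.
Qed.

Let mul1 : left_id (rproj 1) mul.
Proof. by move=> a; have [x <-] := rproj_surj a; rewrite mulE mul1r. Qed.

Let mulDl : left_distributive mul +%R.
Proof.
move=> a b c; have [x <-] := rproj_surj a; have [y <-] := rproj_surj b.
have [z <-] := rproj_surj c.
by rewrite -zprojD !mulE mulrDl; apply: zprojD.
Qed.

HB.instance Definition _ := GRing.Zmodule_isComPzRing.Build rquot mulA mulC mul1 mulDl.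

Let rproj_add : zmod_morphism rproj.
Proof.
move=> x y; apply/esym/eqP; rewrite subr_eq; apply/eqP.
by rewrite -{1}(subrK y x) [LHS]zprojD.
Qed.

Let rproj_mul : monoid_morphism rproj.
Proof. by split=> // x y; rewrite -mulE. Qed.

HB.instance Definition _ := GRing.isZmodMorphism.Build R rquot rproj rproj_add.
HB.instance Definition _ := GRing.isMonoidMorphism.Build R rquot rproj rproj_mul.

Lemma rproj0 x : rproj x = 0 <-> I x.
Proof. by rewrite -(rmorph0 rproj) rprojP subr0. Qed.

Lemma rquotP : is_quotient I rproj.
Proof. by split; [apply: rproj_surj|apply: rproj0]. Qed.

End RQuot.

Definition mulset (R : comPzRingType) (M : set R) : Prop :=
  M 1 /\ forall x y, M x -> M y -> M (x * y).

Section Loc.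
Variables (R : comPzRingType) (M : set R).
Hypothesis hM : mulset M.

Let E (p q : R * R) : bool :=
  `[< M q.2 /\ exists2 u, M u & u * (p.1 * q.2) = u * (q.1 * p.2) >].
Let rep (p : R * R) := choose (E p) p.

Let M1 : M 1. Proof. by case: hM. Qed.
Let MM x y : M x -> M y -> M (x * y). Proof. by case: hM => _; apply. Qed.

Let Epp p : M p.2 -> E p p. Proof. by move=> Mp; apply/asboolP; split=> //; exists 1. Qed.

Let Esym p q : M p.2 -> E p q -> E q p.
Proof. by move=> Mp /asboolP[_ [u Mu e]]; apply/asboolP; split=> //; exists u. Qed.

Let Etrans p q r : E p q -> E q r -> E p r.
Proof.
move=> /asboolP[Mq [u Mu e]] /asboolP[Mr [v Mv f]]; apply/asboolP; split=> //.
exists (q.2 * (u * v)); first by apply: (MM) => //; apply: MM.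
have -> : q.2 * (u * v) * (p.1 * r.2) = (u * (p.1 * q.2)) * (v * r.2) by ring.
rewrite e; have -> : u * (q.1 * p.2) * (v * r.2) = v * (q.1 * r.2) * (u * p.2) by ring.
by rewrite f; ring.
Qed.

Let repP p : M p.2 -> E p (rep p).
Proof. by move=> Mp; apply: (chooseP (Epp Mp)). Qed.

Let rep_eq p q : M p.2 -> E p q -> rep p = rep q.
Proof.
move=> Mp pq; have Mq : M q.2 by have /asboolP[] := pq.
have eE : E p =1 E q.
  by move=> r; apply/idP/idP; apply: Etrans => //; apply: Esym.
by rewrite /rep (eq_choose eE); apply: choose_id; [rewrite -eE|]; apply: Epp.
Qed.

(** Again a set of representatives. The first condition discards the pairs that are not fractions,
    on which [E] is not reflexive. *)
Definition loc (_ : mulset M) : Type := {p : R * R | `[< M p.2 >] && (rep p == p)}.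
HB.instance Definition _ := Choice.on (loc hM).

Let frac_subproof (p : R * R) : M p.2 -> `[< M (rep p).2 >] && (rep (rep p) == rep p).
Proof.
move=> Mp; have /asboolP[Mr _] := repP Mp; apply/andP; split; first exact/asboolP.
by apply/eqP/esym; apply: rep_eq => //; apply: repP.
Qed.

Let frac (x m : R) (Mm : M m) : loc hM :=
  exist _ (rep (x, m)) (@frac_subproof (x, m) Mm).

Let fracP x m (Mm : M m) y n (Mn : M n) :
  frac x Mm = frac y Mn <-> exists2 u, M u & u * (x * n) = u * (y * m).
Proof.
split=> [[e]|h].
  have := Etrans (repP (p := (x, m)) Mm); rewrite e.
  move=> /(_ _ (Esym (p := (y, n)) Mn (repP (p := (y, n)) Mn))).
  by move=> /asboolP[_ [u Mu /= f]]; exists u.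
by apply: val_inj; apply: rep_eq => //; apply/asboolP; split.
Qed.

Let frac_surj (z : loc hM) : exists x m (Mm : M m), frac x Mm = z.
Proof.
have /andP[/asboolP Mz /eqP e] := valP z.
by exists (val z).1, (val z).2, Mz; apply: val_inj => /=; rewrite -surjective_pairing.
Qed.

Let valM (z : loc hM) : M (val z).2.
Proof. by have /andP[/asboolP] := valP z. Qed.

Let frac_val x m (Mm : M m) : exists2 u, M u &
  u * ((val (frac x Mm)).1 * m) = u * (x * (val (frac x Mm)).2).
Proof.
have /asboolP[_ [u Mu e]] := repP (p := (x, m)) Mm.
by exists u.
Qed.

Let add (z w : loc hM) := frac ((val z).1 * (val w).2 + (val w).1 * (val z).2)
  (MM (valM z) (valM w)).
Let opp (z : loc hM) := frac (- (val z).1) (valM z).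
Let mul (z w : loc hM) := frac ((val z).1 * (val w).1) (MM (valM z) (valM w)).

Let addE x m (Mm : M m) y n (Mn : M n) :
  add (frac x Mm) (frac y Mn) = frac (x * n + y * m) (MM Mm Mn).
Proof.
apply/fracP; have [u Mu e] := frac_val x Mm; have [v Mv f] := frac_val y Mn.
move: e f; set a := val (frac x Mm); set b := val (frac y Mn) => e f.
exists (u * v); first exact: MM.
have -> : u * v * ((a.1 * b.2 + b.1 * a.2) * (m * n)) =
  u * (a.1 * m) * (v * b.2 * n) + v * (b.1 * n) * (u * a.2 * m) by ring.
by rewrite e f; ring.
Qed.

Let mulE x m (Mm : M m) y n (Mn : M n) :
  mul (frac x Mm) (frac y Mn) = frac (x * y) (MM Mm Mn).
Proof.
apply/fracP; have [u Mu e] := frac_val x Mm; have [v Mv f] := frac_val y Mn.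
move: e f; set a := val (frac x Mm); set b := val (frac y Mn) => e f.
exists (u * v); first exact: MM.
have -> : u * v * (a.1 * b.1 * (m * n)) = u * (a.1 * m) * (v * (b.1 * n)) by ring.
by rewrite e f; ring.
Qed.

Let oppE x m (Mm : M m) : opp (frac x Mm) = frac (- x) Mm.
Proof.
apply/fracP; have [u Mu e] := frac_val x Mm; exists u => //.
by rewrite !mulNr !mulrN e.
Qed.

Let addA : associative add.
Proof.
move=> a b c; have [x [m [Mm <-]]] := frac_surj a; have [y [n [Mn <-]]] := frac_surj b.
have [z [q [Mq <-]]] := frac_surj c; rewrite !addE.
by apply/fracP; exists 1 => //; ring.
Qed.

Let addC : commutative add.
Proof.
move=> a b; have [x [m [Mm <-]]] := frac_surj a; have [y [n [Mn <-]]] := frac_surj b.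
by rewrite !addE; apply/fracP; exists 1 => //; ring.
Qed.

Let add0 : left_id (frac 0 M1) add.
Proof.
move=> a; have [x [m [Mm <-]]] := frac_surj a.
by rewrite !addE; apply/fracP; exists 1 => //; ring.
Qed.

Let addN : left_inverse (frac 0 M1) opp add.
Proof.
move=> a; have [x [m [Mm <-]]] := frac_surj a.
by rewrite oppE addE; apply/fracP; exists 1 => //; ring.
Qed.

HB.instance Definition _ := GRing.isZmodule.Build (loc hM) addA addC add0 addN.

Let mulA : associative mul.
Proof.
move=> a b c; have [x [m [Mm <-]]] := frac_surj a; have [y [n [Mn <-]]] := frac_surj b.
have [z [q [Mq <-]]] := frac_surj c; rewrite !mulE.
by apply/fracP; exists 1 => //; ring.
Qed.

Let mulC : commutative mul.
Proof.
move=> a b; have [x [m [Mm <-]]] := frac_surj a; have [y [n [Mn <-]]] := frac_surj b.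
by rewrite !mulE; apply/fracP; exists 1 => //; ring.
Qed.

Let mul1 : left_id (frac 1 M1) mul.
Proof.
move=> a; have [x [m [Mm <-]]] := frac_surj a.
by rewrite !mulE; apply/fracP; exists 1 => //; ring.
Qed.

Let mulDl : left_distributive mul add.
Proof.
move=> a b c; have [x [m [Mm <-]]] := frac_surj a; have [y [n [Mn <-]]] := frac_surj b.
have [z [q [Mq <-]]] := frac_surj c; rewrite !(addE, mulE).
by apply/fracP; exists 1 => //; ring.
Qed.

HB.instance Definition _ := GRing.Zmodule_isComPzRing.Build (loc hM) mulA mulC mul1 mulDl.

Definition lproj (x : R) : loc hM := frac x M1.

Let lproj_add : zmod_morphism lproj.
Proof.
move=> x y; apply/esym/eqP; rewrite subr_eq; apply/eqP; rewrite [RHS]addE.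
by apply/fracP; exists 1 => //; ring.
Qed.

Let lproj_mul : monoid_morphism lproj.
Proof.
by split=> // x y; rewrite [RHS]mulE; apply/fracP; exists 1 => //; ring.
Qed.

HB.instance Definition _ := GRing.isZmodMorphism.Build R (loc hM) lproj lproj_add.
HB.instance Definition _ := GRing.isMonoidMorphism.Build R (loc hM) lproj lproj_mul.

Lemma locP : is_localization M lproj.
Proof.
split.
- move=> m Mm; exists (frac 1 Mm); rewrite [LHS]mulE.
  by apply/fracP; exists 1 => //; ring.
- move=> z; have [x [m [Mm <-]]] := frac_surj z; exists x, m; split=> //.
  by rewrite [LHS]mulE; apply/fracP; exists 1 => //; ring.
- move=> x; split=> [/fracP[u Mu e]|[m Mm e]].
    by exists u => //; move: e; rewrite !mulr1 mulr0.
  by apply/fracP; exists m => //; rewrite mulr1 e mul0r mulr0.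
Qed.

End Loc.

(** Covers the universal properties of quotients and localizations alike. *)
Lemma rmorph_extension (A B T : comPzRingType)
    (f : {rmorphism A -> B}) (g : {rmorphism A -> T}) :
  (forall y, exists x m, [/\ is_unit (f m), is_unit (g m) & y * f m = f x]) ->
  (forall x, f x = 0 -> g x = 0) ->
  exists h : {rmorphism B -> T}, forall x, h (f x) = g x.
Proof.
move=> hB hker.
have {}hB y : exists t, exists x m,
    [/\ is_unit (f m), is_unit (g m), y * f m = f x & t * g m = g x].
  have [x [m [fu [v gv] e]]] := hB y.
  exists (g x * v), x, m; split=> //; first by exists v.
  by rewrite -mulrA [v * _]mulrC gv mulr1.
have [h hh] := choice hB.
have hker2 x y : f x = f y -> g x = g y.
  move=> e; apply/eqP; rewrite -subr_eq0 -rmorphB; apply/eqP/hker.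
  by rewrite rmorphB e subrr.
have uniqh y x m : is_unit (g m) -> y * f m = f x -> h y * g m = g x.
  move=> [v gv] e; have [x' [m' [_ [v' gv'] e' t']]] := hh y.
  have e1 : g (x * m') = g (x' * m).
    by apply: hker2; rewrite !rmorphM -e -e'; ring.
  rewrite -[RHS]mulr1 -gv' mulrA -rmorphM e1 rmorphM -t'.
  by rewrite -[RHS]mulrA [g m * v']mulrC mulrA -!mulrA (mulrA (g m') v') gv' mul1r.
have hf x : h (f x) = g x.
  by rewrite -[LHS]mulr1 -(rmorph1 g); apply: uniqh;
    rewrite !rmorph1 ?mulr1 //; exists 1; rewrite mulr1.
have cancelu (v t u w : T) : v * w = 1 -> t * v = u * v -> t = u.
  by move=> vw e; rewrite -[t]mulr1 -vw mulrA e -mulrA vw mulr1.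
have hadd : zmod_morphism h.
  move=> y z; have [x [m [_ [v gv] e t]]] := hh y.
  have [x' [m' [_ [v' gv'] e' t']]] := hh z.
  apply: (cancelu (g (m * m')) _ _ (v * v')).
    by rewrite rmorphM mulrACA gv gv' mulr1.
  rewrite (uniqh _ (x * m' - x' * m)).
  - by rewrite rmorphB !rmorphM -t -t'; ring.
  - by exists (v * v'); rewrite rmorphM mulrACA gv gv' mulr1.
  - by rewrite rmorphB !rmorphM -e -e'; ring.
have hmul : monoid_morphism h.
  split; first by rewrite -(rmorph1 f) hf rmorph1.
  move=> y z; have [x [m [_ [v gv] e t]]] := hh y.
  have [x' [m' [_ [v' gv'] e' t']]] := hh z.
  apply: (cancelu (g (m * m')) _ _ (v * v')).
    by rewrite rmorphM mulrACA gv gv' mulr1.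
  rewrite (uniqh _ (x * x')).
  - by rewrite !rmorphM -t -t'; ring.
  - by exists (v * v'); rewrite rmorphM mulrACA gv gv' mulr1.
  - by rewrite !rmorphM -e -e'; ring.
pose hA := GRing.isZmodMorphism.Build B T h hadd.
pose hMm := GRing.isMonoidMorphism.Build B T h hmul.
pose hr : {rmorphism B -> T} := HB.pack h hA hMm.
by exists hr.
Qed.

Section FieldOf.
Variable Q : comPzRingType.
Hypothesis hQ : (1 <> 0 :> Q) /\ forall x : Q, x <> 0 -> exists y, y * x = 1.

Definition field_of (_ : (1 <> 0 :> Q) /\ forall x : Q, x <> 0 -> exists y, y * x = 1) : Type := Q.

HB.instance Definition _ := GRing.ComPzRing.on (field_of hQ).

Let one_neq0 : (1 : field_of hQ) != 0.
Proof. by apply/eqP; case: hQ. Qed.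

HB.instance Definition _ := GRing.PzSemiRing_isNonZero.Build (field_of hQ) one_neq0.

Let inv_ex (x : field_of hQ) : exists y, (x != 0 -> y * x = 1) /\ (x = 0 -> y = 0).
Proof.
have [->|/eqP nx] := eqVneq x 0; first by exists 0.
by have [y yx] := proj2 hQ x nx; exists y; split=> // /nx.
Qed.

Let inv (x : field_of hQ) := projT1 (cid (inv_ex x)).

Let mulVf (x : field_of hQ) : x != 0 -> inv x * x = 1.
Proof. by rewrite /inv; case: cid => y []. Qed.

Let inv0 : inv 0 = 0.
Proof. by have [_] := projT2 (cid (inv_ex 0)); apply. Qed.

HB.instance Definition _ := GRing.ComNzRing_isField.Build (field_of hQ) mulVf inv0.

Definition to_field (x : Q) : field_of hQ := x.
Let to_field_add : zmod_morphism to_field. Proof. by []. Qed.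
Let to_field_mul : monoid_morphism to_field. Proof. by []. Qed.
HB.instance Definition _ := GRing.isZmodMorphism.Build Q (field_of hQ) to_field to_field_add.
HB.instance Definition _ := GRing.isMonoidMorphism.Build Q (field_of hQ) to_field to_field_mul.

End FieldOf.

(** * Koszul cochains *)

(* Cochains on [t] generators with values in [M], all degrees together: the two
   components of [coch M t.+1] are the part without and the part with the exterior
   generator of index 0. *)
Fixpoint coch (R : comPzRingType) (M : lmodType R) (t : nat) : lmodType R :=
  if t is t'.+1 then (coch M t' * coch M t')%type else M.

Notation shift u := (fun i : nat => u i.+1).

(** The Koszul complex as an iterated mapping cone: a new generator takes the cone of multiplication
    by [l 0] on the complex of the others. *)
Fixpoint kd (R : comPzRingType) (M : lmodType R) (t : nat) :
    (nat -> R) -> coch M t -> coch M t :=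
  if t is t'.+1 then fun l z =>
    (kd (shift l) z.1, l 0%N *: z.1 - kd (shift l) z.2)
  else fun _ _ => 0.

(** The chain map from the complex on the [l i] to the one on the [l i * u i] ([ktr_kd]): a
    component is multiplied by the [u i] of its exterior generators. For powers of one sequence
    these are the transition maps whose colimit is the Čech complex. *)
Fixpoint ktr (R : comPzRingType) (M : lmodType R) (t : nat) :
    (nat -> R) -> coch M t -> coch M t :=
  if t is t'.+1 then fun u z => (ktr (shift u) z.1, u 0%N *: ktr (shift u) z.2)
  else fun _ z => z.

Fixpoint cmap (R R' : comPzRingType) (M : lmodType R) (M' : lmodType R')
    (g : M -> M') (t : nat) : coch M t -> coch M' t :=
  if t is t'.+1 then fun z => (cmap g z.1, cmap g z.2) else g.

Fixpoint call (R : comPzRingType) (M : lmodType R) (Q : set M) (t : nat) :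
    set (coch M t) :=
  if t is t'.+1 then fun z => call Q z.1 /\ call Q z.2 else Q.

Fixpoint cdeg (R : comPzRingType) (M : lmodType R) (t : nat) :
    nat -> coch M t -> Prop :=
  if t is t'.+1 then fun k z =>
    cdeg k z.1 /\ (if k is k'.+1 then cdeg k' z.2 else z.2 = 0)
  else fun k z => if k is k'.+1 then z = 0 else True.

Fixpoint cst (R : comPzRingType) (M : lmodType R) (t : nat) (x : M) : coch M t :=
  if t is t'.+1 then (cst t' x, 0) else x.

Arguments kd {R M t}.
Arguments ktr {R M t}.
Arguments cst {R M}.
Arguments cmap {R R' M M'} g {t}.
Arguments call {R M} Q {t}.

Notation pw f s := (fun i : nat => f i ^+ s).

Section Koszul.
Variables (R : comPzRingType) (M : lmodType R).
Implicit Types (l u v : nat -> R).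

Lemma pairD (A B : lmodType R) (x y : (A * B)%type) : x + y = (x.1 + y.1, x.2 + y.2).
Proof. by []. Qed.
Lemma pairZ (A B : lmodType R) (r : R) (x : (A * B)%type) : r *: x = (r *: x.1, r *: x.2).
Proof. by []. Qed.
Lemma pairN (A B : lmodType R) (x : (A * B)%type) : - x = (- x.1, - x.2).
Proof. by []. Qed.

Lemma kd_is_linear t l : linear (kd l : coch M t -> coch M t).
Proof.
elim: t l => [|t IH] l a x y; first by rewrite /= scaler0 addr0.
rewrite /= !pairD !pairZ /=; congr pair; first exact: IH.
rewrite IH scalerDr !scalerA mulrC -scalerA opprD scalerBr.
by rewrite addrACA -scalerBr.
Qed.
HB.instance Definition _ t l :=
  GRing.isLinear.Build R (coch M t) (coch M t) *:%R (kd l) (@kd_is_linear t l).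

Lemma ktr_is_linear t u : linear (ktr u : coch M t -> coch M t).
Proof.
elim: t u => [|t IH] u a x y //.
rewrite /= !pairD !pairZ /=; congr pair; first exact: IH.
by rewrite IH scalerDr !scalerA mulrC.
Qed.
HB.instance Definition _ t u :=
  GRing.isLinear.Build R (coch M t) (coch M t) *:%R (ktr u) (@ktr_is_linear t u).

Lemma kdK t l (z : coch M t) : kd l (kd l z) = 0.
Proof.
elim: t l z => [|t IH] l z //=; congr pair; first exact: IH.
by rewrite linearB linearZ /= IH subr0 subrr.
Qed.

Lemma ktr_kd t l u (z : coch M t) :
  kd (fun i => l i * u i) (ktr u z) = ktr u (kd l z).
Proof.
elim: t l u z => [|t IH] l u z //=; congr pair; first exact: IH.
rewrite linearZ /= IH [ktr _ (_ - _)]linearB scalerBr; congr (_ - _).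
by rewrite linearZ /= scalerA mulrC.
Qed.

Lemma ktr_comp t u v (z : coch M t) : ktr u (ktr v z) = ktr (fun i => u i * v i) z.
Proof.
elim: t u v z => [|t IH] u v z //=; congr pair; first exact: IH.
by rewrite linearZ /= IH scalerA.
Qed.

Lemma ktr_pw_kd t f s m (z : coch M t) :
  kd (pw f (s + m)) (ktr (pw f m) z) = ktr (pw f m) (kd (pw f s) z).
Proof. by rewrite -ktr_kd; congr kd; apply/funext => i; rewrite exprD. Qed.

Lemma ktr_pw_comp t f s m (z : coch M t) :
  ktr (pw f m) (ktr (pw f s) z) = ktr (pw f (s + m)) z.
Proof. by rewrite ktr_comp; congr ktr; apply/funext => i; rewrite exprD mulrC. Qed.

Lemma call_sub (Q : set M) t : is_submod Q -> is_submod (@call R M Q t).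
Proof.
move=> hQ; elim: t => [|t [h0 hD hZ]] //; split => //=.
- by move=> x y [? ?] [? ?]; split; apply: hD.
- by move=> r x [? ?]; split; apply: hZ.
Qed.

Lemma call_kd (Q : set M) t l (z : coch M t) : is_submod Q -> call Q z -> call Q (kd l z).
Proof.
move=> hQ; elim: t l z => [|t IH] l z /=; first by case: hQ.
have [h0 hD hZ] := @call_sub Q t hQ => -[z1 z2]; split; first exact: IH.
apply: hD; first exact: hZ.
by rewrite -scaleN1r; apply/hZ/IH.
Qed.

Lemma call_ktr (Q : set M) t u (z : coch M t) : is_submod Q -> call Q z -> call Q (ktr u z).
Proof.
move=> hQ; elim: t u z => [|t IH] u z //= [z1 z2].
by have [_ _ hZ] := @call_sub Q t hQ; split; [apply: IH|apply/hZ/IH].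
Qed.

Lemma callS (Q Q' : set M) t (z : coch M t) :
  (forall x, Q x -> Q' x) -> call Q z -> call Q' z.
Proof.
by move=> h; elim: t z => [|t IH] z /=; [apply: h|move=> [? ?]; split; apply: IH].
Qed.

Lemma cdeg_sub t k : is_submod [set z : coch M t | cdeg k z].
Proof.
elim: t k => [|t IH] [|k]; split => //=.
- by move=> x y -> ->; rewrite addr0.
- by move=> r x ->; rewrite scaler0.
- by split=> //; have [] := IH 0%N.
- by have [_ hD _] := IH 0%N => x y [? e] [? f]; split; [apply: hD|rewrite e f addr0].
- by have [_ _ hZ] := IH 0%N => r x [? e]; split; [apply: hZ|rewrite e scaler0].
- by split; [have [] := IH k.+1|have [] := IH k].
- have [_ hD _] := IH k.+1; have [_ hD' _] := IH k.
  by move=> x y [? ?] [? ?]; split; [apply: hD|apply: hD'].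
- have [_ _ hZ] := IH k.+1; have [_ _ hZ'] := IH k.
  by move=> r x [? ?]; split; [apply: hZ|apply: hZ'].
Qed.

Lemma cdegB t k (x y : coch M t) : cdeg k x -> cdeg k y -> cdeg k (x - y).
Proof.
by have [_ hD hZ] := cdeg_sub t k => hx hy; apply: hD => //; rewrite -scaleN1r; apply: hZ.
Qed.

Lemma cdegZ t k r (x : coch M t) : cdeg k x -> cdeg k (r *: x).
Proof. by have [_ _ hZ] := cdeg_sub t k; apply: hZ. Qed.

Lemma cdeg_kd t k l (z : coch M t) : cdeg k z -> cdeg k.+1 (kd l z).
Proof.
elim: t k l z => [|t IH] k l z //= [z1 z2]; split; first exact: IH.
apply: cdegB; first exact: cdegZ.
by case: k z1 z2 => [|k] z1 => [->|z2]; [rewrite linear0; have [] := cdeg_sub t 0%N|apply: IH].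
Qed.

Lemma cdeg_ktr t k u (z : coch M t) : cdeg k z -> cdeg k (ktr u z).
Proof.
elim: t k u z => [|t IH] [|k] u z //= [z1 z2]; (split; first exact: IH).
  by rewrite z2 linear0 scaler0.
by apply/cdegZ/IH.
Qed.

Lemma cdeg0P t (z : coch M t) : cdeg 0 z <-> exists x, z = cst t x.
Proof.
elim: t z => [|t IH] z /=; first by split=> // _; exists z.
split=> [[/IH[x e] f]|[x ->]]; last by split=> //; apply/IH; exists x.
by exists x; case: z e f => a b /= -> ->.
Qed.

Lemma cdeg_cst t x : cdeg 0 (cst t x : coch M t).
Proof. by apply/cdeg0P; exists x. Qed.

Lemma cst_eq0 t (x : M) : cst t x = 0 <-> x = 0.
Proof. by elim: t => [|t IH] //=; split=> [[/IH]//|/IH ->//]. Qed.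

Lemma cst_is_linear t : linear (cst t : M -> coch M t).
Proof.
elim: t => [|t IH] a x y //=; rewrite IH pairD pairZ /=; congr pair.
by rewrite scaler0 addr0.
Qed.
HB.instance Definition _ t :=
  GRing.isLinear.Build R M (coch M t) *:%R (cst t) (@cst_is_linear t).

Lemma cst_inj t (x y : M) : cst t x = cst t y -> x = y.
Proof.
move=> e; apply/eqP; rewrite -subr_eq0; apply/eqP/(cst_eq0 t).
by rewrite linearB /= e subrr.
Qed.

Lemma call_cst (Q : set M) t (x : M) : Q 0 -> Q x -> call Q (cst t x).
Proof.
move=> Q0 Qx; elim: t => [|t IH] //=; split=> //.
by elim: t {IH} => [|t IH] //=.
Qed.

Lemma kd_cst t l x : kd l (cst t x : coch M t) = 0 <-> forall i, (i < t)%N -> l i *: x = 0.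
Proof.
elim: t l => [|t IH] l //=; rewrite linear0 subr0 -linearZ; split.
  by move=> [/IH h /cst_eq0 h0] [|i] // li; apply: h.
move=> h; congr pair; first by apply/IH => i li; apply: (h i.+1).
by apply/cst_eq0/h.
Qed.

Lemma ktr_cst t u x : ktr u (cst t x : coch M t) = cst t x.
Proof. by elim: t u => [|t IH] u //=; rewrite IH linear0 scaler0. Qed.

End Koszul.

Section CMap.
Variables (R R' : comPzRingType) (M : lmodType R) (M' : lmodType R').
Variables (chi : R -> R') (g : M -> M').
Hypothesis gD : forall x y, g (x + y) = g x + g y.
Hypothesis gZ : forall r x, g (r *: x) = chi r *: g x.

Let g0 : g 0 = 0.
Proof. by apply: (addrI (g 0)); rewrite -gD !addr0. Qed.
Let gN x : g (- x) = - g x.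
Proof. by apply: (addrI (g x)); rewrite -gD !subrr. Qed.

Lemma cmap0 t : cmap g (0 : coch M t) = 0.
Proof. by elim: t => [|t IH] //=; rewrite IH. Qed.

Lemma cmapD t (x y : coch M t) : cmap g (x + y) = cmap g x + cmap g y.
Proof. by elim: t x y => [|t IH] x y //=; rewrite !IH. Qed.

Lemma cmapN t (x : coch M t) : cmap g (- x) = - cmap g x.
Proof. by elim: t x => [|t IH] x //=; rewrite !IH. Qed.

Lemma cmapB t (x y : coch M t) : cmap g (x - y) = cmap g x - cmap g y.
Proof. by rewrite cmapD cmapN. Qed.

Lemma cmapZ t r (x : coch M t) : cmap g (r *: x) = chi r *: cmap g x.
Proof. by elim: t x => [|t IH] x //=; rewrite !IH. Qed.

Lemma cmap_kd t l (z : coch M t) :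
  cmap g (kd l z) = kd (fun i => chi (l i)) (cmap g z).
Proof.
elim: t l z => [|t IH] l z /=; first exact: g0.
by rewrite IH cmapB cmapZ IH.
Qed.

Lemma cmap_ktr t u (z : coch M t) :
  cmap g (ktr u z) = ktr (fun i => chi (u i)) (cmap g z).
Proof. by elim: t u z => [|t IH] u z //=; rewrite IH cmapZ IH. Qed.

End CMap.

Lemma cdeg_cmap (R R' : comPzRingType) (M : lmodType R) (M' : lmodType R')
    (g : M -> M') t k (z : coch M t) : g 0 = 0 -> cdeg k z -> cdeg k (cmap g z).
Proof.
move=> g0; have c0 t' : cmap g (0 : coch M t') = 0 by elim: t' => //= t' ->.
elim: t k z => [|t IH] [|k] z //=; first by move=> ->.
  by move=> [? ->]; split; [apply: IH|apply: c0].
by move=> [? ?]; split; apply: IH.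
Qed.

Lemma cmap_surj (R R' : comPzRingType) (M : lmodType R) (M' : lmodType R')
    (g : M -> M') (Q : set M) (Q' : set M') t (z : coch M' t) :
  (forall y, Q' y -> exists2 x, Q x & g x = y) -> call Q' z ->
  exists2 w : coch M t, call Q w & cmap g w = z.
Proof.
move=> hg; elim: t z => [|t IH] z; first exact: hg.
move=> /= [/IH[x Qx ex] /IH[y Qy ey]]; exists (x, y) => //=.
by rewrite ex ey; case: z {ex ey}.
Qed.

Lemma cmap_surj_deg (R R' : comPzRingType) (M : lmodType R) (M' : lmodType R')
    (g : M -> M') (Q' : set M') t k (z : coch M' t) :
  g 0 = 0 -> (forall y, Q' y -> exists x, g x = y) -> call Q' z -> cdeg k z ->
  exists2 w : coch M t, cdeg k w & cmap g w = z.
Proof.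
move=> g0 hg; have c0 t' : cmap g (0 : coch M t') = 0 by elim: t' => //= t' ->.
elim: t k z => [|t IH] [|k] z /=.
- by move=> /hg[x ex] _; exists x.
- by move=> _ ->; exists 0.
- move=> [z1 z2] [/(IH _ _ z1)[x dx ex] e]; exists (x, 0) => //=.
  by rewrite ex c0; case: z e {z1 z2 ex} => a b /= ->.
- move=> [z1 z2] [/(IH _ _ z1)[x dx ex] /(IH _ _ z2)[y dy ey]]; exists (x, y) => //=.
  by rewrite ex ey; case: z {z1 z2 ex ey}.
Qed.

Lemma cmap_eq0 (R R' : comPzRingType) (M : lmodType R) (M' : lmodType R')
    (g : M -> M') t (z : coch M t) :
  cmap g z = 0 <-> call [set x | g x = 0] z.
Proof.
elim: t z => [|t IH] z //=; split=> [[/IH ? /IH ?]//|[/IH e /IH f]].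
by rewrite e f.
Qed.

Lemma call_cmap (R R' : comPzRingType) (M : lmodType R) (M' : lmodType R')
    (g : M -> M') (Q : set M') t (z : coch M t) : (forall x, Q (g x)) -> call Q (cmap g z).
Proof. by move=> hQ; elim: t z => [|t IH] z //=; split. Qed.

Lemma cmap_inj (R R' : comPzRingType) (M : lmodType R) (M' : lmodType R')
    (g : M -> M') t : injective g -> injective (cmap g : coch M t -> coch M' t).
Proof.
by move=> gi; elim: t => [|t IH] //= [x y] [x' y'] /= [/IH -> /IH ->].
Qed.

Section DegreeProjection.
Variables (R : comPzRingType) (M : lmodType R).

(** The homogeneous part of degree [k]. Annihilators are defined with cochains of mixed degree; by
    [cpr_kd] a boundary equation for a homogeneous cochain can be projected to one degree. *)
Fixpoint cpr (t k : nat) : coch M t -> coch M t :=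
  match t with
  | 0 => fun z => if k is 0 then z else 0
  | t'.+1 => fun z => (cpr k z.1, if k is k'.+1 then cpr k' z.2 else 0)
  end.

Lemma cpr_is_linear t k : linear (@cpr t k).
Proof.
elim: t k => [|t IH] [|k] a x y //=; rewrite ?scaler0 ?addr0 //.
  by rewrite pairD pairZ /= IH; congr pair; rewrite scaler0 addr0.
by rewrite pairD pairZ /= !IH.
Qed.
HB.instance Definition _ t k :=
  GRing.isLinear.Build R (coch M t) (coch M t) *:%R (@cpr t k) (@cpr_is_linear t k).

Lemma cpr_deg t k (z : coch M t) : cdeg k (cpr k z).
Proof.
elim: t k z => [|t IH] [|k] z //=; split=> //; exact: IH.
Qed.

Lemma cpr_id t k (z : coch M t) : cdeg k z -> cpr k z = z.
Proof.
elim: t k z => [|t IH] [|k] //=; try by move=> z ->.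
  by move=> [x y] /= [/IH -> ->].
by move=> [x y] /= [/IH -> /IH ->].
Qed.

Lemma cpr0_kd t l (z : coch M t) : cpr 0 (kd l z) = 0.
Proof. by elim: t l z => [|t IH] l z //=; rewrite IH. Qed.

Lemma cpr_kd t k l (z : coch M t) : cpr k.+1 (kd l z) = kd l (cpr k z).
Proof.
elim: t k l z => [|t IH] k l z //=; congr pair; first exact: IH.
case: k => [|k]; rewrite linearB linearZ /=; last by rewrite IH.
by rewrite cpr0_kd [kd _ 0]linear0.
Qed.

End DegreeProjection.

(** * Local cohomology as a colimit of Koszul cohomology *)

Section KoszulInjective.
Variable R : comPzRingType.
Hypothesis hR : acc R.

(** Let the ideals (b : g^k) be constant from k = N on. Multiplication by g^(s+N) embeds R/(b :
    g^(s+N)) in R/b, and r g^N x is well defined on the source since (b : g^(s+N)) = (b : g^N).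
    Injectivity extends this map to R/b, and [y] is the image of 1. *)
Lemma injective_divisible (I : lmodType R) (b : set R) (g : R) (s : nat) (x : I) :
  is_injective_module I -> is_ideal b -> (forall r, b r -> r *: x = 0) ->
  exists N y, (forall r, b r -> r *: y = 0) /\ g ^+ (s + N) *: y = g ^+ N *: x.
Proof.
move=> hI hb bx; have [b0 bD bM] := hb.
have hc k : is_ideal [set r | b (g ^+ k * r)].
  split; first by rewrite /= mulr0.
    by move=> y z /= ? ?; rewrite mulrDr; apply: bD.
  by move=> r y /= ?; rewrite mulrCA; apply: bM.
have [|N hN] := (hR hc); first by move=> k y /= ?; rewrite exprS -mulrA; apply: bM.
have hcm : @is_submod R R^o [set r | b (g ^+ (s + N) * r)] := hc (s + N)%N.
have hbm : @is_submod R R^o b := hb.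
have [||f hf] := @mquot_lift R R^o (mquot hbm) _ hcm
  (fun r => mproj hbm (g ^+ (s + N) * r)).
- by move=> a y z; rewrite -linearP; congr mproj; rewrite mulrDr mulrCA.
- by move=> r cr; apply/mproj0.
have [||G hG] := @mquot_lift R R^o I _ hcm (fun r => r *: (g ^+ N *: x)).
- by move=> a y z; rewrite scalerDl; congr (_ + _); rewrite [RHS]scalerA.
- move=> r cr; rewrite scalerA mulrC; apply: bx; apply: (hN (s + N)%N) => //.
  exact: leq_addl.
have finj : injective f.
  move=> z w; have [r <-] := mproj_surj z; have [r' <-] := mproj_surj w.
  by rewrite !hf => /mprojP; rewrite -mulrBr => h; apply/mprojP.
have [h hh] := hI _ _ f G finj.
exists N, (h (mproj hbm 1)); split.
  by move=> r br; rewrite -linearZ -linearZ /= (_ : mproj _ _ = 0) ?linear0 //;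
    apply/mproj0; rewrite -[_ *: _]mulrC mul1r.
have := hh (mproj hcm 1); rewrite hf hG scale1r mulr1 => <-.
rewrite -linearZ -linearZ /=; congr (h (mproj _ _)).
by rewrite -[_ *: _]/(_ * _) mulr1.
Qed.

(** Induction kills the component without the first generator. What remains is a cocycle [y1] on the
    other generators. In positive degree induction applies again; in degree 0 it is an element
    annihilated by powers of the other generators, and [injective_divisible] divides it by powers of
    [f 0]. *)
Lemma injective_koszul_acyclic (I : lmodType R) t f s k (z : coch I t) :
  is_injective_module I -> cdeg k.+1 z -> kd (pw f s) z = 0 ->
  exists m w, cdeg k w /\ ktr (pw f m) z = kd (pw f (s + m)) w.
Proof.
move=> hI; elim: t f s k z => [|t IH] f s k z.
  by move=> /= -> _; exists 0%N, 0; split=> //; have [] := @cdeg_sub R I 0 k.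
case: z => x y [/= dx dy] [/= kx /eqP]; rewrite subr_eq0 => /eqP ky.
have [m1 [x' [dx' ex]]] := IH _ _ _ _ dx kx.
set s1 := (s + m1)%N in ex.
pose y1 := f 0%N ^+ m1 *: ktr (pw (shift f) m1) y - f 0%N ^+ s1 *: x'.
have dy1 : cdeg k y1 by apply: cdegB; apply: cdegZ => //; apply: cdeg_ktr.
have ky1 : kd (pw (shift f) s1) y1 = 0.
  rewrite /y1 linearB !linearZ /= -ex ktr_pw_kd -ky linearZ /= scalerA -exprD (addnC m1) -/s1.
  by rewrite scalerN subrr.
suff [m2 [w2 [dw2 e2]]] : exists m2 (w2 : coch I t.+1),
    cdeg k w2 /\ ktr (pw f m2) ((0, y1) : coch I t.+1) = kd (pw f (s1 + m2)) w2.
  exists (m1 + m2)%N, (ktr (pw f m2) ((x', 0) : coch I t.+1) + w2); split.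
    have [_ hD _] := @cdeg_sub R I t.+1 k; apply: hD => //; apply: cdeg_ktr.
    by split=> //=; case: (k) => // k'; have [] := @cdeg_sub R I t k'.
  have E : ktr (pw f m1) ((x, y) : coch I t.+1) =
      kd (pw f s1) ((x', 0) : coch I t.+1) + ((0, y1) : coch I t.+1).
    rewrite /= linear0 subr0 pairD /= addr0 -ex; congr pair.
    by rewrite /y1 addrC subrK.
  rewrite addnA -/s1; transitivity (ktr (pw f (m1 + m2)) ((x, y) : coch I t.+1)) => //.
  rewrite -ktr_pw_comp E.
  rewrite [LHS]linearD.
  apply: etrans (congr2 +%R (esym (ktr_pw_kd f s1 m2 _)) e2) _.
  exact: (esym (linearD (kd (pw f (s1 + m2))) (ktr (pw f m2) ((x', 0) : coch I t.+1)) w2)).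
case: k {dx dx' ex dy} dy1 => [|k] dy1.
  have [v ev] := proj1 (cdeg0P _) dy1; rewrite ev in ky1 *.
  have kv := proj1 (kd_cst _ _ _) ky1.
  have [|N [v' [bv' ev']]] := @injective_divisible I
    (nspan (pw (shift f) s1) t) (f 0%N) s1 v hI (nspan_ideal _ _).
    move=> r [c ->]; rewrite scaler_suml big1 // => i _.
    by rewrite -scalerA kv ?scaler0.
  exists N, (cst t v', 0); split; first by split=> //; apply: cdeg_cst.
  rewrite /= !linear0 ?subr0 ?addr0 ktr_cst -!linearZ /= ev'; congr pair; apply/esym/kd_cst.
  by move=> i li; apply: bv'; rewrite exprD mulrC; case: (nspan_ideal (pw (shift f) s1) t)
    => _ _; apply; apply: nspan_mem.
have [m2 [w [dw ew]]] := IH _ _ _ _ dy1 ky1.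
exists m2, (0, - (f 0%N ^+ m2 *: w)); split.
  split; first by have [] := @cdeg_sub R I t k.+1.
  by rewrite /= -scalerN -scaleN1r; do 2!apply: cdegZ.
by rewrite /= !linear0 ?scaler0 ?sub0r ?add0r [kd _ (- _)]linearN opprK linearZ /= ew.
Qed.

End KoszulInjective.

(* [krel d f s c x] links a Koszul cocycle [c] with values in the kernel of [d 0] to
   a cocycle [x] of the torsion complex, by a zigzag through the Koszul cochains with
   values in the modules [I n]. *)
Fixpoint krel (R : comPzRingType) (k : nat) : forall (I : nat -> lmodType R)
    (d : forall n, {linear I n -> I n.+1}) (t : nat) (f : nat -> R) (s : nat),
    coch (I 0%N) t -> I k -> Prop :=
  match k with
  | 0 => fun I d t f s c x => c = cst t x
  | k'.+1 => fun I d t f s c x => exists u : coch (I 0%N) t,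
      [/\ cdeg k' u, kd (pw f s) u = c &
          krel (I := shift I) (fun n => d n.+1) f s (cmap (d 0%N) u) x]
  end.

(** Being a boundary in the colimit, with coefficients in [Q]. In degree 0 there are no boundaries
    and the transition maps are the identity ([ktr_cst]), so only zero qualifies. *)
Definition kbound (R : comPzRingType) (M : lmodType R) (Q : set M) (k t : nat)
    (f : nat -> R) (s : nat) (c : coch M t) : Prop :=
  match k with
  | 0 => c = 0
  | k'.+1 => exists m w, [/\ cdeg k' w, call Q w & kd (pw f (s + m)) w = ktr (pw f m) c]
  end.

Section TorsionComplex.
Variable R : comPzRingType.

Lemma ideal_pow_mem (a : set R) x n : a x -> ideal_pow a n (x ^+ n).
Proof.
move=> ax; elim: n => [|n IH] //=; apply: ideal_gen_mem.
by exists x, (x ^+ n); rewrite exprS.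
Qed.

(** The pigeonhole principle, by induction on the sum of the exponents: splitting off a factor [f i]
    replaces [b] by (b : f i), for which the exponent [E i] may be lowered by one. *)
Lemma ideal_pow_sub (f : nat -> R) t (E : nat -> nat) (b : set R) :
  is_ideal b -> (forall i, (i < t)%N -> b (f i ^+ E i)) ->
  ideal_pow (nspan f t) (\sum_(i < t) E i).+1 `<=` b.
Proof.
move eN : (\sum_(i < t) E i)%N => n.
elim: n E b eN => [|n IH] E b eN hb hE; have [b0 bD bM] := hb.
  have all0 i : (i < t)%N -> E i = 0%N.
    move=> li; apply/eqP; move/eqP: eN; rewrite sum_nat_eq0 => /forallP.
    by move=> /(_ (Ordinal li)).
  apply: ideal_gen_min => // z [x [y [[c ->] _ ->]]].
  rewrite mulr_suml; apply: ideal_sum => // i _.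
  by have := bM (c i * f i * y) _ (hE i (ltn_ord i)); rewrite all0 // expr0 mulr1.
apply: ideal_gen_min => // z [x [y [[c ->] hy ->]]].
rewrite mulr_suml; apply: ideal_sum => // i _; rewrite -mulrA; apply: (bM).
have [e0|epos] := posnP (E i).
  by have := bM (f i * y) _ (hE i (ltn_ord i)); rewrite e0 expr0 mulr1.
apply: (IH (fun j => if j == i then (E i).-1 else E j) [set r | b (f i * r)]) hy.
- apply/eqP; rewrite -eqSS -eN; apply/eqP.
  rewrite [in RHS](bigD1 i) //= [in LHS](bigD1 i) //= eqxx -addSn prednK //.
  congr addn; apply: eq_bigr => j; rewrite -val_eqE /= => /negbTE -> //.
- split; first by rewrite /= mulr0.
    by move=> u v /= ? ?; rewrite mulrDr; apply: bD.
  by move=> r u /= ?; rewrite mulrCA; apply: bM.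
- move=> j lj /=; case: eqP => [->|_]; first by rewrite -exprS prednK //; apply: hE.
  by apply/bM/hE.
Qed.

Lemma torsion_nspan (M : lmodType R) (f : nat -> R) t (x : M) :
  @torsion R (nspan f t) M x <-> exists s, forall i, (i < t)%N -> f i ^+ s *: x = 0.
Proof.
split=> [[n hn]|[s hs]].
  by exists n => i li; apply/hn/ideal_pow_mem/nspan_mem.
exists (\sum_(i < t) s).+1.
apply: (@ideal_pow_sub f t (fun=> s) [set r | r *: x = 0]) => //.
split; first by rewrite /= scale0r.
  by move=> u v /= hu hv; rewrite scalerDl hu hv addr0.
by move=> r u /= hu; rewrite -scalerA hu scaler0.
Qed.

Definition exact_complex (I : nat -> lmodType R) (d : forall n, {linear I n -> I n.+1}) :=
  forall n x, d n.+1 x = 0 <-> exists y, d n y = x.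

Lemma cmap_lin_kd (M N : lmodType R) (h : {linear M -> N}) t l (z : coch M t) :
  cmap h (kd l z) = kd l (cmap h z).
Proof.
by rewrite (@cmap_kd _ _ _ _ id) // => *; rewrite ?linearD ?linearZ.
Qed.

Lemma cmap_lin_ktr (M N : lmodType R) (h : {linear M -> N}) t l (z : coch M t) :
  cmap h (ktr l z) = ktr l (cmap h z).
Proof.
by rewrite (@cmap_ktr _ _ _ _ id) // => *; rewrite ?linearD ?linearZ.
Qed.

Lemma cmap_is_linear (M N : lmodType R) (h : {linear M -> N}) t :
  linear (cmap h : coch M t -> coch N t).
Proof.
move=> a x y; rewrite (@cmapD _ _ _ _ h) => [|*]; last exact: linearD.
by rewrite (@cmapZ _ _ _ _ id) // => *; rewrite ?linearD ?linearZ.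
Qed.
HB.instance Definition _ (M N : lmodType R) (h : {linear M -> N}) t :=
  GRing.isLinear.Build R (coch M t) (coch N t) *:%R (cmap h : coch M t -> coch N t)
    (@cmap_is_linear M N h t).

Lemma cmap_cst (M N : lmodType R) (h : {linear M -> N}) t x :
  cmap h (cst t x) = cst t (h x).
Proof.
by elim: t => [|t IH] //=; rewrite IH [cmap h 0]linear0.
Qed.

Lemma krelZ k (I : nat -> lmodType R) (d : forall n, {linear I n -> I n.+1}) t f s r
    (c : coch (I 0%N) t) (x : I k) :
  krel d f s c x -> krel d f s (r *: c) (r *: x).
Proof.
elim: k I d c x => [|k IH] I d c x /=; first by move=> ->; rewrite linearZ.
move=> [u [du ku hu]]; exists (r *: u); split; first exact: cdegZ.
  by rewrite linearZ /= ku.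
by rewrite linearZ /=; apply: IH.
Qed.

(** Exactness lifts the Koszul cocycle found over the shifted resolution through [d 0]; the Koszul
    differential of the lift is the next cocycle of the zigzag. *)
Lemma krel_surj k (I : nat -> lmodType R) (d : forall n, {linear I n -> I n.+1}) t f s
    (x : I k) :
  exact_complex d -> (forall i, (i < t)%N -> f i ^+ s *: x = 0) -> d k x = 0 ->
  exists c : coch (I 0%N) t, [/\ cdeg k c, kd (pw f s) c = 0,
    call [set y | d 0%N y = 0] c & krel d f s c x].
Proof.
elim: k I d x => [|k IH] I d x hd hx dx.
  exists (cst t x); split=> //; first exact: cdeg_cst.
    exact/kd_cst.
  by apply: call_cst => //=; rewrite linear0.
have [c' [dc' kc' zc' rc']] := IH (shift I) (fun n => d n.+1) x (fun n => hd n.+1) hx dx.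
have [||||u du eu] := @cmap_surj_deg _ _ _ _ (d 0%N) [set y | d 1%N y = 0] t k c'.
- by rewrite linear0.
- by move=> y /hd.
- exact: zc'.
- exact: dc'.
exists (kd (pw f s) u); split; first exact: cdeg_kd.
- exact: kdK.
- by apply/cmap_eq0; rewrite cmap_lin_kd eu.
- by exists u; split=> //; rewrite eu.
Qed.

(** The chase in the double complex of Koszul cochains of the resolution. From torsion coboundaries
    to Koszul boundaries it uses exactness of the resolution; back, it uses that the Koszul colimit
    of the injective module [I 0] is acyclic. *)
Lemma krel_bound (hR : acc R) k (I : nat -> lmodType R)
    (d : forall n, {linear I n -> I n.+1}) t f s (c : coch (I 0%N) t) (x : I k) :
  (forall n, is_injective_module (I n)) -> exact_complex d ->
  krel d f s c x ->
  (torsion_coboundaries (nspan f t) d k x <-> kbound [set y | d 0%N y = 0] k f s c).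
Proof.
elim: k I d c x => [|k IH] I d c x hI hd /=.
  by move=> ->; rewrite cst_eq0.
move=> [u [du ku hu]].
have dd y : d 1%N (d 0%N y) = 0 by apply/hd; exists y.
(* The end of the zigzag is separate: there [u] is an element [u0] of [I 0], and torsion elements of
   [I 0] take the place of acyclicity. *)
case: k IH x du hu => [|k] IH x du hu.
  have [u0 eu] := proj1 (cdeg0P _) du.
  have ex : d 0%N u0 = x by move: hu; rewrite /= eu cmap_cst => /cst_inj.
  split=> [[y /torsion_nspan[m hm] ey]|[m [w [dw zw kw]]]].
    exists m, (cst t (u0 - y)); split; first exact: cdeg_cst.
      by apply: call_cst; rewrite /= ?linear0 // linearB /= ex ey subrr.
    rewrite linearB [kd _ _]linearB /= (_ : kd _ (cst t y) = 0); last first.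
      by apply/kd_cst => i li; rewrite exprD -scalerA hm ?scaler0.
    by rewrite subr0 -(ktr_cst t (pw f m)) ktr_pw_kd -ku eu.
  have [w0 ew] := proj1 (cdeg0P _) dw.
  exists (u0 - w0); last first.
    rewrite linearB /= ex (_ : d 0%N w0 = 0) ?subr0 //.
    by move/cmap_eq0: zw; rewrite ew cmap_cst => /cst_eq0.
  apply/torsion_nspan; exists (s + m)%N; apply/kd_cst; rewrite linearB [kd _ _]linearB /=.
  by rewrite -ew kw -(ktr_cst t (pw f m) u0) ktr_pw_kd -eu ku subrr.
have [] := IH (shift I) (fun n => d n.+1) _ x (fun n => hI n.+1) (fun n => hd n.+1) hu.
move=> h1 h2; split=> [/h1 [m [w' [dw' zw' kw']]]|[m [w [dw zw kw]]]].
  have [||||v dv ev] := @cmap_surj_deg _ _ _ _ (d 0%N) [set y | d 1%N y = 0] t k w'.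
  - by rewrite linear0.
  - by move=> y /hd.
  - exact: zw'.
  - exact: dw'.
  exists m, (ktr (pw f m) u - kd (pw f (s + m)) v); split.
  - by apply: cdegB; [apply: cdeg_ktr|apply: cdeg_kd].
  - by apply/cmap_eq0; rewrite linearB /= cmap_lin_ktr cmap_lin_kd ev kw' subrr.
  - by rewrite linearB /= kdK subr0 ktr_pw_kd ku.
apply: h2; have [|||m2 [v [dv kv]]] := @injective_koszul_acyclic R hR (I 0%N) t f (s + m)
  k (ktr (pw f m) u - w).
- exact: hI.
- by apply: cdegB => //; apply: cdeg_ktr.
- by rewrite linearB /= kw ktr_pw_kd ku subrr.
exists (m + m2)%N, (cmap (d 0%N) v); split.
- by apply: cdeg_cmap => //; rewrite linear0.
- exact: call_cmap.
- rewrite addnA -cmap_lin_kd -kv cmap_lin_ktr linearB /= cmap_lin_ktr.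
  have -> : cmap (d 0%N) w = 0 by apply/cmap_eq0.
  by rewrite subr0 ktr_pw_comp.
Qed.

End TorsionComplex.

Theorem Ass_local_cohomology (R : comPzRingType) (hR : acc R) (t : nat) (f : nat -> R)
    (k : nat) (H : lmodType R) (P : set R) :
  is_local_cohomology (nspan f t) k (R^o)%R H -> Ass H P ->
  exists s (z : coch R^o t), kd (pw f s.+1) z = 0 /\
    forall r, P r <-> exists m y, r *: ktr (pw f m) z = kd (pw f (s.+1 + m)) y.
Proof.
move=> [I [e [d [[hI einj he hd] [pi [pilin pisurj pi0]]]]]] [_ [h ->]].
have [x [tx dx] <-] := pisurj h.
have [s0 hs0] := proj1 (torsion_nspan _ _ _) tx.
(* The exponent is made positive: later denominators are the powers [s.+1] of the generators. *)
have hs : forall i, (i < t)%N -> f i ^+ s0.+1 *: x = 0.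
  by move=> i li; rewrite exprS -scalerA hs0 ?scaler0.
have [c [dc kc zc rc]] := krel_surj hd hs dx.
have [||||z0 dz ez] := @cmap_surj_deg _ _ _ _ e [set y | d 0%N y = 0] t k c.
- by rewrite linear0.
- by move=> y /he.
- exact: zc.
- exact: dc.
have einj' := cmap_inj (t := t) einj.
have kz : kd (pw f s0.+1) z0 = 0.
  by apply: einj'; rewrite cmap_lin_kd ez kc linear0.
have tx0 : torsion_cocycles (nspan f t) d k 0.
  by split; [exists 0%N => r _; rewrite scaler0|rewrite linear0].
have txr r : torsion_cocycles (nspan f t) d k (r *: x).
  split; last by rewrite linearZ /= dx scaler0.
  by have [n hn] := tx; exists n => r' /hn hr; rewrite scalerA mulrC -scalerA hr scaler0.
have pi_0 : pi 0 = 0.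
  have := pilin 1 0 0 tx0 tx0; rewrite !scale1r addr0 => /esym/eqP.
  by rewrite -subr_eq0 addrK => /eqP.
exists s0, z0; split=> // r.
have -> : [set r | r *: pi x = 0] r <-> kbound [set y | d 0%N y = 0] k f s0.+1 (r *: c).
  rewrite -(krel_bound hR hI hd (krelZ r rc)) -pi0; last exact: txr.
  have := pilin r x 0 (conj tx dx) tx0; rewrite !addr0 pi_0 addr0 => ->.
  by [].
rewrite -{}ez; case: k d x {H h pi pilin pisurj pi0 tx dx rc txr tx0 pi_0 hs0 hs dc kc zc}
    dz he hd => [|k] d x dz he hd.
  split=> [|[m [y ey]]] /=.
    rewrite -linearZ -(linear0 (cmap e)) => /einj' e0.
    by exists 0%N, 0; rewrite -linearZ /= e0 !linear0.
  have [v ev] := proj1 (cdeg0P _) dz; move: ey; rewrite {}ev ktr_cst => ey.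
  rewrite -linearZ -(linear0 (cmap e)); congr cmap.
  rewrite -[LHS](cpr_id (k := 0)); last by apply/cdegZ/cdeg_cst.
  by rewrite ey cpr0_kd.
split=> [[m [w [dw zw kw]]]|[m [y ey]]].
  have [||y _ ey] := @cmap_surj _ _ _ _ e setT [set y | d 0%N y = 0] t w.
  - by move=> y /he[v]; exists v.
  - exact: zw.
  exists m, y; apply: einj'.
  by rewrite cmap_lin_kd ey kw [LHS]linearZ /= cmap_lin_ktr [RHS]linearZ.
exists m, (cmap e (cpr k y)); split.
- by apply: cdeg_cmap; [rewrite linear0|apply: cpr_deg].
- by apply: call_cmap => v; apply/he; exists v.
- rewrite -cmap_lin_kd -cpr_kd -ey cpr_id; last by apply/cdegZ/cdeg_ktr.
  by rewrite [cmap e _]linearZ /= cmap_lin_ktr [RHS]linearZ.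
Qed.

(** * From a hypersurface to the ambient ring *)

(* The annihilator of the class of [z] in the colimit of the Koszul cohomologies of the
   powers of [F] over the quotient by [J]. *)
Definition kann (S : comPzRingType) (J : set S) (t : nat) (F : nat -> S) (s : nat)
    (z : coch S^o t) : set S :=
  [set r | exists m y, call (J : set S^o) (r *: ktr (pw F m) z - kd (pw F (s + m)) y)].

Definition consf (S : Type) (h : S) (F : nat -> S) (i : nat) : S :=
  if i is i'.+1 then F i' else h.

Definition ideal_add (S : comPzRingType) (J : set S) (h : S) : set S :=
  [set u | exists v, J (u - v * h)].

Lemma zmod_id1 (V : zmodType) (A B C D E : V) :
  A - B - E = (A - C) - (B - D) + (C - D - E).
Proof.
have -> : A - C - (B - D) = A - B - (C - D).
  by rewrite !opprB addrACA [in RHS]addrACA [- C + _]addrC.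
by rewrite [RHS]addrA subrK.
Qed.

Lemma zmod_id2 (V : zmodType) (G T E K : V) :
  G + T = (E + K) - (E - G) - (K - T).
Proof.
by rewrite !opprB [G - E]addrC [E + K + _]addrACA subrr add0r [T - K]addrC addrACA subrr add0r.
Qed.

Section CochainIdeal.
Variable S : comPzRingType.
Implicit Types (J : set S).

Lemma ideal_addP J h : is_ideal J -> is_ideal (ideal_add J h).
Proof.
move=> [J0 JD JM]; split; first by exists 0; rewrite mul0r subr0.
  move=> x y [v hv] [w hw]; exists (v + w).
  by rewrite mulrDl opprD addrACA; apply: JD.
by move=> r x [v hv]; exists (r * v); rewrite -mulrA -mulrBr; apply: JM.
Qed.

Lemma ideal_add_sub J h : J `<=` ideal_add J h.
Proof. by move=> x Jx; exists 0; rewrite mul0r subr0. Qed.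

Lemma ideal_add_mem J h x : is_ideal J -> ideal_add J h (x * h).
Proof. by move=> [J0 _ _]; exists x; rewrite subrr. Qed.

Section Fixed.
Variables (J : set S) (hJ : is_ideal J).
Let hJm : @is_submod S S^o J := hJ.

Lemma callD t (x y : coch S^o t) : call (J : set S^o) x -> call (J : set S^o) y ->
  call (J : set S^o) (x + y).
Proof. by have [_ + _] := call_sub t hJm; apply. Qed.

Lemma callZ t r (x : coch S^o t) : call (J : set S^o) x -> call (J : set S^o) (r *: x).
Proof. by have [_ _] := call_sub t hJm; apply. Qed.

Lemma callN t (x : coch S^o t) : call (J : set S^o) x -> call (J : set S^o) (- x).
Proof. by rewrite -scaleN1r; apply: callZ. Qed.

Lemma callB t (x y : coch S^o t) : call (J : set S^o) x -> call (J : set S^o) y ->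
  call (J : set S^o) (x - y).
Proof. by move=> hx /callN; apply: callD. Qed.

Lemma call_kd_ideal t l (x : coch S^o t) :
  call (J : set S^o) x -> call (J : set S^o) (kd l x).
Proof. exact: call_kd. Qed.

Lemma call_ktr_ideal t l (x : coch S^o t) :
  call (J : set S^o) x -> call (J : set S^o) (ktr l x).
Proof. exact: call_ktr. Qed.

Lemma call_scale_mem t r (x : coch S^o t) : J r -> call (J : set S^o) (r *: x).
Proof.
move=> Jr; elim: t x => [|t IH] x /=; last by split; apply: IH.
exact: (@idealMr S J r x hJ Jr).
Qed.

Lemma call_kd_congr t l l' (x : coch S^o t) :
  (forall i, (i < t)%N -> J (l i - l' i)) -> call (J : set S^o) (kd l x - kd l' x).
Proof.
elim: t l l' x => [|t IH] l l' x h /=; first by rewrite subrr; case: hJ.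
have h' i : (i < t)%N -> J (l i.+1 - l' i.+1) by move=> li; apply: h.
split; first exact: IH.
rewrite (_ : _ - _ = (l 0%N - l' 0%N) *: x.1 - (kd (shift l) x.2 - kd (shift l') x.2)).
  by apply: callB; [apply: call_scale_mem; apply: h|apply: IH].
by rewrite scalerBl !opprB addrACA [in RHS]addrACA [- _ + _]addrC.
Qed.

Lemma call_nzd t h (x : coch S^o t) : (forall u, J (h * u) -> J u) ->
  call (J : set S^o) (h *: x) -> call (J : set S^o) x.
Proof. by move=> nzd; elim: t x => [|t IH] x /=; [apply: nzd|move=> [? ?]; split; apply: IH]. Qed.

Lemma call_ideal_add t h (x : coch S^o t) : call (ideal_add J h : set S^o) x ->
  exists y, call (J : set S^o) (x - h *: y).
Proof.
elim: t x => [|t IH] x /=; first by move=> [v hv]; exists v; rewrite [h *: _]mulrC.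
by move=> [/IH[y hy] /IH[y' hy']]; exists (y, y').
Qed.

Lemma call_ideal_addI t h (x y : coch S^o t) : call (J : set S^o) (x - h *: y) ->
  call (ideal_add J h : set S^o) x.
Proof.
elim: t x y => [|t IH] x y /=; first by exists y; rewrite mulrC.
by move=> [/IH ? /IH ?].
Qed.

End Fixed.

Lemma call_ktr_congr J J' t u u' r (x : coch S^o t) : is_ideal J -> is_ideal J' ->
  (forall v, J' v -> J (r * v)) ->
  (forall i, (i < t)%N -> J' (u i - u' i)) ->
  call (J : set S^o) (r *: (ktr u x - ktr u' x)).
Proof.
move=> hJ hJ' hr hu.
suff : call (J' : set S^o) (ktr u x - ktr u' x).
  elim: t {u u' hu} x (_ - _) => [|t IH] _ w /=; first exact: hr.
  by move=> [? ?]; split; apply: IH => //; exact: 0.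
elim: t u u' x hu => [|t IH] u u' x h /=; first by rewrite subrr; case: hJ'.
have h' i : (i < t)%N -> J' (u i.+1 - u' i.+1) by move=> li; apply: h.
split; first exact: IH.
rewrite (_ : _ - _ = (u 0%N - u' 0%N) *: ktr (shift u) x.2 +
   u' 0%N *: (ktr (shift u) x.2 - ktr (shift u') x.2)).
  by apply: callD => //; [apply: call_scale_mem => //; apply: h|apply: callZ => //; apply: IH].
by rewrite scalerBl scalerBr addrA subrK.
Qed.

End CochainIdeal.

Section OneStep.
Variable S : comPzRingType.
Variables (J : set S) (h : S).
Hypothesis hJ : is_ideal J.
Hypothesis nzd : forall u, J (h * u) -> J u.
Let J' := ideal_add J h.
Let hJ' : is_ideal J' := ideal_addP h hJ.
Let Jn (mu : nat) : set S := ideal_add J (h ^+ mu).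
Let hJn mu : is_ideal (Jn mu) := ideal_addP (h ^+ mu) hJ.

Let J'P v : J' v -> exists w j, J j /\ v = w * h + j.
Proof. by move=> [w hw]; exists w, (v - w * h); split=> //; ring. Qed.

Let mulJ' mu v : J' v -> Jn mu.+1 (h ^+ mu * v).
Proof.
move=> /J'P[w [j [Jj ->]]]; exists w.
rewrite (_ : _ - _ = h ^+ mu * j); last by rewrite exprS; ring.
by case: hJ => _ _; apply.
Qed.

Let Jn_le mu v : Jn mu.+1 v -> Jn mu v.
Proof. by move=> [w hw]; exists (w * h); rewrite -mulrA -exprS. Qed.

Let Jn1 k v : Jn k.+1 v -> J' v.
Proof. by elim: k => [|k IH]; [rewrite /Jn expr1|move=> /Jn_le]. Qed.

Let powJ' mu v : J' v -> Jn mu (v ^+ mu).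
Proof.
move=> hv; elim: mu => [|mu [w hw]].
  by exists (v ^+ 0); rewrite expr0 mulr1 subrr; case: hJ.
have [w' [j [Jj ev]]] := J'P hv; exists (w' * w).
rewrite (_ : _ - _ = v * (v ^+ mu - w * h ^+ mu) + (w * h ^+ mu) * j).
  by case: hJ => _ hD hM; apply: hD; apply: hM.
by rewrite !exprS; have -> : j = v - w' * h; [rewrite ev; ring|ring].
Qed.

Section Retraction.
Variables (mu : nat) (sigma : {rmorphism S -> S}).
Hypothesis sJ : forall u, J' u -> Jn mu.+1 (sigma u).
Hypothesis s1 : forall u, J' (sigma u - u).

Let sJ_le k u : (k <= mu.+1)%N -> J' u -> Jn k (sigma u).
Proof.
move=> le /sJ; rewrite -(subnK le); elim: (mu.+1 - k)%N => [|d IH] //.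
by rewrite addSn => /Jn_le.
Qed.

(** [b] is the last digit of an h-adic expansion of [u] modulo J + (h^(k+1)), with digits embedded
    by [sigma]. For k <= mu such expansions make S/(J + (h^(k+1))) free over S/J' on 1, h, ...,
    h^k. *)
Let dig (k : nat) (u b : S) : Prop := exists B : nat -> S,
  B k = b /\ Jn k.+1 (u - \sum_(i < k.+1) sigma (B i) * h ^+ i).

Let dig_ex k u : exists b, dig k u b.
Proof.
elim: k u => [|k IH] u.
  exists u, (fun=> u); split=> //; rewrite big_ord1 expr0 mulr1.
  have := s1 u; rewrite -opprB => /(idealN hJ'); rewrite opprK => -[w hw].
  by exists w; rewrite expr1.
have := s1 u; rewrite -opprB => /(idealN hJ'); rewrite opprK => -[u1 hu1].
have [b [B [eB hB]]] := IH u1.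
exists b, (fun i => if i is i'.+1 then B i' else u); split=> //.
move: hB => [w hw]; exists w; rewrite big_ord_recl /= expr0 mulr1.
set X := \sum_(i < _) _; set Y := \sum_(i < _) _ in hw.
have -> : X = Y * h.
  by rewrite /X /Y mulr_suml; apply: eq_bigr => i _; rewrite /= exprSr mulrA.
rewrite (_ : _ - _ = (u - sigma u - u1 * h) + h * (u1 - Y - w * h ^+ k.+1)).
  by case: hJ => _ hD hM; apply: hD => //; apply: hM.
by rewrite [in LHS]exprS; ring.
Qed.

(** The lowest digit lies in [J'] because [sigma] is the identity modulo [J']; its image under
    [sigma] is then negligible, and one factor [h] cancels modulo [J]. *)
Let dig_uniq k (B : nat -> S) : (k <= mu)%N ->
  Jn k.+1 (\sum_(i < k.+1) sigma (B i) * h ^+ i) -> J' (B k).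
Proof.
elim: k B => [|k IH] B le.
  rewrite big_ord1 expr0 mulr1 /Jn expr1 => hs.
  by rewrite -(subKr (sigma (B 0%N)) (B 0%N)); apply: (idealB hJ').
move=> hs; have B0 : J' (B 0%N).
  have : J' (\sum_(i < k.+2) sigma (B i) * h ^+ i).
    exact: Jn1 hs.
  rewrite big_ord_recl expr0 mulr1 => hx.
  have hy : J' (sigma (B 0%N)).
    rewrite -(addrK (\sum_(i < k.+1) sigma (B (lift ord0 i)) * h ^+ (lift ord0 i)) (sigma _)).
    apply: (idealB hJ') => //; apply: ideal_sum => // i _.
    by rewrite exprSr mulrA; apply: ideal_add_mem.
  by rewrite -(subKr (sigma (B 0%N)) (B 0%N)); apply: (idealB hJ').
apply: (IH (fun i => B i.+1)); first exact: ltnW.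
move: hs; rewrite big_ord_recl expr0 mulr1.
set X := \sum_(i < _) _; set Y := \sum_(i < _) _.
have -> : X = Y * h.
  by rewrite /X /Y mulr_suml; apply: eq_bigr => i _; rewrite /= exprSr mulrA.
move=> hs; have : Jn k.+2 (Y * h).
  rewrite -(addrK (sigma (B 0%N)) (Y * h)) [Y * h + _]addrC; apply: (idealB (hJn _)) => //.
  by apply: sJ_le.
move=> [w hw]; exists w; apply: nzd; rewrite mulrBr mulrCA -exprS mulrC.
exact: hw.
Qed.

(** The last digit. It is defined up to [J'] only, hence the congruences below; modulo [J'] it is
    additive, linear over S/J' through [sigma], and a left inverse of multiplication by h^mu. *)
Let rho u := projT1 (cid (dig_ex mu u)).
Let rhoP u : dig mu u (rho u).
Proof. by rewrite /rho; case: cid. Qed.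

Let dig_eq u u' b b' : dig mu u b -> dig mu u' b' -> Jn mu.+1 (u - u') -> J' (b - b').
Proof.
move=> [B [<- hB]] [B' [<- hB']] hu.
apply: (dig_uniq (B := fun i => B i - B' i)) => //.
rewrite (_ : \sum_(i < _) _ = (u - u') - ((u - \sum_(i < mu.+1) sigma (B i) * h ^+ i) -
  (u' - \sum_(i < mu.+1) sigma (B' i) * h ^+ i))).
  by apply: (idealB (hJn _)) => //; apply: (idealB (hJn _)).
under eq_bigr => i _ do rewrite rmorphB mulrBl.
by rewrite sumrB; ring.
Qed.

Let digB u v b c : dig mu u b -> dig mu v c -> dig mu (u - v) (b - c).
Proof.
move=> [B [<- hB]] [C [<- hC]]; exists (fun i => B i - C i); split=> //.
under eq_bigr => i _ do rewrite rmorphB mulrBl.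
rewrite sumrB (_ : _ - _ = (u - \sum_(i < mu.+1) sigma (B i) * h ^+ i) -
  (v - \sum_(i < mu.+1) sigma (C i) * h ^+ i)); last by ring.
exact: (idealB (hJn _)).
Qed.

Let digM u b f : dig mu u b -> dig mu (sigma f * u) (f * b).
Proof.
move=> [B [<- hB]]; exists (fun i => f * B i); split=> //.
under eq_bigr => i _ do rewrite rmorphM -mulrA.
by rewrite -mulr_sumr -mulrBr; case: (hJn mu.+1) => _ _; apply.
Qed.

Let dig_top u : dig mu (h ^+ mu * u) u.
Proof.
exists (fun i => if i == mu then u else 0); rewrite eqxx; split=> //.
rewrite big_ord_recr /= eqxx big1 ?add0r; last first.
  by move=> i _; rewrite ltn_eqF // rmorph0 mul0r.
rewrite [sigma u * _]mulrC -mulrBr; apply: mulJ'.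
by rewrite -opprB; apply: (idealN hJ').
Qed.

Let rho_kd t (v : nat -> S) (y : coch S^o t) :
  call (J' : set S^o) (kd v (cmap (rho : S^o -> S^o) y) -
    cmap (rho : S^o -> S^o) (kd (fun i => sigma (v i)) y)).
Proof.
have rho0 : J' (0 - rho 0).
  apply: (dig_eq (u := 0) (u' := 0)) => //; last by rewrite subrr; case: (hJn mu.+1).
  exists (fun=> 0); split=> //; rewrite big1 ?subrr; first by case: (hJn mu.+1).
  by move=> i _; rewrite rmorph0 mul0r.
have rhoB t' (a b : coch S^o t') : call (J' : set S^o)
    ((cmap (rho : S^o -> S^o) a - cmap (rho : S^o -> S^o) b) - cmap (rho : S^o -> S^o) (a - b)).
  elim: t' a b => [|t' IH] a b /=; last by split; apply: IH.
  by apply: dig_eq (digB (rhoP a) (rhoP b)) (rhoP _) _; rewrite subrr; case: (hJn mu.+1).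
have rhoM t' f (a : coch S^o t') : call (J' : set S^o)
    (f *: cmap (rho : S^o -> S^o) a - cmap (rho : S^o -> S^o) (sigma f *: a)).
  elim: t' a => [|t' IH] a /=; last by split; apply: IH.
  by apply: dig_eq (digM f (rhoP a)) (rhoP _) _; rewrite subrr; case: (hJn mu.+1).
elim: t v y => [|t IH] v y /=; first exact: rho0.
split; first exact: IH.
set a := cmap _ y.1; set b := kd _ (cmap _ y.2).
set c := sigma (v 0%N) *: y.1; set d := kd _ y.2.
rewrite (_ : _ - _ = (v 0%N *: a - cmap (rho : S^o -> S^o) c) -
  (b - cmap (rho : S^o -> S^o) d) +
  (cmap (rho : S^o -> S^o) c - cmap (rho : S^o -> S^o) d - cmap (rho : S^o -> S^o) (c - d))).
  by apply: callD; [exact: hJ'|apply: callB; [exact: hJ'|exact: rhoM|exact: IH]|exact: rhoB].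
exact: zmod_id1.
Qed.

(** [rho] carries the differential with coefficients sigma(v) to the one with coefficients [v], and
    h^mu w to [w]; so it turns a primitive of the one into a primitive of the other. *)
Lemma retract_koszul t (v : nat -> S) (w y : coch S^o t) :
  call (Jn mu.+1 : set S^o) (h ^+ mu *: w - kd (fun i => sigma (v i)) y) ->
  exists y', call (J' : set S^o) (w - kd v y').
Proof.
move=> hw; exists (cmap (rho : S^o -> S^o) y).
rewrite -(subrKA (cmap (rho : S^o -> S^o) (kd (fun i => sigma (v i)) y))).
apply: callD => //; last by rewrite -opprB; apply: callN => //; apply: rho_kd.
move: (kd _ y) hw => x; elim: t w x {v y} => [|t IH] w x /=; last by move=> [? ?]; split; apply: IH.
by move=> hw; apply: dig_eq (dig_top w) (rhoP x) hw.
Qed.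

End Retraction.

Hypothesis sections : forall mu, exists sigma : {rmorphism S -> S},
  (forall u, J' u -> Jn mu.+1 (sigma u)) /\ (forall u, J' (sigma u - u)).

(** In the binomial expansion of (b + d)^(N + mu + 1), d = a - b, the terms with at least mu + 1
    factors [d] vanish modulo J + (h^(mu+1)), and all others contain b^N. *)
Let comparison mu N (a b : S) : J' (a - b) ->
  exists e, Jn mu.+1 (b ^+ N * e - a ^+ (N + mu.+1)) /\ J' (e - b ^+ mu.+1).
Proof.
move=> hab; pose d := a - b.
exists (\sum_(i < mu.+1) (b ^+ (mu.+1 - i) * d ^+ i) *+ 'C(N + mu.+1, i)); split.
  rewrite -[a](subrK b) -/d [d + b]addrC exprDn -(big_mkord xpredT
    (fun i => b ^+ (N + mu.+1 - i) * d ^+ i *+ 'C(N + mu.+1, i))).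
  rewrite (big_cat_nat (n := mu.+1)) //=; last by rewrite -addSn leq_addl.
  rewrite big_mkord mulr_sumr opprD addrA.
  rewrite (_ : \sum_(i < _) _ - _ = 0); last first.
    apply/eqP; rewrite subr_eq0; apply/eqP/eq_bigr => i _.
    by rewrite mulrnAr mulrA -exprD addnBA // (ltnW (ltn_ord i)).
  rewrite sub0r; apply: (idealN (hJn _)).
  rewrite big_nat; apply: ideal_sum => // i /andP[le _].
  rewrite -mulr_natr -mulrA; have [_ _ hM] := hJn mu.+1; apply: (hM).
  by rewrite mulrC -(subnK le) exprD; apply: (hM); apply: (hM); apply: powJ'.
rewrite big_ord_recl subn0 expr0 mulr1 bin0 mulr1n addrC addKr.
apply: ideal_sum => // i _; rewrite -mulr_natr exprS mulrCA.
by do 2!apply: (@idealMr _ J' _ _ hJ').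
Qed.

(** In Čech terms [z] is sent to z/h: S/J' is the part killed by [h] of the quotient of (S/J)[1/h]
    by S/J. With d z = h x modulo [J], the cocycle (x, h^s z) is z/h over the denominator h^(s+1).
    That no annihilator grows is the content of [retract_koszul]. *)
Theorem koszul_one_step t (F : nat -> S) s (z : coch S^o t) :
  call (J' : set S^o) (kd (pw F s.+1) z) ->
  exists z' : coch S^o t.+1,
    call (J : set S^o) (kd (pw (consf h F) s.+1) z') /\
    kann J (consf h F) s.+1 z' = kann J' F s.+1 z.
Proof.
move=> /(call_ideal_add) [x hx].
have Dx : call (J : set S^o) (kd (pw F s.+1) x).
  apply: (call_nzd nzd); rewrite -linearZ /=.
  rewrite -[X in call _ X]opprK -[in X in call _ X](sub0r (kd _ _)).
  rewrite -(kdK (pw F s.+1) z) -linearB /=.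
  by apply: callN => //; apply: call_kd_ideal.
exists (x, h ^+ s *: z); split.
  rewrite /=; split; first exact: Dx.
  rewrite linearZ /= exprSr -scalerA -scalerBr; apply: callZ => //.
  by rewrite -opprB; apply: callN.
apply/seteqP; split=> r.
  move=> [m [[x' y'] /= [_]]]; rewrite [ktr _ (_ *: _)]linearZ /= [h ^+ m *: _]scalerA -exprD.
  set w := ktr _ z => hw.
  (* The cocycle contributes h^s and the transition map h^m in front of [z], while the relation
     holds modulo h^(mu+1). *)
  pose mu := (m + s)%N; pose N := (s.+1 + m)%N.
  have [sigma [sJ s1]] := sections mu.
  (* [retract_koszul] wants coefficients in the image of [sigma]. Replacing F^N by sigma(F)^(N+mu+1)
     costs the factors [e], which modulo [J'] are those of a transition map. *)
  have he i : exists e, Jn mu.+1 (F i ^+ N * e - sigma (F i) ^+ (N + mu.+1)) /\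
      J' (e - F i ^+ mu.+1) by apply: comparison.
  have [e hE] := choice he.
  have hw2 : call (Jn mu.+1 : set S^o) (h ^+ mu *: (r *: w) + kd (pw F N) y').
    have := @call_ideal_addI S J t (h ^+ mu.+1) (h ^+ mu *: (r *: w) + kd (pw F N) y') x'.
    apply; rewrite (_ : mu.+1 = N); last by rewrite /N /mu addSn addnC.
    by move: hw; rewrite opprB scalerA mulrC -scalerA addrA.
  have hw3 : call (Jn mu.+1 : set S^o) (h ^+ mu *: (r *: ktr (pw F mu.+1) w) -
      kd (fun i => sigma (F i ^+ (N + mu.+1))) (- ktr e y')).
    rewrite linearN opprK.
    rewrite (_ : _ + _ = ktr e (h ^+ mu *: (r *: w) + kd (pw F N) y') -
      r *: (h ^+ mu *: (ktr e w - ktr (pw F mu.+1) w)) -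
      (kd (fun i => F i ^+ N * e i) (ktr e y') -
       kd (fun i => sigma (F i ^+ (N + mu.+1))) (ktr e y'))).
      apply: callB => //; [apply: callB => //; [exact: call_ktr_ideal|apply: callZ => //]|].
        by apply: (call_ktr_congr (J' := J')) => // [v|i _]; [apply: mulJ'|case: (hE i)].
      by apply: call_kd_congr => // i _; rewrite rmorphXn; case: (hE i).
    rewrite linearD /= -ktr_kd [ktr e (h ^+ mu *: _)]linearZ /= [ktr e (r *: w)]linearZ /=.
    rewrite [r *: (h ^+ mu *: _)]scalerA [r * _]mulrC -[in RHS]scalerA.
    by rewrite !scalerBr; apply: zmod_id2.
  have [y'' hy] := retract_koszul sJ s1 (v := pw F (N + mu.+1)) hw3.
  exists (m + mu.+1)%N, y''; rewrite addnA -/N.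
  by move: hy; rewrite /w ktr_pw_comp.
move=> [m [y1 /(call_ideal_add) [x1 hx1]]].
exists m, (x1, - (h ^+ (m + s) *: y1)); rewrite /=; split.
  apply: (call_nzd nzd).
  have -> : h *: (r *: ktr (pw F m) x - kd (pw F (s.+1 + m)) x1) =
      r *: ktr (pw F m) (h *: x) - kd (pw F (s.+1 + m)) (h *: x1).
    by rewrite scalerBr [ktr _ (h *: x)]linearZ [kd _ (h *: x1)]linearZ /= !scalerA mulrC.
  set w := ktr _ z in hx1.
  rewrite (_ : _ - _ = r *: (ktr (pw F m) (h *: x - kd (pw F s.+1) z)) +
    kd (pw F (s.+1 + m)) (r *: w - kd (pw F (s.+1 + m)) y1 - h *: x1)).
    apply: callD => //; last exact: call_kd_ideal.
    apply: callZ => //; apply: call_ktr_ideal => //.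
    by rewrite -opprB; apply: callN.
  rewrite [ktr _ (_ - _)]linearB [kd _ (_ - h *: x1)]linearB /=.
  rewrite [kd _ (r *: w - _)]linearB /=.
  by rewrite kdK subr0 [kd _ (r *: w)]linearZ /= ktr_pw_kd scalerBr addrA subrK.
rewrite [ktr _ (h ^+ s *: z)]linearZ /= [kd _ (- _)]linearN /= [kd _ (_ *: y1)]linearZ /= opprK.
rewrite [h ^+ m *: _]scalerA -exprD.
rewrite (_ : _ - _ = h ^+ (m + s) *: (r *: ktr (pw F m) z - kd (pw F (s.+1 + m)) y1 - h *: x1)).
  exact: callZ.
rewrite !scalerBr !scalerA -exprSr [r * _]mulrC (_ : (s.+1 + m)%N = (m + s).+1).
  by rewrite opprD addrA addrAC.
by rewrite addSn addnC.
Qed.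

End OneStep.

(** * Sections from the Jacobian matrix *)

Lemma ideal_congrM (S : comPzRingType) (J : set S) (a b c d : S) : is_ideal J ->
  J (a - b) -> J (c - d) -> J (a * c - b * d).
Proof.
move=> [J0 JD JM] hp hq; rewrite (_ : _ - _ = c * (a - b) + b * (c - d)); last by ring.
by apply: JD; apply: JM.
Qed.

Lemma ideal_taylorD (S : comPzRingType) (K : set S) (a b X c d Y : S) : is_ideal K ->
  K (a - b - X) -> K (c - d - Y) -> K (a + c - (b + d) - (X + Y)).
Proof.
move=> [K0 KD KM] hp hq.
rewrite (_ : _ - _ = (a - b - X) + (c - d - Y)); [exact: KD|ring].
Qed.

Lemma ideal_taylorM (S : comPzRingType) (K : set S) (a b X c d Y : S) : is_ideal K ->
  K (X * Y) -> K (a - b - X) -> K (c - d - Y) -> K (a * c - b * d - (d * X + b * Y)).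
Proof.
move=> [K0 KD KM] hXY hp hq.
rewrite (_ : _ - _ = c * (a - b - X) + (b + X) * (c - d - Y) + X * Y); last by ring.
by apply: (KD) => //; apply: (KD); apply: (KM).
Qed.

Section Sections.
Variables (A : comNzRingType) (n : nat).
Notation S := {mpoly A[n]}.

Definition msubst (xi : 'I_n -> S) : S -> S := mmap (@mpolyC n A) xi.
HB.instance Definition _ xi := GRing.RMorphism.on (msubst xi).

Lemma msubstX xi i : msubst xi 'X_i = xi i.
Proof. by rewrite /msubst mmapX mmap1U. Qed.

Lemma msubstC xi c : msubst xi c%:MP = c%:MP.
Proof. by rewrite /msubst mmapC. Qed.

Lemma msubst_congr (J : set S) xi eta p : is_ideal J ->
  (forall i, J (xi i - eta i)) -> J (msubst xi p - msubst eta p).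
Proof.
move=> hJ hxi; have [J0 JD JM] := hJ; elim/mpoly_subring_ind: p.
- by move=> c; rewrite !msubstC subrr.
- by move=> i; rewrite !msubstX.
- move=> p q hp hq; rewrite !rmorphD /= opprD addrACA; exact: JD.
- by move=> p q hp hq; rewrite !rmorphM /=; apply: ideal_congrM.
Qed.

Lemma msubst_id p : msubst (fun i => 'X_i) p = p.
Proof.
elim/mpoly_subring_ind: p.
- by move=> c; rewrite msubstC.
- by move=> i; rewrite msubstX.
- by move=> p q hp hq; rewrite rmorphD /= hp hq.
- by move=> p q hp hq; rewrite rmorphM /= hp hq.
Qed.

Lemma mpoly_taylor1 (K : set S) xi delta p : is_ideal K ->
  (forall i j, K (delta i * delta j)) ->
  K (msubst (fun i => xi i + delta i) p - msubst xi p -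
     \sum_i msubst xi p^`M(i) * delta i).
Proof.
move=> hK hd; have [K0 KD KM] := hK; elim/mpoly_subring_ind: p.
- move=> c; rewrite !msubstC big1 ?subrr ?subr0 // => i _.
  by rewrite mderivC rmorph0 mul0r.
- move=> j; rewrite !msubstX (bigD1 j) //= mderivX mnmE eqxx /=.
  rewrite (_ : (U_(j) - U_(j))%MM = 0%MM); last by apply/mnmP => l; rewrite !mnmE subnn.
  rewrite mpolyX0 ?mulr1n scale1r rmorph1 mul1r big1 ?addr0; last first.
    by move=> i ij; rewrite mderivX mnmE eq_sym (negbTE ij) scale0r rmorph0 mul0r.
  by rewrite [xi j + _]addrC addrK subrr.
- move=> p q hp hq.
  rewrite (_ : \sum_i _ = \sum_i msubst xi p^`M(i) * delta i +
    \sum_i msubst xi q^`M(i) * delta i); last first.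
    by rewrite -big_split; apply: eq_bigr => i _; rewrite mderivD rmorphD mulrDl.
  by rewrite !rmorphD /=; apply: ideal_taylorD.
- move=> p q hp hq; rewrite !rmorphM /=.
  set dp := \sum_i msubst xi p^`M(i) * delta i in hp.
  set dq := \sum_i msubst xi q^`M(i) * delta i in hq.
  have -> : \sum_i msubst xi (p * q)^`M(i) * delta i = msubst xi q * dp + msubst xi p * dq.
    rewrite /dp /dq !mulr_sumr -big_split; apply: eq_bigr => i _ /=.
    by rewrite mderivM rmorphD !rmorphM /=; ring.
  have hpq : K (dp * dq).
    rewrite /dp mulr_suml; apply: ideal_sum => // i _.
    rewrite /dq mulr_sumr; apply: ideal_sum => // j _.
    by rewrite mulrACA; apply: KM.
  exact: ideal_taylorM.
Qed.

Variables (h : nat -> S) (i : nat).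
Let J := nspan h i.
Let J' := ideal_add J (h i).

(* Newton iteration: [xi] is a zero of [h 0, ..., h i] modulo [J + h i ^ mu.+1]. *)
Lemma jacobian_section (nu : 'I_n -> nat -> S) :
  (forall l l', (l <= i)%N -> (l' <= i)%N ->
     J' (\sum_j (h l)^`M(j) * nu j l' - (l == l')%:R)) ->
  forall mu, exists sigma : {rmorphism S -> S},
    (forall u, J' u -> ideal_add J (h i ^+ mu.+1) (sigma u)) /\
    (forall u, J' (sigma u - u)).
Proof.
move=> hnu mu.
have hJ : is_ideal J := nspan_ideal h i.
have hJ' : is_ideal J' := ideal_addP (h i) hJ.
have hJn k : is_ideal (ideal_add J (h i ^+ k)) := ideal_addP _ hJ.
have hl l : (l <= i)%N -> J' (h l).
  rewrite leq_eqVlt => /predU1P[->|lt]; last exact/ideal_add_sub/nspan_mem.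
  by rewrite -[h i]mul1r; apply: ideal_add_mem.
suff [xi [hxi xi0]] : exists xi : 'I_n -> S,
    (forall l, (l <= i)%N -> ideal_add J (h i ^+ mu.+1) (msubst xi (h l))) /\
    (forall j, J' (xi j - 'X_j)).
  exists (msubst xi); split; last first.
    by move=> u; rewrite -{2}(msubst_id u); apply: msubst_congr.
  move=> u [v [c ev]]; rewrite -(subrK (v * h i) u) ev rmorphD rmorphM rmorph_sum /=.
  have [_ JD JM] := hJn mu.+1; apply: JD; last by apply/JM/hxi.
  apply: ideal_sum => // l _; rewrite rmorphM /=; apply/JM/hxi; exact: ltnW.
elim: mu => [|mu [xi [hxi xi0]]].
  exists (fun j => 'X_j); split; last by move=> j; rewrite subrr; case: hJ'.
  by move=> l li; rewrite expr1 msubst_id; apply: hl.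
have {}hxi l : exists e, (l <= i)%N -> J (msubst xi (h l) - e * h i ^+ mu.+1).
  have [li|] := boolP (l <= i)%N; last by exists 0.
  by have [e he] := hxi l li; exists e.
have [eps heps] := choice hxi.
(* Newton's correction: [nu] is a right inverse of the Jacobian matrix modulo [J'], and eps h^(mu+1)
   are the current values of the equations. Products of two corrections contain h^(2 mu + 2). *)
pose delta j := - (h i ^+ mu.+1 * \sum_(l' < i.+1) nu j l' * eps l').
exists (fun j => xi j + delta j); split; last first.
  move=> j; rewrite addrAC; have [_ JD JM] := hJ'; apply: JD => //.
  rewrite (_ : delta j = - (h i ^+ mu * \sum_(l' < i.+1) nu j l' * eps l') * h i).
    exact: ideal_add_mem.
  by rewrite /delta exprSr; ring.
move=> l li; have [K0 KD KM] := hJn mu.+2.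
have mulJ' v : J' v -> ideal_add J (h i ^+ mu.+2) (h i ^+ mu.+1 * v).
  move=> [w hw]; exists w; rewrite (_ : _ - _ = h i ^+ mu.+1 * (v - w * h i)).
    by case: hJ => _ _; apply.
  by rewrite [h i ^+ mu.+2]exprSr; ring.
have hT := @mpoly_taylor1 (ideal_add J (h i ^+ mu.+2)) xi delta (h l) (hJn _).
rewrite -(subrK (msubst xi (h l) + \sum_j msubst xi (h l)^`M(j) * delta j)
  (msubst _ (h l))).
apply: KD.
  rewrite opprD addrA; apply: hT => j j'.
  rewrite /delta mulrNN mulrACA -exprD; rewrite (_ : (mu.+1 + mu.+1 = mu + mu.+2)%N); last by lia.
  by rewrite exprD -mulrA mulrCA mulrC; apply: ideal_add_mem.
pose D := \sum_(l' < i.+1) (\sum_j (h l)^`M(j) * nu j l' - (l == l')%:R) * eps l'.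
pose E := \sum_j (msubst xi (h l)^`M(j) - (h l)^`M(j)) * \sum_(l' < i.+1) nu j l' * eps l'.
have eD : D = \sum_j (h l)^`M(j) * (\sum_(l' < i.+1) nu j l' * eps l') - eps l.
  rewrite /D; under eq_bigr => l' _ do rewrite mulrBl mulr_suml.
  rewrite sumrB; congr (_ - _); last first.
    rewrite (bigD1 (Ordinal (li : (l < i.+1)%N))) //= eqxx mul1r big1 ?addr0 //.
    by move=> l'; rewrite -val_eqE /= eq_sym => /negbTE ->; rewrite mul0r.
  rewrite exchange_big; apply: eq_bigr => j _; rewrite mulr_sumr.
  by apply: eq_bigr => l' _; rewrite mulrA.
rewrite (_ : _ + _ = (msubst xi (h l) - eps l * h i ^+ mu.+1) - h i ^+ mu.+1 * (D + E)).
  apply: (idealB (hJn _)); first by apply/ideal_add_sub/heps.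
  apply: mulJ'; have [_ JD JM] := hJ'; apply: JD.
    rewrite /D; apply: ideal_sum => // l' _; apply: (@idealMr _ J' _ _ hJ').
    by apply: hnu => //; rewrite -ltnS.
  rewrite /E; apply: ideal_sum => // j _; apply: (@idealMr _ J' _ _ hJ').
  by rewrite -{2}(msubst_id (h l)^`M(j)); apply: msubst_congr.
rewrite eD.
have -> : \sum_j msubst xi (h l)^`M(j) * delta j = - (h i ^+ mu.+1 *
   \sum_j msubst xi (h l)^`M(j) * \sum_(l' < i.+1) nu j l' * eps l').
  rewrite mulr_sumr -sumrN; apply: eq_bigr => j _; rewrite /delta; ring.
have -> : E = \sum_j msubst xi (h l)^`M(j) * \sum_(l' < i.+1) nu j l' * eps l' -
   \sum_j (h l)^`M(j) * \sum_(l' < i.+1) nu j l' * eps l'.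
  by rewrite /E -sumrB; apply: eq_bigr => j _; rewrite mulrBl.
ring.
Qed.

End Sections.

(** * Divided derivatives *)

Section StrongRec.
Variables (T : Type) (x0 : T) (G : nat -> (nat -> T) -> T).

Fixpoint srec_tbl (b : nat) : nat -> T :=
  if b is b'.+1 then fun c => if c == b' then G b' (srec_tbl b') else srec_tbl b' c
  else fun=> x0.

Definition srec (b : nat) : T := srec_tbl b.+1 b.

Lemma srecE : (forall b f g, (forall c, (c < b)%N -> f c = g c) -> G b f = G b g) ->
  forall b, srec b = G b srec.
Proof.
move=> hG b; rewrite /srec /= eqxx; apply: hG => c lt.
elim: b c lt => [|b IH] c //=; rewrite ltnS leq_eqVlt => /predU1P[->|lt].
  by rewrite eqxx.
by rewrite ltn_eqF // IH.
Qed.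

End StrongRec.

Section Conv.
Variable K : comNzRingType.
Implicit Types a b c : nat -> K.

Definition conv a b (n : nat) : K := \sum_(i < n.+1) a i * b (n - i)%N.

Lemma conv_poly N a b n : (n < N)%N ->
  (\poly_(i < N) a i * \poly_(i < N) b i)`_n = conv a b n.
Proof.
move=> lt; rewrite coefM; apply: eq_bigr => i _; rewrite !coef_poly.
rewrite (leq_ltn_trans (leq_subr _ _) lt).
by rewrite (leq_ltn_trans _ lt) // -ltnS.
Qed.

Lemma convC a b : conv a b = conv b a.
Proof. by apply/funext => n; rewrite -!(@conv_poly n.+1) // mulrC. Qed.

Lemma convA a b c : conv a (conv b c) = conv (conv a b) c.
Proof.
apply/funext => n; have h d e : conv d e n =
    (\poly_(i < n.+1) d i * \poly_(i < n.+1) e i)`_n by rewrite conv_poly.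
have trunc (p q : {poly K}) : (p * \poly_(i < n.+1) q`_i)`_n = (p * q)`_n.
  rewrite !coefM; apply: eq_bigr => i _; rewrite coef_poly.
  by rewrite (leq_ltn_trans (leq_subr _ _) (ltnSn n)).
rewrite [LHS]h [RHS]h.
have -> : \poly_(i < n.+1) conv b c i =
    \poly_(i < n.+1) (\poly_(i < n.+1) b i * \poly_(i < n.+1) c i)`_i.
  by apply/polyP => i; rewrite !coef_poly; case: ltnP => // lt; rewrite conv_poly.
have -> : \poly_(i < n.+1) conv a b i =
    \poly_(i < n.+1) (\poly_(i < n.+1) a i * \poly_(i < n.+1) b i)`_i.
  by apply/polyP => i; rewrite !coef_poly; case: ltnP => // lt; rewrite conv_poly.
have trunc' (p q : {poly K}) : (\poly_(i < n.+1) p`_i * q)`_n = (p * q)`_n.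
  by rewrite mulrC trunc mulrC.
by rewrite trunc trunc' mulrA.
Qed.

End Conv.

Lemma conv_cancel (K : fieldType) (a b c : nat -> K) : a 0%N != 0 ->
  conv a b = conv a c -> b = c.
Proof.
move=> a0 e; apply/funext => n; elim/ltn_ind: n => n IH; have := congr1 (fun f => f n) e.
rewrite /conv !big_ord_recl /= subn0 => /eqP.
rewrite (eq_bigr (fun i : 'I_n => a (bump 0 i) * c (n - bump 0 i)%N)); last first.
  by move=> i _; rewrite IH //= /bump /= add1n; have := ltn_ord i; lia.
by rewrite (inj_eq (addIr _)) => /eqP /(mulfI a0).
Qed.

Section Hasse.
Variables (A : comNzRingType) (n : nat).
Notation S := {mpoly A[n]}.

Definition taylor_var (i l : 'I_n) : {poly S} := ('X_l)%:P + 'X *+ (l == i).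

Definition taylor (i : 'I_n) : S -> {poly S} :=
  mmap ((@polyC S) \o (@mpolyC n A)) (taylor_var i).
HB.instance Definition _ i := GRing.RMorphism.on (taylor i).

(** The j-th derivative in the i-th variable divided by j!, read off the expansion of p(x_i + X),
    which makes sense over any coefficient ring. *)
Definition hasse (i : 'I_n) (j : nat) (p : S) : S := (taylor i p)`_j.

Lemma hasse_is_additive i j : zmod_morphism (hasse i j).
Proof. by move=> p q; rewrite /hasse rmorphB coefB. Qed.
HB.instance Definition _ i j :=
  GRing.isZmodMorphism.Build S S (hasse i j) (hasse_is_additive i j).

Lemma taylorC i c : taylor i c%:MP = (c%:MP)%:P.
Proof. by rewrite /taylor mmapC. Qed.

Lemma taylorX i l : taylor i 'X_l = taylor_var i l.
Proof. by rewrite /taylor mmapX mmap1U. Qed.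

Lemma hasseC i j c : hasse i j c%:MP = if j == 0%N then c%:MP else 0.
Proof. by rewrite /hasse taylorC coefC. Qed.

Lemma hasseM i p q : (fun j => hasse i j (p * q)) =1
  conv (fun j => hasse i j p) (fun j => hasse i j q).
Proof. by move=> j; rewrite /hasse rmorphM coefM. Qed.

Lemma hasseXU i l j : hasse i j 'X_l =
  if j == 0%N then 'X_l else if (j == 1%N) && (l == i) then 1 else 0.
Proof.
rewrite /hasse taylorX /taylor_var coefD coefC coefMn coefX.
by case: j => [|[|j]]; case: (l == i); rewrite /= ?mulr0n ?mul0rn ?addr0 ?add0r.
Qed.

Lemma hasse0 i p : hasse i 0 p = p.
Proof.
elim/mpoly_subring_ind: p => [c|l|p q hp hq|p q hp hq].
- by rewrite hasseC.
- by rewrite hasseXU.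
- by rewrite raddfD /= hp hq.
- by have := hasseM i p q 0; rewrite /conv big_ord1 subn0 hp hq.
Qed.

Lemma hasse_monomial i j (m : 'X_{1..n}) :
  hasse i j 'X_[m] = 'X_[m - U_(i) *+ j] *+ 'C(m i, j).
Proof.
rewrite /hasse mpolyXE_id rmorph_prod (bigD1 i) //= rmorphXn /= taylorX.
rewrite /taylor_var eqxx mulr1n.
rewrite (eq_bigr (fun l : 'I_n => ('X_l ^+ m l)%:P)); last first.
  move=> l li; rewrite rmorphXn /= taylorX /taylor_var (negbTE li) mulr0n addr0.
  by rewrite rmorphXn.
rewrite -rmorph_prod /= coefMC exprDn coef_sum.
have [lt|le] := ltnP (m i) j.
  rewrite bin_small // mulr0n big1 ?mul0r // => c _.
  rewrite coefMn -rmorphXn coefCM coefXn [j == _]gtn_eqF ?mulr0 ?mul0rn //.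
  by apply: leq_ltn_trans lt; rewrite -ltnS.
rewrite (bigD1 (Ordinal (le : (j < (m i).+1)%N))) //= big1 => [|c cj].
  rewrite addr0 coefMn -rmorphXn coefCM coefXn eqxx mulr1 mulrnAl; congr (_ *+ _).
  rewrite [RHS]mpolyXE_id [RHS](bigD1 i) //= !mnmE mulmnE mnmE eqxx mul1n.
  congr (_ * _); apply: eq_bigr => l li.
  by rewrite !mnmE mulmnE mnmE eq_sym (negbTE li) mul0n subn0.
rewrite coefMn -rmorphXn coefCM coefXn; case: eqP => [e|]; last by rewrite mulr0 mul0rn.
by move: cj; rewrite -val_eqE /= -e eqxx.
Qed.

Lemma mcoeff_hasse i j p m : (hasse i j p)@_m = p@_(m + U_(i) *+ j) *+ 'C(m i + j, j).
Proof.
rewrite {1}[p]mpolyE raddf_sum raddf_sum /=.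
have e (m' : 'X_{1..n}) : (hasse i j (p@_m' *: 'X_[m']))@_m =
    if m' == (m + U_(i) *+ j)%MM then p@_(m + U_(i) *+ j) *+ 'C(m i + j, j) else 0.
  rewrite -mul_mpolyC hasseM /conv big_ord_recl hasseC /= big1; last first.
    by move=> l _; rewrite hasseC mul0r.
  rewrite addr0 subn0 mcoeffCM hasse_monomial mcoeffMn mcoeffX.
  case: (eqVneq m' _) => [->|ne].
    rewrite mnmE mulmnE mnmE eqxx mul1n (_ : (_ - _)%MM = m); last first.
      by apply/mnmP => l; rewrite !mnmE addnK.
    by rewrite eqxx mulrnAr mulr1.
  case: eqP => [em|]; last by rewrite mul0rn mulr0.
  rewrite bin_small ?mulr0n ?mulr0 // ltnNge; apply/negP => le.
  move/eqP: ne; apply; apply/mnmP => l; rewrite -em !mnmE !mulmnE !mnmE.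
  by case: eqP => [<-|_]; [rewrite mul1n subnK|rewrite mul0n subn0 addn0].
rewrite (eq_bigr _ (fun m' _ => e m')).
have [hm|/memN_msupp_eq0 h0] := boolP ((m + U_(i) *+ j)%MM \in msupp p).
  rewrite (bigD1_seq _ hm) ?msupp_uniq //= eqxx big1 ?addr0 //.
  by move=> m' /negbTE ->.
by rewrite h0 mul0rn big1 // => m' _; case: eqP.
Qed.

Lemma msize_hasse i j p : (msize (hasse i j p) <= msize p)%N.
Proof.
rewrite {1}/mmeasure; apply/bigmax_leqP_seq => m hm _.
have : (m + U_(i) *+ j)%MM \in msupp p.
  move: hm; rewrite !mcoeff_msupp mcoeff_hasse; apply: contraNneq => ->.
  by rewrite mul0rn.
by move=> /msize_mdeg_lt; rewrite mdegD; apply: leq_trans; rewrite ltnS leq_addr.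
Qed.

End Hasse.

Lemma map_hasse (A B : comNzRingType) n (f : {rmorphism A -> B}) i j (p : {mpoly A[n]}) :
  map_mpoly f (hasse i j p) = hasse i j (map_mpoly f p).
Proof.
by apply/mpolyP => m; rewrite mcoeff_map_mpoly !mcoeff_hasse mcoeff_map_mpoly raddfMn.
Qed.

(* [pole i E G w b] is [G ^+ (E + b)] times the [b]-th divided derivative of
   [w / G ^+ E], in a form that makes sense over any coefficient ring. *)
Section Pole.
Variables (A : comNzRingType) (n : nat) (i : 'I_n).
Notation S := {mpoly A[n]}.

Fixpoint pole (E : nat) (G w : S) : nat -> S :=
  if E is E'.+1 then
    srec 0 (fun b u => pole E' G w b -
      \sum_(j < b) hasse i j.+1 G * G ^+ j * u (b - j.+1)%N)
  else fun b => G ^+ b * hasse i b w.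

Lemma poleS E G w b : pole E.+1 G w b = pole E G w b -
  \sum_(j < b) hasse i j.+1 G * G ^+ j * pole E.+1 G w (b - j.+1).
Proof.
rewrite /= srecE // => b' f g e; congr (_ - _); apply: eq_bigr => j _.
by rewrite e //; have := ltn_ord j; lia.
Qed.

Lemma msizeM_leq (p q : S) : (msize (p * q) <= msize p + msize q)%N.
Proof.
have [->|p0] := eqVneq p 0; first by rewrite mul0r mmeasure0.
have [->|q0] := eqVneq q 0; first by rewrite mulr0 mmeasure0.
rewrite {1}/mmeasure; apply/bigmax_leqP_seq => m hm _.
have /msuppM_le/allpairsP[[m1 m2] /= [h1 h2 ->]] := hm.
rewrite mdegD; have := msize_mdeg_lt h1; have := msize_mdeg_lt h2; lia.
Qed.

Lemma msizeX_leq (p : S) b : (0 < b)%N -> (msize (p ^+ b) <= b * msize p)%N.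
Proof.
case: b => // b _; elim: b => [|b IH]; first by rewrite expr1 mul1n.
by rewrite exprS (leq_trans (msizeM_leq _ _)) // [in X in (_ <= X)%N]mulSn leq_add2l.
Qed.

(** The bound is independent of the pole order [E]. This is why an operator of order [b] raises the
    filtration of the Čech module by [b] only. *)
Lemma msize_pole E G w b : (msize (pole E G w b) <= msize w + b * msize G)%N.
Proof.
elim: E b => [|E IHE] b.
  rewrite /=; case: b => [|b].
    by rewrite expr0 mul1r mul0n addn0; apply: msize_hasse.
  rewrite (leq_trans (msizeM_leq _ _)) // addnC leq_add ?msize_hasse //.
  exact: msizeX_leq.
elim/ltn_ind: b => b IH; rewrite poleS.
apply: leq_trans (msizeD_le _ _) _; rewrite geq_max msizeN IHE /=.
apply: leq_trans (msize_sum _ _ _) _; apply/bigmax_leqP => j _.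
have lj := ltn_ord j.
have h1 : (msize (hasse i j.+1 G * G ^+ j) <= j.+1 * msize G)%N.
  have [j0|jp] := posnP (nat_of_ord j).
    by rewrite j0 expr0 mulr1 mul1n; apply: msize_hasse.
  rewrite (leq_trans (msizeM_leq _ _)) // mulSn leq_add ?msize_hasse //.
  exact: msizeX_leq.
apply: leq_trans (msizeM_leq _ _) _.
have h2 := IH (b - j.+1)%N ltac:(lia).
apply: leq_trans (leq_add h1 h2) _.
by rewrite addnCA -mulnDl leq_add2l leq_mul2r; apply/orP; right; lia.
Qed.

End Pole.

Lemma map_pole (A B : comNzRingType) n (f : {rmorphism A -> B}) i E
    (G w : {mpoly A[n]}) b :
  map_mpoly f (pole i E G w b) = pole i E (map_mpoly f G) (map_mpoly f w) b.
Proof.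
elim: E b => [|E IHE] b; first by rewrite /= rmorphM rmorphXn /= map_hasse.
elim/ltn_ind: b => b IH; rewrite !poleS rmorphB /= IHE rmorph_sum /=; congr (_ - _).
apply: eq_bigr => j _; rewrite !rmorphM rmorphXn /= map_hasse IH //.
by have := ltn_ord j; lia.
Qed.

(** * Divided derivatives of rational functions *)

Section Fractions.
Variables (k : fieldType) (n : nat).
Notation S := {mpoly k[n]}.
Variables (K : fieldType) (iota : {rmorphism S -> K}).
Hypothesis iota_inj : injective iota.
Hypothesis iota_frac : forall y, exists w h, h != 0 /\ y * iota h = iota w.

Let iota0 h : (iota h == 0) = (h == 0).
Proof. by rewrite -(rmorph0 iota) (inj_eq iota_inj). Qed.

Let T : 'I_n -> S -> nat -> K := locked (fun i w b => iota (hasse i b w)).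

Let TE i w b : T i w b = iota (hasse i b w).
Proof. by rewrite /T -lock. Qed.

Let T0 i w : T i w 0 = iota w.
Proof. by rewrite TE hasse0. Qed.

Let TM i w h : T i (w * h) = conv (T i w) (T i h).
Proof.
apply/funext => b; rewrite TE; have := hasseM i w h b => /= ->.
by rewrite /conv rmorph_sum; apply: eq_bigr => j _; rewrite rmorphM !TE.
Qed.

Let solve : 'I_n -> S -> S -> nat -> K := locked (fun i w h => srec 0 (fun b u =>
  (T i w b - \sum_(j < b) T i h j.+1 * u (b - j.+1)%N) / iota h)).

Let solveP i w h : h != 0 -> conv (T i h) (solve i w h) = T i w.
Proof.
move=> h0; apply/funext => b; rewrite /conv big_ord_recl T0 subn0.
have -> : solve i w h b =
    (T i w b - \sum_(j < b) T i h j.+1 * solve i w h (b - j.+1)%N) / iota h.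
  rewrite /solve -lock srecE // => b' f g e; congr (_ / _); congr (_ - _).
  by apply: eq_bigr => j _; rewrite e //; have := ltn_ord j; lia.
by rewrite mulrC divfK ?iota0 // subrK.
Qed.

(** The Taylor series of a fraction is the quotient of the series of numerator and denominator;
    cross multiplication shows that it does not depend on the fraction chosen. *)
Let dfrac_ex i y : exists s : nat -> K,
  forall w h, y * iota h = iota w -> conv (T i h) s = T i w.
Proof.
have [w0 [h0 [nh e0]]] := iota_frac y; exists (solve i w0 h0) => w h e.
apply: (conv_cancel (a := T i h0)); first by rewrite T0 iota0.
have ew : h * w0 = h0 * w by apply: iota_inj; rewrite !rmorphM /= -e -e0; ring.
rewrite -(TM i h0 w) -ew (TM i h w0) convA (convC (T i h0) (T i h)) -convA.
by rewrite (solveP i w0 nh).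
Qed.

Let dseq i y : nat -> K := projT1 (cid (dfrac_ex i y)).

Definition dfrac (i : 'I_n) (b : nat) (y : K) : K := dseq i y b.

Let dseqP i y w h : y * iota h = iota w -> conv (T i h) (dseq i y) = T i w.
Proof. by rewrite /dseq; case: cid => s /= hs; apply: hs. Qed.

Let dseq_uniq i y w h s : h != 0 -> y * iota h = iota w ->
  conv (T i h) s = T i w -> s = dseq i y.
Proof.
move=> h0 e hs; apply: (conv_cancel (a := T i h)); first by rewrite T0 iota0.
by rewrite hs (dseqP _ e).
Qed.

Lemma dfrac_poly i b w : dfrac i b (iota w) = iota (hasse i b w).
Proof.
suff /(congr1 (fun f => f b)) : T i w = dseq i (iota w) by rewrite TE.
apply: (@dseq_uniq i _ w 1); first exact: oner_neq0.
  by rewrite rmorph1 mulr1.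
by rewrite -TM mul1r.
Qed.

Lemma dfrac_is_additive i b : zmod_morphism (dfrac i b).
Proof.
move=> y z; have [w [h [h0 e]]] := iota_frac y; have [w' [h' [h0' e']]] := iota_frac z.
suff : (fun j => dseq i y j - dseq i z j) = dseq i (y - z).
  by move/(congr1 (fun f => f b)).
apply: (@dseq_uniq i _ (w * h' - w' * h) (h * h')).
- by rewrite mulf_neq0.
- by rewrite rmorphB !rmorphM /= -e -e'; ring.
have -> : conv (T i (h * h')) (fun l => dseq i y l - dseq i z l) =
    (fun j => conv (T i (h * h')) (dseq i y) j - conv (T i (h * h')) (dseq i z) j).
  by apply/funext => j; rewrite /conv -sumrB; apply: eq_bigr => l _; rewrite mulrBr.
rewrite (@dseqP i y (w * h')); last by rewrite !rmorphM /= -e; ring.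
rewrite (@dseqP i z (w' * h)); last by rewrite !rmorphM /= -e'; ring.
by apply/funext => j; rewrite !TE raddfB rmorphB.
Qed.
HB.instance Definition _ i b :=
  GRing.isZmodMorphism.Build K K (dfrac i b) (dfrac_is_additive i b).

Lemma dfracM i y z b :
  dfrac i b (y * z) = \sum_(j < b.+1) dfrac i j y * dfrac i (b - j) z.
Proof.
have [w [h [h0 e]]] := iota_frac y; have [w' [h' [h0' e']]] := iota_frac z.
suff : conv (dseq i y) (dseq i z) = dseq i (y * z).
  by move/(congr1 (fun f => f b)) => e0; apply/esym.
apply: (@dseq_uniq i _ (w * w') (h * h')).
- by rewrite mulf_neq0.
- by rewrite !rmorphM /= -e -e'; ring.
rewrite [h * h']mulrC TM -convA [conv (T i h) _]convA (dseqP i e) [conv (T i w) _]convC convA.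
by rewrite (dseqP i e') convC TM.
Qed.

Lemma dfrac0 i y : dfrac i 0 y = y.
Proof.
have [w [h [h0 e]]] := iota_frac y.
have := congr1 (fun f => f 0%N) (dseqP i e); rewrite /conv big_ord1 !T0 -e mulrC.
by move/(mulIf _); apply; rewrite iota0.
Qed.

(** The recursion [poleS] is the Leibniz rule for w/G^E = G (w/G^(E+1)). A zero [G] is allowed, its
    inverse being 0: the exponent is positive, so both sides vanish. *)
Lemma dfrac_pole i E G w b :
  dfrac i b (iota w / iota G ^+ E.+1) = iota (pole i E.+1 G w b) / iota G ^+ (E.+1 + b).
Proof.
have [->|G0] := eqVneq G 0.
  by rewrite !rmorph0 addSn !expr0n /= invr0 !mulr0 raddf0.
have G0' : iota G != 0 by rewrite iota0.
suff main E' b' : dfrac i b' (iota w / iota G ^+ E') * iota G ^+ (E' + b') =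
    iota (pole i E' G w b').
  by rewrite -main mulfK // expf_neq0.
elim: E' b' => [|E' IHE] b'.
  by rewrite expr0 divr1 dfrac_poly add0n /= rmorphM rmorphXn mulrC.
elim/ltn_ind: b' => b' IH; rewrite poleS rmorphB -IHE rmorph_sum.
set y := iota w / iota G ^+ E'; set u := iota w / iota G ^+ E'.+1.
have yu : y = iota G * u by rewrite /y /u exprS invfM mulrCA mulVKf.
have := dfracM i (iota G) u b'; rewrite -yu big_ord_recl dfrac0 subn0 => ->.
rewrite mulrDl -addrA [X in _ = _ + X](_ : _ = 0) ?addr0.
  by rewrite addSn exprS; ring.
apply/eqP; rewrite subr_eq0; apply/eqP; rewrite mulr_suml; apply: eq_bigr => j _ /=.
have lj := ltn_ord j; rewrite !rmorphM rmorphXn /= -IH; last by lia.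
rewrite dfrac_poly -!mulrA; congr (_ * _); rewrite mulrCA; congr (_ * _).
by rewrite -exprD; congr (_ ^+ _); rewrite /bump /=; lia.
Qed.

End Fractions.

(** * Modules over divided derivatives have finite length *)

Lemma linear_dependence (k : fieldType) (I J : finType) (lam : I -> J -> k) :
  (#|J| < #|I|)%N ->
  exists c : I -> k, (exists i, c i != 0) /\ forall j, \sum_i c i * lam i j = 0.
Proof.
move=> lt; pose M : 'M[k]_(#|I|, #|J|) := \matrix_(i, j) lam (enum_val i) (enum_val j).
have : kermx M != 0.
  rewrite -mxrank_eq0 mxrank_ker subn_eq0 -ltnNge.
  by apply: leq_ltn_trans (rank_leq_col M) lt.
move=> /rowV0Pn[v /sub_kermxP vM v0].
exists (fun i => v 0 (enum_rank i)); split.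
  have [j vj] : exists j, v 0 j != 0.
    apply/existsP; apply: contraR v0; rewrite negb_exists => /forallP h.
    by apply/eqP/rowP => j; rewrite mxE; apply/eqP; have := h j; rewrite negbK.
  by exists (enum_val j); rewrite enum_valK.
move=> j; have E := congr1 (fun X : 'rV_#|J| => X 0 (enum_rank j)) vM.
rewrite !mxE in E; rewrite -[RHS]E.
rewrite (reindex_onto (@enum_rank I) enum_val) /=; last by move=> i _; apply: enum_valK.
apply: eq_big => [i|i _]; first by rewrite enum_rankK eqxx.
by rewrite !mxE !enum_rankK.
Qed.

(** An operator of order [c] destroys at most [c] of the factors [f]. *)
Lemma hasse_pow (A : comNzRingType) n (i : 'I_n) c (f : {mpoly A[n]}) m :
  exists w, hasse i c (f ^+ m) = f ^+ (m - c) * w.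
Proof.
elim: m c => [|m IH] c; first by exists (hasse i c (f ^+ 0)); rewrite sub0n mul1r.
rewrite exprS (hasseM i f (f ^+ m) c) /conv.
elim/big_rec: _ => [|j x _ [w ->]]; first by exists 0; rewrite mulr0.
have lj := ltn_ord j; have [w' ->] := IH (c - j)%N.
case: (posnP j) => [->|j0].
  case: (ltnP m c) => h.
    have -> : (m.+1 - c = 0)%N by lia.
    by exists (hasse i 0 f * (f ^+ (m - (c - 0)) * w') + w); rewrite expr0; ring.
  exists (w' + w); rewrite hasse0 subn0 subSn // exprS; ring.
exists (hasse i j f * f ^+ ((m - (c - j)) - (m.+1 - c)) * w' + w).
have {1}-> : (m - (c - j) = (m.+1 - c) + ((m - (c - j)) - (m.+1 - c)))%N by lia.
rewrite exprD; ring.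
Qed.

Section DModule.
Variables (k : fieldType) (n : nat).
Notation S := {mpoly k[n]}.
Variables (K : fieldType) (iota : {rmorphism S -> K}).
Variables (V : lmodType K) (D : 'I_n -> nat -> V -> V).
Hypothesis DB : forall i b, zmod_morphism (D i b).
Hypothesis D0 : forall i v, D i 0 v = v.
Hypothesis DM : forall i b g v,
  D i b (iota g *: v) = \sum_(c < b.+1) iota (hasse i c g) *: D i (b - c) v.

Notation cst c := (iota (c%:MP)).

Definition dsub (N : set V) : Prop :=
  [/\ subgroup N, forall g v, N v -> N (iota g *: v) & forall i b v, N v -> N (D i b v)].

(** A Bernstein filtration: a variable raises the index by 1 and an operator of order [b] by [b],
    while the dimension over the constants is bounded by a polynomial of degree [n], the number of
    variables. *)
Variable fil : nat -> set V.
Hypothesis filB : forall s, subgroup (fil s).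
Hypothesis filS : forall s v, fil s v -> fil s.+1 v.
Hypothesis filX : forall s i v, fil s v -> fil s.+1 (iota 'X_i *: v).
Hypothesis filD : forall s i b v, fil s v -> fil (s + b) (D i b v).
Variable B : nat.
Hypothesis fil_span : forall s, exists2 m, (m <= B * s.+1 ^ n)%N & exists w : 'I_m -> V,
  forall v, fil s v -> exists c : 'I_m -> k, v = \sum_j cst (c j) *: w j.

Let D_add i b x y : D i b (x + y) = D i b x + D i b y.
Proof.
have h0 : D i b 0 = 0 by have := DB i b 0 0; rewrite subr0 subrr.
have -> : x + y = x - (0 - y) by rewrite sub0r opprK.
by rewrite DB DB h0 sub0r opprK.
Qed.

Let D_0 i b : D i b 0 = 0.
Proof. by have := DB i b 0 0; rewrite subr0 subrr. Qed.

Let D_cst i b c v : D i b (cst c *: v) = cst c *: D i b v.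
Proof.
rewrite DM big_ord_recl subn0 hasse0 big1 ?addr0 // => j _.
by rewrite hasseC /= rmorph0 scale0r.
Qed.

Let D_var i b j v : D i b.+1 (iota 'X_j *: v) =
  iota 'X_j *: D i b.+1 v + (if j == i then D i b v else 0).
Proof.
rewrite DM big_ord_recl subn0 hasse0; congr (_ + _).
rewrite big_ord_recl hasseXU /bump /= ?add1n subSS subn0 big1 ?addr0; last first.
  by move=> l _; rewrite hasseXU /bump /= rmorph0 scale0r.
by case: eqP => _; rewrite ?rmorph1 ?scale1r ?rmorph0 ?scale0r.
Qed.

Let sgD (N : set V) x y : subgroup N -> N x -> N y -> N (x + y).
Proof.
move=> [N0 NB] Nx Ny; rewrite -[y]opprK; apply: (NB) => //.
by rewrite -sub0r; apply: NB.
Qed.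

Let sg_sum (N : set V) (T : Type) (r : seq T) (P : pred T) (F : T -> V) :
  subgroup N -> (forall j, P j -> N (F j)) -> N (\sum_(j <- r | P j) F j).
Proof. by move=> hN hF; elim/big_ind: _ => //; [case: hN|move=> x y; apply: sgD]. Qed.

Let fil_le s s' v : (s <= s')%N -> fil s v -> fil s' v.
Proof. by move=> /subnKC <-; elim: (s' - s)%N => [|d IH]; rewrite ?addn0 ?addnS // => /IH/filS. Qed.

Section Bernstein.
Variables (N N' : set V).
Hypothesis hN : dsub N.
Hypothesis hN' : dsub N'.

Let NB : subgroup N. Proof. by case: hN. Qed.
Let NM g v : N v -> N (iota g *: v). Proof. by case: hN => _ + _; apply. Qed.
Let ND i b v : N v -> N (D i b v). Proof. by case: hN => _ _; apply. Qed.
Let N'M g v : N' v -> N' (iota g *: v). Proof. by case: hN' => _ + _; apply. Qed.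
Let N'D i b v : N' v -> N' (D i b v). Proof. by case: hN' => _ _; apply. Qed.

(** The Leibniz rule for D_j(g w) solved for its last term, which is the j-th derivative of [g]
    times [w]. The other terms involve derivatives of [g] of lower order and elements D_(j-c) w,
    whose filtration index has grown by j - c. *)
Let hasse_kills i g r j : (j <= r)%N ->
  (forall w, N' w -> fil r w -> N (iota g *: w)) ->
  forall w, N' w -> fil (r - j) w -> N (iota (hasse i j g) *: w).
Proof.
move=> le hg; elim/ltn_ind: j le => j IH le w Nw fw.
have := DM i j g w; rewrite big_ord_recr /= subnn D0; set X := \sum_(i0 < j) _ => e.
have -> : iota (hasse i j g) *: w = D i j (iota g *: w) - X by rewrite e [X + _]addrC addrK.
apply: NB.2; first by apply: ND; apply: hg => //; apply: fil_le fw; apply: leq_subr.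
apply: sg_sum => // c _; have lc := ltn_ord c.
apply: IH => //; first by apply: leq_trans le; apply: ltnW.
  exact: N'D.
by have := filD i (j - c)%N fw; apply: fil_le; lia.
Qed.

(* A nonzero polynomial killing enough of [N' / N] has a nonzero constant as one of its
   divided derivatives. *)
Let poly_kills (u : nat) (l : seq 'I_n) : forall g r, g != 0 ->
  (forall m, m \in msupp g -> forall i, (m i < u)%N /\ (i \notin l -> m i = 0%N)) ->
  (forall w, N' w -> fil (r + size l * u) w -> N (iota g *: w)) ->
  forall w, N' w -> fil r w -> N w.
Proof.
elim: l => [|i l IH] g r g0 hm hg w Nw fw.
  have ec : g = (g@_0)%:MP.
    apply/mpolyP => m; rewrite mcoeffC; case: eqP => [<-|ne]; first by rewrite mulr1.
    rewrite mulr0; apply: memN_msupp_eq0; apply/negP => /hm h; apply: ne.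
    by apply/mnmP => i; rewrite mnmE; have [_ ->] := h i.
  have c0 : g@_0 != 0 by apply: contraNneq g0 => e; rewrite ec e mpolyC0.
  have hc : iota (g@_0)^-1%:MP * iota g = 1.
    by rewrite {2}ec -rmorphM -mpolyCM mulVf // mpolyC1 rmorph1.
  have := hg w Nw; rewrite addn0 => /(_ fw) /(NM (g@_0)^-1%:MP).
  by rewrite scalerA hc scale1r.
pose j := (\max_(m <- msupp g) m i)%N.
have jmax m : m \in msupp g -> (m i <= j)%N.
  by move=> hmg; rewrite /j (big_rem m) //= leq_maxl.
have [m0 hm0 em0] : exists2 m0, m0 \in msupp g & m0 i = j.
  have : msupp g != [::] by rewrite msupp_eq0.
  rewrite /j; case: (msupp g) => // a s _; elim: s a => [|b s IHs] a.
    by exists a; rewrite ?inE // big_seq1.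
  have [m0 h0 e0] := IHs b; rewrite big_cons.
  case: (leqP (m0 i) (a i)) => h.
    by exists a; rewrite ?inE ?eqxx // -e0; apply/esym/maxn_idPl.
  exists m0; first by rewrite in_cons h0 orbT.
    by rewrite -e0; apply/esym/maxn_idPr/ltnW.
have lju : (j < u)%N by rewrite -em0; have [] := hm _ hm0 i.
have hsupp m : m \in msupp (hasse i j g) ->
    (m + U_(i) *+ j)%MM \in msupp g /\ m i = 0%N.
  rewrite !mcoeff_msupp mcoeff_hasse => h.
  have h1 : g@_(m + U_(i) *+ j) != 0 by apply: contraNneq h => ->; rewrite mul0rn.
  split=> //; have := jmax (m + U_(i) *+ j)%MM; rewrite mcoeff_msupp => /(_ h1).
  by rewrite mnmE mulmnE mnmE eqxx mul1n -{2}[j]add0n leq_add2r leqn0 => /eqP.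
apply: (IH (hasse i j g) r) => //.
- apply: contraNneq g0 => e; have := mcoeff_hasse i j g (m0 - U_(i) *+ j)%MM.
  rewrite e mcoeff0; rewrite (_ : (m0 - _ + _)%MM = m0); last first.
    by apply/mnmP => l'; rewrite !mnmE mulmnE mnmE; case: eqP => [<-|_];
      rewrite ?mul1n ?mul0n ?subn0 ?addn0 // em0 subnn add0n.
  rewrite !mnmE mulmnE mnmE eqxx mul1n em0 subnn add0n binn mulr1n => /esym/eqP.
  by move: hm0; rewrite mcoeff_msupp => /negbTE ->.
- move=> m /hsupp[/hm h mi0] i'; have [h1 h2] := h i'; split.
    by apply: leq_ltn_trans h1; rewrite mnmE leq_addr.
  move=> i'l; have [->//|ni] := eqVneq i' i.
  have := h2 _; rewrite inE negb_or ni i'l => /(_ isT).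
  by rewrite mnmE => /eqP; rewrite addn_eq0 => /andP[/eqP].
- have := @hasse_kills i g (r + (size l).+1 * u) j; rewrite mulSn.
  move=> /(_ ltac:(lia) hg) h w' Nw' fw'; apply: h => //.
  by apply: fil_le fw'; lia.
Qed.

Variable u : nat.

Notation idx := {ffun 'I_n -> 'I_u}.

Let upd (be : idx) (i : 'I_n) (b : 'I_u) : idx := [ffun j => if j == i then b else be j].

(* [dop l g be] is the operator with coefficients [g be'] in front of the monomial in
   the divided derivatives [D i (be' i)], [i] in [l], with [be'] equal to [be] off [l]. *)
Let dop : seq 'I_n -> (idx -> S) -> idx -> V -> V :=
  fix dop l g be v := match l with
  | [::] => iota (g be) *: v
  | i :: l' => \sum_(b < u) dop l' g (upd be i b) (D i b v)
  end.

Let dop_0 l g be : dop l g be 0 = 0.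
Proof.
elim: l be => [|i l IH] be /=; first by rewrite scaler0.
by rewrite big1 // => b _; rewrite D_0 IH.
Qed.

Let dop_var l g be i v : i \notin l ->
  dop l g be (iota 'X_i *: v) = iota 'X_i *: dop l g be v.
Proof.
elim: l be v => [|i' l IH] be v; first by rewrite /= !scalerA mulrC.
rewrite inE negb_or => /andP[ni il] /=; rewrite scaler_sumr; apply: eq_bigr => b _.
rewrite -IH //; congr dop; case: b => -[|b] lb /=; first by rewrite !D0.
by rewrite D_var (negbTE ni) addr0.
Qed.

Let dop_linear l be (T : finType) (c : T -> k) (g : T -> idx -> S) v :
  dop l (fun be => \sum_t (c t)%:MP * g t be) be v = \sum_t cst (c t) *: dop l (g t) be v.
Proof.
elim: l be v => [|i l IH] be v /=.
  by rewrite rmorph_sum scaler_suml; apply: eq_bigr => t _; rewrite rmorphM scalerA.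
under eq_bigr => b _ do rewrite IH.
by rewrite exchange_big; apply: eq_bigr => t _; rewrite scaler_sumr.
Qed.

Let dop_fil l g be v s d : (forall be' w s, fil s w -> fil (s + d) (iota (g be') *: w)) ->
  fil s v -> fil (s + size l * u + d) (dop l g be v).
Proof.
move=> hg; elim: l be v s => [|i l IH] be v s fv /=; first by rewrite addn0; apply: hg.
apply: sg_sum => // b _; have lb := ltn_ord b.
by have := IH (upd be i b) _ _ (filD i b fv); apply: fil_le; lia.
Qed.

Let dop_sub l g be v : N' v -> N' (dop l g be v).
Proof.
elim: l be v => [|i l IH] be v Nv /=; first exact: N'M.
by apply: sg_sum; [case: hN'|move=> b _; apply/IH/N'D].
Qed.

(** The commutator with ['X_i] lowers each [D i b] to [D i (b - 1)]. If [bs] is the largest order in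
    [i] with a nonzero coefficient, [bs] commutators leave just the coefficient of [D i bs], free of
    derivatives in [i]; the other variables follow by induction. *)
Let dop_kills l : uniq l -> forall (g : idx -> S) (be : idx) r,
  (exists2 be' : idx, (forall i, i \notin l -> be' i = be i) & g be' != 0) ->
  (forall w, N' w -> fil (r + size l * u) w -> N (dop l g be w)) ->
  exists2 be', g be' != 0 & forall w, N' w -> fil r w -> N (iota (g be') *: w).
Proof.
elim: l => [|i l IH] /=.
  move=> _ g be r [be' hbe hg] hk; exists be => //; last first.
    by move=> w Nw fw; apply: hk => //; rewrite addn0.
  by rewrite (_ : be = be') //; apply/ffunP => i; rewrite hbe.
move=> /andP[il ul] g be r [be' hbe hg] hk.
pose nz (b : 'I_u) := `[< exists2 be' : idx, (forall i1, i1 \notin l -> be' i1 = upd be i b i1) & g be' != 0 >].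
have nz0 : nz (be' i).
  apply/asboolP; exists be' => // i' il'; rewrite ffunE; case: (i' =P i) => [->//|/eqP ne].
  by apply: hbe; rewrite inE negb_or il' ne.
pose bs := [arg max_(b > be' i | nz b) (b : nat)].
have [nzb bmax] : nz bs /\ forall b, nz b -> (b <= bs)%N.
  by rewrite /bs; case: arg_maxnP => // b.
have z (b : 'I_u) v : (bs < b)%N -> dop l g (upd be i b) v = 0.
  move=> lt; have hz : forall be' : idx, (forall i', i' \notin l -> be' i' = upd be i b i') -> g be' = 0.
    move=> be1 h1; apply/eqP; apply: contraTT lt => g1; rewrite -leqNgt.
    by apply: bmax; apply/asboolP; exists be1.
  elim: l {IH il ul hbe nz nz0 bs nzb bmax lt hk} (upd be i b) v hz => [|i1 l1 IH1] be1 v hz /=.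
    by rewrite hz // rmorph0 scale0r.
  apply: big1 => b1 _; apply: IH1 => be2 h2; apply: hz => i2 h2'.
  move: h2'; rewrite inE negb_or => /andP[n2 l2].
  by rewrite h2 // ffunE (negbTE n2).
(* The j-fold commutator of the operator with ['X_i]. Each commutator uses up one step of the
   filtration. *)
pose T j v := \sum_(b < u | (j <= b)%N) dop l g (upd be i b) (D i (b - j) v).
have hT j : (j <= bs)%N -> forall w, N' w -> fil (r + (size l).+1 * u - j) w -> N (T j w).
  elim: j => [|j IHj] lj w Nw fw.
    rewrite subn0 in fw; have -> : T 0%N w = \sum_(b < u) dop l g (upd be i b) (D i b w).
      by apply: eq_big => [b|b _]; rewrite ?leq0n ?subn0.
    exact: hk.
  have e : T j.+1 w = T j (iota 'X_i *: w) - iota 'X_i *: T j w.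
    rewrite /T scaler_sumr -sumrB [RHS](bigID (fun b : 'I_u => (j < b)%N)) /=.
    rewrite [X in _ = _ + X]big1 ?addr0; last first.
      move=> b /andP[h1 h2]; have -> : (b - j)%N = 0%N by lia.
      by rewrite !D0 dop_var // subrr.
    apply: eq_big => [b|b lb]; first by rewrite andb_idl //; apply: ltnW.
    have -> : (b - j)%N = (b - j.+1).+1 by lia.
    have dD a a' : dop l g (upd be i b) (a + a') =
        dop l g (upd be i b) a + dop l g (upd be i b) a'.
      elim: (l) (upd be i b) a a' => [|i1 l1 IH1] be1 a a' /=; first by rewrite scalerDr.
      by rewrite -big_split; apply: eq_bigr => b1 _; rewrite D_add IH1.
    by rewrite D_var eqxx dD dop_var // addrAC subrr add0r.
  rewrite e; have leu := ltn_ord bs; apply: NB.2.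
    apply: IHj; [exact: ltnW|exact: N'M|].
    by have := filX i fw; apply: fil_le; lia.
  by apply: NM; apply: IHj; [exact: ltnW|by []|apply: fil_le fw; lia].
have [be1 hg1 hk1] : exists2 be', g be' != 0 &
    forall w, N' w -> fil r w -> N (iota (g be') *: w).
  apply: (IH ul g (upd be i bs) r); first by move/asboolP: nzb.
  move=> w Nw fw; have := hT bs (leqnn _) w Nw _; rewrite /T.
  rewrite (bigD1 bs) //= subnn D0 big1 ?addr0; last first.
    move=> b /andP[h1 h2]; apply: z; rewrite ltn_neqAle h1 andbT.
    by apply: contraNneq h2 => e; apply/eqP/val_inj.
  apply; apply: fil_le fw; have := ltn_ord bs; move: (nat_of_ord bs) => b lb.
  by rewrite mulSn; move: (size l * u)%N => X; clear -lb; lia.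
by exists be1.
Qed.

Definition kfree (N : set V) (T : finType) (v : T -> V) : Prop :=
  forall c : T -> k, N (\sum_t cst (c t) *: v t) -> forall t, c t = 0.

Hypothesis u0 : (0 < u)%N.

Let mnm (a : idx) : 'X_{1..n} := [multinom (a i : nat) | i < n].
Let mon (a : idx) : S := 'X_[mnm a].

Let fil_mon a w s : fil s w -> fil (s + n * u) (iota (mon a) *: w).
Proof.
have varX i c s' w' : fil s' w' -> fil (s' + c) (iota ('X_i ^+ c) *: w').
  elim: c => [|c IH] fw; first by rewrite addn0 expr0 rmorph1 scale1r.
  by rewrite addnS exprS rmorphM -scalerA; apply/filX/IH.
have prodX (r : seq 'I_n) s' w' : fil s' w' ->
    fil (s' + \sum_(i <- r) a i) (iota (\prod_(i <- r) 'X_i ^+ (mnm a i)) *: w').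
  elim: r s' w' => [|i r IH] s' w' fw; first by rewrite !big_nil addn0 rmorph1 scale1r.
  rewrite !big_cons rmorphM -scalerA [(a i + _)%N]addnC addnA mnmE.
  by apply: varX; apply: IH.
move=> /(prodX (index_enum _)); rewrite -mpolyXE_id; apply: fil_le.
rewrite leq_add2l (_ : (n * u)%N = (\sum_(i < n) u)%N); last by rewrite sum_nat_const card_ord.
by apply: leq_sum => i _; apply/ltnW/ltn_ord.
Qed.

Let good a d := exists v : 'I_d -> V, (forall t, N' (v t) /\ fil a (v t)) /\ kfree N v.

Let kfree_inj (T T' : finType) (h : T' -> T) (v : T -> V) : injective h ->
  kfree N v -> kfree N (fun t => v (h t)).
Proof.
move=> hinj free c hc t; pose c' s := \sum_(t' | h t' == s) c t'.
have := free c' _ (h t); rewrite /c' (big_pred1 t); last by move=> t'; rewrite (inj_eq hinj).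
apply; rewrite (_ : \sum_s _ = \sum_t cst (c t) *: v (h t)) //.
rewrite (partition_big h xpredT) //=; apply: eq_bigr => s _.
rewrite (raddf_sum (@mpolyC n k)) rmorph_sum scaler_suml.
by apply: eq_bigr => t' /eqP <-.
Qed.

Let good_le a d d' : (d' <= d)%N -> good a d -> good a d'.
Proof.
move=> le [v [hv free]]; exists (fun t => v (widen_ord le t)); split=> //.
by apply: kfree_inj => // x y /(congr1 val) /= e; apply: val_inj.
Qed.

Let good_max a : exists d, good a d /\ forall d', good a d' -> (d' <= d)%N.
Proof.
have [M hM] : exists M, forall d, good a d -> (d <= M)%N.
  have [m _ [w hw]] := fil_span a; exists m => d hd.
  case: hd => v [hv free]; rewrite leqNgt; apply/negP => lt.
  have hv' t : exists c : 'I_m -> k, v t = \sum_j cst (c j) *: w j.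
    by apply: hw; have [] := hv t.
  have [lam hlam] := choice hv'.
  have [|c [[t0 ct0] hc]] := @linear_dependence k 'I_d 'I_m lam; first by rewrite !card_ord.
  have := free c; rewrite (_ : \sum_t _ = 0); last first.
    under eq_bigr => t _ do rewrite hlam scaler_sumr.
    rewrite exchange_big big1 // => j _ /=.
    under eq_bigr => t _ do rewrite scalerA -rmorphM -mpolyCM.
    by rewrite -scaler_suml -rmorph_sum -(raddf_sum (@mpolyC n k)) /= hc mpolyC0 rmorph0 scale0r.
  by case: NB => N0 _ /(_ N0 t0) e; rewrite e eqxx in ct0.
have g0 : good a 0 by exists (fun=> 0); split; [case|move=> c _ []].
have ex0 : exists d, `[< good a d >] by exists 0%N; apply/asboolP.
have exM : forall d, `[< good a d >] -> (d <= M)%N by move=> d /asboolP /hM.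
have [d /asboolP gd dmax] := ex_maxnP ex0 exM.
by exists d; split=> // d' gd'; apply/dmax/asboolP.
Qed.

Let good_spans a d (v : 'I_d -> V) x : (forall d', good a d' -> (d' <= d)%N) ->
  (forall t, N' (v t) /\ fil a (v t)) -> kfree N v -> N' x -> fil a x ->
  exists c, N (x - \sum_t cst (c t) *: v t).
Proof.
move=> dmax hv free Nx fx; apply: contrapT => hno.
pose v' (i : 'I_d.+1) := if unlift ord_max i is Some j then v j else x.
have : good a d.+1; last by move/dmax; rewrite ltnn.
exists v'; split; first by move=> t; rewrite /v'; case: unliftP.
move=> c; rewrite big_ord_recr /= {2}/v' unlift_none.
rewrite (eq_bigr (fun j : 'I_d => cst (c (widen_ord (leqnSn d) j)) *: v j)); last first.
  move=> j _; rewrite /v'; case: unliftP => [j' e|/(congr1 val) /= e].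
    by congr (_ *: v _); apply: val_inj; have := congr1 val e; rewrite /= /bump leqNgt ltn_ord.
  by have := ltn_ord j; rewrite e ltnn.
move=> hc; have cmax : c ord_max = 0.
  apply/eqP; apply: contrapT => /negP cm; apply: hno.
  exists (fun j => - ((c ord_max)^-1 * c (widen_ord (leqnSn d) j))).
  have := NM ((c ord_max)^-1)%:MP hc; rewrite scalerDr scalerA -rmorphM -mpolyCM mulVf //.
  rewrite mpolyC1 rmorph1 scale1r addrC scaler_sumr; congr (N (_ + _)).
  rewrite -sumrN; apply: eq_bigr => j _.
  by rewrite mpolyCN rmorphN scaleNr opprK scalerA -rmorphM -mpolyCM.
move: hc; rewrite cmax mpolyC0 rmorph0 scale0r addr0 => /free hc t.
case: (unliftP ord_max t) => [j|] -> //.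
by rewrite -(hc j); congr c; apply: val_inj; rewrite /= /bump leqNgt ltn_ord.
Qed.

(** Bernstein's inequality by counting. The u^(2n) operators X^a D^b with exponents below [u] map a
    space of dimension d1 to one of dimension d2 >= d1. If d2 < u^n they are linearly dependent, and
    some nonzero combination kills [fil a1] modulo [N]. [dop_kills] and [poly_kills] reduce it to a
    nonzero constant that puts [c0] in [N]. *)
Lemma bernstein_lower_bound r c0 : N' c0 -> ~ N c0 -> fil r c0 ->
  exists v : 'I_(u ^ n) -> V,
    (forall t, N' (v t) /\ fil (r + 4 * n * u) (v t)) /\ kfree N v.
Proof.
(* Each of [dop_kills] and [poly_kills] costs n u, which gives a1; the monomials and the divided
   derivatives raise the index by at most n u each, which gives a2. *)
move=> N'c nNc fc; pose a1 := (r + 2 * n * u)%N; pose a2 := (r + 4 * n * u)%N.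
have [d1 [[v1 [hv1 free1]] max1]] := good_max a1.
have [d2 [g2 max2]] := good_max a2.
suff le : (u ^ n <= d2)%N by apply: good_le le g2.
have d12 : (d1 <= d2)%N.
  apply: max2; exists v1; split=> // t; have [h1 h2] := hv1 t; split=> //.
  by apply: fil_le h2; rewrite /a1 /a2; lia.
rewrite leqNgt; apply/negP => lt; apply: nNc.
have [v2 [hv2 free2]] := g2.
pose be0 : idx := [ffun=> Ordinal u0].
pose l := enum 'I_n.
pose e (ab : idx * idx) : V -> V :=
  dop l (fun ga => if ga == ab.2 then mon ab.1 else 0) be0.
have size_l : size l = n by rewrite size_enum_ord.
have he ab t : exists c, N (e ab (v1 t) - \sum_j cst (c j) *: v2 j).
  have [h1 h2] := hv1 t; apply: (good_spans max2 hv2 free2); first exact: dop_sub.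
  apply: (@fil_le (a1 + size l * u + n * u)%N); first by rewrite size_l /a1 /a2; lia.
  apply: dop_fil => // be' w s fw; case: eqP => _; first exact: fil_mon.
  by rewrite rmorph0 scale0r; case: (filB (s + n * u)).
have {}he (abt : (idx * idx) * 'I_d1) : exists c : 'I_d2 -> k,
    N (e abt.1 (v1 abt.2) - \sum_j cst (c j) *: v2 j) by apply: he.
have [lam hlam] := choice he.
have [|c [[ab0 cab0] hc]] := @linear_dependence k (idx * idx)%type ('I_d1 * 'I_d2)%type
    (fun ab tj => lam (ab, tj.1) tj.2).
  rewrite !card_prod !card_ord card_ffun !card_ord.
  apply: leq_ltn_trans (leq_mul d12 (leqnn d2)) _.
  by apply: ltn_mul.
pose g ga : S := \sum_ab (c ab)%:MP * (if ga == ab.2 then mon ab.1 else 0).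
have dopD l' g' be x y : dop l' g' be (x + y) = dop l' g' be x + dop l' g' be y.
  elim: l' be x y => [|i l' IH] be x y /=; first by rewrite scalerDr.
  by rewrite -big_split; apply: eq_bigr => b _; rewrite D_add IH.
have dopC l' g' be c' x : dop l' g' be (cst c' *: x) = cst c' *: dop l' g' be x.
  elim: l' be x => [|i l' IH] be x /=; first by rewrite !scalerA mulrC.
  by rewrite scaler_sumr; apply: eq_bigr => b _; rewrite D_cst IH.
have dopN l' g' be x : N x -> N (dop l' g' be x).
  elim: l' be x => [|i l' IH] be x Nx /=; first exact: NM.
  by apply: sg_sum => // b _; apply/IH/ND.
have kill1 t : N (dop l g be0 (v1 t)).
  rewrite /g dop_linear.
  have -> : \sum_ab cst (c ab) *: dop l (fun ga => if ga == ab.2 then mon ab.1 else 0) be0 (v1 t) =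
      \sum_ab cst (c ab) *: (e ab (v1 t) - \sum_j cst (lam (ab, t) j) *: v2 j).
    under [RHS]eq_bigr => ab _ do rewrite scalerBr scaler_sumr.
    rewrite sumrB exchange_big [X in _ = _ - X]big1 ?subr0 // => j _ /=.
    under eq_bigr => ab _ do rewrite scalerA -rmorphM -mpolyCM.
    rewrite -scaler_suml -rmorph_sum -(raddf_sum (@mpolyC n k)) /= (hc (t, j)).
    by rewrite mpolyC0 rmorph0 scale0r.
  by apply: sg_sum => // ab _; apply/NM/(hlam (ab, t)).
have kill x : N' x -> fil a1 x -> N (dop l g be0 x).
  move=> Nx fx; have [c' hc'] := good_spans max1 hv1 free1 Nx fx.
  rewrite -(subrK (\sum_t cst (c' t) *: v1 t) x) dopD; apply: sgD => //; first exact: dopN.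
  have -> : dop l g be0 (\sum_t cst (c' t) *: v1 t) = \sum_t cst (c' t) *: dop l g be0 (v1 t).
    by elim/big_rec2: _ => [|t x' y' _ <-]; rewrite ?dop_0 // dopD dopC.
  by apply: sg_sum => // t _; apply: NM.
have mcoef ga a : (g ga)@_(mnm a) = c (a, ga).
  rewrite /g raddf_sum (bigD1 (a, ga)) //= eqxx mcoeffCM mcoeffX eqxx mulr1 big1 ?addr0 //.
  move=> [a' ga'] ne; rewrite mcoeffCM /=; case: eqP => [e1|_]; last by rewrite mcoeff0 mulr0.
  rewrite mcoeffX; case: eqP => [e2|_]; last by rewrite mulr0.
  case/eqP: ne; congr pair => //; apply/ffunP => i; apply: val_inj.
  by have := congr1 (fun m : 'X_{1..n} => m i) e2; rewrite !mnmE.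
have [||ga hga kga] := @dop_kills l (enum_uniq _) g be0 (r + n * u)%N.
- exists ab0.2; first by move=> i; rewrite mem_enum.
  apply: contraNneq cab0 => e0; have := mcoef ab0.2 ab0.1.
  by rewrite e0 mcoeff0 -surjective_pairing => <-.
- move=> w Nw fw; apply: kill => //; apply: fil_le fw; rewrite size_l /a1; lia.
apply: (@poly_kills u l (g ga) r hga) => //.
  move=> m hm i; split; last by rewrite mem_enum.
  have [ab em] : exists ab : idx * idx, m = mnm ab.1; last by rewrite em mnmE.
  apply: contrapT => hno; move: hm; rewrite mcoeff_msupp /g raddf_sum /= big1 ?eqxx //.
  move=> ab _; rewrite mcoeffCM; case: eqP => _; last by rewrite mcoeff0 mulr0.
  by rewrite mcoeffX; case: eqP => [e1|_]; [case: hno; exists ab|rewrite mulr0].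
by move=> w Nw fw; apply: kga => //; apply: fil_le fw; rewrite size_l; lia.
Qed.

End Bernstein.

(** Each step contributes u^n vectors of [fil a], independent modulo the previous term, so L u^n is
    at most B (a + 1)^n. With u = s0 + 1 one has a + 1 = (4 n + 1) u, and the powers of [u] cancel:
    the bound does not depend on where the steps occur in the filtration. *)
Theorem dmodule_chain (N : nat -> set V) (L : nat) :
  (forall i, (i <= L)%N -> dsub (N i)) -> (forall i, (i < L)%N -> N i `<=` N i.+1) ->
  (forall i, (i < L)%N -> exists s v, [/\ N i.+1 v, ~ N i v & fil s v]) ->
  (L <= B * (4 * n).+1 ^ n)%N.
Proof.
move=> hN sN hv.
have {}hv (i : 'I_L) : exists s, exists v, [/\ N i.+1 v, ~ N i v & fil s v] by apply: hv.
have [s hs] := choice hv; pose s0 := (\sum_i s i)%N; pose u := s0.+1.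
pose a := (s0 + 4 * n * u)%N.
have hw (i : 'I_L) : exists v : 'I_(u ^ n) -> V,
    (forall t, N i.+1 (v t) /\ fil a (v t)) /\ kfree (N i) v.
  have [v [h1 h2 h3]] := hs i.
  have hNi : dsub (N i) by apply: hN; apply: ltnW.
  have hNi' : dsub (N i.+1) by apply: hN.
  apply: (@bernstein_lower_bound _ _ hNi hNi' u (ltn0Sn s0) s0 v h1 h2).
  by apply: fil_le h3; rewrite /s0 (bigD1 i) //= leq_addr.
have [w hw'] := choice hw.
have sle i j : (i <= j)%N -> (j <= L)%N -> N i `<=` N j.
  move=> /subnKC <-; elim: (j - i)%N => [|d IH] le; first by rewrite addn0.
  by move: le; rewrite addnS => le x /(IH (ltnW le)); apply: sN.
pose W (it : 'I_L * 'I_(u ^ n)) := w it.1 it.2.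
have free : kfree (N 0%N) W.
  move=> c hc; apply: contrapT => hno.
  have [i0 hi0] : exists i0 : 'I_L, [exists t, c (i0, t) != 0].
    apply: contrapT => hno'; apply: hno => -[i t]; apply/eqP; apply: contrapT => /negP h.
    by apply: hno'; exists i; apply/existsP; exists t.
  pose i1 := [arg max_(i > i0 | [exists t, c (i, t) != 0]) (i : nat)].
  have [/existsP[t1 ct1] i1max] : [exists t, c (i1, t) != 0] /\
      forall i : 'I_L, [exists t, c (i, t) != 0] -> (i <= i1)%N.
    by rewrite /i1; case: arg_maxnP => // i.
  have [_ free1] := hw' i1; have hN1 := hN i1 (ltnW (ltn_ord i1)).
  have sg1 : subgroup (N i1) by case: hN1.
  have := free1 (fun t => c (i1, t)) _ t1; rewrite (_ : \sum_t _ =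
    \sum_it cst (c it) *: W it - \sum_(it | it.1 != i1) cst (c it) *: W it); last first.
    rewrite (bigID (fun it : 'I_L * 'I_(u ^ n) => it.1 == i1)) /= addrK.
    rewrite (reindex_onto (fun t => (i1, t)) snd) /=; last by case=> i t /= /eqP ->.
    by apply: eq_bigl => t; rewrite !eqxx.
  move=> h; move: ct1; rewrite h ?eqxx //; apply: sg1.2.
    by apply: (sle 0%N) => //; apply: ltnW.
  apply: sg_sum => // -[i t] /= ne; have [lt|le] := ltnP i i1.
    have [hw1 _] := hw' i; have [h1 _] := hw1 t.
    by case: hN1 => _ + _; apply; apply: (sle i.+1) => //; apply: ltnW.
  have [->|/eqP c0] := eqVneq (c (i, t)) 0.
    by rewrite mpolyC0 rmorph0 scale0r; case: sg1.
  have : (i <= i1)%N by apply: i1max; apply/existsP; exists t; apply/eqP.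
  by rewrite leq_eqVlt ltnNge le orbF => /eqP e; case/eqP: ne; apply: val_inj.
have [m hm [x hx]] := fil_span a.
have hW it : exists c : 'I_m -> k, W it = \sum_j cst (c j) *: x j.
  by apply: hx; have [hw1 _] := hw' it.1; have [] := hw1 it.2.
have [lam hlam] := choice hW.
have le : (L * u ^ n <= m)%N.
  rewrite leqNgt; apply/negP => lt.
  have [|c [[t0 ct0] hc]] := @linear_dependence k ('I_L * 'I_(u ^ n))%type 'I_m lam.
    by rewrite card_prod !card_ord.
  have sg0 : subgroup (N 0%N) by have [] := hN 0%N isT.
  have := free c; rewrite (_ : \sum_t _ = 0); last first.
    under eq_bigr => t _ do rewrite hlam scaler_sumr.
    rewrite exchange_big big1 // => j _ /=.
    under eq_bigr => t _ do rewrite scalerA -rmorphM -mpolyCM.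
    by rewrite -scaler_suml -rmorph_sum -(raddf_sum (@mpolyC n k)) /= hc mpolyC0 rmorph0 scale0r.
  by case: sg0 => N0 _ /(_ N0 t0) e; rewrite e eqxx in ct0.
have up : (0 < u ^ n)%N by rewrite expn_gt0.
rewrite -(leq_pmul2r up); apply: leq_trans le _; apply: leq_trans hm _.
by rewrite -mulnA -expnMn; apply: leq_mul.
Qed.

(** By [hasse_pow], [b] additional factors [f] absorb an operator of order [b]. *)
Lemma torsion_dsub (N : set V) (Z : set S) : dsub N ->
  dsub [set v | forall f, Z f -> exists j, N (iota (f ^+ j) *: v)].
Proof.
move=> [NB NM ND].
have up f j j' v : (j <= j')%N -> N (iota (f ^+ j) *: v) -> N (iota (f ^+ j') *: v).
  move=> /subnK <- /(NM (f ^+ (j' - j))).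
  by rewrite scalerA -rmorphM -exprD.
split.
- split=> [f _|x y hx hy f Zf]; first by exists 0%N; rewrite scaler0; case: NB.
  have [j hj] := hx f Zf; have [j' hj'] := hy f Zf; exists (j + j')%N.
  rewrite scalerBr; apply: NB.2; first by apply: up hj; apply: leq_addr.
  by apply: up hj'; apply: leq_addl.
- move=> g v hv f Zf; have [j hj] := hv f Zf; exists j.
  by rewrite scalerA mulrC -scalerA; apply: NM.
move=> i b v hv f Zf; have [j hj] := hv f Zf; exists (j + b)%N.
elim/ltn_ind: b => b IH.
have := DM i b (f ^+ (j + b)) v; rewrite big_ord_recl /= hasse0 subn0 => e.
have -> : iota (f ^+ (j + b)) *: D i b v = D i b (iota (f ^+ (j + b)) *: v) -
    \sum_(c < b) iota (hasse i (bump 0 c) (f ^+ (j + b))) *: D i (b - bump 0 c) v.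
  by rewrite e addrK.
apply: NB.2; first by apply: ND; apply: up hj; apply: leq_addr.
apply: sg_sum => // c _; have lc := ltn_ord c.
have [w ->] := hasse_pow i (bump 0 c) f (j + b); rewrite /bump leq0n add1n mulrC rmorphM -scalerA.
by apply: NM; rewrite -addnBA //; apply: IH; lia.
Qed.

(** Out of infinitely many primes, choosing a maximal one among the remaining ones each time gives a
    list in which no prime lies in a later one. Let G_i be the elements on which every member of
    P_0, ..., P_(i-1) at once is nilpotent modulo [N]. The element with annihilator P_i lies in
    G_(i+1), and by primality not in G_i; so the chain is longer than [dmodule_chain] allows. *)
Lemma dmodule_ass (S0 : comPzRingType) (hS0 : acc S0) (chi : {rmorphism S0 -> S})
    (N : set V) : dsub N ->
  finite_set [set P | prime_ideal P /\
    exists s v, fil s v /\ P = [set r | N (iota (chi r) *: v)]].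
Proof.
move=> hN; set A := (X in finite_set X); apply: contrapT => inf.
have pick m : exists P : nat -> set S0, [/\ forall i, (i < m)%N -> A (P i),
    forall i j, (i < j < m)%N -> ~ (P i `<=` P j) &
    forall i Q, (i < m)%N -> A Q -> (forall j, (j < m)%N -> Q <> P j) -> ~ (P i `<=` Q)].
  elim: m => [|m [P [hA hP hQ]]]; first by exists (fun=> set0); split=> // i j /andP[].
  have [||Q [AQ nQ] maxQ] := @acc_max _ hS0 [set Q | A Q /\ forall j, (j < m)%N -> Q <> P j].
  - by move=> Q [[[]]].
  - apply: contrapT => hno; apply: inf; apply: (@sub_finite_set _ _ (P @` `I_m)).
      move=> Q AQ; apply: contrapT => hQ'; apply: hno; exists Q; split=> // j lj e.
      by apply: hQ'; exists j.
    exact/finite_image/finite_II.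
  exists (fun i => if (i < m)%N then P i else Q); split.
  - by move=> i _; case: ifP => // /hA.
  - move=> i j /andP[lij ljm]; rewrite (leq_trans lij ljm).
    case: ifP => [ljm'|nj]; first by apply: hP; rewrite lij.
    by apply: hQ => //; apply: leq_trans lij ljm.
  move=> i Q' lim AQ' nQ'; have Q'P j : (j < m)%N -> Q' <> P j.
    by move=> lj; have := nQ' j (ltnW lj); rewrite lj.
  case: ifP => [lim'|ge]; first by apply: hQ.
  move=> le; apply: (nQ' m (leqnn _)); rewrite ltnn; apply/seteqP; split=> //.
  by apply: maxQ => //; split.
pose L := (B * (4 * n).+1 ^ n).+1.
have [P [hA hP _]] := pick L.
pose Z (i : nat) := [set f | exists2 r, (forall j, (j < i)%N -> P j r) & f = chi r].
pose G i := [set v | forall f, Z i f -> exists j, N (iota (f ^+ j) *: v)].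
suff: (L <= B * (4 * n).+1 ^ n)%N by rewrite ltnn.
apply: (@dmodule_chain G).
- by move=> i _; apply: torsion_dsub.
- move=> i _ v Gv f [r hr ->]; apply: Gv; exists r => // j lj.
  by apply: hr; apply: ltnW.
move=> i li; have [prP [s [v [fv eP]]]] := hA i li; exists s, v; split=> //.
  by move=> f [r hr ->]; exists 1%N; rewrite expr1; have := hr i (leqnn _); rewrite eP.
have [idP P1 hPm] := prP.
have [r hr nr] : exists2 r, (forall j, (j < i)%N -> P j r) & ~ P i r.
  have {}hP j : (j < i)%N -> exists2 r, P j r & ~ P i r.
    move=> lj; have /existsNP[r /not_implyP[h1 h2]] : ~ (P j `<=` P i).
      by apply: hP; rewrite lj.
    by exists r.
  suff: forall l, (l <= i)%N -> exists2 r, (forall j, (j < l)%N -> P j r) & ~ P i r by apply.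
  elim=> [_|l IH ll]; first by exists 1.
  have [r hr nr] := IH (ltnW ll); have [r' hr' nr'] := hP l ll.
  exists (r' * r); last by move/hPm => [].
  have idPj j : (j < i)%N -> is_ideal (P j).
    by move=> lj; have [[]] := hA j (ltn_trans lj li).
  move=> j; rewrite ltnS leq_eqVlt => /predU1P[->|lj].
    by rewrite mulrC; case: (idPj l ll) => _ _; apply.
  by case: (idPj j (ltn_trans lj ll)) => _ _; apply; apply: hr.
move=> Gv; have [j] : exists j, N (iota (chi r ^+ j) *: v) by apply: Gv; exists r.
rewrite -rmorphXn; have {Gv} : ~ P i (r ^+ j).
  by elim: j => [|j IH] //; rewrite exprS => /hPm[].
by rewrite {1}eP.
Qed.

End DModule.

(** * The Čech module *)

(** The numerators of the divided derivative of a Čech cochain; [G] accumulates the denominators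
    [F i] of the exterior generators met so far. *)
Fixpoint cpole (A : comNzRingType) (n t : nat) (F : nat -> {mpoly A[n]}) (G : {mpoly A[n]})
    (i : 'I_n) (E b : nat) : coch {mpoly A[n]}^o t -> coch {mpoly A[n]}^o t :=
  if t is t'.+1 then fun z =>
    (cpole (shift F) G i E b z.1, cpole (shift F) (G * F 0%N) i E b z.2)
  else fun z => pole i E G z b.
Arguments cpole {A n t}.

Lemma cmap_cpole (A B : comNzRingType) n (f : {rmorphism A -> B}) t F G i E b
    (z : coch {mpoly A[n]}^o t) :
  cmap (M := {mpoly A[n]}^o) (M' := {mpoly B[n]}^o) (map_mpoly f) (cpole F G i E b z) =
  cpole (fun j => map_mpoly f (F j)) (map_mpoly f G) i E b
    (cmap (M := {mpoly A[n]}^o) (M' := {mpoly B[n]}^o) (map_mpoly f) z).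
Proof.
elim: t F G z => [|t IH] F G z /=; first exact: map_pole.
by rewrite !IH rmorphM.
Qed.

Section Cech.
Variables (k : fieldType) (n : nat).
Notation S := {mpoly k[n]}.
Variables (K : fieldType) (iota : {rmorphism S -> K}).
Hypothesis iota_inj : injective iota.
Hypothesis iota_frac : forall y, exists w h, h != 0 /\ y * iota h = iota w.
Notation dK i b := (dfrac iota_inj iota_frac i b).
Notation dV i b := (cmap (M := K^o) (M' := K^o) (dK i b)).

Let iota_eq0 h : (iota h == 0) = (h == 0).
Proof. by rewrite -(inj_eq iota_inj) rmorph0. Qed.

Lemma cmap_dfrac_additive t i b : zmod_morphism (dV i b : coch K^o t -> coch K^o t).
Proof.
elim: t => [|t IH] x y /=; first by rewrite raddfB.
by rewrite !IH !pairD !pairN.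
Qed.

Lemma cmap_dfrac0 t i (v : coch K^o t) : dV i 0 v = v.
Proof. by elim: t v => [|t IH] v /=; [rewrite dfrac0|rewrite !IH -surjective_pairing]. Qed.

Lemma cmap_dfracM t i b g (v : coch K^o t) :
  dV i b (iota g *: v) = \sum_(c < b.+1) iota (hasse i c g) *: dV i (b - c) v.
Proof.
elim: t v => [|t IH] v /=.
  by rewrite [_ *: v]/(_ * _) dfracM; apply: eq_bigr => c _; rewrite dfrac_poly.
rewrite !IH; elim/big_rec3: _ => [|c x y z _ e]; first by [].
by rewrite -e pairZ pairD.
Qed.

Lemma kd1_cmap_dfrac t i b (v : coch K^o t) :
  kd (fun=> 1) (dV i b v) = dV i b (kd (fun=> 1) v).
Proof.
elim: t v => [|t IH] v /=; first by rewrite raddf0.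
by rewrite !IH !scale1r cmap_dfrac_additive.
Qed.

(** A Koszul cochain as a Čech cochain: a component is divided by the power [s.+1] of the product of
    the [F i] of its exterior generators. With all Čech modules inside [K], the differential has all
    coefficients 1 ([theta_kd]) and the transition maps become inclusions ([theta_tr]). *)
Fixpoint theta (t : nat) (F : nat -> S) (G : S) (s : nat) : coch S^o t -> coch K^o t :=
  if t is t'.+1 then fun z =>
    (theta (shift F) G s z.1, theta (shift F) (G * F 0%N) s z.2)
  else fun z => iota z / iota G ^+ s.+1.
Arguments theta {t}.

Lemma theta_linear t F G s a (x y : coch S^o t) :
  theta F G s (a *: x + y) = iota a *: theta F G s x + theta F G s y.
Proof.
elim: t F G x y => [|t IH] F G x y /=.
  by rewrite rmorphD rmorphM mulrDl -mulrA.
by rewrite !IH pairZ pairD.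
Qed.

Lemma theta0 t F G s : theta F G s (0 : coch S^o t) = 0.
Proof. by have := theta_linear F G s (-1) (0 : coch S^o t) 0;
  rewrite scaler0 addr0 rmorphN1 scaleN1r addNr. Qed.

Lemma thetaZ t F G s a (x : coch S^o t) : theta F G s (a *: x) = iota a *: theta F G s x.
Proof. by rewrite -[_ *: x]addr0 theta_linear theta0 addr0. Qed.

Lemma thetaD t F G s (x y : coch S^o t) : theta F G s (x + y) = theta F G s x + theta F G s y.
Proof. by rewrite -[x]scale1r theta_linear rmorph1 !scale1r. Qed.

Lemma thetaN t F G s (x : coch S^o t) : theta F G s (- x) = - theta F G s x.
Proof. by rewrite -scaleN1r thetaZ rmorphN1 scaleN1r. Qed.

Lemma thetaB t F G s (x y : coch S^o t) : theta F G s (x - y) = theta F G s x - theta F G s y.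
Proof. by rewrite thetaD thetaN. Qed.

Lemma theta_ktr t F G s m (z : coch S^o t) :
  theta F G (s + m) (G ^+ m *: ktr (pw F m) z) = theta F G s z.
Proof.
elim: t F G z => [|t IH] F G z /=.
  rewrite [_ *: z]/(_ * _) rmorphM rmorphXn -addSn exprD.
  have [->|g0] := eqVneq (iota G) 0; first by rewrite [0 ^+ s.+1]exprS !mul0r invr0 !mulr0.
  by rewrite [X in X / _]mulrC -mulf_div divff ?mulr1 // expf_neq0.
congr pair; first exact: IH.
by rewrite scalerA -exprMn IH.
Qed.

Lemma theta_tr t F s m (z : coch S^o t) : theta F 1 (s + m) (ktr (pw F m) z) = theta F 1 s z.
Proof. by rewrite -[RHS](theta_ktr F 1 s m) expr1n scale1r. Qed.

Lemma theta_mulF t F G H s (z : coch S^o t) : H != 0 ->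
  theta F (G * H) s (H ^+ s.+1 *: z) = theta F G s z.
Proof.
move=> H0; elim: t F G z => [|t IH] F G z /=.
  rewrite [_ *: z]/(_ * _) !rmorphM rmorphXn exprMn [X in X / _]mulrC -mulf_div.
  by rewrite divff ?mulr1 // expf_neq0 ?iota_eq0.
by rewrite IH mulrAC IH.
Qed.

Lemma theta_kd t F G s (z : coch S^o t) : (forall i, (i < t)%N -> F i != 0) ->
  theta F G s (kd (pw F s.+1) z) = kd (fun=> 1) (theta F G s z).
Proof.
elim: t F G z => [|t IH] F G z hF /=; first by rewrite rmorph0 mul0r.
have hF' i : (i < t)%N -> F i.+1 != 0 by move=> lt; apply: hF.
by rewrite thetaB theta_mulF ?hF // scale1r !(IH (shift F)).
Qed.

Lemma theta_eq0 t F G s (z : coch S^o t) : G != 0 -> (forall i, (i < t)%N -> F i != 0) ->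
  theta F G s z = 0 -> z = 0.
Proof.
elim: t F G z => [|t IH] F G z G0 hF /=.
  move/eqP; rewrite mulf_eq0 invr_eq0 expf_eq0 /= !iota_eq0 (negbTE G0) orbF.
  by move/eqP.
have hF' i : (i < t)%N -> F i.+1 != 0 by move=> lt; apply: hF.
case: z => x y [/(IH _ _ _ G0 hF') ->] /(IH _ _ _ _ hF') ->//.
by rewrite mulf_neq0 ?hF.
Qed.

Lemma theta_pole t F G s i b (z : coch S^o t) :
  dV i b (theta F G s z) = theta F G (s + b) (cpole F G i s.+1 b z).
Proof. by elim: t F G z => [|t IH] F G z /=; [rewrite dfrac_pole addSn|rewrite !IH]. Qed.

Definition msF t (F : nat -> S) : nat := (\sum_(i < t) msize (F i))%N.

Lemma msF_S t F : msF t.+1 F = (msize (F 0%N) + msF t (shift F))%N.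
Proof. by rewrite /msF big_ord_recl. Qed.

Notation small M := [set p : S^o | (msize p <= M)%N].

Lemma small_ktr t F M m (z : coch S^o t) : call (small M) z ->
  call (small (M + m * msF t F)) (ktr (pw F m) z).
Proof.
elim: t F M z => [|t IH] F M z /=; first by move=> h; apply: leq_trans h (leq_addr _ _).
move=> [h1 h2]; rewrite msF_S; split.
  by apply: callS (IH (shift F) _ _ h1) => p /= h; apply: leq_trans h _; nia.
have sc (x : coch S^o t) M' : call (small M') x ->
    call (small (M' + m * msize (F 0%N))) (F 0%N ^+ m *: x).
  elim: t x {IH z h1 h2} => [|t IH] x /=; last by case=> *; split; apply: IH.
  move=> h; case: (posnP m) => [->|m0]; first by rewrite expr0 scale1r mul0n addn0.
  apply: leq_trans (msizeM_leq _ _) _; rewrite addnC; apply: leq_add => //.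
  exact: msizeX_leq.
by apply: callS (sc _ _ (IH (shift F) _ _ h2)) => p /= h; apply: leq_trans h _; lia.
Qed.

Lemma small_scale t M a (z : coch S^o t) : call (small M) z ->
  call (small (M + msize a)) (a *: z).
Proof.
elim: t z => [|t IH] z /=; last by case=> *; split; apply: IH.
by move=> h; apply: leq_trans (msizeM_leq _ _) _; rewrite addnC leq_add2r.
Qed.

Lemma small_pole t F G i E b M (z : coch S^o t) : call (small M) z ->
  call (small (M + b * (msize G + msF t F))) (cpole F G i E b z).
Proof.
elim: t F G z => [|t IH] F G z /=.
  by move=> h; apply: leq_trans (msize_pole _ _ _ _ _) _;
    rewrite leq_add // leq_mul2l leq_addr orbT.
move=> [h1 h2]; rewrite msF_S; split.
  by apply: callS (IH (shift F) G _ h1) => p /= h; apply: leq_trans h _; nia.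
apply: callS (IH (shift F) (G * F 0%N) _ h2) => p /= h; apply: leq_trans h _.
by rewrite leq_add2l leq_mul2l addnA leq_add2r msizeM_leq orbT.
Qed.

Lemma small_ex t (z : coch S^o t) : exists M, call (small M) z.
Proof.
elim: t z => [|t IH] z /=; first by exists (msize z).
have [M1 h1] := IH z.1; have [M2 h2] := IH z.2; exists (M1 + M2)%N.
by split; [apply: callS h1|apply: callS h2] => p /= h; apply: leq_trans h _; lia.
Qed.

Lemma small_add t M (x y : coch S^o t) :
  call (small M) x -> call (small M) y -> call (small M) (x - y).
Proof.
elim: t x y => [|t IH] x y /=; last by move=> [? ?] [? ?]; split; apply: IH.
move=> hx hy; apply: leq_trans (msizeD_le _ _) _.
by rewrite geq_max hx msizeN.
Qed.

Lemma small_span t F G s N : exists2 T : finType, #|T| = (2 ^ t * N ^ n)%N &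
  exists w : T -> coch K^o t, forall z : coch S^o t, call (small N) z ->
  exists c : T -> k, theta F G s z = \sum_j iota (c j)%:MP *: w j.
Proof.
elim: t F G => [|t IH] F G.
  exists {ffun 'I_n -> 'I_N} => /=; first by rewrite card_ffun !card_ord expn0 mul1n.
  pose mnm (a : {ffun 'I_n -> 'I_N}) : 'X_{1..n} := [multinom (a i : nat) | i < n].
  exists (fun a => iota 'X_[mnm a] / iota G ^+ s.+1) => z hz; exists (fun a => z@_(mnm a)).
  have {1}-> : z = \sum_a (z@_(mnm a))%:MP * 'X_[mnm a].
    apply/mpolyP => m; rewrite raddf_sum /=.
    have mnm_inj : injective mnm.
      move=> a b e; apply/ffunP => i; apply: val_inj.
      by have := congr1 (fun m : 'X_{1..n} => m i) e; rewrite !mnmE.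
    have [[a em]|hno] := pselect (exists a, m = mnm a).
      rewrite em (bigD1 a) //= mcoeffCM mcoeffX eqxx mulr1 big1 ?addr0 // => b ne.
      by rewrite mcoeffCM mcoeffX (inj_eq mnm_inj) (negbTE ne) mulr0.
    rewrite big1 => [|a _]; last first.
      by rewrite mcoeffCM mcoeffX; case: eqP => [e|]; [case: hno; exists a|rewrite mulr0].
    apply: memN_msupp_eq0; apply/negP => hm; apply: hno.
    have lt i : (m i < N)%N.
      apply: leq_trans hz; apply: leq_ltn_trans (msize_mdeg_lt hm).
      by rewrite mdegE (bigD1 i) //= leq_addr.
    exists [ffun i => Ordinal (lt i)]; apply/mnmP => i; rewrite mnmE ffunE //.
  rewrite rmorph_sum mulr_suml; apply: eq_bigr => a _.
  by rewrite rmorphM -mulrA.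
have [T1 c1 [w1 h1]] := IH (shift F) G; have [T2 c2 [w2 h2]] := IH (shift F) (G * F 0%N).
exists (T1 + T2)%type; first by rewrite card_sum c1 c2 expnS -mulnA; lia.
exists (fun j => match j with inl a => (w1 a, 0) | inr a => (0, w2 a) end) => z /= [hz1 hz2].
have [d1 ->] := h1 _ hz1; have [d2 ->] := h2 _ hz2.
exists (fun j => match j with inl a => d1 a | inr a => d2 a end).
rewrite big_sumType /=.
have -> : \sum_i iota (d1 i)%:MP *: (w1 i, 0 : coch K^o t) =
    ((\sum_i iota (d1 i)%:MP *: w1 i, 0) : coch K^o t.+1).
  by elim/big_rec2: _ => [|a x y _ ->] //; rewrite pairZ pairD /= scaler0 addr0.
have -> : \sum_i iota (d2 i)%:MP *: (0 : coch K^o t, w2 i) =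
    ((0, \sum_i iota (d2 i)%:MP *: w2 i) : coch K^o t.+1).
  by elim/big_rec2: _ => [|a x y _ ->] //; rewrite pairZ pairD /= scaler0 addr0.
by rewrite pairD /= addr0 add0r.
Qed.

Section Filtration.
Variables (t : nat) (F : nat -> S).
Notation V := (coch K^o t).
Let e := (2 + msF t F)%N.

(** Pole order and size of numerators are bounded together. The slope [e] pays for one transition
    map (the sizes of the [F i]) and one variable (size 2). *)
Definition cfil (s : nat) : set V :=
  [set v | exists2 z, call (small (s.+1 * e)) z & v = theta F 1 s z].

Lemma cfil_sub s : subgroup (cfil s).
Proof.
split=> [|x y [z hz ->] [z' hz' ->]].
  exists 0; last by rewrite theta0.
  have [M] := small_ex (0 : coch S^o t); elim: (t) => [|t' IH] /=; first by rewrite msize0.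
  by case=> *; split; apply: IH; eauto.
by exists (z - z'); [apply: small_add|rewrite thetaB].
Qed.

Lemma cfil_tr s m M (z : coch S^o t) : call (small M) z ->
  (M + m * msF t F <= (s + m).+1 * e)%N -> cfil (s + m) (theta F 1 s z).
Proof.
move=> hz le; exists (ktr (pw F m) z); last by rewrite theta_tr.
by apply: callS (small_ktr F m hz) => p /= h; apply: leq_trans h le.
Qed.

Lemma cfilS s v : cfil s v -> cfil s.+1 v.
Proof. by move=> [z hz ->]; rewrite -addn1; apply: cfil_tr hz _; rewrite /e; nia. Qed.

Lemma cfilX s i v : cfil s v -> cfil s.+1 (iota 'X_i *: v).
Proof.
move=> [z hz ->]; rewrite -thetaZ -addn1.
by apply: cfil_tr (small_scale 'X_i hz) _; rewrite msizeX mdeg1 /e; nia.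
Qed.

Lemma cfilD s i b v : cfil s v -> cfil (s + b) (dV i b v).
Proof.
move=> [z hz ->]; rewrite theta_pole; exists (cpole F 1 i s.+1 b z) => //.
apply: callS (small_pole F 1 i s.+1 b hz) => p /= h; apply: leq_trans h _.
by rewrite msize1 /e; nia.
Qed.

Lemma cfil_span s : exists2 m, (m <= 2 ^ t * e ^ n * s.+1 ^ n)%N & exists w : 'I_m -> V,
  forall v, cfil s v -> exists c : 'I_m -> k, v = \sum_j iota (c j)%:MP *: w j.
Proof.
have [T cT [w hw]] := @small_span t F 1 s (s.+1 * e).
exists #|T|; first by rewrite cT expnMn -mulnA [(e ^ n * _)%N]mulnC.
exists (fun j => w (enum_val j)) => v [z hz ->]; have [c ->] := hw _ hz.
exists (fun j => c (enum_val j)); rewrite (reindex_onto (@enum_val T T) enum_rank) /=; last first.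
  by move=> a _; rewrite enum_rankK.
by apply: eq_bigl => j; rewrite enum_valK eqxx.
Qed.

Lemma cfil_ex s (z : coch S^o t) : exists s', cfil s' (theta F 1 s z).
Proof.
by have [M hM] := small_ex z; exists (s + M)%N; apply: cfil_tr hM _; rewrite /e; nia.
Qed.

Notation cdsub := (dsub iota (fun i b => (dV i b : V -> V))).

Lemma cech_dsub : cdsub [set v | exists s z, v = theta F 1 s z].
Proof.
split.
- split=> [|x y [s [z ->]] [s' [z' ->]]]; first by exists 0%N, 0; rewrite theta0.
  exists (s + s')%N, (ktr (pw F s') z - ktr (pw F s) z').
  by rewrite thetaB theta_tr addnC theta_tr.
- by move=> g v [s [z ->]]; exists s, (g *: z); rewrite thetaZ.
by move=> i b v [s [z ->]]; exists (s + b)%N, (cpole F 1 i s.+1 b z); rewrite theta_pole.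
Qed.

Lemma cech_chain : exists L0, forall (N : nat -> set V) L,
  (forall i, (i <= L)%N -> cdsub (N i)) -> (forall i, (i < L)%N -> N i `<=` N i.+1) ->
  (forall i, (i < L)%N -> exists s z, N i.+1 (theta F 1 s z) /\ ~ N i (theta F 1 s z)) ->
  (L <= L0)%N.
Proof.
exists (2 ^ t * e ^ n * (4 * n).+1 ^ n)%N => N L hN sN hs.
apply: (dmodule_chain (D :=
  fun i b => (dV i b : V -> V)) (@cmap_dfrac_additive t) (@cmap_dfrac0 t) (@cmap_dfracM t)
  cfil_sub cfilS cfilX cfilD cfil_span hN sN) => i lt.
have [s [z [h1 h2]]] := hs i lt; have [s' fs'] := cfil_ex s z.
by exists s', (theta F 1 s z).
Qed.

Lemma cech_ass (S0 : comPzRingType) (hS0 : acc S0) (chi : {rmorphism S0 -> S})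
    (N : set V) : cdsub N ->
  finite_set [set P | prime_ideal P /\
    exists s z, P = [set r | N (iota (chi r) *: theta F 1 s z)]].
Proof.
move=> hN; apply: sub_finite_set (dmodule_ass (D :=
  fun i b => (dV i b : V -> V)) (@cmap_dfrac_additive t) (@cmap_dfrac0 t)
  (@cmap_dfracM t) cfil_sub cfilS cfilX cfilD cfil_span hS0 chi hN).
move=> P [prP [s [z eP]]]; split=> //; have [s' fs'] := cfil_ex s z.
by exists s', (theta F 1 s z).
Qed.

End Filtration.
End Cech.

(** * Frobenius descent of cocycles *)

Section Frobenius.
Variables (k : fieldType) (n p : nat).
Hypothesis hp : p \in [pchar k].
Hypothesis perf : forall c : k, c ^+ p = c.
Notation S := {mpoly k[n]}.
Variables (K : fieldType) (iota : {rmorphism S -> K}).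
Hypothesis iota_inj : injective iota.
Hypothesis iota_frac : forall y, exists w h, h != 0 /\ y * iota h = iota w.
Notation dK i b := (dfrac iota_inj iota_frac i b).
Notation dV i b := (cmap (M := K^o) (M' := K^o) (dK i b)).
Notation frob := (fun y : K^o => y ^+ p : K^o).
Notation cfr := (cmap (M := K^o) (M' := K^o) frob).

Let iota_eq0 h : (iota h == 0) = (h == 0).
Proof. by rewrite -(inj_eq iota_inj) rmorph0. Qed.

Let p_pr : prime p. Proof. exact: pcharf_prime hp. Qed.
Let p_gt0 : (0 < p)%N. Proof. exact: prime_gt0. Qed.
Let p_gt1 : (1 < p)%N. Proof. exact: prime_gt1. Qed.

Let hpS : p \in [pchar S]. Proof. exact: rmorph_pchar (@mpolyC n k) _ hp. Qed.
Let hpK : p \in [pchar K]. Proof. exact: rmorph_pchar iota _ hpS. Qed.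

Let frS_sum (T : Type) (r : seq T) (P : pred T) (u : T -> S) :
  (\sum_(j <- r | P j) u j) ^+ p = \sum_(j <- r | P j) u j ^+ p.
Proof. by rewrite -(pFrobenius_autE hpS) rmorph_sum. Qed.

Let frK_D (x y : K) : (x + y) ^+ p = x ^+ p + y ^+ p.
Proof. by rewrite -!(pFrobenius_autE hpK) rmorphD. Qed.

Let frK_sum (T : Type) (r : seq T) (P : pred T) (u : T -> K) :
  (\sum_(j <- r | P j) u j) ^+ p = \sum_(j <- r | P j) u j ^+ p.
Proof. by rewrite -(pFrobenius_autE hpK) rmorph_sum. Qed.

Let frZ (r x : K) : (r *: (x : K^o)) ^+ p = r ^+ p *: (x ^+ p : K^o).
Proof. exact: exprMn. Qed.

Notation idx := {ffun 'I_n -> 'I_p}.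
Let mnm (a : idx) : 'X_{1..n} := [multinom (a i : nat) | i < n].

Let mnm_inj a b m m' : (mnm a + m *+ p = mnm b + m' *+ p)%MM -> a = b /\ m = m'.
Proof.
move=> e; have h i : (a i + m i * p = b i + m' i * p)%N.
  by have := congr1 (fun m : 'X_{1..n} => m i) e; rewrite !mnmE !mulmnE ?mnmE.
have ab : a = b.
  apply/ffunP => i; apply: val_inj; have := congr1 (modn^~ p) (h i).
  by rewrite /= ![(_ + _ * p)%N]addnC !modnMDl !modn_small.
split=> //; apply/mnmP => i; have := h i; rewrite ab => /addnI /eqP.
by rewrite eqn_pmul2r // => /eqP.
Qed.

Let mnm_ex m : exists a m', m = (mnm a + m' *+ p)%MM.
Proof.
have lt i : (m i %% p < p)%N by rewrite ltn_mod.
exists [ffun i => Ordinal (lt i)], [multinom (m i %/ p)%N | i < n].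
by apply/mnmP => i; rewrite !mnmE mulmnE !mnmE ffunE /= addnC -divn_eq.
Qed.

(* The [p]-th root of the component of [u] along the monomial [a], in the basis of the
   monomials of exponents below [p] over the ring of [p]-th powers. *)
Let froot (a : idx) (u : S) : S :=
  \sum_(m : 'X_{1..n < msize u}) u@_(mnm a + m *+ p) *: 'X_[m].

Let mcoeff_froot a u m : (froot a u)@_m = u@_(mnm a + m *+ p).
Proof.
rewrite raddf_sum /=; have [lt|ge] := ltnP (mdeg m) (msize u).
  rewrite (bigD1 (BMultinom lt)) //= mcoeffZ mcoeffX eqxx mulr1 big1 ?addr0 // => m' ne.
  rewrite mcoeffZ mcoeffX; case: eqP => [em|_]; last by rewrite mulr0.
  by case/eqP: ne; apply: val_inj.
rewrite big1 => [|m' _].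
  apply/esym/memN_msupp_eq0; apply: contraL ge => /msize_mdeg_lt; rewrite -ltnNge.
  apply: leq_ltn_trans; rewrite !mdegE leq_sum // => i _.
  by rewrite mnmE mulmnE; apply: leq_trans (leq_addl _ _); rewrite leq_pmulr.
rewrite mcoeffZ mcoeffX; case: eqP => [e|]; last by rewrite mulr0.
by have := bmdeg m'; rewrite e ltnNge ge.
Qed.

Let mcoeff_Xfr a b (w : S) m :
  ('X_[mnm b] * w ^+ p)@_(mnm a + m *+ p) = if b == a then w@_m ^+ p else 0.
Proof.
rewrite {1}[w]mpolyE frS_sum mulr_sumr raddf_sum /=.
have e (m' : 'X_{1..n}) : mcoeff (mnm a + m *+ p)%MM (('X_[mnm b] : S) * (w@_m' *: ('X_[m'] : S)) ^+ p) =
    if (b == a) && (m' == m) then w@_m' ^+ p else 0.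
  rewrite exprZn -scalerAr mcoeffZ mpolyXn -mpolyXD mcoeffX.
  case: eqP => [/mnm_inj[-> ->]|ne]; first by rewrite !eqxx mulr1.
  rewrite mulr0; case: eqP => //= ba; case: eqP => // mm.
  by case: ne; rewrite ba mm.
rewrite (eq_bigr _ (fun m' _ => e m')); case: eqP => _ /=; last by rewrite big1.
have [hm|hm] := boolP (m \in msupp w).
  rewrite (bigD1_seq m) ?msupp_uniq //= eqxx big1 ?addr0 // => m' ne.
  by rewrite (negbTE ne).
rewrite memN_msupp_eq0 // expr0n gtn_eqF //= big_seq big1 // => m' hm'.
by case: eqP => // mm; rewrite mm (negbTE hm) in hm'.
Qed.

Let froot_decomp u : u = \sum_a 'X_[mnm a] * froot a u ^+ p.
Proof.
apply/mpolyP => m; have [a [m' ->]] := mnm_ex m; rewrite raddf_sum /=.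
rewrite (eq_bigr _ (fun b _ => mcoeff_Xfr a b (froot b u) m')) -big_mkcond big_pred1_eq.
by rewrite perf mcoeff_froot.
Qed.

Let frac_family (T : finType) (y : T -> K) :
  exists h, h != 0 /\ forall a, exists w, y a * iota h = iota w.
Proof.
have {}hy a : exists h, h != 0 /\ exists w, y a * iota h = iota w.
  by have [w [h [h0 e]]] := iota_frac (y a); exists h; split=> //; exists w.
have [h hh] := choice hy; exists (\prod_a h a); split.
  by apply/prodf_neq0 => a _; case: (hh a).
move=> a; have [_ [w e]] := hh a; exists (w * \prod_(b | b != a) h b).
by rewrite (bigD1 a) //= !rmorphM mulrA e.
Qed.

(** With a common denominator cleared, the exponents mnm a + p m for different [a] do not overlap,
    so every coefficient of each term vanishes by itself. *)
Let frob_indep (y : idx -> K) : \sum_a iota 'X_[mnm a] * y a ^+ p = 0 -> forall a, y a = 0.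
Proof.
have [h [h0 hy]] := frac_family y; have [w hw] := choice hy => e a.
have e' : \sum_a 'X_[mnm a] * w a ^+ p = 0.
  apply: iota_inj; rewrite rmorph0 rmorph_sum.
  have e1 : (\sum_b iota 'X_[mnm b] * y b ^+ p) * iota h ^+ p = 0 by rewrite e mul0r.
  rewrite -[RHS]e1 mulr_suml.
  by apply: eq_bigr => b _; rewrite rmorphM rmorphXn -hw exprMn mulrA.
suff w0 : w a = 0.
  by apply/eqP; have /eqP := hw a; rewrite w0 rmorph0 mulf_eq0 iota_eq0 (negbTE h0) orbF.
apply/mpolyP => m; have := congr1 (mcoeff (mnm a + m *+ p)%MM) e'.
rewrite raddf_sum mcoeff0 /= (eq_bigr _ (fun b _ => mcoeff_Xfr a b (w b) m)).
by rewrite -big_mkcond big_pred1_eq; move/eqP; rewrite expf_eq0 mcoeff0 => /andP[_ /eqP ->].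
Qed.

Let cfr0 t : cfr (0 : coch K^o t) = 0.
Proof. exact: (cmap0 (g := frob) frK_D). Qed.

Let cfrB t (x y : coch K^o t) : cfr (x - y) = cfr x - cfr y.
Proof. exact: (cmapB (g := frob) frK_D). Qed.

Let cfrZ t a (x : coch K^o t) : cfr (a *: x) = a ^+ p *: cfr x.
Proof. exact: (cmapZ (g := frob) (chi := fun a : K => a ^+ p) frZ). Qed.

Let cfr_kd t (x : coch K^o t) : cfr (kd (fun=> 1) x) = kd (fun=> 1) (cfr x).
Proof.
rewrite (cmap_kd (g := frob) (chi := fun a : K => a ^+ p) frK_D frZ).
by congr kd; apply/funext => i; rewrite expr1n.
Qed.

Let sum_fst (A B : lmodType K) (T : Type) (r : seq T) (P : pred T) (u : T -> (A * B)%type) :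
  \sum_(j <- r | P j) u j = (\sum_(j <- r | P j) (u j).1, \sum_(j <- r | P j) (u j).2).
Proof. by elim/big_rec3: _ => [|j x y z _ ->]; rewrite // pairD. Qed.

Let cfr_indep t (y : idx -> coch K^o t) :
  \sum_a iota 'X_[mnm a] *: cfr (y a) = 0 -> forall a, y a = 0.
Proof.
elim: t y => [|t IH] y /=; first exact: frob_indep.
rewrite sum_fst => -[e1 e2] a.
have h1 := IH _ e1 a; have h2 := IH _ e2 a.
by move: h1 h2; case: (y a) => y1 y2 /= -> ->.
Qed.

(** Frobenius raises the Taylor coefficients to the p-th power and replaces X by X^p. This is clear
    for polynomials and passes to fractions by uniqueness of the quotient of series. *)
Let dfrac_frob i b y : dK i b (y ^+ p) = if (p %| b)%N then dK i (b %/ p)%N y ^+ p else 0.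
Proof.
have poly b' (u : S) : hasse i b' (u ^+ p) = if (p %| b')%N then hasse i (b' %/ p)%N u ^+ p else 0.
  have hpP : p \in [pchar {poly S}] by apply: rmorph_pchar (@polyC S) _ hpS.
  rewrite /hasse rmorphXn /= -{1}[taylor i u]coefK poly_def.
  rewrite -(pFrobenius_autE hpP) rmorph_sum coef_sum /=.
  under eq_bigr => j _ do rewrite pFrobenius_autE exprZn -exprM coefZ coefXn.
  case: ifP => [/dvdnP[c ->]|nd]; last first.
    by apply: big1 => j _; case: eqP => [e|_]; [rewrite e dvdn_mull in nd|rewrite mulr0].
  rewrite mulnK //; have [lt|ge] := ltnP c (size (taylor i u)).
    rewrite (bigD1 (Ordinal lt)) //= eqxx mulr1 big1 ?addr0 // => j ne.
    rewrite eqn_pmul2r //; case: eqP => [e|_]; last by rewrite mulr0.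
    by case/eqP: ne; apply: val_inj.
  rewrite [(taylor i u)`_c]nth_default // expr0n gtn_eqF //= big1 // => j _.
  rewrite eqn_pmul2r //; case: eqP => [e|_]; last by rewrite mulr0.
  by have := ltn_ord j; rewrite -e ltnNge ge.
have [w [h [h0 e]]] := iota_frac y.
pose X j := dK i j (iota (h ^+ p)).
have e1 : conv (fun j => dK i j (y ^+ p)) X = fun j => iota (hasse i j (w ^+ p)).
  apply/funext => j; rewrite /conv -dfracM rmorphXn -exprMn e -rmorphXn dfrac_poly //.
pose Y j := if (p %| j)%N then dK i (j %/ p)%N y ^+ p else 0.
have e2 : conv Y X = fun j => iota (hasse i j (w ^+ p)).
  apply/funext => j; rewrite poly /conv.
  have [dj|ndj] := boolP (p %| j)%N; last first.
    rewrite rmorph0 big1 // => c _; rewrite /Y /X dfrac_poly poly.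
    case: ifP => [dc|_]; last by rewrite mul0r.
    rewrite dvdn_subl ?(negbTE ndj) ?rmorph0 ?mulr0 //.
    by rewrite -ltnS.
  rewrite rmorphXn -dfrac_poly -e dfracM frK_sum.
  move: dj => /dvdnP[c ->]; rewrite mulnK //.
  have lt (c' : 'I_c.+1) : (c' * p < (c * p).+1)%N by rewrite ltnS leq_pmul2r // -ltnS.
  rewrite (bigID (fun j' : 'I_(c * p).+1 => (p %| j')%N)) /= [X in _ + X]big1 ?addr0; last first.
    by move=> j' /negbTE nd; rewrite /Y nd mul0r.
  rewrite (reindex_onto (fun c' => Ordinal (lt c')) (fun j' => inord (j' %/ p)%N)) /=; last first.
    move=> j' /dvdnP[q ej]; apply: val_inj; rewrite /= ej mulnK // inordK //.
    by have := ltn_ord j'; rewrite ej !ltnS leq_pmul2r.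
  apply: eq_big => [c'|c' _].
    by rewrite dvdn_mull //= mulnK // inord_val eqxx.
  rewrite /Y /X dvdn_mull // mulnK // exprMn; congr (_ * _).
  rewrite dfrac_poly poly -mulnBl dvdn_mull // mulnK // rmorphXn dfrac_poly.
  by [].
have X0 : X 0%N != 0 by rewrite /X dfrac0 iota_eq0 expf_neq0.
have E : (fun j => dK i j (y ^+ p)) = Y.
  by apply: (conv_cancel X0); rewrite ![conv X _]convC e1 e2.
by have := congr1 (fun f => f b) E.
Qed.

Let cmap_dfrac_frob t i b (v : coch K^o t) :
  dV i b (cfr v) = if (p %| b)%N then cfr (dV i (b %/ p)%N v) else 0.
Proof.
elim: t v => [|t IH] v /=; first exact: dfrac_frob.
by rewrite !IH; case: ifP.
Qed.

Section Descent.
Variables (t : nat) (F : nat -> S).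
Hypothesis F0 : forall i, (i < t)%N -> F i != 0.
Notation V := (coch K^o t).
Notation cdsub := (dsub iota (fun i b => (dV i b : V -> V))).

(** The Frobenius pullback of [N]: the span over polynomials of its p-th powers, written in the
    basis of the monomials with exponents below [p]. *)
Let G (N : set V) : set V := [set v | exists2 y : idx -> V,
  (forall a, N (y a)) & v = \sum_a iota 'X_[mnm a] *: cfr (y a)].

Let G_mul (N : set V) g v : cdsub N -> N v -> G N (iota g *: cfr v).
Proof.
move=> [_ NM _] Nv; exists (fun a => iota (froot a g) *: v); first by move=> a; apply: NM.
rewrite {1}[g]froot_decomp rmorph_sum scaler_suml; apply: eq_bigr => a _.
by rewrite rmorphM rmorphXn cfrZ scalerA.
Qed.

Let G_sub (N : set V) : cdsub N -> subgroup (G N).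
Proof.
move=> [[N0 NB] _ _]; split.
  by exists (fun=> 0) => //; rewrite big1 // => a _; rewrite cfr0 scaler0.
move=> x y [u hu ->] [v hv ->]; exists (fun a => u a - v a); first by move=> a; apply: NB.
by rewrite -sumrB; apply: eq_bigr => a _; rewrite cfrB scalerBr.
Qed.

Let G_sum (N : set V) (T : Type) (r : seq T) (P : pred T) (u : T -> V) :
  cdsub N -> (forall j, P j -> G N (u j)) -> G N (\sum_(j <- r | P j) u j).
Proof.
move=> hN hu; have [G0 GB] := G_sub hN; elim/big_rec: _ => // j x Pj Gx.
by rewrite -[x]opprK; apply: (GB _ _ (hu _ Pj)); rewrite -sub0r; apply: GB.
Qed.

(** By the Leibniz rule the operators meet monomials and p-th powers separately. On p-th powers they
    act through operators of order b/p before Frobenius, or as zero, and [G_mul] absorbs the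
    polynomial factors. *)
Let G_dsub (N : set V) : cdsub N -> cdsub (G N).
Proof.
move=> hN; have [_ _ ND] := hN; split; first exact: G_sub.
  move=> g v [y hy ->]; rewrite scaler_sumr; apply: G_sum => // a _.
  by rewrite scalerA -rmorphM; apply: G_mul.
move=> i b v [y hy ->].
have -> : dV i b (\sum_a iota 'X_[mnm a] *: cfr (y a)) =
    \sum_a dV i b (iota 'X_[mnm a] *: cfr (y a)).
  have A := @cmap_dfrac_additive _ _ _ _ iota_inj iota_frac t i b.
  pose f : {additive V -> V} := HB.pack (dV i b : V -> V) (GRing.isZmodMorphism.Build V V _ A).
  exact: (raddf_sum f).
apply: G_sum => // a _; rewrite cmap_dfracM; apply: G_sum => // c _.
rewrite cmap_dfrac_frob; case: ifP => _; first exact/G_mul/ND.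
by rewrite scaler0; case: (G_sub hN).
Qed.

Let G_descent (N : set V) v : G N (cfr v) -> N v.
Proof.
move=> [y hy e]; pose a0 : idx := [ffun=> Ordinal p_gt0].
have m0 : mnm a0 = 0%MM by apply/mnmP => i; rewrite !mnmE ffunE.
have := @cfr_indep t (fun a => y a - (if a == a0 then v else 0)) _ a0.
rewrite eqxx => h; suff /h /eqP : \sum_a iota 'X_[mnm a] *: cfr (y a - (if a == a0 then v else 0)) = 0.
  by rewrite subr_eq0 => /eqP <-.
under eq_bigr => a _ do rewrite cfrB scalerBr.
rewrite sumrB -e (bigD1 a0) //= eqxx m0 mpolyX0 rmorph1 scale1r big1 ?addr0 ?subrr // => a ne.
by rewrite (negbTE ne) cfr0 scaler0.
Qed.

(** Enlarge the denominator to the p-th power of the one for [s'], then decompose the numerator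
    along the monomial basis. *)
Let theta_decomp s s' (z : coch S^o t) : (s.+1 <= p * s'.+1)%N ->
  exists za : idx -> coch S^o t, theta iota F 1 s z =
    \sum_a iota 'X_[mnm a] *: cfr (theta iota F 1 s' (za a)).
Proof.
move=> le; have : (1 : S) != 0 by apply: oner_neq0.
elim: (t) (F) (1 : S) F0 z => [|t' IH] F' H hF z H0 /=.
  exists (fun a => froot a (z * H ^+ (p * s'.+1 - s.+1))).
  have e : iota z / iota H ^+ s.+1 =
      iota (z * H ^+ (p * s'.+1 - s.+1)) / iota H ^+ (p * s'.+1).
    rewrite rmorphM rmorphXn -{2}(subnK le) exprD -[X in _ = _ / X]mulrC -mulf_div.
    by rewrite divff ?mulr1 // expf_neq0 ?iota_eq0.
  rewrite e {1}[z * _]froot_decomp rmorph_sum mulr_suml; apply: eq_bigr => a _.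
  by rewrite rmorphM rmorphXn -mulrA; congr (_ * _); rewrite exprMn exprVn -exprM mulnC.
have hF' i : (i < t')%N -> F' i.+1 != 0 by move=> lt; apply: hF.
have [z1 e1] := IH (shift F') H hF' z.1 H0.
have [z2 e2] := IH (shift F') (H * F' 0%N) hF' z.2 (mulf_neq0 H0 (hF 0%N isT)).
by exists (fun a => (z1 a, z2 a)); rewrite sum_fst e1 e2.
Qed.

Let theta_frob s (z : coch S^o t) :
  exists s' z', cfr (theta iota F 1 s z) = theta iota F 1 s' z'.
Proof.
exists (s.+1 * p).-1, (cmap (M := S^o) (M' := S^o) (fun u => u ^+ p) z).
elim: (t) (F) (1 : S) z => [|t' IH] F' H z /=; last by rewrite !IH.
by rewrite exprMn rmorphXn exprVn -exprM prednK // muln_gt0.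
Qed.

(** Let [N] be the smallest submodule containing the cocycles with poles of order one. Those are
    combinations of p-th powers of such cocycles, so [N] lies in [G N], and finite length stops the
    chain of iterates. Hence G N = N on Čech elements. A cocycle with poles of order s + 2 <= p (s +
    1) is a combination of p-th powers of cocycles with poles of order s + 1, and induction on the
    order concludes. *)
Lemma cocycle_descent (N' : set V) : cdsub N' ->
  (forall z, kd (fun=> 1) (theta iota F 1 0 z) = 0 -> N' (theta iota F 1 0 z)) ->
  forall s z, kd (fun=> 1) (theta iota F 1 s z) = 0 -> N' (theta iota F 1 s z).
Proof.
move=> hN' hN'0; pose K1 : set V :=
  [set v | kd (fun=> 1) v = 0 /\ exists z, v = theta iota F 1 0 z].
pose N : set V := fun v => forall M, cdsub M -> K1 `<=` M -> M v.
have hN : cdsub N.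
  split.
  - split=> [M [[]] //|x y Nx Ny M hM h]; have [[_ MB] _ _] := hM.
    by apply: MB; [apply: Nx|apply: Ny].
  - by move=> g v Nv M hM h; have [_ MM _] := hM; apply: MM; apply: Nv.
  by move=> i b v Nv M hM h; have [_ _ MD] := hM; apply: MD; apply: Nv.
have N1 : K1 `<=` N by move=> v hv M hM; apply.
suff main : forall s z, kd (fun=> 1) (theta iota F 1 s z) = 0 -> N (theta iota F 1 s z).
  by move=> s z /main; apply=> // v [e [z' ev]]; rewrite ev; apply: hN'0; rewrite -ev.
have step s s' z : (s.+1 <= p * s'.+1)%N -> kd (fun=> 1) (theta iota F 1 s z) = 0 ->
    exists za : idx -> coch S^o t, (forall a, kd (fun=> 1) (theta iota F 1 s' (za a)) = 0) /\
      theta iota F 1 s z = \sum_a iota 'X_[mnm a] *: cfr (theta iota F 1 s' (za a)).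
  move=> le; have [za e] := theta_decomp z le; rewrite e => hk; exists za; split=> //.
  apply: cfr_indep; rewrite -[RHS]hk linear_sum; apply: eq_bigr => a _.
  by rewrite linearZ /= cfr_kd.
have GN : N `<=` G N.
  move=> v; apply; first exact: G_dsub.
  move=> w [hw [z ew]]; rewrite ew in hw *.
  have [za [ha ->]] := step 0%N 0%N z ltac:(lia) hw.
  exists (fun a => theta iota F 1 0 (za a)) => // a; apply: N1; split=> //.
  by exists (za a).
have GS (M M' : set V) : M `<=` M' -> G M `<=` G M'.
  by move=> h v [y hy ->]; exists y => // a; apply: h.
have hI i : cdsub (iter i G N) by elim: i => //= i IH; apply: G_dsub.
have sI i : iter i G N `<=` iter i.+1 G N by elim: i => //= i IH; apply: GS.
have [L0 hL0] := cech_chain iota_inj iota_frac t F.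
have [i hi] : exists i, forall s z,
    iter i.+1 G N (theta iota F 1 s z) -> iter i G N (theta iota F 1 s z).
  apply: contrapT => hno; have := hL0 (fun i => iter i G N) L0.+1.
  rewrite ltnn => h; apply: not_false_is_true; apply: h => // i _.
  apply: contrapT => hno'; apply: hno; exists i => s z h1; apply: contrapT => h2.
  by apply: hno'; exists s, z.
(* Frobenius moves an element into the next iterate and [G_descent] reflects membership, so
   stability at level i descends to level 0. *)
have {i hi} hG s z : G N (theta iota F 1 s z) -> N (theta iota F 1 s z).
  elim: i hi s z => [|i IH] hi; first exact: hi.
  apply: IH => s z h; have [s' [z' e]] := theta_frob s z.
  apply: G_descent; rewrite e; apply: (hi s' z').
  rewrite -e; exists (fun a => if a == [ffun=> Ordinal p_gt0] then theta iota F 1 s z else 0).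
    by move=> a; case: eqP => // _; have [[]] := hI i.+1.
  rewrite (bigD1 [ffun=> Ordinal p_gt0]) //= eqxx big1 ?addr0 => [|a /negbTE ->]; last first.
    by rewrite cfr0 scaler0.
  rewrite (_ : mnm _ = 0%MM) ?mpolyX0 ?rmorph1 ?scale1r //.
  by apply/mnmP => j; rewrite !mnmE ffunE.
elim=> [|s IH] z hz; first by apply: N1; split=> //; exists z.
have [za [ha e]] := step s.+1 s z ltac:(nia) hz.
by apply: hG; rewrite e; exists (fun a => theta iota F 1 s (za a)) => // a; apply: IH.
Qed.

End Descent.
End Frobenius.

(** * Finiteness over the integers *)

Lemma tofrac_frac (R : idomainType) (y : {fraction R}) :
  exists w h : R, h != 0 /\ y * FracField.tofrac h = FracField.tofrac w.
Proof.
exists (\n_(generic_quotient.repr y)), (\d_(generic_quotient.repr y)); split;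
  first exact: denom_ratioP.
rewrite -{1}[y]reprK; move: (generic_quotient.repr y) => x; rewrite /FracField.tofrac; unlock.
rewrite -[LHS]FracField.pi_mul; apply/eqmodP.
by rewrite /= FracField.equivfE /FracField.mulf !numden_Ratio ?oner_eq0 ?mulr1 ?denom_ratioP // mulrC.
Qed.

Lemma tofrac_inj (R : idomainType) : injective (@FracField.tofrac R).
Proof. by move=> x y /eqP; rewrite tofrac_eq => /eqP. Qed.

Lemma accm_coch (R : comPzRingType) (M : lmodType R) t : accm M -> accm (coch M t).
Proof.
move=> hM; elim: t => [|t IH] //= N hN sN.
pose N1 i := [set x | N i (x, 0)]; pose N2 i := [set y | exists x, N i (x, y)].
have [m1 h1] : exists m, forall i, (m <= i)%N -> N1 i `<=` N1 m.
  apply: IH => i; last by move=> x; apply: sN.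
  have [N0 ND NZ] := hN i; split=> // [x y hx hy|r x hx].
    by have := ND _ _ hx hy; rewrite pairD /= addr0.
  by have := NZ r _ hx; rewrite pairZ /= scaler0.
have [m2 h2] : exists m, forall i, (m <= i)%N -> N2 i `<=` N2 m.
  apply: IH => i; last by move=> y [x hx]; exists x; apply: sN.
  have [N0 ND NZ] := hN i; split; first by exists 0.
    by move=> y y' [x hx] [x' hx']; exists (x + x'); have := ND _ _ hx hx'; rewrite pairD.
  by move=> r y [x hx]; exists (r *: x); have := NZ r _ hx; rewrite pairZ.
exists (m1 + m2)%N => i le [x y] Nxy.
have [x' Nx'] : N2 m2 y by apply: (h2 i); [lia|exists x].
have Nm : N (m1 + m2)%N (x', y) by apply: (chain_le sN) Nx'; lia.
have [_ ND NZ] := hN i; have [_ ND' _] := hN (m1 + m2)%N.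
have : N1 i (x - x').
  have := ND _ _ Nxy (NZ (-1) _ (chain_le sN le Nm)).
  by rewrite scaleN1r pairN pairD /= subrr.
move=> /(h1 i ltac:(lia)) /(chain_le sN (n := (m1 + m2)%N)) => /(_ ltac:(lia)) h.
by have := ND' _ _ h Nm; rewrite pairD /= subrK add0r.
Qed.

Section Reduction.
Variables (n : nat) (k : fieldType).
Notation Sg := {mpoly int[n]}.
Notation S := {mpoly k[n]}.
Definition red : {rmorphism Sg -> S} :=
  locked (map_mpoly (intmul (1 : k)) : {rmorphism Sg -> S}).

Lemma redE : red = map_mpoly (intmul (1 : k)) :> (Sg -> S).
Proof. by rewrite /red -lock. Qed.

Lemma redC c : red c%:MP = (c%:~R)%:MP.
Proof. by rewrite redE map_mpolyC. Qed.

Lemma redX i : red 'X_i = 'X_i.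
Proof. by rewrite redE map_mpolyX. Qed.

Lemma mcoeff_red m u : (red u)@_m = (u@_m)%:~R.
Proof. by rewrite redE mcoeff_map_mpoly. Qed.

Notation cred := (cmap (M := Sg^o) (M' := S^o) red).

Lemma cred_kd t F s (z : coch Sg^o t) :
  cred (kd (pw F s) z) = kd (pw (fun i => red (F i)) s) (cred z).
Proof.
rewrite (cmap_kd (g := red : Sg^o -> S^o) (chi := red)) ?rmorphM //; last first.
- exact: rmorphM.
- exact: rmorphD.
by congr kd; apply/funext => i; rewrite rmorphXn.
Qed.

Lemma cred_ktr t F s (z : coch Sg^o t) :
  cred (ktr (pw F s) z) = ktr (pw (fun i => red (F i)) s) (cred z).
Proof.
rewrite (cmap_ktr (g := red : Sg^o -> S^o) (chi := red)) ?rmorphM //; last first.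
- exact: rmorphM.
by congr ktr; apply/funext => i; rewrite rmorphXn.
Qed.

Lemma credZ t a (z : coch Sg^o t) : cred (a *: z) = red a *: cred z.
Proof. by apply: (cmapZ (g := red : Sg^o -> S^o) (chi := red)); apply: rmorphM. Qed.

Lemma credB t (x y : coch Sg^o t) : cred (x - y) = cred x - cred y.
Proof. by apply: (cmapB (g := red : Sg^o -> S^o)); apply: rmorphD. Qed.

Section Theta.
Variables (t : nat) (F : nat -> Sg).
Notation K := {fraction S}.
Notation iota := (@FracField.tofrac S).
Notation Fr := (fun i => red (F i)).

Definition thr (s : nat) (z : coch Sg^o t) : coch K^o t := theta iota Fr 1 s (cred z).

Definition dvr (i : 'I_n) (b : nat) : coch K^o t -> coch K^o t :=
  cmap (M := K^o) (M' := K^o) (dfrac (@tofrac_inj _) (@tofrac_frac _) i b).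

Lemma thr_tr s m z : thr (s + m) (ktr (pw F m) z) = thr s z.
Proof. by rewrite /thr cred_ktr theta_tr. Qed.

Lemma thrZ s a z : thr s (a *: z) = iota (red a) *: thr s z.
Proof. by rewrite /thr credZ thetaZ. Qed.

Lemma thrB s x y : thr s (x - y) = thr s x - thr s y.
Proof. by rewrite /thr credB thetaB. Qed.

Lemma thr0 s : thr s 0 = 0.
Proof. by rewrite -(subrr 0) thrB subrr. Qed.

Lemma dvr0 i b : dvr i b 0 = 0.
Proof.
by rewrite /dvr -[in LHS](subrr 0) cmap_dfrac_additive subrr.
Qed.

Lemma thr_pole s i b z : dvr i b (thr s z) = thr (s + b) (cpole F 1 i s.+1 b z).
Proof.
rewrite /dvr /thr theta_pole; congr theta.
by rewrite redE cmap_cpole rmorph1.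
Qed.

Hypothesis F0 : forall i, (i < t)%N -> red (F i) != 0.

Lemma thr_kd s z : thr s (kd (pw F s.+1) z) = kd (fun=> 1) (thr s z).
Proof. by rewrite /thr cred_kd (theta_kd (@tofrac_inj S)); [|apply: F0]. Qed.

Lemma thr_eq0 s z : thr s z = 0 -> cred z = 0.
Proof. by apply: theta_eq0 => //; [apply: tofrac_inj|apply: oner_neq0]. Qed.

End Theta.
End Reduction.
Arguments thr {n} k {t}.
Arguments dvr {n k t}.
Notation cdsubr k := (dsub (@FracField.tofrac {mpoly k[_]}) dvr).

(** The counterpart of [kann] over [A] itself, pulled back to [S0]; the ring whose primes are
    counted need not be the one carrying the cochains. *)
Definition kann0 (A : comPzRingType) (S0 : comPzRingType) (chi : S0 -> A) t (F : nat -> A)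
    (s : nat) (z : coch A^o t) : set S0 :=
  [set r | exists m y, chi r *: ktr (pw F m) z = kd (pw F (s + m)) y].

(** * Primes that contain no positive integer *)

Section RationalPart.
Variables (n t : nat) (F : nat -> {mpoly int[n]}).
Hypothesis F0 : forall i, (i < t)%N -> F i != 0.
Notation Sg := {mpoly int[n]}.
Notation S := {mpoly rat[n]}.
Notation cred := (cmap (M := Sg^o) (M' := S^o) (red n rat)).

Let red_inj : injective (red n rat).
Proof.
move=> x y /(congr1 (fun u => u@_ _)) e; apply/mpolyP => m.
by have := e m; rewrite !mcoeff_red => /intr_inj.
Qed.

Let redF0 i : (i < t)%N -> red n rat (F i) != 0.
Proof. by move=> /F0; apply: contra => /eqP e; apply/eqP/red_inj; rewrite rmorph0. Qed.

Lemma thr_rat_inj s (z : coch Sg^o t) : thr rat F s z = 0 -> z = 0.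
Proof.
move=> /(thr_eq0 redF0) /cmap_eq0 h; elim: (t) z h => [|t' IH] z /=.
  by move=> h; apply: red_inj; rewrite rmorph0.
by case: z => x y [/IH /= -> /IH /= ->].
Qed.

(** Checked over Q, into which the integral cochains embed and where [cpole] is an actual
    derivative, commuting with the Čech differential. Thus divided derivatives of integral cocycles
    are integral cocycles. *)
Lemma cpole_cocycle s i b (z : coch Sg^o t) :
  kd (pw F s.+1) z = 0 -> kd (pw F (s + b).+1) (cpole F 1 i s.+1 b z) = 0.
Proof.
move=> hz; apply: (@thr_rat_inj (s + b)).
rewrite (thr_kd redF0) -thr_pole /dvr kd1_cmap_dfrac -(thr_kd redF0) hz.
by rewrite thr0; apply: dvr0.
Qed.

Let clear_denoms (y : coch S^o t) :
  exists d y', (0 < d)%N /\ cred y' = d%:R *: y.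
Proof.
have base (u : S) : exists d v, (0 < d)%N /\ red n rat v = d%:R * u.
  elim/mpoly_subring_ind: u => [c|i|u v [d [u' [d0 hu]]] [e [v' [e0 hv]]]|
      u v [d [u' [d0 hu]]] [e [v' [e0 hv]]]].
  - exists `|denq c|%N, (numq c)%:MP; rewrite absz_gt0 denq_neq0; split=> //.
    rewrite redC -mpolyC_nat -mpolyCM; congr (_%:MP).
    rewrite natr_absz ger0_norm ?denq_ge0 // mulrC.
    by rewrite -{2}[c]divq_num_den mulrVK // unitfE intr_eq0 denq_neq0.
  - by exists 1%N, 'X_i; rewrite redX mul1r.
  - exists (d * e)%N, (e%:R * u' + d%:R * v'); rewrite muln_gt0 d0 e0; split=> //.
    rewrite natrM rmorphD [red n rat (e%:R * _)]rmorphM [red n rat (d%:R * _)]rmorphM.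
    by rewrite !rmorph_nat hu hv mulrDr !mulrA [e%:R * d%:R]mulrC.
  exists (d * e)%N, (u' * v'); rewrite muln_gt0 d0 e0; split=> //.
  by rewrite natrM rmorphM hu hv mulrACA.
elim: (t) y => [|t' IH] y /=; first exact: base.
have [d [u [d0 hu]]] := IH y.1; have [e [v [e0 hv]]] := IH y.2.
exists (d * e)%N, (e%:R *: u, d%:R *: v); rewrite muln_gt0 d0 e0; split=> //=.
rewrite !credZ !rmorph_nat hu hv pairZ !scalerA natrM.
by congr pair; congr (_ *: _); rewrite mulrC.
Qed.

(** The annihilators are computed modulo the Čech boundaries over Q. A rational primitive becomes
    integral after multiplication by a positive integer, which can be cancelled in [P]. *)
Lemma rational_part (S0 : comPzRingType) (hS0 : acc S0) (chi : {rmorphism S0 -> Sg}) :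
  finite_set [set P | [/\ prime_ideal P, forall d, (0 < d)%N -> ~ P d%:R &
    exists s (z : coch Sg^o t), P = kann0 chi F s.+1 z]].
Proof.
pose N : set (coch {fraction S}^o t) :=
  [set v | exists s z, v = kd (fun=> 1) (theta (@FracField.tofrac S) (fun i => red n rat (F i)) 1 s z)].
have [CB CM CD] := @cech_dsub _ n _ _ (@tofrac_inj _) (@tofrac_frac _) t (fun i => red n rat (F i)).
have hN : cdsubr rat N.
  split.
  - split; first by exists 0%N, 0; rewrite theta0 linear0.
    move=> _ _ [s [z ->]] [s' [z' ->]].
    have [s'' [z'' e]] := CB.2 _ _ (ex_intro _ s (ex_intro _ z erefl)) (ex_intro _ s' (ex_intro _ z' erefl)).
    by exists s'', z''; rewrite -e linearB.
  - by move=> g _ [s [z ->]]; exists s, (g *: z); rewrite thetaZ linearZ.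
  move=> i b _ [s [z ->]]; rewrite /dvr -kd1_cmap_dfrac theta_pole.
  by eexists _, _.
apply: sub_finite_set (cech_ass (fun i => red n rat (F i)) hS0 (red n rat \o chi) hN).
move=> P [prP hP [s [z eP]]]; split=> //; exists s, (cred z); apply/seteqP; split=> r.
  rewrite {1}eP => -[m [y e]]; exists (s + m)%N, (cred y).
  have := congr1 (thr rat F (s + m)) e; rewrite thrZ thr_tr => ->.
  by rewrite addSn (thr_kd redF0).
move=> [s' [y e]]; have [d [y' [d0 hy']]] := clear_denoms y.
have [[_ _ PM] _ Pp] := prP; suff : P (d%:R * r) by move=> /Pp[/(hP d d0)|].
rewrite eP; exists s', (ktr (pw F s) y'); apply/eqP; rewrite -subr_eq0; apply/eqP.
apply: (@thr_rat_inj (s + s')%N); rewrite thrB thrZ thr_tr addSn (thr_kd redF0).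
rewrite addnC thr_tr /thr hy' thetaZ linearZ /= -e scalerA -rmorphM.
by rewrite !rmorphM !rmorph_nat subrr.
Qed.

End RationalPart.

(** * Primes that contain a given prime number *)

Section PrimePart.
Variables (n t : nat) (F : nat -> {mpoly int[n]}).
Hypothesis F0 : forall i, (i < t)%N -> F i != 0.
Variable p : nat.
Hypothesis p_pr : prime p.
Notation Sg := {mpoly int[n]}.
Notation k := 'F_p.
Notation S := {mpoly k[n]}.
Notation cred := (cmap (M := Sg^o) (M' := S^o) (red n k)).

Lemma red_surj (u : S) : exists v, red n k v = u.
Proof.
elim/mpoly_subring_ind: u => [c|i|_ _ [u <-] [v <-]|_ _ [u <-] [v <-]].
- exists (c : nat)%:R; rewrite rmorph_nat -[in RHS](natr_Zp c).
  by rewrite -mpolyC_nat.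
- by exists 'X_i; rewrite redX.
- by exists (u + v); rewrite rmorphD.
by exists (u * v); rewrite rmorphM.
Qed.

Lemma red_eq0 (u : Sg) : red n k u = 0 -> exists v, u = p%:R * v.
Proof.
move=> e; exists (\sum_(m <- msupp u) (u@_m %/ p)%Z *: 'X_[m]).
rewrite {1}[u]mpolyE mulr_sumr; apply: eq_bigr => m _.
rewrite -mpolyC_nat mul_mpolyC scalerA; congr (_ *: _).
have := congr1 (mcoeff m) e; rewrite mcoeff_red mcoeff0 => /eqP.
rewrite -(dvdz_pcharf (pchar_Fp p_pr)) => /divzK {1}<-.
by rewrite mulrC pmulrn intz.
Qed.

Lemma red_p : red n k p%:R = 0.
Proof. by rewrite rmorph_nat -mpolyC_nat pchar_Fp_0 // mpolyC0. Qed.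

Lemma cred_eq0 t' (x : coch Sg^o t') : cred x = 0 -> exists y, x = p%:R *: y.
Proof.
elim: t' x => [|t' IH] x /=; first exact: red_eq0.
case: x => x1 x2 [/IH /= [y1 ->] /IH /= [y2 ->]].
by exists (y1, y2); rewrite pairZ.
Qed.

Lemma coch_p_inj t' (x y : coch Sg^o t') : p%:R *: x = p%:R *: y -> x = y.
Proof.
elim: t' x y => [|t' IH] x y /=.
  apply: mulfI; rewrite -mpolyC_nat mpolyC_eq0 pnatr_eq0.
  by rewrite -lt0n prime_gt0.
by case: x y => x1 x2 [y1 y2]; rewrite !pairZ => -[/IH -> /IH ->].
Qed.

(* Where [F i] vanishes modulo [p], the coordinates of [theta] involving it are divided
   by zero, hence zero; this is harmless up to one transition map. *)
Lemma theta_p_eq0 t' (F' : nat -> Sg) G s (x : coch Sg^o t') :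
  theta (@FracField.tofrac S) (fun i => red n k (F' i)) (red n k G) s (cred x) = 0 ->
  exists y, G *: ktr (pw F' 1) x = p%:R *: y.
Proof.
elim: t' F' G x => [|t' IH] F' G x /=.
  move/eqP; rewrite mulf_eq0 invr_eq0 expf_eq0 /= !tofrac_eq0 => h.
  have [|v ev] := @red_eq0 (G * x); last by exists v.
  by apply/eqP; rewrite rmorphM mulf_eq0 orbC.
rewrite -rmorphM => -[/IH[y1 e1] /IH[y2 e2]]; exists (y1, y2).
by rewrite pairZ /= e1 scalerA expr1 e2 pairZ.
Qed.

Lemma thr_p_eq0 s (x : coch Sg^o t) : thr k F s x = 0 ->
  exists y, ktr (pw F 1) x = p%:R *: y.
Proof.
by rewrite /thr -(rmorph1 (red n k)) => /theta_p_eq0[y]; rewrite scale1r; exists y.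
Qed.

(** The cocycles modulo [p] that lift to Z. By [cpole_cocycle] they are stable under the divided
    operators. *)
Definition cocycles_p : set (coch {fraction S}^o t) :=
  [set v | exists s z, kd (pw F s.+1) z = 0 /\ v = thr k F s z].

Lemma cocycles_p_dsub : cdsubr k cocycles_p.
Proof.
split.
- split; first by exists 0%N, 0; rewrite linear0 thr0.
  move=> _ _ [s [z [hz ->]]] [s' [z' [hz' ->]]].
  exists (s + s')%N, (ktr (pw F s') z - ktr (pw F s) z').
  rewrite thrB thr_tr addnC thr_tr addnC linearB /= -addSn ktr_pw_kd hz.
  by rewrite addSn addnC -addSn ktr_pw_kd hz' !linear0 ?addr0.
- move=> g _ [s [z [hz ->]]]; have [g' <-] := red_surj g.
  by exists s, (g' *: z); rewrite linearZ /= hz scaler0 thrZ.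
move=> i b _ [s [z [hz ->]]]; exists (s + b)%N, (cpole F 1 i s.+1 b z).
by rewrite cpole_cocycle // thr_pole.
Qed.

Variables (S0 : comPzRingType) (chi : {rmorphism S0 -> Sg}).

(** The Bockstein map: if p z = d y0, then [y0] is a cocycle modulo [p]. If r z = d y, then r y0 - p
    y is an integral cocycle lifting r y0; conversely, if r y0 - w = p v with [w] a cocycle,
    cancelling [p] gives r z = d v. All of this is up to transition maps. *)
Lemma kann0_p s (z : coch Sg^o t) : kann0 chi F s.+1 z p%:R ->
  exists s1 y0, (exists x, kd (pw F s1.+1) y0 = p%:R *: x) /\
    forall r, kann0 chi F s.+1 z r <->
      cocycles_p (FracField.tofrac (red n k (chi r)) *: thr k F s1 y0).
Proof.
move=> [m0 [y0]]; rewrite rmorph_nat addSn => e0; exists (s + m0)%N, y0.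
split; first by exists (ktr (pw F m0) z).
move=> r; split=> [[m [y e]]|[s' [w [hw ew]]]].
  exists (s + m0 + m)%N, (chi r *: ktr (pw F m) y0 - p%:R *: ktr (pw F m0) y); split.
    have h1 : kd (pw F (s + m0 + m).+1) (ktr (pw F m) y0) =
        p%:R *: ktr (pw F (m0 + m)%N) z.
      by rewrite -addSn ktr_pw_kd -e0 linearZ /= ktr_pw_comp.
    have h2 : kd (pw F (s + m0 + m).+1) (ktr (pw F m0) y) =
        chi r *: ktr (pw F (m0 + m)%N) z.
      have -> : ((s + m0 + m).+1 = s.+1 + m + m0)%N by lia.
      by rewrite ktr_pw_kd -e linearZ /= ktr_pw_comp addnC.
    rewrite linearB /= [kd _ (chi r *: _)]linearZ [kd _ (p%:R *: _)]linearZ /= h1 h2.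
    by rewrite !scalerA mulrC subrr.

  by rewrite thrB !thrZ red_p rmorph0 scale0r subr0 thr_tr.
have [|v ev] := @thr_p_eq0 (s + m0 + s')%N (chi r *: ktr (pw F s') y0 - ktr (pw F (s + m0)%N) w).
  by rewrite thrB thrZ thr_tr ew addnC thr_tr subrr.
have hw' : kd (pw F (s + m0 + s').+1) (ktr (pw F (s + m0)%N) w) = 0.
  by rewrite addnC -addSn ktr_pw_kd hw linear0.
have hy : kd (pw F (s + m0 + s').+1) (ktr (pw F s') y0) = p%:R *: ktr (pw F (m0 + s')%N) z.
  by rewrite -addSn ktr_pw_kd -e0 linearZ /= ktr_pw_comp.
have hv : kd (pw F ((s + m0 + s').+1 + 1)%N) (p%:R *: v) =
    p%:R *: (chi r *: ktr (pw F (m0 + s' + 1)%N) z).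
  rewrite -ev ktr_pw_kd linearB /= hw' subr0 [kd _ _]linearZ /= hy.
  by rewrite !linearZ /= ktr_pw_comp !scalerA mulrC.
exists (m0 + s' + 1)%N, v; apply: coch_p_inj.
have -> : (s.+1 + (m0 + s' + 1) = (s + m0 + s').+1 + 1)%N by lia.
by rewrite -hv linearZ.
Qed.

Lemma prime_part (hS0 : acc S0) :
  finite_set [set P | [/\ prime_ideal P, P p%:R &
    exists s (z : coch Sg^o t), P = kann0 chi F s.+1 z]].
Proof.
apply: sub_finite_set (cech_ass (fun i => red n k (F i)) hS0 (red n k \o chi) cocycles_p_dsub).
move=> P [prP Pp [s [z eP]]]; split=> //; rewrite eP in Pp.
have [s1 [y0 [_ h]]] := kann0_p Pp; exists s1, (cred y0).
by rewrite eP; apply/seteqP; split=> r /h.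
Qed.

(** By [cocycle_descent] it is enough to lift the cocycles with poles of order one. If d z0 = p u,
    the hypothesis on torsion gives u = d y, and z0 - p y is the lift. That hypothesis concerns the
    exponent 1 only, whatever [s] is. *)
Lemma prime_part_good s (z : coch Sg^o t) :
  (forall i, (i < t)%N -> red n k (F i) != 0) ->
  (forall x : coch Sg^o t, (exists y, p%:R *: x = kd (pw F 1) y) ->
     exists y, x = kd (pw F 1) y) ->
  kann0 chi F s.+1 z p%:R -> kann0 chi F s.+1 z 1.
Proof.
move=> Fp tors /kann0_p[s1 [y0 [[x ex] h]]]; apply/h; rewrite !rmorph1 scale1r.
have frK (c : k) : c ^+ p = c by rewrite -[X in _ ^+ X](card_Fp p_pr) expf_card.
apply: (cocycle_descent (pchar_Fp p_pr) frK Fp cocycles_p_dsub); last first.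
  rewrite -(thr_kd Fp) ex thrZ red_p rmorph0 scale0r //.
move=> zb hz; have [z0 _ ez] : exists2 z0 : coch Sg^o t, call setT z0 & cred z0 = zb.
  apply: (cmap_surj (Q' := setT)) => [y _|]; first by have [v ev] := red_surj y; exists v.
  by elim: (t) zb {hz} => //= t' IH zb; split; apply: IH.
rewrite -ez -/(thr k F 0 z0) in hz *; rewrite -(thr_kd Fp) in hz.
have [u eu] := cred_eq0 (thr_eq0 Fp hz).
have [|y ey] := tors u; first by exists z0.
exists 0%N, (z0 - p%:R *: y); split; first by rewrite linearB linearZ /= eu ey subrr.
by rewrite thrB thrZ red_p rmorph0 scale0r subr0.
Qed.

End PrimePart.

Theorem koszul_primes_finite n t (F : nat -> {mpoly int[n]}) (S0 : comPzRingType)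
    (hS0 : acc S0) (chi : {rmorphism S0 -> {mpoly int[n]}}) :
  (forall i, (i < t)%N -> F i != 0) ->
  finite_set [set P | prime_ideal P /\
    exists s (z : coch {mpoly int[n]}^o t), P = kann0 chi F s.+1 z].
Proof.
move=> F0.
(* Factorials make the torsion of the cokernel an increasing chain. Once it is stationary at [N0],
   an element killed by a prime p > N0 is also killed by N0!, which is coprime to [p]. *)
pose T m := [set x : coch {mpoly int[n]}^o t | exists y, (m`!)%:R *: x = kd (pw F 1) y].
have [|||N0 hN0] := @accm_coch _ ({mpoly int[n]}^o) t _ T.
- by move=> I hI sI; apply: (@acc_mpoly _ n acc_int I hI sI).
- move=> m; split=> [|x x' [y e] [y' e']|r x [y e]].
  + by exists 0; rewrite scaler0 linear0.
  + by exists (y + y'); rewrite scalerDr linearD /= e e'.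
  by exists (r *: y); rewrite [kd _ (r *: _)]linearZ /= -e !scalerA mulrC.
- by move=> m x [y e]; exists (m.+1%:R *: y); rewrite linearZ /= -e scalerA -natrM factS.
have {}tors p : prime p -> (N0 < p)%N -> forall x : coch {mpoly int[n]}^o t,
    (exists y, p%:R *: x = kd (pw F 1) y) -> exists y, x = kd (pw F 1) y.
  move=> p_pr ltp x [y e].
  have [y' e'] : T N0 x.
    apply: (hN0 p (ltnW ltp)); exists ((p.-1)`!%:R *: y); rewrite linearZ /= -e scalerA -natrM.
    by case: (p) (prime_gt0 p_pr) => // p' _; rewrite factS mulnC.
  have cop : coprime p N0`!.
    rewrite prime_coprime //; elim: {hN0 e'} N0 ltp => [|m IH] ltp.
      by rewrite fact0 dvdn1 gtn_eqF // prime_gt1.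
    by rewrite factS Euclid_dvdM // gtnNdvd //= IH // ltnW.
  have [[a b] /= eab] := coprimeP N0`! (prime_gt0 p_pr) cop.
  exists (a%:R *: y - b%:R *: y').
  rewrite linearB /= [kd _ (a%:R *: y)]linearZ [kd _ (b%:R *: y')]linearZ /= -e -e' !scalerA.
  by rewrite -!natrM -scalerBl -natrB ?eab ?scale1r //; lia.
have bigc i : exists c, (i < t)%N -> forall p, prime p -> (c < p)%N -> red n 'F_p (F i) != 0.
  case: (ltnP i t) => [lt|_]; last by exists 0%N.
  have [m hm] : exists m, (F i)@_m != 0.
    apply: contrapT => hno; move: (F0 i lt) => /eqP; apply; apply/mpolyP => m.
    by rewrite mcoeff0; apply/eqP; apply: contrapT => /negP h; apply: hno; exists m.
  exists `|(F i)@_m|%N => _ p p_pr ltp; apply: contraNneq hm => e.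
  have := congr1 (mcoeff m) e; rewrite mcoeff_red mcoeff0 => /eqP.
  rewrite -(dvdz_pcharf (pchar_Fp p_pr)) dvdzE => /dvdn_leq h.
  by rewrite -absz_eq0 -leqn0 leqNgt; apply/negP => /h; rewrite leqNgt ltp.
have [c hc] := choice bigc.
pose M := (N0 + \sum_(i < t) c i)%N.
set A := (X in finite_set X).
pose Q (p : nat) := [set P | A P /\ (P (p%:R : S0))].
apply: (@sub_finite_set _ _ ([set P | [/\ prime_ideal P, forall d, (0 < d)%N -> ~ P d%:R &
    exists s (z : coch {mpoly int[n]}^o t), P = kann0 chi F s.+1 z]] `|`
    \bigcup_(p in [set p | (p <= M)%N /\ prime p]) Q p)).
  move=> P [prP hP].
  have [[d [d0 Pd]]|hno] := pselect (exists d, (0 < d)%N /\ P d%:R); last first.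
    by left; split=> // d d0 Pd; apply: hno; exists d.
  right; have [idP P1 Pm] := prP.
  have [p p_pr Pp] : exists2 p, prime p & P p%:R.
    elim/ltn_ind: d d0 Pd => d IH d0 Pd.
    case: (ltnP 1 d) => [d1|d1]; last first.
      by case: P1; have -> : (1 : S0) = d%:R by have -> : d = 1%N by lia.
    have [q q_pr /dvdnP[e ed]] := pdivP d1; rewrite ed natrM in Pd.
    case: (Pm _ _ Pd) => [Pe|Pq]; last by exists q.
    have e0 : (0 < e)%N by move: d0; rewrite ed muln_gt0 => /andP[].
    by apply: (IH e) => //; rewrite ed -{1}[e]muln1 ltn_pmul2l // prime_gt1.
  exists p; last by split.
  split=> //; rewrite leqNgt; apply/negP => ltM; apply: P1.
  have [s [z eP]] := hP; rewrite eP in Pp *.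
  apply: (prime_part_good F0 p_pr) Pp.
    move=> i lt; apply: hc => //; apply: leq_ltn_trans ltM.
    by rewrite /M (bigD1 (Ordinal lt)) //=; lia.
  by apply: tors => //; apply: leq_ltn_trans ltM; rewrite leq_addr.
rewrite finite_setU; split; first exact: rational_part.
apply: bigcup_finite.
  by apply: (@sub_finite_set _ _ `I_M.+1) => // p [h _].
move=> p [_ p_pr]; apply: sub_finite_set (prime_part F0 p_pr chi hS0).
by move=> P [[prP hP] Pp].
Qed.

(** * Chains of primes in polynomial rings *)

Fixpoint expo (B N : nat) : finType := if N is N'.+1 then ('I_B * expo B N')%type else unit.

Fixpoint emon (A : comPzRingType) (B N : nat) (z : nat -> A) : expo B N -> A :=
  if N is N'.+1 then fun al => z 0%N ^+ al.1 * emon (shift z) al.2 else fun=> 1.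
Arguments emon {A B N}.

Lemma card_expo B N : #|expo B N| = (B ^ N)%N.
Proof. by elim: N => [|N IH] /=; rewrite ?card_unit // card_prod card_ord IH expnS. Qed.

(* A chain of primes with [z i] in [p i.+1] but not in [p i] makes the [z i] algebraically
   independent: factor out the largest power of [z 0] and descend along the chain. *)
Lemma prime_chain_indep (k : fieldType) (A : comPzRingType) (iota : {rmorphism k -> A}) B N
    (p : nat -> set A) (z : nat -> A) (c : expo B N -> k) :
  (forall i, (i <= N)%N -> prime_ideal (p i)) ->
  (forall i, (i < N)%N -> p i `<=` p i.+1) ->
  (forall i, (i < N)%N -> p i.+1 (z i) /\ ~ p i (z i)) ->
  p 0%N (\sum_al iota (c al) * emon z al) -> forall al, c al = 0.
Proof.
elim: N p z c => [|N IH] p z c prP sP hz hp.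
  case; apply: contrapT => /eqP c0; have [[_ _ pM] p1 _] := prP 0%N (leqnn _).
  apply: p1; have := pM (iota (c tt)^-1) _ hp.
  by rewrite (bigD1 tt) //= big1 ?addr0 ?mulr1 -?rmorphM ?mulVf ?rmorph1 //; case.
case=> j0 al0; move: j0 al0; apply: contrapT => hno.
have [j1 hj1] : exists j1 : 'I_B, `[< exists al, c (j1, al) != 0 >].
  apply: contrapT => hno'; apply: hno => j0 al0; apply/eqP; apply: contrapT => /negP h.
  by apply: hno'; exists j0; apply/asboolP; exists al0.
pose j := [arg min_(j < j1 | `[< exists al, c (j, al) != 0 >]) (j : nat)].
have [/asboolP[al1 cal1] jmin] : `[< exists al, c (j, al) != 0 >] /\
    forall j', `[< exists al, c (j', al) != 0 >] -> (j <= j')%N.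
  by rewrite /j; case: arg_minnP.
have [[p0 pD pM] p1 pP] := prP 0%N isT.
pose X (j' : 'I_B) := \sum_al iota (c (j', al)) * emon (shift z) al.
have X0 (j' : 'I_B) : (j' < j)%N -> X j' = 0.
  move=> lt; apply: big1 => al _; have [->|ne] := eqVneq (c (j', al)) 0.
    by rewrite rmorph0 mul0r.
  by move: lt; rewrite ltnNge jmin //; apply/asboolP; exists al.
have [y hy] : exists y, \sum_al iota (c al) * emon z al = z 0%N ^+ j * (X j + z 0%N * y).
  have -> : \sum_al iota (c al) * emon z al = \sum_(j' < B) z 0%N ^+ j' * X j'.
    rewrite (eq_bigr (fun j' : 'I_B => \sum_al iota (c (j', al)) * emon z ((j', al) : expo B N.+1))).
      by rewrite pair_bigA; apply: eq_bigr => -[].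
    by move=> j' _; rewrite mulr_sumr; apply: eq_bigr => al _; rewrite /= mulrCA.
  rewrite (bigD1 j) //=; exists (\sum_(j' < B | j' != j) z 0%N ^+ (j' - j).-1 * X j').
  rewrite mulrDr; congr (_ + _); rewrite !mulr_sumr; apply: eq_bigr => j' ne.
  case: (ltnP j' j) => [lt|ge]; first by rewrite X0 // !mulr0.
  rewrite !mulrA -exprSr -exprD; congr (_ ^+ _ * _).
  have : (j' != j :> nat) by []. by lia.
have hz0 := hz 0%N isT.
have : p 1%N (X j).
  have [[_ qD qM] _ _] := prP 1%N isT.
  have -> : X j = (X j + z 0%N * y) + (- y) * z 0%N by rewrite mulNr mulrC addrK.
  apply: qD; last by apply: qM; case: hz0.
  apply: sP => //; move: hp; rewrite hy => /pP[|//] h; exfalso; apply: hz0.2.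
  elim: (nat_of_ord j) h => [|m IHm]; first by rewrite expr0 => /p1.
  by rewrite exprS => /pP[].
move=> /(IH (fun i => p i.+1) (shift z) (fun al => c (j, al))) h.
by move/eqP: cal1; apply; apply: (h _ _ _ al1) => i lt; [apply: prP|apply: sP|apply: hz].
Qed.

(** There are B^(n+1) products of powers below [B], in a space of dimension at most M^n, and [M]
    grows only linearly with [B]. *)
Lemma mpoly_dependent (k : fieldType) n (z : nat -> {mpoly k[n]}) :
  exists B (c : expo B n.+1 -> k), (exists al, c al != 0) /\
    \sum_al (c al)%:MP * emon z al = 0.
Proof.
pose E := (\sum_(i < n.+1) msize (z i)).+1.
(* Since [M] is at most (n + 2) E B, any B > ((n + 2) E)^n makes B^(n+1) exceed M^n. *)
pose B := ((n.+2 * E) ^ n).+1; pose M := (n.+1 * (B * E)).+1.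
have zE i : (i < n.+1)%N -> (msize (z i) <= E)%N.
  by move=> lt; rewrite /E (bigD1 (Ordinal lt)) //= leqW // leq_addr.
have small N (z' : nat -> {mpoly k[n]}) (al : expo B N) :
    (forall i, (i < N)%N -> (msize (z' i) <= E)%N) ->
    (msize (emon z' al) <= (N * (B * E)).+1)%N.
  elim: N z' al => [|N IH] z' al hz /=; first by rewrite msize1.
  apply: leq_trans (msizeM_leq _ _) _; rewrite mulSn -addnS; apply: leq_add; last first.
    by apply: IH => i lt; apply: hz.
  case: (posnP (al.1)) => [->|j0].
    by rewrite expr0 msize1 muln_gt0.
  apply: leq_trans (msizeX_leq _ j0) _; apply: leq_mul; last exact: hz.
  by apply/ltnW/ltn_ord.
pose mnm (m : {ffun 'I_n -> 'I_M}) : 'X_{1..n} := [multinom (m i : nat) | i < n].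
have [|c [[al cal] hc]] := @linear_dependence k (expo B n.+1) {ffun 'I_n -> 'I_M}
    (fun al m => (emon z al)@_(mnm m)).
  rewrite card_ffun !card_ord card_expo expnS.
  apply: (@leq_ltn_trans ((n.+2 * E) ^ n * B ^ n)); last first.
    by rewrite ltn_pmul2r ?expn_gt0.
  have expm a b e : (a <= b)%N -> (a ^ e <= b ^ e)%N.
    by move=> h; elim: e => // e IH; rewrite !expnS leq_mul.
  by rewrite -expnMn; apply: expm; rewrite /M; nia.
exists B, c; split; first by exists al.
apply/mpolyP => m; rewrite raddf_sum mcoeff0 /=.
under eq_bigr => al' _ do rewrite mcoeffCM.
have [[m' ->]|hno] := pselect (exists m', m = mnm m'); first exact: hc.
apply: big1 => al' _; rewrite memN_msupp_eq0 ?mulr0 //; apply/negP => hm; apply: hno.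
have lt i : (m i < M)%N.
  have sm := small n.+1 z al' zE; apply: leq_trans _ sm; apply: leq_ltn_trans (msize_mdeg_lt hm).
  by rewrite mdegE (bigD1 i) //= leq_addr.
by exists [ffun i => Ordinal (lt i)]; apply/mnmP => i; rewrite mnmE ffunE.
Qed.

Theorem mpoly_prime_chain (k : fieldType) n m (p : nat -> set {mpoly k[n]}) :
  prime_chain m p -> (m <= n)%N.
Proof.
move=> [prP sP]; rewrite leqNgt; apply/negP => lt.
have hz i : exists z, (i < m)%N -> p i.+1 z /\ ~ p i z.
  case: (ltnP i m) => [lti|_]; last by exists 0.
  have [_ /existsNP[z /not_implyP hz]] := sP i lti.
  by exists z.
have [z {}hz] := choice hz; have [B [c [[al cal] hc]]] := mpoly_dependent z.
have := @prime_chain_indep k _ (@mpolyC n k : {rmorphism k -> _}) B n.+1 p z c.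
move=> h; move/eqP: cal; apply; apply: h => //.
- by move=> i le; apply: prP; apply: leq_trans le lt.
- by move=> i le; have [] := sP i (leq_trans le lt).
- by move=> i le; apply: hz; apply: leq_trans le lt.
by rewrite hc; have [[]] := prP 0%N isT.
Qed.

(** * Flatness over the integers *)

(** Flatness is applied to multiplication by [d] on Z, with [R] itself serving as the tensor product
    of Z and [R]. *)
Lemma flat_int_torsion_free (R : comPzRingType) (phi : {rmorphism int -> R}) (d : nat) :
  flat phi -> (0 < d)%N -> forall r : R, d%:R * r = 0 -> r = 0.
Proof.
move=> hflat d0 r hr.
have phiE (c : int) : phi c = c%:~R by rewrite -[in LHS](intz c) rmorph_int.
pose f : {linear int^o -> int^o} := ( *:%R d%:Z : {linear int^o -> int^o}).
pose b (x : int^o) (s : R) : (zmodule R) := x%:~R * s.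
pose g : {linear (zmodule R) -> (zmodule R)} := ( *:%R d%:Z : {linear (zmodule R) -> (zmodule R)}).
have tensor : is_tensor phi b.
  split.
    split=> [c x y s|c x s s']; rewrite /b.
      by rewrite intrD (intrM _ c x) mulrDl -mulrA mulrzl.
    by rewrite mulrDr phiE mulrCA [c%:~R * _]mulrzl.
  move=> P c [c1 c2]; have cD s s' : c 1 (s + s') = c 1 s + c 1 s'.
    by have := c2 1 1 s s'; rewrite rmorph1 mul1r scale1r.
  have c0 : c 1 0 = 0 by apply: (addrI (c 1 0)); rewrite -cD !addr0.
  have cZ a s : c 1 (a *: (s : zmodule R)) = a *: c 1 s.
    by have := c2 a 1 s 0; rewrite c0 !addr0 phiE mulrzl.
  have lin : linear (c 1 : zmodule R -> P) by move=> a s s'; rewrite cD cZ.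
  pose h : {linear zmodule R -> P} :=
    HB.pack (c 1 : zmodule R -> P) (GRing.isLinear.Build _ _ _ _ _ lin).
  exists h => [x s|h' hh' s].
    rewrite /b mulrzl [LHS](cZ x s); have := c1 x 1 0 s.
    have -> : c 0 s = 0.
      have := c1 1 0 0 s; rewrite scaler0 addr0 scale1r => e.
      by apply: (addrI (c 0 s)); rewrite -e addr0.
    by rewrite !addr0 [x *: _]mulr1.
  by rewrite -[RHS]hh' /b mul1r.
have finj : injective f by move=> x y /= /mulfI; apply; rewrite -lt0n.
have := hflat _ _ f finj _ _ b b g tensor tensor.
move=> /(_ _ r 0); apply.
  by move=> x s; rewrite /b (intrM _ d%:Z x) -mulrA [d%:Z%:~R * _]mulrzl.
by rewrite [RHS]scaler0; move: hr; rewrite mulr_natl.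
Qed.

(** * Zariski's lemma *)

(** Generation as an algebra in the form of an induction principle, so that no polynomial in the
    generators has to be written. *)
Definition generated (k L : fieldType) (iota : k -> L) (n : nat) (x : nat -> L) : Prop :=
  forall Q : set L, (forall c, Q (iota c)) -> (forall i, (i < n)%N -> Q (x i)) ->
    (forall u v, Q u -> Q v -> Q (u + v)) -> (forall u v, Q u -> Q v -> Q (u * v)) ->
    forall y, Q y.

Section Transcendental.
Variables (k L : fieldType) (iota : {rmorphism k -> L}) (x0 : L).
Hypothesis tr : forall p, p != 0 -> ~~ root (map_poly iota p) x0.
Notation A := {poly k}.
Notation F := {fraction A}.
Let e : {rmorphism A -> L} := horner_morph (fun c : k => mulrC x0 (iota c)).

Let eC c : e c%:P = iota c. Proof. exact: horner_morphC. Qed.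
Let eX : e 'X = x0. Proof. exact: horner_morphX. Qed.
Let e_eq0 p : e p = 0 -> p = 0.
Proof. by move=> h; apply/eqP; apply: contrapT => /negP /tr /negP; apply; apply/eqP. Qed.

Let e_neq0 p : p != 0 -> e p != 0.
Proof. by apply: contraNneq => /e_eq0 ->. Qed.

Lemma transcendental_ext : exists h : {rmorphism F -> L}, forall p, h (FracField.tofrac p) = e p.
Proof.
apply: (rmorph_extension (f := @FracField.tofrac A)) => [y|p /eqP].
  have [w [h [h0 ew]]] := tofrac_frac y; exists w, h; split=> //.
    by exists (FracField.tofrac h)^-1; rewrite divff // tofrac_eq0.
  by exists (e h)^-1; rewrite divff // e_neq0.
by rewrite tofrac_eq0 => /eqP ->; rewrite rmorph0.
Qed.

Lemma transcendental_integral (h : {rmorphism F -> L}) (y : L) :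
  (forall p, h (FracField.tofrac p) = e p) -> integralOver h y ->
  exists d, d != 0 /\ integralOver e (e d * y).
Proof.
move=> he [q qm /eqP qy]; pose m := (size q).-1.
have qs : size q = m.+1 by rewrite prednK // lt0n size_poly_eq0 monic_neq0.
have {}fr i : exists wh : A * A, wh.2 != 0 /\ q`_i * FracField.tofrac wh.2 = FracField.tofrac wh.1.
  by have [w [h' hw]] := tofrac_frac q`_i; exists (w, h').
have [wh hwh] := choice fr; pose d := \prod_(i < m) (wh i).2.
have d0 : d != 0 by apply/prodf_neq0 => i _; case: (hwh i).
have [a ha] : exists a : nat -> A, forall i, (i < m)%N ->
    q`_i * FracField.tofrac d = FracField.tofrac (a i).
  suff : forall i, exists a, (i < m)%N -> q`_i * FracField.tofrac d = FracField.tofrac a.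
    by move=> /choice[a ha]; exists a.
  move=> i; case: (ltnP i m) => [lt|_]; last by exists 0.
  exists ((wh i).1 * \prod_(j < m | j != Ordinal lt) (wh j).2) => _.
  by rewrite /d (bigD1 (Ordinal lt)) //= !rmorphM mulrA; have [_ ->] := hwh i.
exists d; split=> //; pose p := \poly_(i < m.+1) (h q`_i * e d ^+ (m - i)).
have qm1 : q`_m = 1 by move: qm; rewrite monicE lead_coefE qs => /eqP.
apply: (@integral_root_monic _ _ _ _ p).
- by rewrite monicE lead_coef_poly //= qm1 rmorph1 mul1r subnn expr0 ?oner_neq0.
- apply/eqP; rewrite horner_poly.
  transitivity (e d ^+ m * (map_poly h q).[y]); last by rewrite qy mulr0.
  rewrite (horner_coef_wide y (leq_trans (size_poly _ _) (eq_leq qs))) mulr_sumr.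
  apply: eq_bigr => i _; rewrite coef_map /= exprMn.
  have le : (i <= m)%N by rewrite -ltnS.
  have -> : e d ^+ m = e d ^+ (m - i) * e d ^+ i by rewrite -exprD subnK.
  by rewrite [RHS]mulrACA; congr (_ * _); apply: mulrC.
apply/integral_poly => i; rewrite coef_poly; case: ltnP => [|_]; last exact: integral0.
rewrite ltnS leq_eqVlt => /predU1P[->|lt].
  by rewrite qm1 rmorph1 mul1r subnn expr0; apply: integral1.
have -> : h q`_i * e d ^+ (m - i) = e (a i * d ^+ (m - i).-1).
  have -> : (m - i = (m - i).-1.+1)%N by rewrite prednK // subn_gt0.
  by rewrite exprS mulrA -[e d]he -rmorphM ha // !he rmorphM rmorphXn.
exact: integral_id.
Qed.

(** With [E] a common denominator, every element of [L] becomes integral over k[X] after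
    multiplication by a power of [E]. For the inverse of a polynomial [u] this makes [u] divide a
    power of [E], as k[X] is integrally closed. *)
Lemma transcendental_not_generated n (x : nat -> L) :
  (forall i, (i < n)%N -> exists d, d != 0 /\ integralOver e (e d * x i)) ->
  generated iota n.+1 (fun i => if i is i'.+1 then x i' else x0) -> False.
Proof.
move=> hx gen.
have [d hd] : exists d : nat -> A, forall i, (i < n)%N -> d i != 0 /\ integralOver e (e (d i) * x i).
  suff : forall i, exists d, (i < n)%N -> d != 0 /\ integralOver e (e d * x i).
    by move=> /choice[d hd]; exists d.
  by move=> i; case: (ltnP i n) => [/hx[d hd]|_]; [exists d|exists 0].
pose E := \prod_(i < n) d i.
have E0 : E != 0 by apply/prodf_neq0 => i _; have [] := hd i (ltn_ord i).
have pw_int N y : integralOver e (e (E ^+ N) * y) -> forall M, (N <= M)%N -> integralOver e (e (E ^+ M) * y).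
  move=> hy M /subnK <-; rewrite exprD rmorphM -mulrA; apply: integral_mul => //.
  exact: integral_id.
have int y : exists N, integralOver e (e (E ^+ N) * y).
  apply: (gen [set y | exists N, integralOver e (e (E ^+ N) * y)]) => [c|[|i] lt|u v [N hu] [M hv]|u v [N hu] [M hv]].
  - by exists 0%N; rewrite expr0 rmorph1 mul1r -eC; apply: integral_id.
  - by exists 0%N; rewrite expr0 rmorph1 mul1r -eX; apply: integral_id.
  - exists 1%N; rewrite expr1 /E (bigD1 (Ordinal (lt : (i < n)%N))) //= [d _ * _]mulrC rmorphM -mulrA.
    by apply: integral_mul; [apply: integral_id|have [] := hd i lt].
  - exists (N + M)%N; rewrite mulrDr; apply: integral_add.
      by apply: pw_int hu _ _; apply: leq_addr.
    by apply: pw_int hv _ _; apply: leq_addl.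
  exists (N + M)%N; rewrite exprD rmorphM mulrACA.
  exact: integral_mul.
(* Not constant, and coprime to [E]. *)
pose u := 1 + 'X * E.
have su : (1 < size u)%N.
  rewrite /u addrC size_polyDl;
    last by rewrite size_poly1 mulrC size_mulX // ltnS lt0n size_poly_eq0.
  by rewrite mulrC size_mulX // ltnS lt0n size_poly_eq0.
have u0 : u != 0 by rewrite -size_poly_gt0 (ltn_trans _ su).
have [N [p pm /eqP pv]] := int (e u)^-1.
pose m := (size p).-1.
have ps : size p = m.+1 by rewrite prednK // lt0n size_poly_eq0 monic_neq0.
have pm1 : p`_m = 1 by move: pm; rewrite monicE lead_coefE ps => /eqP.
have eu : e u != 0 by apply: e_neq0.
have dvd : u %| E ^+ (N * m).
  apply/dvdpP; exists (- \sum_(i < m) p`_i * E ^+ (N * i) * u ^+ (m - i).-1).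
  apply/eqP; rewrite -subr_eq0; apply/eqP/e_eq0; rewrite mulNr opprK.
  transitivity (e u ^+ m * (map_poly e p).[e (E ^+ N) * (e u)^-1]); last by rewrite pv mulr0.
  rewrite rmorphD rmorphM rmorph_sum.
  rewrite (horner_coef_wide _ (leq_trans (size_poly _ _) (eq_leq ps))) big_ord_recr /=.
  rewrite coef_map /= pm1 rmorph1 mul1r mulrDr [RHS]addrC; congr (_ + _).
    by rewrite exprMn mulrCA exprVn mulfV ?expf_neq0 // mulr1 exprM rmorphXn.
  rewrite mulr_suml mulr_sumr; apply: eq_bigr => i _.
  rewrite coef_map /= !rmorphM !rmorphXn exprMn -exprM exprVn.
  have -> : e u ^+ m = e u ^+ (m - i).-1 * e u * e u ^+ i.
    rewrite -exprSr -exprD; congr (_ ^+ _).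
    by have : (i < m)%N by []; lia.
  have G (f1 f2 f3 f4 f5 : L) : f5 != 0 -> f1 * f2 * f3 * f4 = f3 * f4 * f5 * (f1 * (f2 * f5^-1)).
    by move=> f0; field.
  by apply: G; rewrite expf_neq0.
have : coprimep u (E ^+ (N * m)).
  apply: coprimep_expr; apply/Bezout_coprimepP; exists (1, - 'X) => /=.
  by rewrite mul1r mulNr /u addrK eqpxx.
move=> /Gauss_dvdpl -/(_ 1); rewrite mul1r dvd dvdp1 => /esym /eqP e1.
by rewrite e1 in su.
Qed.

End Transcendental.

(** Induction over all base fields. If the first generator is algebraic it is adjoined to the base.
    Otherwise [L] would by induction be finite over k(X), and its generators integral up to
    denominators, which [transcendental_not_generated] excludes. *)
Theorem zariski n : forall (k L : fieldType) (iota : {rmorphism k -> L}) (x : nat -> L),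
  generated iota n x -> exists (K : fieldExtType k) (j : {rmorphism K -> L}),
    (forall c, j c%:A = iota c) /\ forall y, exists z, j z = y.
Proof.
elim: n => [|n IH] k L iota x gen.
  exists (k^o : fieldExtType k), (iota : {rmorphism k^o -> L}); split.
    by move=> c; rewrite [c%:A]mulr1.
  apply: (gen [set y | exists z, iota z = y]) => //; first by move=> c; exists c.
    by move=> _ _ [u <-] [v <-]; exists (u + v); rewrite rmorphD.
  by move=> _ _ [u <-] [v <-]; exists (u * v); rewrite rmorphM.
have [[p [p0 px]]|htr] := pselect (exists p, p != 0 /\ root (map_poly iota p) (x 0%N)); last first.
  exfalso; have tr p : p != 0 -> ~~ root (map_poly iota p) (x 0%N).
    by move=> p0; apply/negP => px; apply: htr; exists p.
  have [h he] := transcendental_ext tr.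
  have genh : generated h n (shift x).
    move=> Q Qh Qx QD QM; apply: gen => // [c|[_|i lt]]; last exact: Qx.
      by have := Qh (FracField.tofrac c%:P); rewrite he /= horner_morphC.
    by have := Qh (FracField.tofrac 'X); rewrite he /= horner_morphX.
  have [K [j [jh js]]] := IH _ _ h _ genh.
  apply: (transcendental_not_generated tr (n := n) (x := shift x)); last first.
    by move=> Q Qc Qx; apply: gen => // -[|i] lt; [apply: (Qx 0%N)|apply: (Qx i.+1)].
  move=> i _; suff int : integralOver h (x i.+1).
    by have [d hd] := transcendental_integral he int; exists d.
  have [z <-] := js (x i.+1).
  have /polyOver1P[q eq] := minPolyOver 1%AS z.
  exists q.
    by rewrite -(map_monic (GRing.in_alg K)) -eq monic_minPoly.
  have := root_minPoly 1%AS z; rewrite eq => /(rmorph_root j).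
  rewrite -map_poly_comp; congr (root _ _); apply: eq_map_poly => c.
  exact: jh.
have [p' [p'0 p'x] pmin] : exists2 p, p != 0 /\ root (map_poly iota p) (x 0%N) &
    forall q, q != 0 -> root (map_poly iota q) (x 0%N) -> (size p <= size q)%N.
  have ex : exists m, `[< exists p, [/\ p != 0, root (map_poly iota p) (x 0%N) & size p = m] >].
    by exists (size p); apply/asboolP; exists p.
  have [m /asboolP[q [q0 qx qs]] mmin] := ex_minnP ex.
  by exists q => // q' q'0 q'x; rewrite qs; apply: mmin; apply/asboolP; exists q'.
have irr : irreducible_poly p'.
  split=> [|q q1 /dvdpP[r er]].
    by have := root_size_gt1 _ p'x; rewrite size_map_poly map_poly_eq0; apply.
  have r0 : r != 0 by apply: contraNneq p'0 => r0; rewrite er r0 mul0r.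
  have q0 : q != 0 by apply: contraNneq p'0 => q0; rewrite er q0 mulr0.
  have dq : q %| p' by rewrite er dvdp_mulIr.
  have := p'x; rewrite {1}er rmorphM rootM => /orP[rx|qx].
    have := pmin _ r0 rx; rewrite er size_mul // => le.
    have q0' : (0 < size q)%N by rewrite size_poly_gt0.
    have sq : (size q = 1)%N by move: le q0'; move: (size q) (size r) => a b; lia.
    by rewrite sq in q1.
  by rewrite -(dvdp_size_eqp dq) eqn_leq (pmin _ q0 qx) dvdp_leq.
pose K1 := SubFieldExtType p'x irr; pose j1 : {rmorphism K1 -> L} := @subfx_inj _ _ iota (x 0%N) p'.
have j1E q : j1 (subfx_eval iota (x 0%N) p' q) = (map_poly iota q).[x 0%N].
  exact: subfx_inj_eval.
have j1c c : j1 c%:A = iota c.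
  have -> : (c%:A : K1) = subfx_eval iota (x 0%N) p' (c *: 1).
    by rewrite linearZ /= rmorph1.
  by rewrite j1E alg_polyC map_polyC hornerC.
have gen1 : generated j1 n (shift x).
  move=> Q Qj Qx QD QM; apply: gen => // [c|[_|i lt]]; last exact: Qx.
    by rewrite -j1c.
  by have := Qj (subfx_eval iota (x 0%N) p' 'X); rewrite j1E map_polyX hornerX.
have [K2 [j2 [j2c j2s]]] := IH _ _ j1 _ gen1.
exists (baseFieldType K2 : fieldExtType k), (j2 : {rmorphism baseFieldType K2 -> L}).
split; last exact: j2s.
by move=> c; rewrite baseField_scaleE -j1c -j2c.
Qed.

(** * Regular parameters at a rational point *)

Fact psub_key : unit. Proof. exact: tt. Qed.

Definition psub (A T : comNzRingType) (n : nat) (f : {rmorphism A -> T}) (y : 'I_n -> T) :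
    {mpoly A[n]} -> T :=
  locked_with psub_key (mmap f y).

Section PSub.
Variables (A T : comNzRingType) (n : nat) (f : {rmorphism A -> T}) (y : 'I_n -> T).

Let psubE : psub f y = mmap f y.
Proof. exact: unlock_with. Qed.

Lemma psub_is_additive : zmod_morphism (psub f y).
Proof. by move=> u v; rewrite psubE raddfB. Qed.
HB.instance Definition _ := GRing.isZmodMorphism.Build _ _ (psub f y) psub_is_additive.

Lemma psub_is_multiplicative : monoid_morphism (psub f y).
Proof. by rewrite psubE; split; [apply: rmorph1|apply: rmorphM]. Qed.
HB.instance Definition _ := GRing.isMonoidMorphism.Build _ _ (psub f y) psub_is_multiplicative.

Lemma psubX i : psub f y 'X_i = y i.
Proof. by rewrite psubE mmapX mmap1U. Qed.

Lemma psubC c : psub f y c%:MP = f c.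
Proof. by rewrite psubE mmapC. Qed.

End PSub.

(** [J] extended to the localization at [M] and contracted back; local rings are handled through
    these ideals of the polynomial ring. *)
Definition satw (R : comPzRingType) (M J : set R) : set R :=
  [set u | exists2 w, M w & J (w * u)].

Lemma satw_ideal (R : comPzRingType) (M J : set R) :
  mulset M -> is_ideal J -> is_ideal (satw M J).
Proof.
move=> [M1 MM] hJ; split; first by exists 1; rewrite ?mulr0; case: hJ.
  move=> x y [v Mv hx] [w Mw hy]; exists (v * w); first exact: MM.
  rewrite mulrDr; have [_ JD JM] := hJ; apply: JD.
    by rewrite mulrAC mulrC; apply: JM.
  by rewrite -mulrA; apply: JM.
move=> r x [w Mw hx]; exists w => //.
by rewrite mulrCA; case: hJ => _ _; apply.
Qed.

(** * Taylor expansion along the lines through a point *)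

Section Line.
Variables (K : fieldType) (n : nat).
Notation S := {mpoly K[n]}.

Definition line (a : 'I_n -> K) : S -> {poly S} :=
  psub ((@polyC S) \o (@mpolyC n K)) (fun i => ((a i)%:MP)%:P + ('X_i)%:P * 'X).
HB.instance Definition _ a := GRing.RMorphism.on (line a).

Lemma lineC a c : line a c%:MP = (c%:MP)%:P.
Proof. exact: psubC. Qed.

Lemma lineX a i : line a 'X_i = ((a i)%:MP)%:P + ('X_i)%:P * 'X.
Proof. exact: psubX. Qed.

(** The homogeneous part of degree [d] of [u], expanded at the point [a]. *)
Definition lc (a : 'I_n -> K) (d : nat) (u : S) : S := (line a u)`_d.

Lemma lc_is_additive a d : zmod_morphism (lc a d).
Proof. by move=> u v; rewrite /lc rmorphB coefB. Qed.
HB.instance Definition _ a d := GRing.isZmodMorphism.Build S S (lc a d) (lc_is_additive a d).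

Lemma lcM a d u v : lc a d (u * v) = \sum_(i < d.+1) lc a i u * lc a (d - i) v.
Proof. by rewrite /lc rmorphM coefM. Qed.

Lemma lcC a d c : lc a d c%:MP = if d == 0%N then c%:MP else 0.
Proof. by rewrite /lc lineC coefC. Qed.

Lemma lcX a d i : lc a d 'X_i =
  if d == 0%N then (a i)%:MP else if d == 1%N then 'X_i else 0.
Proof.
rewrite /lc lineX coefD coefC coefCM coefX.
by case: d => [|[|d]] /=; rewrite ?mulr0 ?mulr1 ?addr0 ?add0r.
Qed.

Lemma lc0 a u : lc a 0 u = (u.@[a])%:MP.
Proof.
elim/mpoly_subring_ind: u => [c|i|u v hu hv|u v hu hv].
- by rewrite lcC mevalC.
- by rewrite lcX mevalXU.
- by rewrite raddfD /= hu hv mevalD mpolyCD.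
by rewrite lcM big_ord1 subnn hu hv mevalM mpolyCM.
Qed.

Lemma lc1 a u : lc a 1 u = \sum_j (u^`M(j)).@[a] *: 'X_j.
Proof.
elim/mpoly_subring_ind: u => [c|i|u v hu hv|u v hu hv].
- by rewrite lcC big1 // => j _; rewrite mderivC meval0 scale0r.
- rewrite lcX (bigD1 i) //= mderivX mnm1E eqxx big1 ?addr0.
    have -> : (U_(i) - U_(i) = 0 :> 'X_{1..n})%MM.
      by apply/mnmP => l; rewrite mnmBE subnn mnm0E.
    by rewrite mpolyX0 scale1r meval1 scale1r.
  by move=> j ne; rewrite mderivX mnm1E eq_sym (negbTE ne) scale0r meval0 scale0r.
- by rewrite raddfD /= hu hv -big_split; apply: eq_bigr => j _; rewrite mderivD mevalD scalerDl.
rewrite lcM big_ord_recr big_ord1 /= subnn subn0 hu hv !lc0 !mul_mpolyC mulrC mul_mpolyC.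
rewrite addrC !scaler_sumr -big_split; apply: eq_bigr => j _ /=.
rewrite mderivM mevalD !mevalM scalerDl !scalerA; congr (_ *: _ + _ *: _); exact: mulrC.
Qed.

Lemma line0_lc a d u : line (fun=> 0) (lc a d u) = (lc a d u)%:P * 'X^d.
Proof.
elim/mpoly_subring_ind: u d => [c|i|u v hu hv|u v hu hv] d.
- rewrite lcC; case: eqP => [->|_]; last by rewrite rmorph0 mul0r.
  by rewrite expr0 mulr1 lineC.
- rewrite lcX; case: eqP => [->|_]; first by rewrite expr0 mulr1 lineC.
  case: eqP => [->|_]; last by rewrite rmorph0 mul0r.
  by rewrite lineX mpolyC0 add0r expr1.
- have -> : lc a d (u + v) = lc a d u + lc a d v by rewrite raddfD.
  by rewrite rmorphD /= hu hv polyCD mulrDl.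
rewrite lcM (raddf_sum (line (fun=> 0))) (raddf_sum (@polyC S)) mulr_suml /=.
apply: eq_bigr => i _; rewrite rmorphM /= hu hv polyCM mulrACA -exprD subnKC //.
by rewrite -ltnS.
Qed.

Lemma line0_mon m : line (fun=> 0) 'X_[m] = ('X_[m])%:P * 'X^(mdeg m).
Proof.
rewrite mpolyXE_id !rmorph_prod mdegE; elim/big_rec3: _ => [|i x y d _ ->].
  by rewrite mulr1.
rewrite !rmorphXn /= lineX mpolyC0 add0r exprMn.
by rewrite exprD -!mulrA; congr (_ * _); rewrite mulrCA.
Qed.

Lemma lc0_mpolyE d u : lc (fun=> 0) d u =
  \sum_(m <- msupp u) (if mdeg m == d then u@_m *: 'X_[m] else 0).
Proof.
rewrite {1}[u]mpolyE raddf_sum /=; apply: eq_bigr => m _.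
rewrite /lc -mul_mpolyC rmorphM /= lineC line0_mon mulrA -polyCM coefCM coefXn.
by rewrite eq_sym; case: eqP => _; rewrite ?mulr1 ?mulr0.
Qed.

Lemma mcoeff_lc0 d u m : (lc (fun=> 0) d u)@_m = if mdeg m == d then u@_m else 0.
Proof.
rewrite lc0_mpolyE raddf_sum /=.
have [hm|hm] := boolP (m \in msupp u); last first.
  rewrite memN_msupp_eq0 // if_same big_seq big1 // => m' hm'.
  case: eqP => _; last by rewrite mcoeff0.
  rewrite mcoeffZ mcoeffX; case: eqP => [e|]; last by rewrite mulr0.
  by rewrite -e hm' in hm.
rewrite (bigD1_seq m) ?msupp_uniq //= big1 => [|m' ne].
  by case: eqP => _; rewrite ?mcoeffZ ?mcoeffX ?eqxx ?mulr1 ?mcoeff0 addr0.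
by case: eqP => _; rewrite ?mcoeff0 // mcoeffZ mcoeffX (negbTE ne) mulr0.
Qed.

Definition Ord (a : 'I_n -> K) (M : nat) : set S :=
  [set u | forall d, (d < M)%N -> lc a d u = 0].

Lemma OrdM a M M' u v : Ord a M u -> Ord a M' v -> Ord a (M + M') (u * v).
Proof.
move=> hu hv d lt; rewrite lcM big1 // => i _.
case: (ltnP i M) => [/hu ->|ge]; first by rewrite mul0r.
by rewrite hv ?mulr0 //; have := ltn_ord i; lia.
Qed.

Lemma Ord_ideal a M : is_ideal (Ord a M).
Proof.
split=> [d _|u v hu hv d lt|r u hu]; first by rewrite raddf0.
  by rewrite raddfD /= hu // hv // addr0.
by rewrite -[M]add0n; apply: OrdM.
Qed.

(** Lowest forms multiply without cancellation, polynomials being a domain. Primality of the ideals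
    of parameters rests on this. *)
Lemma Ord_prod a M M' u v : ~ Ord a M u -> ~ Ord a M' v -> ~ Ord a (M + M') (u * v).
Proof.
have low N w : ~ Ord a N w -> exists d, [/\ (d < N)%N, lc a d w != 0 & Ord a d w].
  move=> h; have ex : exists d, lc a d w != 0.
    by move: h => /existsNP[d /not_implyP[_ /eqP h]]; exists d.
  have [d hd dmin] := ex_minnP ex; exists d; split=> //.
    rewrite ltnNge; apply/negP => le; apply: h => d' lt; apply/eqP.
    by apply: contraTT (leq_trans lt le) => /dmin; rewrite leqNgt.
  by move=> d' lt; apply/eqP; apply: contraTT lt => /dmin; rewrite leqNgt.
move=> /low[d [dM ud du]] /low[d' [dM' vd dv]] /(_ (d + d')%N).
rewrite (_ : (d + d' < M + M')%N); last by lia.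
move=> /(_ isT); have lt : (d < (d + d').+1)%N by lia.
rewrite lcM (bigD1 (Ordinal lt)) //= addKn big1 ?addr0 => [/eqP|i ne].
  by rewrite mulf_eq0 (negbTE ud) (negbTE vd).
case: (ltnP i d) => [/du ->|ge]; first by rewrite mul0r.
rewrite dv ?mulr0 //; have : (i != d :> nat) by [].
by have := ltn_ord i; lia.
Qed.

Lemma Ord_le a M M' u : (M <= M')%N -> Ord a M' u -> Ord a M u.
Proof. by move=> le hu d lt; apply: hu; apply: leq_trans le. Qed.

(* Taylor expansion at [a]. *)
Lemma line_expand a u : u = \sum_(d < size (line a u))
  psub (@mpolyC n K) (fun j => 'X_j - (a j)%:MP) (lc a d u).
Proof.
pose sg : {rmorphism S -> S} := psub (@mpolyC n K) (fun j => 'X_j - (a j)%:MP).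
have h1 : u = (map_poly sg (line a u)).[1].
  pose ev1 := (horner_eval (1 : S) \o map_poly sg \o line a).
  suff : id =1 ev1 by move/(_ u).
  apply: (mpoly_rmorph_eq (f := idfun) (g := ev1)) => [c|i]; rewrite /ev1 /=.
    by rewrite lineC map_polyC horner_evalE hornerC /sg /= psubC.
  rewrite lineX rmorphD rmorphM /= map_polyX !map_polyC horner_evalE !hornerE.
  rewrite /sg /= psubX psubC.

 by rewrite addrC subrK.
rewrite {1}h1 (@horner_coef_wide _ (size (line a u))) ?size_poly //.
by apply: eq_bigr => d _; rewrite expr1n mulr1 coef_map.
Qed.

End Line.

(** * Local parameters behave like variables modulo every power of the maximal ideal *)

Section LocalParameters.
Variables (K : fieldType) (n N : nat) (a : 'I_n -> K).
Notation S := {mpoly K[n]}.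
Notation SY := {mpoly K[N]}.
Variables (z : nat -> S) (l1 : 'I_N -> S) (tau : 'I_n -> SY).
Hypothesis z0 : forall l : 'I_N, lc a 0 (z l) = 0.
Hypothesis z1 : forall l : 'I_N, lc a 1 (z l) = l1 l.
Notation lam := (psub (@mpolyC n K) l1).
Notation mu := (psub (@mpolyC N K) tau).
Hypothesis lamK : forall l, mu (l1 l) = 'X_l.
Hypothesis muK : forall j, lam (tau j) = 'X_j.
Hypothesis tau1 : forall j, line (fun=> 0) (tau j) = (tau j)%:P * 'X.
Notation Phi := (psub (@mpolyC n K) (fun l : 'I_N => z l)).
Notation zr := (fun=> 0).

Let mu_lam F : mu (lam F) = F.
Proof.
suff : (mu \o lam) =1 id by move/(_ F).
apply: (mpoly_rmorph_eq (f := mu \o lam) (g := idfun)) => [c|i] /=; first by rewrite !psubC.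
by rewrite psubX lamK.
Qed.

Let lam_mu u : lam (mu u) = u.
Proof.
suff : (lam \o mu) =1 id by move/(_ u).
apply: (mpoly_rmorph_eq (f := lam \o mu) (g := idfun)) => [c|i] /=; first by rewrite !psubC.
by rewrite psubX muK.
Qed.

Let pr (u L : S) (e : nat) := Ord a e u /\ lc a e u = L.

Let prM u L e u' L' e' : pr u L e -> pr u' L' e' -> pr (u * u') (L * L') (e + e').
Proof.
move=> [hu eu] [hu' eu']; split; first exact: OrdM.
have lt : (e < (e + e').+1)%N by lia.
rewrite lcM (bigD1 (Ordinal lt)) //= addKn eu eu' big1 ?addr0 // => i ne.
case: (ltnP i e) => [/hu ->|ge]; first by rewrite mul0r.
rewrite hu' ?mulr0 //; have : (i != e :> nat) by [].
by have := ltn_ord i; lia.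
Qed.

Let pr1 : pr 1 1 0.
Proof. by split=> //; rewrite -mpolyC1 lcC. Qed.

Let pr_mon m : pr (Phi 'X_[m]) (lam 'X_[m]) (mdeg m).
Proof.
have eP (y : 'I_N -> S) : psub (@mpolyC n K) y 'X_[m] = \prod_i y i ^+ m i.
  rewrite mpolyXE_id (rmorph_prod (psub (@mpolyC n K) y)); apply: eq_bigr => i _.
  by rewrite rmorphXn /= psubX.
rewrite !eP mdegE; elim/big_rec3: _ => [|i d x y _ h]; first exact: pr1.
apply: prM h; elim: (m i) => [|e IH]; first by rewrite !expr0; apply: pr1.
rewrite !exprS -add1n; apply: prM IH.
by split=> [[|d'] // _|]; rewrite ?z0 ?z1.
Qed.

(** On lowest forms the substitution [Phi] is the linear substitution [lam], which has the inverse
    [mu]. Hence [Phi] preserves the order of vanishing exactly. *)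
Let lead r (F : SY) : Ord zr r F -> pr (Phi F) (lam (lc zr r F)) r.
Proof.
move=> hF; have F0 m : (mdeg m < r)%N -> F@_m = 0.
  by move=> /hF h; have := mcoeff_lc0 (mdeg m) F m; rewrite h mcoeff0 eqxx.
have eP d : lc a d (Phi F) = \sum_(m <- msupp F) F@_m *: lc a d (Phi 'X_[m]).
  rewrite {1}[F]mpolyE !raddf_sum /=.
  apply: eq_bigr => m _.
  by rewrite -[F@_m *: 'X_[m]]mul_mpolyC (rmorphM Phi) /= psubC /lc rmorphM /= lineC coefCM mul_mpolyC.
split=> [d lt|].
  rewrite eP big1 // => m _; case: (ltnP (mdeg m) r) => [/F0 ->|ge]; first by rewrite scale0r.
  by rewrite (pr_mon m).1 ?scaler0 //; apply: leq_trans ge.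
rewrite eP (lc0_mpolyE r F) (rmorph_sum lam); apply: eq_bigr => m _ /=.
case: eqP => [<-|ne]; first by rewrite (pr_mon m).2 -!mul_mpolyC (rmorphM lam) /= psubC.
rewrite (rmorph0 lam); case: (ltnP (mdeg m) r) => [/F0 ->|ge]; first by rewrite scale0r.
by rewrite (pr_mon m).1 ?scaler0 // ltn_neqAle ge andbT; apply/eqP => /esym.
Qed.

Let Phi_Ord M (F : SY) : Ord a M (Phi F) <-> Ord zr M F.
Proof.
split=> h; last by have [+ _] := lead h.
elim/ltn_ind => d IH lt; have [_ e] := lead (fun d' lt' => IH d' lt' (ltn_trans lt' lt)).
by rewrite -[LHS]mu_lam -e h // rmorph0.
Qed.

Let line_mu u : line zr (mu u) = map_poly mu (line zr u).
Proof.
suff : (line zr \o mu) =1 (map_poly mu \o line zr) by move/(_ u).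
apply: (mpoly_rmorph_eq (f := line zr \o mu) (g := map_poly mu \o line zr)) => [c|i] /=.
  by rewrite psubC !lineC map_polyC /= psubC.
by rewrite psubX tau1 lineX mpolyC0 add0r rmorphM /= map_polyX map_polyC /= psubX.
Qed.

(** Successive approximation: the lowest form of the error is pulled back by [mu] and added to
    [F]. *)
Let approx u M : exists F : SY, Ord a M (u - Phi F).
Proof.
elim: M => [|M [F hF]]; first by exists 0.
set v := u - Phi F in hF; pose H := lc a M v; exists (F + mu H).
have lH d : lc zr d (mu H) = if d == M then mu H else 0.
  rewrite /lc line_mu /H line0_lc rmorphM /= map_polyC map_polyXn coefCM coefXn.
  by case: eqP; rewrite ?mulr1 ?mulr0.
have [h1 h2] : pr (Phi (mu H)) (lam (lc zr M (mu H))) M.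
  by apply: lead => d lt; rewrite lH ltn_eqF.
rewrite (rmorphD Phi) opprD addrA -/v => d; rewrite ltnS leq_eqVlt => /predU1P[->|lt].
  by rewrite (raddfB (lc a M)) /= h2 lH eqxx lam_mu subrr.
by rewrite (raddfB (lc a d)) /= hF // h1 // subrr.
Qed.

Let rho (i : nat) : SY -> SY :=
  psub (@mpolyC N K) (fun l : 'I_N => if (l < i)%N then 0 else 'X_l).
HB.instance Definition _ i := GRing.RMorphism.on (rho i).

Let rho_Ord i M (F : SY) : Ord zr M F -> Ord zr M (rho i F).
Proof.
have e : line zr (rho i F) = map_poly (rho i) (line zr F).
  suff : (line zr \o rho i) =1 (map_poly (rho i) \o line zr) by move/(_ F).
  apply: (mpoly_rmorph_eq (f := line zr \o rho i) (g := map_poly (rho i) \o line zr)) => [c|l] /=.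
    by rewrite /rho psubC !lineC map_polyC /= psubC.
  rewrite /rho psubX lineX mpolyC0 add0r rmorphM /= map_polyX map_polyC /= psubX.
  case: ifP => _; first by rewrite rmorph0 mul0r.
  by rewrite lineX mpolyC0 add0r.
by move=> h d lt; have := h d lt; rewrite /lc e coef_map /= => ->; rewrite rmorph0.
Qed.

Let rho_span i (F : SY) : (i <= N)%N -> nspan z i (Phi F - Phi (rho i F)).
Proof.
move=> le; have hJ := nspan_ideal z i; have [J0 JD JM] := hJ.
elim/mpoly_subring_ind: F => [c|l|F G hF hG|F G hF hG].
- by rewrite /rho !psubC subrr.
- have -> : rho i 'X_l = if (l < i)%N then 0 else 'X_l by rewrite /rho psubX.
  case: ifP => [lt|_]; last by rewrite subrr.
  by rewrite (rmorph0 Phi) subr0 psubX; apply: nspan_mem.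
- by rewrite !(rmorphD (rho i), rmorphD Phi) opprD addrACA; apply: JD.
rewrite (rmorphM (rho i)) !(rmorphM Phi) /=.
have Gm (R0 : comNzRingType) (p q p' q' : R0) : p * q - p' * q' = p * (q - q') + q' * (p - p') by ring.
by rewrite Gm; apply: JD; apply: JM.
Qed.

Let A i M : set S := [set u | exists2 j, nspan z i j & Ord a M (u - j)].

(** Modulo the M-th power of the maximal ideal, [Phi] identifies the ideal of the first [i]
    parameters with that of the first [i] variables, and [rho i] is the reduction by the latter. *)
Let A_char i M u (F : SY) : (i <= N)%N -> Ord a M (u - Phi F) ->
  A i M u <-> Ord zr M (rho i F).
Proof.
move=> le huF; have hO := Ord_ideal a M; split=> [[_ [c ->] hu]|hF].
  have [C hC] := choice (fun l => approx (c l) M).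
  pose F' := \sum_(l < i) C l * 'X_(widen_ord le l).
  have r0 : rho i F' = 0.
    rewrite /F' (rmorph_sum (rho i)) big1 // => l _; rewrite (rmorphM (rho i)) /= {2}/rho psubX /=.
    by rewrite ltn_ord mulr0.
  have : Ord a M (Phi (F - F')).
    have G (V : zmodType) (x y p q : V) : y - q = (x - p) - (x - y) + (p - q).
      by rewrite opprB [x - p + _]addrC [y - x + _]addrA subrK addrA subrK.
    have -> : Phi (F - F') = (u - \sum_(l < i) c l * z l) - (u - Phi F) +
        \sum_(l < i) (c l - Phi (C l)) * z l.
      rewrite (rmorphB Phi) /F' (rmorph_sum Phi) (G _ u _ (\sum_(l < i) c l * z l)).
      congr (_ + _); rewrite -sumrB; apply: eq_bigr => l _.
      by rewrite (rmorphM Phi) /= psubX mulrBl.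
    have [_ OD _] := hO; apply: OD; first exact: (idealB hO).
    by apply: ideal_sum => // l _; apply: (idealMr _ hO).
  by move=> /Phi_Ord /(@rho_Ord i M); rewrite (rmorphB (rho i)) /= r0 subr0.
exists (Phi F - Phi (rho i F)); first exact: rho_span.
rewrite opprB addrCA; have [_ OD _] := hO; apply: OD huF.
by apply: (Phi_Ord M _).2.
Qed.

Notation unit_at := [set w : S | w.@[a] != 0].

Let unit_mul : mulset unit_at.
Proof.
split=> [|u v hu hv] /=; first by rewrite meval1 oner_neq0.
by rewrite mevalM mulf_neq0.
Qed.

(** A polynomial not vanishing at [a] is invertible modulo each power of the maximal ideal by a
    geometric series; the converse is Krull's intersection theorem. *)
Let sat_A i u : (i <= N)%N -> satw unit_at (nspan z i) u <-> forall M, A i M u.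
Proof.
move=> le; have hJ := nspan_ideal z i; have [J0 JD JM] := hJ; split=> [[w w0 hw] M|hu].
  pose e := 1 - (w.@[a])^-1%:MP * w.
  have Oe : Ord a 1 e.
    by case=> // _; rewrite lc0 /e mevalB meval1 mevalM mevalC mulVf // subrr mpolyC0.
  have eM : Ord a M (e ^+ M).
    elim: (M) => [|M' IH]; first by move=> d.
    by rewrite exprS; apply: (OrdM (M := 1%N) (M' := M') Oe IH).
  exists ((1 - e ^+ M) * u); last by rewrite mulrBl mul1r subKr; apply: (idealMr _ (Ord_ideal a M)).
  have -> : (1 - e ^+ M) * u = (\sum_(i < M) e ^+ i) * (w.@[a])^-1%:MP * (w * u).
    rewrite -[1](expr1n _ M) subrXX; under eq_bigr => l _ do rewrite expr1n mul1r.
    have -> : 1 - e = (w.@[a])^-1%:MP * w by rewrite /e subKr.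
    by rewrite -!mulrA [RHS]mulrCA [_ * (w * u)]mulrCA.
  exact: JM.
pose X : set S := [set u | forall M, A i M u].
have hX : is_ideal X.
  split=> [M|x y hx hy M|r x hx M].
  - by exists 0; rewrite // subr0; case: (Ord_ideal a M).
  - have [j hj oj] := hx M; have [j' hj' oj'] := hy M; exists (j + j'); first exact: JD.
    by rewrite opprD addrACA; case: (Ord_ideal a M) => _ OD _; apply: OD.
  have [j hj oj] := hx M; exists (r * j); first exact: JM.
  by rewrite -mulrBr; case: (Ord_ideal a M) => _ _; apply.
pose g (j : nat) : S := if insub j is Some j' then 'X_j' - (a j')%:MP else 0.
have gE (j : 'I_n) : g j = 'X_j - (a j)%:MP by rewrite /g valK.
have accS : acc S.
  apply: acc_mpoly; apply: acc_of_field => x /eqP x0; exists x^-1.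
  by rewrite mulVf.
have [|e [c ec] he] := krull_intersection accS hJ hX (n := n) (g := g).
  move=> U hU JU hpow x hx.
  have hm (j : 'I_n) : exists m, U (('X_j - (a j)%:MP) ^+ m).
    by have [m hm] := hpow j (ltn_ord j); exists m; rewrite -gE.
  have [m {}hm] := choice hm; pose M := (\sum_j m j).+1.
  have [j hj oj] := hx M; have [U0 UD UM] := hU.
  rewrite -(subrK j x); apply: UD; last exact: JU.
  rewrite [x - j](line_expand a); apply: ideal_sum => // d _.
  case: (ltnP d M) => [lt|ge]; first by rewrite oj // (rmorph0 (psub _ _)).
  have := line0_lc a d (x - j); set H := lc a d _ => hH.
  rewrite [H]mpolyE (rmorph_sum (psub _ _)) big_seq; apply: ideal_sum => // mm hmm.
  have dm : mdeg mm = d.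
    have := mcoeff_lc0 d H mm; rewrite /lc hH coefCM coefXn eqxx mulr1.
    by case: eqP => // _ h0; move: hmm; rewrite mcoeff_msupp h0 eqxx.
  rewrite -mul_mpolyC (rmorphM (psub _ _)); apply: (UM).
  have [j0 lej] : exists j0 : 'I_n, (m j0 <= mm j0)%N.
    apply: contrapT => hno; move: ge; rewrite leqNgt => /negP; apply.
    rewrite -dm mdegE ltnS; apply: leq_sum => j0 _; rewrite leqNgt; apply/negP => h.
    by apply: hno; exists j0; apply: ltnW.
  rewrite mpolyXE_id (rmorph_prod (psub _ _)) (bigD1 j0) //= mulrC; apply: (UM).
  rewrite (rmorphXn (psub _ _)) /= psubX -(subnK lej) exprD; apply: (UM).
  exact: hm.
exists (1 + e); last by apply: he.
rewrite /= mevalD meval1 ec raddf_sum /= big1 ?addr0 ?oner_neq0 // => j _.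
by rewrite mevalM gE mevalB mevalXU mevalC subrr mulr0.
Qed.

(** If neither factor lies in the ideal, this shows modulo some powers M1 and M2. Their
    approximations have images under [rho i] of order below M1 and M2, so by [Ord_prod] the product
    is outside already modulo the power M1 + M2. *)
Lemma parameters_prime i : (i <= N)%N -> prime_ideal (satw unit_at (nspan z i)).
Proof.
move=> le; split; first exact/satw_ideal/nspan_ideal.
  move=> [w w0 [c e]]; move: w0; rewrite /= -[w]mulr1 e raddf_sum /= big1 ?eqxx // => l _.
  have := z0 (widen_ord le l); rewrite lc0 mevalM /= => /eqP.
  by rewrite mpolyC_eq0 => /eqP ->; rewrite mulr0.
move=> u v huv; apply: contrapT => hno.
have low w : ~ satw unit_at (nspan z i) w -> exists M, ~ A i M w.
  by move=> h; apply/existsNP => h'; apply: h; apply/sat_A.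
have [M1 h1] : exists M, ~ A i M u by apply: low => h; apply: hno; left.
have [M2 h2] : exists M, ~ A i M v by apply: low => h; apply: hno; right.
pose M := (M1 + M2)%N; have [Fu hFu] := approx u M; have [Fv hFv] := approx v M.
have [_ OD OM] := Ord_ideal a M.
have hF : Ord a M (u * v - Phi (Fu * Fv)).
  have -> : u * v - Phi (Fu * Fv) = u * (v - Phi Fv) + Phi Fv * (u - Phi Fu).
    have G (R0 : comNzRingType) (x y p q : R0) : x * y - p * q = x * (y - q) + q * (x - p) by ring.
    by rewrite (rmorphM Phi); apply: G.
  by apply: OD; apply: OM.
have /sat_A /(_ M) /(A_char le hF) := huv => /(_ le); rewrite (rmorphM (rho i)).
apply: Ord_prod => h.
  by apply: h1; apply: (A_char le (Ord_le (leq_addr M2 M1) hFu)).2 h.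
by apply: h2; apply: (A_char le (Ord_le (leq_addl M1 M2) hFv)).2 h.
Qed.

Lemma parameters_strict i : (i < N)%N -> ~ satw unit_at (nspan z i) (z i).
Proof.
move=> lt /(sat_A _ (ltnW lt)) /(_ 2%N) h.
have h0 : Ord a 2 (z i - Phi 'X_(Ordinal lt)) by rewrite psubX subrr => d _; rewrite raddf0.
have /(_ 1%N isT) := (A_char (ltnW lt) h0).1 h.
have -> : rho i 'X_(Ordinal lt) = 'X_(Ordinal lt) by rewrite /rho psubX ltnn.
rewrite lcX /= => /(congr1 (mcoeff U_(Ordinal lt))) /eqP.
by rewrite mcoeffXU eqxx mcoeff0 oner_eq0.
Qed.

End LocalParameters.

Theorem regular_parameters (K : fieldType) n (a : 'I_n -> K) (c : nat)
    (h : nat -> {mpoly K[n]}) :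
  (forall l, (l < c)%N -> (h l).@[a] = 0) ->
  row_free (\matrix_(l < c, j < n) ((h l)^`M(j)).@[a]) ->
  (forall i, (i <= c)%N -> prime_ideal (satw [set w | w.@[a] != 0] (nspan h i))) /\
  (forall i, (i < c)%N -> ~ satw [set w | w.@[a] != 0] (nspan h i) (h i)).
Proof.
set A := \matrix_(_, _) _ => h0 Afree.
(* The gradients are completed to a basis; the missing parameters are linear forms vanishing at [a],
   and [T] is the inverse change of coordinates. *)
pose e := \rank (A^C)%MS; pose G : 'M[K]_(c + e, n) := col_mx A (row_base (A^C)%MS).
have rkA : \rank A = c by apply/eqP.
have ce : (c + e = n)%N by rewrite /e mxrank_compl rkA subnKC // -rkA rank_leq_col.
have Gfull : row_full G.
  have full := addsmx_compl_full A; rewrite -sub1mx in full; rewrite -sub1mx.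
  apply: submx_trans full _; rewrite /G -addsmxE; apply: addsmxS => //.
  by rewrite eq_row_base.
have rkG : \rank G = n by apply/eqP.
have Gfree : row_free G by rewrite /row_free rkG ce.
have /row_fullP[T TG] := Gfull; have /row_freeP[T' GT'] := Gfree.
have GT : G *m T = 1%:M.
  have TT' : T = T' by rewrite -[LHS]mulmx1 -GT' mulmxA TG mul1mx.
  by rewrite TT'.
pose z (l : nat) : {mpoly K[n]} := if (l < c)%N then h l else
  if insub l is Some l' then \sum_j G l' j *: ('X_j - (a j)%:MP) else 0.
pose l1 (l : 'I_(c + e)) : {mpoly K[n]} := \sum_j G l j *: 'X_j.
pose tau (j : 'I_n) : {mpoly K[c + e]} := \sum_l T j l *: 'X_l.
have zE i : (i <= c)%N -> nspan z i = nspan h i.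
  move=> le; apply/seteqP; split=> _ [d ->]; exists d; apply: eq_bigr => l _.
    by rewrite /z (leq_trans (ltn_ord l) le).
  by rewrite /z (leq_trans (ltn_ord l) le).
have z0 (l : 'I_(c + e)) : lc a 0 (z l) = 0.
  rewrite lc0 /z valK; case: ltnP => lt; first by rewrite h0 // mpolyC0.
  rewrite (raddf_sum (meval a)) /= big1 ?mpolyC0 // => j _.
  by rewrite mevalZ mevalB mevalXU mevalC subrr mulr0.
have z1 (l : 'I_(c + e)) : lc a 1 (z l) = l1 l.
  rewrite lc1 /l1 /z valK; case: ltnP => lt; apply: eq_bigr => j _; congr (_ *: _).
    rewrite /G mxE; case: split_ordP => l' el; last by rewrite el /= ltnNge leq_addr in lt.
    by rewrite mxE el.
  have D j' : ((G l j' *: ('X_j' - (a j')%:MP))^`M(j)).@[a] = if j' == j then G l j' else 0.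
    rewrite mderivZ mderivB mderivC subr0 mderivX mnm1E mevalZ.
    case: eqP => [->|_]; last by rewrite scale0r meval0 mulr0.
    have -> : (U_(j) - U_(j) = 0 :> 'X_{1..n})%MM.
      by apply/mnmP => i; rewrite mnmBE subnn mnm0E.
    by rewrite mpolyX0 scale1r meval1 mulr1.
  rewrite (raddf_sum (mderiv j)) (raddf_sum (meval a)) /= (eq_bigr _ (fun j' _ => D j')).
  by rewrite -big_mkcond big_pred1_eq.
have lamK l : psub (@mpolyC (c + e) K) tau (l1 l) = 'X_l.
  rewrite /l1 raddf_sum /=.
  under eq_bigr => j _ do rewrite -mul_mpolyC rmorphM /= psubC psubX mul_mpolyC /tau scaler_sumr.
  rewrite exchange_big /= (bigD1 l) //= [X in _ + X]big1 ?addr0 => [|l' ne].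
    under eq_bigr => j _ do rewrite scalerA.
    have := congr1 (fun X : 'M_(c + e) => X l l) GT; rewrite !mxE eqxx -scaler_suml => ->.
    by rewrite scale1r.
  under eq_bigr => j _ do rewrite scalerA.
  have := congr1 (fun X : 'M_(c + e) => X l l') GT; rewrite !mxE -scaler_suml => ->.
  by rewrite eq_sym (negbTE ne) scale0r.
have muK j : psub (@mpolyC n K) l1 (tau j) = 'X_j.
  rewrite /tau raddf_sum /=.
  under eq_bigr => l _ do rewrite -mul_mpolyC rmorphM /= psubC psubX mul_mpolyC /l1 scaler_sumr.
  rewrite exchange_big /= (bigD1 j) //= [X in _ + X]big1 ?addr0 => [|j' ne].
    under eq_bigr => l _ do rewrite scalerA.
    have := congr1 (fun X : 'M_n => X j j) TG; rewrite !mxE eqxx -scaler_suml => ->.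
    by rewrite scale1r.
  under eq_bigr => l _ do rewrite scalerA.
  have := congr1 (fun X : 'M_n => X j j') TG; rewrite !mxE -scaler_suml => ->.
  by rewrite eq_sym (negbTE ne) scale0r.
have tau1 j : line (fun=> 0) (tau j) = (tau j)%:P * 'X.
  rewrite /tau raddf_sum (raddf_sum (@polyC _)) mulr_suml; apply: eq_bigr => l _ /=.
  by rewrite -mul_mpolyC rmorphM /= lineC lineX mpolyC0 add0r mulrA polyCM.
split=> i lt.
  rewrite -zE //; apply: (parameters_prime z0 z1 lamK muK tau1).
  by apply: leq_trans lt (leq_addr _ _).
rewrite -zE ?(ltnW lt) //; have -> : h i = z i by rewrite /z lt.
apply: (parameters_strict z0 z1 lamK muK tau1).
by apply: leq_trans lt (leq_addr _ _).
Qed.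

(** * Regularity at a rational point *)

Section RegularPoint.
Variables (K : fieldType) (n : nat) (a : 'I_n -> K).
Notation S := {mpoly K[n]}.
Variable I : set S.
Hypothesis hI : is_ideal I.
Hypothesis Ia : forall u, I u -> u.@[a] = 0.
Notation unit_at := [set w : S | w.@[a] != 0].

Let hU : mulset unit_at.
Proof.
split=> [|u v hu hv] /=; first by rewrite meval1 oner_neq0.
by rewrite mevalM mulf_neq0.
Qed.

(** The two halves of regularity, a chain of primes of length [d] and [d] generators of the maximal
    ideal, are brought back to polynomials, where they are compared with the equations. *)
Lemma regular_local_point (Rq : comPzRingType) (pi : {rmorphism S -> Rq}) :
  (forall w, w.@[a] != 0 -> is_unit (pi w)) ->
  (forall y, exists u w, w.@[a] != 0 /\ y * pi w = pi u) ->
  (forall t, pi t = 0 -> exists w, w.@[a] != 0 /\ I (w * t)) ->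
  (forall t, I t -> pi t = 0) ->
  regular_local_ring Rq ->
  exists d,
    (exists p : nat -> set S, [/\ prime_chain d p, forall i, (i <= d)%N -> I `<=` p i &
       forall i w, (i <= d)%N -> p i w -> w.@[a] = 0]) /\
    exists u : nat -> S, (forall i, (i < d)%N -> (u i).@[a] = 0) /\
      forall j : 'I_n, exists w v, w.@[a] != 0 /\
        I (w * ('X_j - (a j)%:MP) - \sum_(i < d) v i * u i).
Proof.
move=> piU piD pi0 piI [_ [m [mm mu [d [[p' [prp' sp']] _] [[s ss es] _]]]]].
pose n' : set Rq := [set y | exists u w, [/\ w.@[a] != 0, u.@[a] = 0 & y * pi w = pi u]].
have mn : m = n'.
  apply/esym/mu; split.
  - split; first by exists 0, 1; rewrite meval1 oner_neq0 meval0 mul0r rmorph0.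
      move=> y y' [u [w [wa ua e]]] [u' [w' [wa' ua' e']]].
      exists (u * w' + u' * w), (w * w'); split.
      - by rewrite mevalM; apply: mulf_neq0.
      - by rewrite mevalD !mevalM ua ua' !mul0r addr0.
      by rewrite rmorphD !rmorphM -e -e'; ring.
    move=> y y' [u [w [wa ua e]]]; have [u' [w' [wa' e']]] := piD y.
    exists (u' * u), (w' * w); split.
    - by rewrite mevalM; apply: mulf_neq0.
    - by rewrite mevalM ua mulr0.
    by rewrite !rmorphM -e -e'; ring.
  - move=> [u [w [wa ua]]]; rewrite mul1r => e.
    have /pi0[w' [wa']] : pi (w - u) = 0 by rewrite rmorphB e subrr.
    move=> /Ia /eqP; rewrite mevalM mevalB ua subr0 mulf_eq0.
    by rewrite (negbTE wa) (negbTE wa').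
  move=> J [J0 JD JM] J1 nJ; apply/seteqP; split=> // y Jy.
  have [u [w [wa e]]] := piD y; exists u, w.
  suff ua : u.@[a] = 0 by split; [exact: wa|exact: ua|exact: e].
  apply/eqP; apply: contrapT => /negP ua.
  have [v euv] := piU u ua; apply: J1; have -> : 1 = pi w * v * y.
    by rewrite [RHS]mulrC mulrA e euv.
  exact: JM.
exists d; split.
  exists (fun i => [set u | p' i (pi u)]); split.
  - split=> [i le|i lt].
      have [[P0 PD PM] P1 PP] := prp' i le; split.
      + split=> [|x y hx hy|r x hx] /=; first by rewrite rmorph0.
          by rewrite rmorphD; apply: PD.
        by rewrite rmorphM; apply: PM.
      + by rewrite /= rmorph1.
      by move=> x y /=; rewrite rmorphM => /PP.
    have [sub /existsNP[y /not_implyP[py npy]]] := sp' i lt; split; first by move=> u; apply: sub.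
    move=> /(_ _); have [u [w [wa e]]] := piD y.
    have [[_ _ PM] _ _] := prp' i (ltnW lt); have [[_ _ PM'] _ _] := prp' i.+1 lt.
    have [v ev] := piU w wa.
    move=> /(_ u) h; apply: npy; have -> : y = v * pi u by rewrite -e mulrCA [v * _]mulrC ev mulr1.
    by apply/PM/h; rewrite /= -e mulrC; apply: PM'.
  - move=> i le u Iu /=; rewrite (piI u Iu).
    by have [[]] := prp' i le.
  move=> i w le /= pw; apply/eqP; apply: contrapT => /negP wa.
  have [[_ _ PM] P1 _] := prp' i le; have [v ev] := piU w wa.
  by apply: P1; rewrite -ev mulrC; apply: PM.
have [[m0 mD mM] _ _] := mm; rewrite ideal_gen_seq ss in es.
have hs i : exists uw : S * S, (i < d)%N -> [/\ uw.2.@[a] != 0, uw.1.@[a] = 0 & nth 0 s i * pi uw.2 = pi uw.1].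
  case: (ltnP i d) => [lt|_]; last by exists (0, 0).
  have : m (nth 0 s i) by rewrite es; apply: nspan_mem.
  by rewrite mn => -[u [w h]]; exists (u, w).
have [uw huw] := choice hs; exists (fun i => (uw i).1); split=> [i lt|j];
  first by have [] := huw i lt.
have : m (pi ('X_j - (a j)%:MP)).
  rewrite mn; exists ('X_j - (a j)%:MP), 1; split.
  - by rewrite meval1 oner_neq0.
  - by rewrite mevalB mevalXU mevalC subrr.
  by rewrite (rmorph1 pi) mulr1.
rewrite es => -[r er].
have [w [v [wa ev]]] : exists w (v : nat -> S), w.@[a] != 0 /\
    pi w * \sum_(i < d) r i * nth 0 s i = pi (\sum_(i < d) v i * (uw i).1).
  suff : forall l, (l <= d)%N -> exists w (v : nat -> S), w.@[a] != 0 /\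
      pi w * \sum_(i < l) r i * nth 0 s i = pi (\sum_(i < l) v i * (uw i).1) by apply.
  elim=> [_|l IH lt].
    by exists 1, (fun=> 0); rewrite meval1 oner_neq0 !big_ord0 mulr0 (rmorph0 pi).
  have [w [v [wa ev]]] := IH (ltnW lt); have [b [t [ta et]]] := piD (r l).
  have [wl _ el] := huw l lt.
  exists (w * (t * (uw l).2)), (fun i : nat => if i == l then w * b else t * (uw l).2 * v i : S).
  rewrite !mevalM !mulf_neq0 //; split=> //; rewrite !big_ord_recr /= eqxx mulrDr rmorphD.
  congr (_ + _).
    rewrite (eq_bigr (fun i : 'I_l => t * (uw l).2 * (v i * (uw i).1))); last first.
      by move=> i _; rewrite ltn_eqF // mulrA.
    by rewrite -mulr_sumr [RHS]rmorphM -ev [RHS]mulrC (rmorphM pi w) mulrAC.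
  by rewrite !rmorphM -el -et; ring.
have /pi0[w' [wa' hw']] : pi (w * ('X_j - (a j)%:MP) - \sum_(i < d) v i * (uw i).1) = 0.
  by rewrite rmorphB rmorphM er ev subrr.
exists (w' * w), (fun i => w' * v i); rewrite mevalM mulf_neq0 //; split=> //.
rewrite (eq_bigr (fun i : 'I_d => w' * (v i * (uw i).1))); last by move=> i _; rewrite mulrA.
by rewrite -mulr_sumr -mulrA -mulrBr.
Qed.

Lemma regular_point : regular_ring (rquot hI) ->
  exists d,
    (exists p : nat -> set S, [/\ prime_chain d p, forall i, (i <= d)%N -> I `<=` p i &
       forall i w, (i <= d)%N -> p i w -> w.@[a] = 0]) /\
    exists u : nat -> S, (forall i, (i < d)%N -> (u i).@[a] = 0) /\
      forall j : 'I_n, exists w v, w.@[a] != 0 /\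
        I (w * ('X_j - (a j)%:MP) - \sum_(i < d) v i * u i).
Proof.
move=> [_ reg]; pose q : set (rquot hI) := [set y | exists2 u, u.@[a] = 0 & rproj hI u = y].
have nq u : q (rproj hI u) -> u.@[a] = 0.
  move=> [v va /rprojP /Ia]; rewrite mevalB va sub0r => /eqP.
  by rewrite oppr_eq0 => /eqP.
have prq : prime_ideal q.
  split; first split.
  - by exists 0; rewrite ?meval0 ?rmorph0.
  - by move=> _ _ [u ua <-] [v va <-]; exists (u + v); rewrite ?mevalD ?ua ?va ?addr0 ?rmorphD.
  - move=> y _ [u ua <-]; have [v <-] := rproj_surj y.
    by exists (v * u); rewrite ?mevalM ?ua ?mulr0 ?rmorphM.
  - by rewrite -(rmorph1 (rproj hI)) => /nq /eqP; rewrite meval1 oner_eq0.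
  move=> x y; have [u <-] := rproj_surj x; have [v <-] := rproj_surj y.
  rewrite -rmorphM => /nq /eqP; rewrite mevalM mulf_eq0 => /orP[] /eqP h; [left|right].
    by exists u.
  by exists v.
have hM : mulset (~` q).
  by have [_ q1 qM] := prq; split=> // x y nx ny /qM[].
have [locU locD loc0] := locP hM.
pose pi : {rmorphism S -> loc hM} := lproj hM \o rproj hI.
have piU w : w.@[a] != 0 -> is_unit (pi w) by move=> wa; apply: locU => /nq /eqP;
  rewrite (negbTE wa).
have piD y : exists u w, w.@[a] != 0 /\ y * pi w = pi u.
  have [x [m' [Mm' e]]] := locD y; have [u eu] := rproj_surj x; have [w ew] := rproj_surj m'.
  exists u, w; split; last by rewrite /pi /= ew eu.
  by apply/eqP => wa; apply: Mm'; rewrite -ew; exists w.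
have pi0 t : pi t = 0 -> exists w, w.@[a] != 0 /\ I (w * t).
  move=> /loc0[m' Mm']; have [w ew] := rproj_surj m'.
  rewrite -ew -rmorphM => /rproj0 h; exists w; split=> //.
  by apply/eqP => wa; apply: Mm'; rewrite -ew; exists w.
apply: (regular_local_point piU piD pi0) => [t It|]; last exact: reg q _ (lproj hM) prq (locP hM).
by rewrite /pi /= (rproj0 hI t).2 // rmorph0.
Qed.

Definition grad (u : S) : 'rV[K]_n := \row_j (u^`M(j)).@[a].

Lemma gradM u v : grad (u * v) = v.@[a] *: grad u + u.@[a] *: grad v.
Proof. by apply/rowP => j; rewrite !mxE mderivM mevalD !mevalM mulrC; congr (_ + _). Qed.

Lemma gradD u v : grad (u + v) = grad u + grad v.
Proof. by apply/rowP => j; rewrite !mxE mderivD mevalD. Qed.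

Lemma gradN u : grad (- u) = - grad u.
Proof. by apply/rowP => j; rewrite !mxE mderivN mevalN. Qed.

(** The cotangent space at [a] is spanned by the [c] gradients of [h] and those of [d] parameters,
    so n <= c + d. An element of [I] outside the local ideal of [h] would make the chain from 0
    through the ideals of [h] to the primes above [I] have length c + d + 1, which exceeds [n]. *)
Theorem regular_local_equations (c : nat) (h : nat -> S) : regular_ring (rquot hI) ->
  (forall l, (l < c)%N -> I (h l)) ->
  row_free (\matrix_(l < c, j < n) ((h l)^`M(j)).@[a]) ->
  (forall u, I u -> (grad u <= \matrix_(l < c, j < n) ((h l)^`M(j)).@[a])%MS) ->
  forall u, I u -> satw unit_at (nspan h c) u.
Proof.
set A := \matrix_(_, _) _ => reg hh Afree Imax.
have [d [[p [[prp sp] Ip pa]] [y [ya hy]]]] := regular_point reg.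
have [I0 ID IM] := hI.
have ncd : (n <= c + d)%N.
  pose U := \matrix_(i < d) grad (y i).
  have full : (1%:M <= A + U)%MS.
    apply/row_subP => j; have [w [v [wa hw]]] := hy j.
    have := Imax _ hw; rewrite gradD gradM gradN => hsub.
    have gx : grad ('X_j - (a j)%:MP) = row j 1%:M.
      apply/rowP => l; rewrite !mxE mderivB mderivC subr0 mderivX mnm1E mevalZ.
      case: eqP => [->|_]; last by rewrite mul0r.
      have -> : (U_(l) - U_(l) = 0 :> 'X_{1..n})%MM.
        by apply/mnmP => i; rewrite mnmBE subnn mnm0E.
      by rewrite mpolyX0 meval1 mulr1.
    move: hsub; rewrite mevalB mevalXU mevalC subrr scale0r add0r gx.
    set sm := grad _ => hsub.
    have smU : (sm <= U)%MS.
      rewrite /sm; elim/big_ind: _ => [|u u' hu hu'|i _].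
      - have -> : grad 0 = 0 by apply/rowP => l; rewrite !mxE mderiv0 meval0.
        exact: sub0mx.
      - by rewrite gradD addmx_sub.
      rewrite gradM ya // scale0r add0r scalemx_sub //.
      by have := row_sub i U; rewrite rowK.
    have -> : row j 1%:M = (w.@[a])^-1 *: ((w.@[a] *: row j 1%:M - sm) + sm).
      by rewrite subrK scalerA mulVf // scale1r.
    rewrite scalemx_sub // addmx_sub //; first by apply: submx_trans hsub (addsmxSl _ _).
    exact: submx_trans smU (addsmxSr _ _).
  have := mxrankS full; rewrite mxrank1 => /leq_trans; apply.
  apply: leq_trans (mxrank_adds_leqif _ _).1 _.
  by apply: leq_add; apply: rank_leq_row.
have h0 l : (l < c)%N -> (h l).@[a] = 0 by move=> /hh /Ia.
have [prL sL] := regular_parameters h0 Afree.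
pose L i := satw unit_at (nspan h i).
have Lp0 : L c `<=` p 0%N.
  move=> u [w wa hw]; have [[_ _ _] _ P] := prp 0%N isT.
  have /P[/pa wa0|//] : p 0%N (w * u).
    apply: (Ip 0%N) => //; apply: (nspan_sub hI) hw => i lt; exact: hh.
  by move: wa; rewrite /= wa0 ?eqxx.
move=> t It; apply: contrapT => nLt.
(* The inclusion of [L c] in [p 0] is strict because of [t]. *)
pose Q i := if (i <= c)%N then L i else p (i - c.+1)%N.
have : prime_chain (c + d).+1 Q.
  split=> [i le|i lt]; rewrite /Q.
    by case: leqP => h'; [apply: prL|apply: prp; lia].
  case: (ltnP i c) => [ltc|gec].
    rewrite (ltnW ltc); split=> [u [w wa hw]|].
      by exists w => //; apply: nspan_le hw.
    move=> /(_ (h i)) hsub; apply: (sL i ltc); apply: hsub; exists 1; first by case: hU.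
    by rewrite mul1r; apply: nspan_mem.
  case: (leqP i c) => [lec|gtc].
    have -> : i = c by lia.
    rewrite subnn; split=> // /(_ t) hsub; apply: nLt; apply: hsub.
    exact: (Ip 0%N).
  have -> : (i.+1 - c.+1 = (i - c.+1).+1)%N by lia.
  by apply: sp; lia.
by move=> /mpoly_prime_chain; lia.
Qed.

End RegularPoint.

(** * Fibers *)

Lemma localized_ideal_gen (R Rp : comPzRingType) (M X : set R) (l : {rmorphism R -> Rp}) y :
  mulset M -> is_ideal X -> is_localization M l -> ideal_gen (l @` X) y ->
  exists x m, [/\ X x, M m & y * l m = l x].
Proof.
move=> [M1 MM] [X0 XD XM] [_ ld _]; move: y; apply: ideal_gen_min; last first.
  by move=> _ [x Xx <-]; exists x, 1; rewrite rmorph1 mulr1.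
split; first by exists 0, 1; rewrite rmorph0 mul0r.
  move=> y y' [x [m [Xx Mm e]]] [x' [m' [Xx' Mm' e']]].
  exists (m' * x + m * x'), (m * m'); split; [by apply: XD; apply: XM|exact: MM|].
  by rewrite rmorphD !rmorphM -e -e'; ring.
move=> r y [x [m [Xx Mm e]]]; have [x' [m' [Mm' e']]] := ld r.
exists (x' * x), (m' * m); split; [exact: XM|exact: MM|].
by rewrite !rmorphM -e -e'; ring.
Qed.

Lemma ker_ideal (R T : comPzRingType) (f : {rmorphism R -> T}) : is_ideal [set x | f x = 0].
Proof.
split=> [|u v /= hu hv|r u /= hu]; first exact: rmorph0.
  by rewrite rmorphD hu hv addr0.
by rewrite rmorphM hu mulr0.
Qed.

Lemma loc_ex (R : comPzRingType) (M : set R) : mulset M ->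
  exists (Rp : comPzRingType) (l : {rmorphism R -> Rp}), is_localization M l.
Proof. by move=> hM; exists (loc hM), (lproj hM); apply: locP. Qed.

Lemma quot_ex (R : comPzRingType) (I : set R) : is_ideal I ->
  exists (F : comPzRingType) (r : {rmorphism R -> F}), is_quotient I r.
Proof. by move=> hI; exists (rquot hI), (rproj hI); apply: rquotP. Qed.

Lemma residue_field (A : comPzRingType) (p : set A) : prime_ideal p ->
  exists (Ap : comPzRingType) (lA : {rmorphism A -> Ap}) (k : fieldType)
    (qA : {rmorphism Ap -> k}),
  [/\ is_localization (~` p) lA, is_quotient (ideal_gen (lA @` p)) qA,
      forall m, qA (lA m) = 0 <-> p m &
      forall x, exists m d, ~ p d /\ x * qA (lA d) = qA (lA m)].
Proof.
move=> prp; have [idp p1 pM] := prp.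
have hM : mulset (~` p) by split=> // x y nx ny /pM[].
have [Ap [l hl]] := loc_ex hM.
have [lU lD l0] := hl; set J := ideal_gen (l @` p); have hJ : is_ideal J := ideal_genP _.
have Jp m : J (l m) -> p m.
  move=> /(localized_ideal_gen hM idp hl)[x [m' [px pm' e]]].
  have /l0[m'' pm'' e'] : l (m * m' - x) = 0 by rewrite rmorphB rmorphM e subrr.
  have [p0 pD pMl] := idp.
  have : p (m'' * (m * m' - x) + m'' * x) by rewrite e' add0r; apply: pMl.
  by rewrite -mulrDr subrK => /pM[//|/pM[]].
have hQ : (1 <> 0 :> rquot hJ) /\ forall x : rquot hJ, x <> 0 -> exists y, y * x = 1.
  split; first by rewrite -(rmorph1 (rproj hJ)) => /rproj0; rewrite -(rmorph1 l) => /Jp.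
  move=> x x0; have [y ey] := rproj_surj x; have [m [d [pd e]]] := lD y.
  have [v ev] : is_unit (l m).
    apply: (lU) => pm; apply: x0; rewrite -ey; apply/rproj0.
    have [v ev] := lU d pd; have -> : y = v * l m by rewrite -e mulrCA [v * _]mulrC ev mulr1.
    by rewrite mulrC; apply: (idealMr _ hJ); apply: (@ideal_gen_mem _ (l @` p)); exists m.
  exists (rproj hJ (v * l d)); rewrite -ey -rmorphM.
  have -> : v * l d * y = 1 by rewrite -mulrA [l d * y]mulrC e mulrC.
  exact: rmorph1.
exists Ap, l, (field_of hQ), (to_field hQ \o rproj hJ); split.
- exact: hl.
- by split; [apply: rproj_surj|apply: rproj0].
- move=> m; split=> [/(rproj0 hJ) /Jp //|pm]; apply: (rproj0 hJ _).2.
  by apply: ideal_gen_mem; exists m.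
move=> x; have [y ey] := rproj_surj (x : rquot hJ); have [m [d [pd e]]] := lD y.
exists m, d; split=> //; rewrite /= -e rmorphM; congr (_ * _).
by rewrite -ey.
Qed.

Definition nz_of (T : comPzRingType) (_ : 1 <> 0 :> T) : Type := T.
Section NonZero.
Variables (T : comPzRingType) (h : 1 <> 0 :> T).
HB.instance Definition _ := GRing.ComPzRing.on (nz_of h).
Let nz : (1 : nz_of h) != 0.
Proof. exact/eqP. Qed.
HB.instance Definition _ := GRing.PzSemiRing_isNonZero.Build (nz_of h) nz.
End NonZero.

Section Fiber.
Variables (R : comPzRingType) (phi : {rmorphism int -> R}) (n : nat).
Notation S := {mpoly int[n]}.
Variable f : {rmorphism S -> R}.
Hypothesis fC : forall c, f c%:MP = phi c.
Hypothesis fsurj : forall y, exists x, f x = y.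
Variables (p0 : set int) (k : fieldType) (kap : {rmorphism int -> k}).
Hypothesis p0_prime : prime_ideal p0.
Hypothesis kap0 : forall m, kap m = 0 <-> p0 m.
Hypothesis kap_frac : forall x, exists m d, ~ p0 d /\ x * kap d = kap m.
Notation Sk := {mpoly k[n]}.
Notation redk := (map_mpoly kap : {rmorphism S -> Sk}).

(** The extension of the ideal [X] to k[x]. As [k] is the fraction field of Z/p0, one integer
    outside [p0] clears all denominators. *)
Definition spread (X : set S) : set Sk :=
  [set v | exists m u, [/\ ~ p0 m, X u & (kap m)%:MP * v = redk u]].

Lemma fiber_denom (v : Sk) : exists m u, ~ p0 m /\ (kap m)%:MP * v = redk u.
Proof.
have [_ p1 pM] := p0_prime.
elim/mpoly_subring_ind: v => [c|i|v v' [m [u [pm e]]] [m' [u' [pm' e']]]|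
    v v' [m [u [pm e]]] [m' [u' [pm' e']]]].
- have [m [d [pd e]]] := kap_frac c; exists d, m%:MP; split=> //.
  by rewrite /= map_mpolyC -mpolyCM mulrC e.
- by exists 1, 'X_i; rewrite rmorph1 mpolyC1 mul1r /= map_mpolyX.
- exists (m * m'), (m'%:MP * u + m%:MP * u'); split; first by move=> /pM[].
  by rewrite rmorphD !rmorphM /= !map_mpolyC -e -e'; ring.
exists (m * m'), (u * u'); split; first by move=> /pM[].
by rewrite !rmorphM /= -e -e'; ring.
Qed.

Lemma spread_ideal X : is_ideal X -> is_ideal (spread X).
Proof.
move=> [X0 XD XM]; have [_ p1 pM] := p0_prime.
split; first by exists 1, 0; rewrite mulr0 rmorph0.
  move=> v v' [m [u [pm Xu e]]] [m' [u' [pm' Xu' e']]].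
  exists (m * m'), (m'%:MP * u + m%:MP * u'); split; first by move=> /pM[].
    by apply: XD; apply: XM.
  by rewrite rmorphD !rmorphM /= !map_mpolyC -e -e'; ring.
move=> r v [m [u [pm Xu e]]]; have [m' [u' [pm' e']]] := fiber_denom r.
exists (m' * m), (u' * u); split; [by move=> /pM[]|exact: XM|].
by rewrite !rmorphM /= -e -e'; ring.
Qed.

Lemma spread_mem (X : set S) u : X u -> spread X (redk u).
Proof.
by move=> Xu; exists 1, u; split=> //; [case: p0_prime|rewrite rmorph1 mpolyC1 mul1r].
Qed.

Lemma redk_eq0 (J : set R) u : is_ideal J -> (forall m, p0 m -> J (phi m)) ->
  redk u = 0 -> J (f u).
Proof.
move=> hJ hp e; rewrite [u]mpolyE rmorph_sum; apply: ideal_sum => // m _.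
rewrite -mul_mpolyC rmorphM fC; apply: idealMr => //; apply/hp/kap0.
by have := congr1 (mcoeff m) e; rewrite mcoeff_map_mpoly mcoeff0.
Qed.

Notation kerf := [set u | f u = 0].

Let hIk : is_ideal (spread kerf) := spread_ideal (ker_ideal f).

(** Realizes the fiber as the quotient of k[x] by the extension of the kernel of [f], where
    gradients and points make sense. *)
Lemma fiber_ex (Ap : comPzRingType) (lA : {rmorphism int -> Ap}) (qA : {rmorphism Ap -> k}) :
  is_localization (~` p0) lA -> is_quotient (ideal_gen (lA @` p0)) qA ->
  (forall m, qA (lA m) = kap m) ->
  exists (F : comPzRingType) (psi : {rmorphism k -> F}) (rF : {rmorphism Sk -> F}),
    [/\ is_fiber phi p0 psi, is_quotient (spread kerf) rF & forall c, psi c = rF c%:MP].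
Proof.
move=> hlA hqA qlA; have [idp p1 pM] := p0_prime; have [lAU lAD lA0] := hlA.
have hM0 : mulset (~` p0) by split=> // x y nx ny /pM[].
have hM : mulset (phi @` (~` p0)).
  split; first by exists 1; rewrite ?rmorph1.
  by move=> _ _ [x px <-] [y py <-]; exists (x * y); [case: hM0 => _; apply|rewrite rmorphM].
have [Rp [lR hlR]] := loc_ex hM; have [lRU lRD lR0] := hlR.
have [F [rF hrF]] := quot_ex hIk; have [rFs rF0] := hrF.
have [phip hphip] : exists h : {rmorphism Ap -> Rp}, forall x : int, h (lA x) = lR (phi x).
  apply: (rmorph_extension (f := lA) (g := lR \o phi)).
    move=> y; have [x [m [pm e]]] := lAD y; exists x, m; split=> //; first exact: lAU.
    by apply: lRU; exists m.
  move=> x /lA0[m pm e]; apply/lR0; exists (phi m); first by exists m.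
  by rewrite -rmorphM e rmorph0.
have [r hr] : exists h : {rmorphism R -> F}, forall x : S, h (f x) = (rF \o redk) x.
  apply: (rmorph_extension (f := f) (g := rF \o redk)).
    move=> y; have [x ex] := fsurj y; exists x, 1; rewrite !rmorph1 mulr1 ex.
    by split=> //; exists 1; rewrite mulr1.
  by move=> x fx; apply/rF0/spread_mem.
have rphi m : r (phi m) = rF (kap m)%:MP by rewrite -fC hr /= map_mpolyC.
have rU m : ~ p0 m -> is_unit (r (phi m)).
  move=> pm; exists (rF (kap m)^-1%:MP); rewrite rphi -rmorphM -mpolyCM mulfV ?mpolyC1 ?rmorph1 //.
  by apply/eqP => /kap0.
have [qR hqR] : exists h : {rmorphism Rp -> F}, forall x, h (lR x) = r x.
  apply: (rmorph_extension (f := lR) (g := r)).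
    move=> y; have [x [_ [[m pm <-] e]]] := lRD y; exists x, (phi m); split=> //; last exact: rU.
    by apply: lRU; exists m.
  move=> x /lR0[_ [m pm <-] e]; have [v ev] := rU m pm.
  by rewrite -[r x]mulr1 -ev mulrA [r x * _]mulrC -rmorphM e rmorph0 mul0r.
exists F, (rF \o @mpolyC n k), rF; split=> //.
exists Ap, Rp, lA, lR, phip, qA, qR; split=> //; last first.
  split=> [x|y]; first exact: hphip.
  have [x [m [pm e]]] := lAD y; have [v ev] := rU m pm.
  have E x' : rF (qA (lA x'))%:MP = qR (phip (lA x')) by rewrite hphip hqR /= rphi qlA.
  have E2 : rF (qA y)%:MP * r (phi m) = qR (phip y) * r (phi m).
    have -> : r (phi m) = qR (phip (lA m)) by rewrite hphip hqR.
    rewrite -[in LHS]E -!rmorphM /= e; exact: E.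
  by rewrite /= -[LHS]mulr1 -ev mulrA E2 -mulrA ev mulr1.
set X := ideal_gen _; have hX : is_ideal X := ideal_genP _; have [X0 XD XM] := hX.
split=> [y|y].
  have [v ev] := rFs y; have [m [u [pm e]]] := fiber_denom v;
    have [t et] := lRU _ (ex_intro2 _ _ m pm erefl).
  exists (lR (f u) * t); rewrite rmorphM hqR hr /= -e rmorphM -rphi -hqR -ev.
  by rewrite mulrAC -rmorphM et rmorph1 mul1r.
split; last first.
  move: y; apply: (@ideal_gen_min _ _ [set y | qR y = 0]).
    exact: ker_ideal.
  by move=> _ [m pm <-] /=; rewrite hqR rphi (kap0 m).2 // mpolyC0 rmorph0.
move=> qy; have [x [_ [[m pm <-] e]]] := lRD y; have [u eu] := fsurj x.
have : qR (y * lR (phi m)) = 0 by rewrite rmorphM qy mul0r.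
rewrite e hqR -eu hr => /rF0[m' [w [pm' fw e']]].
have : X (lR (f (m'%:MP * u - w))).
  apply: (@redk_eq0 [set s | X (lR s)]).
  - split; first by rewrite /= rmorph0.
      by move=> s s' hs hs'; rewrite /= rmorphD; apply: XD.
    by move=> s s' hs; rewrite /= rmorphM; apply: XM.
  - by move=> m'' pm''; apply: ideal_gen_mem; exists m''.
  by rewrite rmorphB rmorphM /= map_mpolyC e' subrr.
rewrite rmorphB rmorphM fw subr0 fC eu rmorphM -e => Xy.
have [t et] := lRU _ (ex_intro2 _ _ m pm erefl);
  have [t' et'] := lRU _ (ex_intro2 _ _ m' pm' erefl).
have -> : y = t * t' * (lR (phi m') * (y * lR (phi m))).
  rewrite -[LHS]mulr1 -[1]mulr1 -{1}et -et'; ring.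
exact: XM.
Qed.

Section Extension.
Variable K : fieldExtType k.
Notation SK := {mpoly K[n]}.
Notation mapK := (map_mpoly (GRing.in_alg K) : {rmorphism Sk -> SK}).

Definition spreadK (X : set S) : set SK := ideal_gen (mapK @` spread X).

Lemma fiber_tensor (F : comPzRingType) (psi : {rmorphism k -> F}) (rF : {rmorphism Sk -> F}) :
  is_quotient (spread kerf) rF -> (forall c, psi c = rF c%:MP) ->
  forall (T0 : comPzRingType) (rK : {rmorphism SK -> T0}), is_quotient (spreadK kerf) rK ->
  exists g1 g2, @is_algebra_tensor k F K T0 psi (GRing.in_alg K) g1 g2.
Proof.
move=> [rFs rF0] psiE T0 rK [rKs rK0].
have [g1 hg1] : exists h : {rmorphism F -> T0}, forall x : Sk, h (rF x) = rK (mapK x).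
  apply: (rmorph_extension (f := rF) (g := rK \o mapK)).
    move=> y; have [x ex] := rFs y; exists x, 1; rewrite !rmorph1 mulr1 ex.
    by split=> //; exists 1; rewrite mulr1.
  by move=> x /rF0 hx; apply/(rK0 _).2; apply: ideal_gen_mem; exists x.
exists g1, (rK \o @mpolyC n K); split=> [c|T h1 h2 h12].
  by rewrite psiE hg1 /= map_mpolyC.
have uniq (h h' : {rmorphism T0 -> T}) : (forall x, h (g1 x) = h1 x) ->
    (forall x, h ((rK \o @mpolyC n K) x) = h2 x) -> (forall x, h' (g1 x) = h1 x) ->
    (forall x, h' ((rK \o @mpolyC n K) x) = h2 x) -> forall y, h' y = h y.
  move=> e1 e2 e1' e2' y; have [u <-] := rKs y.
  elim/mpoly_subring_ind: u => [c|i|u v hu hv|u v hu hv].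
  - by have := e2' c; rewrite /= => ->; rewrite -e2.
  - have -> : rK 'X_i = g1 (rF 'X_i) by rewrite hg1 /= map_mpolyX.
    by rewrite e1' e1.
  - by rewrite !rmorphD hu hv.
  by rewrite !rmorphM hu hv.
suff [h [e1 e2]] : exists h : {rmorphism T0 -> T}, (forall x, h (g1 x) = h1 x) /\
    forall x, h ((rK \o @mpolyC n K) x) = h2 x.
  by exists h; split=> // h' e1' e2'; apply: uniq.
(* The zero ring is treated apart, since [psub] evaluates polynomials in nonzero rings. *)
have [t01|t10] := pselect (1 = 0 :> T).
  have triv (x y : T) : x = y by rewrite -[x]mulr1 -[y]mulr1 t01 !mulr0.
  have [u0 _] := rFs 0.
  pose z (y : T0) : T := 0.
  have za : zmod_morphism z by move=> x y; apply: triv.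
  have zm : monoid_morphism z by split=> [|x y]; apply: triv.
  pose hz : {rmorphism T0 -> T} := HB.pack z (GRing.isZmodMorphism.Build _ _ z za)
    (GRing.isMonoidMorphism.Build _ _ z zm).
  by exists hz; split=> x; apply: triv.
pose T' : comNzRingType := nz_of t10.
have [E EE] : exists E : {rmorphism SK -> T'}, (forall c, E c%:MP = h2 c) /\
    forall i, E 'X_i = h1 (rF 'X_i).
  exists (psub (h2 : {rmorphism K -> T'}) (fun i => h1 (rF 'X_i) : T')).
  by split=> [c|i]; [apply: psubC|apply: psubX].
have [EC EX] := EE.
have Emap v : E (mapK v) = h1 (rF v).
  apply: (mpoly_rmorph_eq (f := E \o mapK) (g := h1 \o rF)) v => [c|i] /=.
    by rewrite map_mpolyC EC -h12 psiE.
  by rewrite map_mpolyX EX.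
have Eker v : spreadK kerf v -> E v = 0.
  move: v; apply: (@ideal_gen_min _ _ [set v | E v = 0]).
    exact: ker_ideal.
  by move=> _ [v Iv <-] /=; rewrite Emap (rF0 v).2 // rmorph0.
have [h hh] : exists h : {rmorphism T0 -> T}, forall x : SK, h (rK x) = E x.
  apply: (rmorph_extension (f := rK) (g := E : {rmorphism SK -> T})).
    move=> y; have [x ex] := rKs y; exists x, 1; rewrite !rmorph1 mulr1 ex.
    by split=> //; exists 1; rewrite mulr1.
  by move=> x /rK0; apply: Eker.
exists h; split=> x; last by rewrite /= hh EC.
by have [v <-] := rFs x; rewrite hg1 /= hh Emap.
Qed.

End Extension.

(** [P] need not be closed in its fiber. A maximal ideal above it is a closed point, with residue
    field finite over [k] by Zariski's lemma, as geometric regularity is tested on finite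
    extensions. What does not vanish at this point is not in [P]. *)
Lemma fiber_point (P : set R) : prime_ideal P -> (forall m, P (phi m) <-> p0 m) ->
  exists (K : fieldExtType k) (a : 'I_n -> K), forall v, spread (f @^-1` P) v ->
    (map_mpoly (GRing.in_alg K) v).@[a] = 0.
Proof.
move=> [hP P1 PM] Pphi.
have hfP : is_ideal (f @^-1` P).
  have [P0 PD PMl] := hP; split; rewrite /preimage /=; first by rewrite rmorph0.
    by move=> x y hx hy; rewrite rmorphD; apply: PD.
  by move=> r x hx; rewrite rmorphM; apply: PMl.
have hX := spread_ideal hfP.
have hX1 : ~ spread (f @^-1` P) 1.
  move=> [m [u [pm Pu]]]; rewrite mulr1 => e.
  have : P (f (m%:MP - u)).
    apply: redk_eq0 => //; first by move=> m' /Pphi.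
    by rewrite rmorphB /= map_mpolyC e subrr.
  rewrite rmorphB fC => h; apply/pm/Pphi; rewrite -[phi m](subrK (f u)).
  by have [_ PD _] := hP; apply: PD.
have accSk : acc Sk by apply: acc_mpoly; apply: acc_of_field => x /eqP x0; exists x^-1;
  rewrite mulVf.
have [mm [hm m1 mmax] Xm] := max_ideal_ex accSk hX hX1.
have hQ : (1 <> 0 :> rquot hm) /\ forall x : rquot hm, x <> 0 -> exists y, y * x = 1.
  split; first by rewrite -(rmorph1 (rproj hm)) => /rproj0.
  move=> x x0; have [y ey] := rproj_surj x.
  apply: contrapT => hno; pose I := [set z : Sk | exists r w, mm w /\ z = r * y + w].
  have [mm0 mmD mmM] := hm.
  have hI : is_ideal I.
    split; first by exists 0, 0; rewrite mul0r addr0.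
      move=> _ _ [r [w [hw ->]]] [r' [w' [hw' ->]]]; exists (r + r'), (w + w').
      by split; [apply: mmD|ring].
    move=> s _ [r [w [hw ->]]]; exists (s * r), (s * w).
    by split; [apply: mmM|ring].
  have eI : I = mm.
    apply: mmax => //; last by move=> w hw; exists 0, w; rewrite mul0r add0r.
    move=> [r [w [hw e]]]; apply: hno; exists (rproj hm r); rewrite -ey -rmorphM.
    rewrite -(rmorph1 (rproj hm)); apply/(rprojP hm).
    by rewrite e opprD addNKr; apply: idealN.
  apply: x0; rewrite -ey; apply/rproj0; rewrite -eI.
  by exists 1, 0; split=> //; rewrite mul1r addr0.
pose L : fieldType := field_of hQ.
pose q : {rmorphism Sk -> L} := (to_field hQ \o rproj hm).
have q0 v : mm v -> q v = 0 by move=> hv; apply: (rproj0 hm v).2.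
have qs y : exists v, q v = y by apply: rproj_surj.
move: q q0 qs; move: L => L q q0 qs.
pose x j := if insub j is Some i then q 'X_(i : 'I_n) else 0.
have xE (i : 'I_n) : x i = q 'X_i by rewrite /x valK.
have gen : generated (q \o @mpolyC n k) n x.
  move=> Q QC QX QD QM y; have [v <-] := qs y.
  elim/mpoly_subring_ind: v => [c|i|u v hu hv|u v hu hv].
  - exact: QC.
  - by rewrite -xE; apply: QX.
  - by rewrite rmorphD; apply: QD.
  by rewrite rmorphM; apply: QM.
have [K [j [jC js]]] := zariski gen.
have [a ha] := choice (fun i : 'I_n => js (q 'X_i)).
exists K, a => v /Xm mv; apply: (fmorph_inj j); rewrite rmorph0 -(q0 v mv).
move: v {mv}.
apply: (mpoly_rmorph_eq (f :=
  (j \o (meval a \o (map_mpoly (GRing.in_alg K)))) : {rmorphism Sk -> L}) (g := q)) => [c|i] /=.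
  by rewrite map_mpolyC mevalC jC.
by rewrite map_mpolyX mevalXU.
Qed.

End Fiber.

Lemma smooth_point (R : comPzRingType) (phi : {rmorphism int -> R}) n
    (f : {rmorphism {mpoly int[n]} -> R}) (P : set R) :
  smooth phi -> (forall c, f c%:MP = phi c) -> (forall y, exists x, f x = y) ->
  prime_ideal P ->
  exists (k : fieldType) (kap : {rmorphism int -> k}) (K : fieldExtType k) (a : 'I_n -> K)
    (I : set {mpoly K[n]}) (hI : is_ideal I),
  [/\ (forall m, kap m = 0 <-> P (phi m)) /\
        (forall x, exists m d, ~ P (phi d) /\ x * kap d = kap m),
      forall u, P (f u) -> (map_mpoly (GRing.in_alg K) (map_mpoly kap u)).@[a] = 0,
      regular_ring (rquot hI),
      forall u, f u = 0 -> I (map_mpoly (GRing.in_alg K) (map_mpoly kap u)) &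
      forall J, is_ideal J ->
        (forall u, f u = 0 -> J (map_mpoly (GRing.in_alg K) (map_mpoly kap u))) -> I `<=` J].
Proof.
move=> [_ _ hreg] fC fs prP; have [hP P1 PM] := prP.
pose p0 := phi @^-1` P.
have pr0 : prime_ideal p0.
  have [P0 PD PMl] := hP; split; [split| |]; rewrite /p0 /preimage /=.
  - by rewrite rmorph0.
  - by move=> x y hx hy; rewrite rmorphD; apply: PD.
  - by move=> r x hx; rewrite rmorphM; apply: PMl.
  - by rewrite rmorph1.
  by move=> x y; rewrite rmorphM; apply: PM.
have [Ap [lA [k [qA [hlA hqA q0 qfrac]]]]] := residue_field pr0.
pose kap : {rmorphism int -> k} := (qA \o lA).
have kap0 m : kap m = 0 <-> p0 m by apply: q0.
have kap_frac x : exists m d, ~ p0 d /\ x * kap d = kap m by apply: qfrac.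
have [F [psi [rF [hF hrF psiE]]]] := fiber_ex fC fs pr0 kap0 kap_frac hlA hqA (fun=> erefl).
have [K [a ha]] := fiber_point fC pr0 kap0 kap_frac prP (fun m => conj id id).
have hI : is_ideal (spreadK p0 kap (K := K) [set u | f u = 0]) by apply: ideal_genP.
have [g1 [g2 ht]] := fiber_tensor hrF psiE (rquotP hI).
exists k, kap, K, a, _, hI; split.
- by [].
- by move=> u Pu; apply: (ha (map_mpoly kap u)); exists 1, u; split=> //;
  [by case: pr0|by rewrite rmorph1 mpolyC1 mul1r].
- by apply: (hreg _ pr0 _ _ _ hF) ht.
- move=> u fu; apply: ideal_gen_mem; exists (map_mpoly kap u) => //.
  by exists 1, u; split=> //; [case: pr0|rewrite rmorph1 mpolyC1 mul1r].
move=> J hJ hJu; apply: ideal_gen_min => // _ [v [m [u [pm fu e]]] <-].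
have km : kap m != 0 by apply/eqP => /kap0.
have -> : v = (kap m)^-1%:MP * map_mpoly kap u.
  by rewrite -e mulrA -mpolyCM mulVf // mpolyC1 mul1r.
by rewrite rmorphM /= mulrC; apply: (idealMr _ hJ); apply: hJu.
Qed.

(** * Jacobian charts *)

Lemma satw_mem (R : comPzRingType) (M J : set R) u : M 1 -> J u -> satw M J u.
Proof. by move=> M1 Ju; exists 1; rewrite ?mul1r. Qed.

Section ScalarDescent.
Variables (k : fieldType) (K : fieldExtType k) (n : nat).
Notation Sk := {mpoly k[n]}.
Notation SK := {mpoly K[n]}.
Notation mapK := (map_mpoly (GRing.in_alg K) : {rmorphism Sk -> SK}).

Let e : (\dim {:K}).-tuple K := vbasis {:K}.

Let comp (b : 'I_(\dim {:K})) (x : SK) : Sk := map_mpoly (coord e b) x.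

Let compE b x m : (comp b x)@_m = coord e b x@_m.
Proof. exact: mcoeff_map_mpoly. Qed.

Let comp_mul b x v : comp b (x * mapK v) = comp b x * v.
Proof.
apply/mpolyP => m; rewrite compE !mcoeffM raddf_sum; apply: eq_bigr => p _ /=.
by rewrite mcoeff_map_mpoly compE /= mulr_algr linearZ mulrC.
Qed.

Let comp_sum (x : SK) : x = \sum_(b < \dim {:K}) (e`_b)%:MP * mapK (comp b x).
Proof.
apply/mpolyP => m; rewrite raddf_sum {1}(coord_vbasis (memvf x@_m)).
apply: eq_bigr => b _; rewrite /= mcoeffCM mcoeff_map_mpoly compE /=.
by rewrite mulr_algr.
Qed.

(** K[x] is free over k[x] on a basis of [K], so the relation can be read in each coordinate; as
    w(a) is not 0, some coordinate of [w] does not vanish at [a]. *)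
Lemma scalar_descent (a : 'I_n -> K) i (h : nat -> Sk) (c : nat -> SK) (w : SK) (u : Sk) :
  w.@[a] != 0 -> w * mapK u = \sum_(l < i) c l * mapK (h l) ->
  exists w' (d : nat -> Sk), (mapK w').@[a] != 0 /\ w' * u = \sum_(l < i) d l * h l.
Proof.
move=> wa eq; have [b hb] : exists b, (mapK (comp b w)).@[a] != 0.
  apply: contrapT => hno; case/negP: wa; rewrite (comp_sum w) (raddf_sum (meval a)).
  have h0 b : (mapK (comp b w)).@[a] = 0 by apply/eqP; apply: contrapT => /negP nz; apply: hno;
    exists b.
  apply/eqP; apply: big1 => b _; transitivity ((e`_b)%:MP.@[a] * (mapK (comp b w)).@[a]).
    exact: mevalM.
  by rewrite h0 mulr0.
exists (comp b w), (fun l => comp b (c l)); split=> //.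
rewrite -comp_mul eq /comp raddf_sum; apply: eq_bigr => l _.
exact: comp_mul.
Qed.

End ScalarDescent.

Lemma map_mpoly_deriv (A B : comNzRingType) (g : {rmorphism A -> B}) n (u : {mpoly A[n]}) j :
  (map_mpoly g u)^`M(j) = map_mpoly g u^`M(j).
Proof.
by apply/mpolyP => m; rewrite mcoeff_mderiv !mcoeff_map_mpoly mcoeff_mderiv raddfMn.
Qed.

Lemma char_generator (k : fieldType) (kap : {rmorphism int -> k}) :
  exists p : int, kap p = 0 /\ forall m, kap m = 0 -> exists q, m = p * q.
Proof.
have kapE m : kap m = m%:~R by rewrite -[m in LHS]intz rmorph_int.
have [ex|no] := pselect (exists p, (0 < p)%N && ((p%:R : k) == 0)); last first.
  exists 0; rewrite rmorph0; split=> // m; rewrite kapE => m0; exists 0; rewrite mulr0.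
  apply/eqP; rewrite -absz_eq0; apply: contrapT => /negP; rewrite -lt0n => am.
  apply: no; exists `|m|%N; rewrite am /=; case: m m0 {am} => m m0; first exact/eqP.
  by rewrite /= -oppr_eq0; apply/eqP.
case: (ex_minnP ex) => p /andP[p0 /eqP kp] pmin.
exists p%:Z; rewrite kapE; split=> // m; rewrite kapE => km; exists (m %/ p)%Z.
have pz : p%:Z != 0 by rewrite -lt0n.
rewrite {1}(divz_eq m p) mulrC -[RHS]addr0; congr (_ + _).
case e : (m %% p)%Z => [r|r]; last by have := modz_ge0 m pz; rewrite e.
have rp : (r < p)%N by have := ltz_pmod m (p0 : 0 < p%:Z); rewrite e.
have kr : (r%:R : k) = 0.
  by move: km; rewrite (divz_eq m p) e rmorphD rmorphM /= -!pmulrn kp mulr0 add0r.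
case: r e rp kr => [//|r] e rp kr.
by have := pmin r.+1; rewrite /= kr eqxx => /(_ erefl); rewrite leqNgt rp.
Qed.

Section Chart.
Variables (R : comPzRingType) (n : nat).
Notation S := {mpoly int[n]}.
Variable f : {rmorphism S -> R}.

(** Once [g] is inverted, [h] is a regular sequence generating the kernel of [f], and [nu] is up to
    the unit [g] a right inverse of its Jacobian matrix. A single factor [g] serves in every clause,
    since finitely many denominators are multiplied together. *)
Definition chart (g : S) : Prop :=
  exists (c : nat) (h : nat -> S) (nu : 'I_n -> nat -> S),
  [/\ forall l, (l < c)%N -> f (h l) = 0,
      forall u, f u = 0 -> nspan h c (g * u),
      forall l l', (l < c)%N -> (l' < c)%N ->
        \sum_j (h l)^`M(j) * nu j l' = (l == l')%:R * g &
      forall i, (i < c)%N -> forall u, nspan h i (h i * u) -> nspan h i (g * u)].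

Section Descent.
Variables (k : fieldType) (kap : {rmorphism int -> k}) (K : fieldExtType k) (a : 'I_n -> K).
Hypothesis kap_frac : forall x, exists m d, kap d <> 0 /\ x * kap d = kap m.
Notation Sk := {mpoly k[n]}.
Notation SK := {mpoly K[n]}.
Notation redk := (map_mpoly kap : {rmorphism S -> Sk}).
Notation mapK := (map_mpoly (GRing.in_alg K) : {rmorphism Sk -> SK}).
Variables (red : {rmorphism S -> SK}) (ev : {rmorphism S -> K}).
Hypothesis redE : forall u, red u = mapK (redk u).
Hypothesis evE : forall u, ev u = (red u).@[a].
Notation U := [set g : S | ev g != 0].
Notation UK := [set w : SK | w.@[a] != 0].

Let U_mulset : mulset U.
Proof.
split=> [|x y hx hy]; first by rewrite /= !rmorph1 oner_eq0.
by change (ev (x * y) != 0); rewrite rmorphM mulf_neq0.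
Qed.

Let denoms (i : nat) (c : nat -> Sk) : exists m (d : nat -> S), kap m <> 0 /\
  forall l, (l < i)%N -> (kap m)%:MP * c l = redk (d l).
Proof.
have one (v : Sk) : exists m u, kap m <> 0 /\ (kap m)%:MP * v = redk u.
  apply: (@fiber_denom n [set m | kap m = 0] k kap); last exact: kap_frac.
  split; first exact: ker_ideal.
    by rewrite /= rmorph1; apply/eqP/oner_neq0.
  by move=> x y /eqP; rewrite /= rmorphM mulf_eq0 => /orP[]/eqP; [left|right].
elim: i => [|i [m [d [km hd]]]]; first by exists 1, (fun=> 0); split=> //; rewrite rmorph1;
  apply/eqP/oner_neq0.
have [m' [u [km' hu]]] := one (c i).
exists (m' * m), (fun l => if l == i then m%:MP * u else m'%:MP * d l); split.
  by rewrite rmorphM => /eqP; rewrite mulf_eq0 => /orP[]/eqP.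
move=> l; rewrite ltnS leq_eqVlt; case: eqP => [->|_] /= li.
  rewrite (rmorphM redk) -hu (rmorphM kap) mpolyCM /= map_mpolyC.
  by rewrite -mulrA mulrCA.
by rewrite (rmorphM redk) -(hd l) // (rmorphM kap) mpolyCM /= map_mpolyC mulrA.
Qed.

Let redk_integral i (h : nat -> S) u : satw UK (nspan (fun l => red (h l)) i) (red u) ->
  exists w (d : nat -> S), U w /\ redk (w * u - \sum_(l < i) d l * h l) = 0.
Proof.
move=> [w wa [c ec]]; have ec' : w * mapK (redk u) = \sum_(l < i) c l * mapK (redk (h l)).
  by rewrite -redE ec; apply: eq_bigr => l _; rewrite redE.
have [w' [d [wa' ed]]] := scalar_descent (h := fun l => redk (h l)) wa ec'.
have [m [d' [km hd]]] := denoms i.+1 (fun l : nat => if l is l'.+1 then d l' else w').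
exists (d' 0%N), (fun l => d' l.+1); split.
  have e0 : redk (d' 0%N) = (kap m)%:MP * w' by rewrite -(hd 0%N).
  rewrite /= evE redE e0 (rmorphM mapK) (rmorphM (meval a)) mulf_neq0 //.
  by rewrite /= map_mpolyC mevalC fmorph_eq0; apply/eqP.
rewrite (rmorphB redk) (rmorphM redk) -(hd 0%N) // (rmorph_sum redk) -mulrA ed mulr_sumr -sumrB.
by rewrite big1 // => l _; rewrite (rmorphM redk) -(hd l.+1) ?ltnS // mulrA subrr.
Qed.

Variable p : int.
Hypothesis kp : kap p = 0.
Hypothesis p_gen : forall m, kap m = 0 -> exists q, m = p * q.

Let redk_ker v : redk v = 0 -> exists v', v = p%:MP * v'.
Proof.
move=> e; have hm m : exists q, v@_m = p * q.
  by apply: p_gen; rewrite -mcoeff_map_mpoly e mcoeff0.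
have [q hq] := choice hm; exists (\sum_(m <- msupp v) (q m)%:MP * 'X_[m]).
rewrite mulr_sumr [LHS]mpolyE; apply: eq_bigr => m _.
by rewrite -mul_mpolyC hq mpolyCM mulrA.
Qed.

Let red_p v : red (p%:MP * v) = 0.
Proof.
have e : redk p%:MP = (kap p)%:MP by exact: map_mpolyC.
by rewrite redE (rmorphM redk) e kp mpolyC0 mul0r rmorph0.
Qed.

Let ev_p v : ev (p%:MP * v) = 0.
Proof. by rewrite evE red_p meval0. Qed.

Let integral_descent i (h : nat -> S) u : satw UK (nspan (fun l => red (h l)) i) (red u) ->
  exists w v, U w /\ nspan h i (w * u - p%:MP * v).
Proof.
move=> /redk_integral[w [d [Uw /redk_ker[v e]]]]; exists w, v; split=> //.
by exists d; rewrite -e opprB addrC subrK.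
Qed.

(** [X] is finitely generated, and a product [w] of the given multipliers maps it into J + p X. The
    determinant trick yields a multiplier w^N plus a multiple of [p]; as [p] vanishes at the point,
    this one does not. *)
Let uniform (X J : set S) : is_ideal X -> is_ideal J ->
  (forall u, X u -> exists w v, [/\ U w, X v & J (w * u - p%:MP * v)]) ->
  exists2 g, U g & forall u, X u -> J (g * u).
Proof.
move=> hX hJ hw; have accS : acc S by apply: acc_mpoly; apply: acc_int.
have [N [x [Xx Xspan]]] := acc_fg accS X.
have hw' j : exists w v, [/\ U w, X v & (j < N)%N -> J (w * x j - p%:MP * v)].
  have [jN|] := ltnP j N; first by have [w [v [? ? ?]]] := hw _ (Xx j jN); exists w, v.
  by exists 1, 0; split=> //; [case: U_mulset|case: hX].
have [wj hwj] := choice hw'; have [vj hvj] := choice hwj.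
pose w := \prod_(j < N) wj j.
have Uw : U w.
  by apply: (big_ind U) => [|y z|j _]; [apply U_mulset.1|apply U_mulset.2|have [] := hvj j].
have [||e [q eq] he] := @nakayama _ J [set y | exists q, y = p%:MP * q] w N x hJ.
- split; first by exists 0; rewrite mulr0.
    by move=> _ _ [y ->] [z ->]; exists (y + z); rewrite mulrDr.
  by move=> r _ [y ->]; exists (r * y); rewrite mulrCA.
- move=> j jN; have [Uj /Xspan[d ed] /(_ jN) hj] := hvj j.
  have [r er] : exists r, w = r * wj j.
    by exists (\prod_(l < N | l != Ordinal jN) wj l); rewrite /w (bigD1 (Ordinal jN)) //= mulrC.
  exists (fun l => p%:MP * (r * d l)); split=> [l|]; first by exists (r * d l).
  have -> : \sum_(l < N) p%:MP * (r * d l) * x l = p%:MP * r * vj j.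
    by rewrite ed mulr_sumr; apply: eq_bigr => l _; rewrite !mulrA.
  rewrite er; have -> : r * wj j * x j - p%:MP * r * vj j = (wj j * x j - p%:MP * vj j) * r by ring.
  exact: idealMr.
exists (w ^+ N + e).
  by rewrite /= rmorphD eq ev_p addr0 rmorphXn expf_neq0.
move=> u /Xspan[d ->]; rewrite mulr_sumr; apply: ideal_sum => // l _.
by rewrite mulrCA mulrC; apply: idealMr => //; apply: he.
Qed.

Hypothesis p_torsion : p != 0 -> forall v, f (p%:MP * v) = 0 -> f v = 0.

Variables (c : nat) (h : nat -> S).
Hypothesis fh : forall l, (l < c)%N -> f (h l) = 0.
Hypothesis eqs : forall u, f u = 0 -> satw UK (nspan (fun l => red (h l)) c) (red u).
Hypothesis L_prime : forall i, (i <= c)%N ->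
  prime_ideal (satw UK (nspan (fun l => red (h l)) i)).
Hypothesis L_strict : forall i, (i < c)%N ->
  ~ satw UK (nspan (fun l => red (h l)) i) (red (h i)).

(** A relation in the fiber gives w u = p v modulo [h], with [u] in the kernel of [f]. Then p v is
    in the kernel, and by flatness so is [v], as [uniform] requires. *)
Let chart_equations : exists2 g, U g & forall u, f u = 0 -> nspan h c (g * u).
Proof.
apply: (@uniform [set u | f u = 0]); [exact: ker_ideal|exact: nspan_ideal|].
move=> u fu; have [w [v [Uw e]]] := integral_descent (eqs fu).
have fJ x : nspan h c x -> f x = 0.
  by move: x; apply: nspan_sub; [apply: ker_ideal|].
have [p0|p0] := eqVneq p 0.
  exists w, 0; rewrite mulr0; split=> //; first exact: rmorph0.
  by move: e; rewrite p0 mpolyC0 mul0r.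
exists w, v; split=> //; apply: p_torsion => //.
by have /eqP := fJ _ e; rewrite rmorphB rmorphM fu mulr0 sub0r oppr_eq0 => /eqP.
Qed.

(** In a relation for p v, reduction modulo [p] puts the last coefficient in the prime ideal of the
    earlier equations, which does not contain [h i]. Lifting this back replaces that coefficient by
    a multiple of [p], and one equation fewer is left. *)
Let p_regular i v : p != 0 -> (i <= c)%N ->
  satw U (nspan h i) (p%:MP * v) -> satw U (nspan h i) v.
Proof.
move=> p0; elim: i v => [|i IH] v ic [w Uw [d e]].
  exists w => //; move/eqP: e; rewrite big_ord0 mulrCA mulf_eq0 mpolyC_eq0 (negbTE p0) /=.
  by move=> /eqP ->; case: (nspan_ideal h 0).
have [Lid L1 Lpr] := L_prime (ltnW ic).
have Ld : satw UK (nspan (fun l => red (h l)) i) (red (d i)).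
  have : satw UK (nspan (fun l => red (h l)) i) (red (d i) * red (h i)).
    apply: satw_mem; first by rewrite /= rmorph1 oner_eq0.
    exists (fun l => - red (d l)).
    have : red (w * (p%:MP * v)) = 0 by rewrite (rmorphM red) red_p mulr0.
    rewrite e big_ord_recr (rmorphD red) (rmorph_sum red) (rmorphM red (d i)) addrC => /eqP.
    rewrite addr_eq0 => /eqP ->; rewrite -sumrN; apply: eq_bigr => l _.
    by rewrite (rmorphM red) mulNr.
  by move=> /Lpr[//|/(L_strict ic)].
have [w' [v' [Uw' [d' e']]]] := integral_descent Ld.
have [w2 U2 H2] : satw U (nspan h i) (w' * w * v - v' * h i).
  apply: IH; first exact: ltnW.
  apply: satw_mem; first exact: U_mulset.1.
  exists (fun l => w' * d l + d' l * h i); under eq_bigr do rewrite mulrDl.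
  have -> : p%:MP * (w' * w * v - v' * h i) = w' * (w * (p%:MP * v)) - p%:MP * v' * h i by ring.
  rewrite e big_ord_recr /= mulrDr mulrA;
    have {e'} e' : w' * d i = \sum_(l < i) d' l * h l + p%:MP * v'.
    by rewrite -e' subrK.
  rewrite e' mulrDl addrA addrK big_split /= mulr_sumr mulr_suml.
  by congr (_ + _); apply: eq_bigr => l _; ring.
exists (w2 * w' * w); first by apply: U_mulset.2 => //; apply: U_mulset.2.
apply/nspanS; exists (w2 * v').
by have -> : w2 * w' * w * v - w2 * v' * h i = w2 * (w' * w * v - v' * h i) by ring.
Qed.

(** In the fiber [u] is in the ideal by primality, so w u = p v modulo the earlier equations; then p
    h_i v is in the ideal and [p_regular] removes [p], so that [v] satisfies the hypothesis on
    [u]. *)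
Let chart_regular i : (i < c)%N ->
  exists2 g, U g & forall u, nspan h i (h i * u) -> nspan h i (g * u).
Proof.
move=> ic; have hJ := nspan_ideal h i; have [J0 JD JM] := hJ.
apply: (@uniform [set u | nspan h i (h i * u)]) => //.
  split; rewrite /=; first by rewrite mulr0.
    by move=> x y hx hy; rewrite mulrDr; apply: JD.
  by move=> r x hx; rewrite mulrCA; apply: JM.
move=> u hu; have [Lid L1 Lpr] := L_prime (ltnW ic).
have Lu : satw UK (nspan (fun l => red (h l)) i) (red u).
  have : satw UK (nspan (fun l => red (h l)) i) (red (h i) * red u).
    apply: satw_mem; first by rewrite /= rmorph1 oner_eq0.
    have [d e] := hu; exists (fun l => red (d l)).
    by rewrite -(rmorphM red) e (rmorph_sum red); apply: eq_bigr => l _; rewrite (rmorphM red).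
  by move=> /Lpr[/(L_strict ic)|].
have [w [v [Uw e]]] := integral_descent Lu.
have [p0|p0] := eqVneq p 0.
  exists w, 0; split=> //; first by rewrite /= mulr0.
  by move: e; rewrite p0 mpolyC0 !mul0r.
have [w' Uw' H'] : satw U (nspan h i) (h i * v).
  apply: p_regular => //; first exact: ltnW.
  apply: satw_mem; first exact: U_mulset.1.
  have -> : p%:MP * (h i * v) = w * (h i * u) - h i * (w * u - p%:MP * v) by ring.
  by apply: idealB => //; apply: JM.
exists (w' * w), (w' * v); split; [exact: U_mulset.2|by rewrite /= mulrCA|].
have -> : w' * w * u - p%:MP * (w' * v) = w' * (w * u - p%:MP * v) by ring.
exact: JM.
Qed.

Let chart_jacobian : row_free (\matrix_(l < c, j < n) ((red (h l))^`M(j)).@[a]) ->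
  exists g (nu : 'I_n -> nat -> S), U g /\ forall l l', (l < c)%N -> (l' < c)%N ->
    \sum_j (h l)^`M(j) * nu j l' = (l == l')%:R * g.
Proof.
set A := \matrix_(l < c, j < n) _ => fA.
have fAT : row_full A^T by rewrite /row_full mxrank_tr.
have := fullrowsub_unit fAT; move: (fullrankfun fAT) => ff.
pose D : 'M[S]_c := \matrix_(j, l) (h l)^`M(ff j).
have -> : rowsub ff A^T = map_mx ev D.
  by apply/matrixP => j l; rewrite !mxE evE !redE /= !map_mpoly_deriv.
rewrite unitmxE unitfE det_map_mx => UD.
exists (\det D), (fun j l' => if insub l' is Some l'' then
  \sum_(j' < c | ff j' == j) (\adj D) (l'' : 'I_c) j' else 0); split=> // l l' lc lc'.
rewrite (insubT (fun l => (l < c)%N) lc').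
have := congr1 (fun M : 'M_c => M (Ordinal lc') (Ordinal lc)) (mul_adj_mx D).
rewrite /= !mxE => e; transitivity (\sum_(j' < c) (\adj D) (Ordinal lc') j' * D j' (Ordinal lc)).
  rewrite (partition_big ff predT) //=; apply: eq_bigr => j _.
  by rewrite mulr_sumr; apply: eq_bigr => j' /eqP <-; rewrite mulrC [D _ _]mxE.
by rewrite e mulr_natl -val_eqE /= eq_sym.
Qed.

Lemma chart_at : row_free (\matrix_(l < c, j < n) ((red (h l))^`M(j)).@[a]) ->
  exists2 g, U g & chart g.
Proof.
move=> /chart_jacobian[gD [nu [UD hnu]]]; have [gI UI hI] := chart_equations.
have hC i : exists g, U g /\ ((i < c)%N -> forall u, nspan h i (h i * u) -> nspan h i (g * u)).
  have [/chart_regular[g Ug hg]|_] := ltnP i c; first by exists g.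
  by exists 1; split=> //; apply: U_mulset.1.
have [gi hgi] := choice hC; pose gC := \prod_(i < c) gi i.
have UC : U gC.
  by apply: (big_ind U) => [|y z|j _]; [apply U_mulset.1|apply U_mulset.2|have [] := hgi j].
exists (gC * (gD * gI)); first by apply: U_mulset.2 => //; apply: U_mulset.2.
exists c, h, (fun j l => nu j l * (gC * gI)); split=> //.
- move=> u fu; have -> : gC * (gD * gI) * u = gI * u * (gC * gD) by ring.
  by apply: idealMr; [apply: nspan_ideal|apply: hI].
- move=> l l' lc lc'; under eq_bigr do rewrite mulrA.
  by rewrite -mulr_suml hnu //; ring.
move=> i ic u hu; have [r er] : exists r, gC = r * gi i.
  by exists (\prod_(l < c | l != Ordinal ic) gi l); rewrite /gC (bigD1 (Ordinal ic)) //= mulrC.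
rewrite er; have -> : r * gi i * (gD * gI) * u = gi i * u * (r * gD * gI) by ring.
by apply: idealMr; [apply: nspan_ideal|apply: (hgi i).2].
Qed.

End Descent.

Theorem chart_cover (phi : {rmorphism int -> R}) (P : set R) : smooth phi ->
  (forall c, f c%:MP = phi c) -> (forall y, exists x, f x = y) -> prime_ideal P ->
  exists2 g, ~ P (f g) & chart g.
Proof.
move=> hR fC fs prP; have [k [kap [K [a [I [hI [[kap0 kap_frac] Pa hreg fI Imin]]]]]]] :=
  smooth_point hR fC fs prP.
pose red : {rmorphism S -> {mpoly K[n]}} := (map_mpoly (GRing.in_alg K) \o map_mpoly kap).
pose A (c : nat) (h : nat -> S) := \matrix_(l < c, j < n) ((red (h l))^`M(j)).@[a].
have AE c h l : row l (A c h) = grad a (red (h l)) by apply/rowP => j; rewrite !mxE.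
pose Q c := `[< exists h : nat -> S, (forall l, (l < c)%N -> f (h l) = 0) /\ row_free (A c h) >].
have exQ : exists c, Q c.
  exists 0%N; apply/asboolP; exists (fun=> 0); split=> //.
  by rewrite /row_free; apply/eqP/eqP; rewrite -leqn0 rank_leq_row.
have bQ c : Q c -> (c <= n)%N.
  by move=> /asboolP[h [_ /eqP <-]]; apply: rank_leq_col.
case: (ex_maxnP exQ bQ) => c /asboolP[h [fh hA]] cmax.
have spanA u : f u = 0 -> (grad a (red u) <= A c h)%MS.
  move=> fu; apply: contrapT => /negP nle.
  pose h' l := if l == c then u else h l.
  have hA' : \rank (A c.+1 h') = c.+1.
    apply/eqP; rewrite eqn_leq rank_leq_row /= -{1}(eqP hA) rank_ltmx //.
    rewrite ltmxE; apply/andP; split.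
      apply/row_subP => l; have -> : row l (A c h) = row (widen_ord (leqnSn c) l) (A c.+1 h').
        by rewrite !AE /h' /= ltn_eqF.
      exact: row_sub.
    apply/negP => /row_subP/(_ ord_max); rewrite AE /h' eqxx.
    exact/negP.
  suff /cmax : Q c.+1 by rewrite ltnn.
  apply/asboolP; exists h'; split; last exact/eqP.
  by move=> l; rewrite ltnS leq_eqVlt /h'; case: eqP => //= _; apply: fh.
have red0 u : f u = 0 -> (red u).@[a] = 0.
  by move=> fu; apply: Pa; rewrite fu; have [[]] := prP.
(* It is enough to look at the kernel of [f]: where [u] vanishes, the gradient of r u is a multiple
   of that of [u], so the right side is an ideal. *)
have IA : I `<=` [set u | u.@[a] = 0 /\ (grad a u <= A c h)%MS].
  apply: Imin; last by move=> u fu; split; [apply: red0|apply: spanA].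
  split=> [|u v [u0 gu] [v0 gv]|r u [u0 gu]]; rewrite /=.
  - split; first exact: meval0.
    by have -> : grad a 0 = 0 by [apply/rowP => j; rewrite !mxE linear0 meval0]; apply: sub0mx.
  - by rewrite mevalD u0 v0 addr0 gradD; split=> //; apply: addmx_sub.
  by rewrite mevalM u0 mulr0 gradM u0 scale0r add0r; split=> //; apply: scalemx_sub.
have [p [kp pgen]] := char_generator kap.
have [Lpr Lst] := regular_parameters (h := fun l => red (h l)) (fun l lc => red0 _ (fh l lc)) hA.
have [|||g Ug hg] := chart_at (red := red) (ev :=
  (meval a \o red : {rmorphism S -> K})) _ (fun=> erefl) (fun=> erefl) kp pgen _ fh _ Lpr Lst hA.
- by move=> x; have [m [d [pd e]]] := kap_frac x; exists m, d; split=> // /kap0.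
- move=> p0 v; rewrite (rmorphM f) fC => e; have [_ hfl _] := hR.
  apply: (flat_int_torsion_free (d := `|p|%N) hfl); first by rewrite lt0n absz_eq0.
  have pE : phi p = p%:~R by rewrite -[in LHS](intz p) rmorph_int.
  move: e; rewrite pE {pE}; case: (p) => d //.
  by rewrite NegzE mulrNz mulNr => /eqP; rewrite oppr_eq0 => /eqP.
- move=> u fu; apply: (regular_local_equations (fun u Iu => (IA u Iu).1) hreg _ hA) (fI u fu).
    by move=> l lc; apply/fI/fh.
  by move=> v /IA[].
exists g => // Pg; case/negP: Ug; apply/eqP; exact: Pa.
Qed.

End Chart.

(** * Finiteness over a chart *)

Section Transfer.
Variables (R S T : comPzRingType) (f : {rmorphism S -> R}) (E : {rmorphism S -> T}).
Variables (g : S) (J : set T).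
Hypothesis hJ : is_ideal J.
Hypothesis fsurj : forall y, exists x, f x = y.
Hypothesis fJ : forall u, f u = 0 -> J (E u).
Hypothesis Jf : forall u, J (E u) -> exists N, f (g ^+ N * u) = 0.
Hypothesis JT : forall x, exists N v, J (E g ^+ N * x - E v).

Let hJm : is_submod (J : set T^o).
Proof. by case: hJ. Qed.

Let cf t : coch S^o t -> coch R^o t := cmap (f : S^o -> R^o) (t := t).
Let cE t : coch S^o t -> coch T^o t := cmap (E : S^o -> T^o) (t := t).

Let fD (x y : S^o) : (f : S^o -> R^o) (x + y) = f x + f y. Proof. exact: rmorphD. Qed.
Let fZ (r : S) (x : S^o) : (f : S^o -> R^o) (r *: x) = f r *: (f x : R^o).
Proof. exact: rmorphM. Qed.
Let ED (x y : S^o) : (E : S^o -> T^o) (x + y) = E x + E y. Proof. exact: rmorphD. Qed.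
Let EZ (r : S) (x : S^o) : (E : S^o -> T^o) (r *: x) = E r *: (E x : T^o).
Proof. exact: rmorphM. Qed.

Let pwf F s : (fun i => f (pw F s i)) = pw (fun i => f (F i)) s.
Proof. by apply/funext => i; rewrite /= rmorphXn. Qed.
Let pwE F s : (fun i => E (pw F s i)) = pw (fun i => E (F i)) s.
Proof. by apply/funext => i; rewrite /= rmorphXn. Qed.

Let cf_onto t (z : coch R^o t) : exists w, cf w = z.
Proof.
elim: t z => [|t IH] z /=; first exact: fsurj.
by case: z => x y; have [u <-] := IH x; have [v <-] := IH y; exists (u, v).
Qed.

Let cfJ t (w : coch S^o t) : cf w = 0 -> call (J : set T^o) (cE w).
Proof.
elim: t w => [|t IH] w; first exact: fJ.
by case: w => u v [hu hv]; split; apply: IH.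
Qed.

Let cJf t (w : coch S^o t) : call (J : set T^o) (cE w) -> exists N, cf (g ^+ N *: w) = 0.
Proof.
elim: t w => [|t IH] w; first exact: Jf.
case: w => u v [/IH[N hu] /IH[N' hv]]; exists (N + N')%N.
have cZ r (x : coch S^o t) : cf (r *: x) = f r *: cf x by apply: cmapZ.
rewrite /cf /= exprD; congr pair; first by rewrite mulrC -scalerA -/(cf _) cZ hu scaler0.
by rewrite -scalerA -/(cf _) cZ hv scaler0.
Qed.

Let cJT t (x : coch T^o t) : exists N v, call (J : set T^o) (E g ^+ N *: x - cE v).
Proof.
elim: t x => [|t IH] x; first exact: JT.
case: x => x y; have [N [u hu]] := IH x; have [N' [v hv]] := IH y.
exists (N + N')%N, (g ^+ N' *: u, g ^+ N *: v).
have cZ r (w : coch S^o t) : cE (r *: w) = E r *: cE w by apply: cmapZ.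
have [_ _ hZ] := call_sub t hJm.
split=> /=; rewrite -/(cE _) cZ rmorphXn exprD.
  by rewrite mulrC -scalerA -scalerBr; apply: hZ.
by rewrite -scalerA -scalerBr; apply: hZ.
Qed.

(** [R] and T/J agree once [g] is inverted. A relation over T/J comes back to [R] up to a power of
    [g], and as [P] is a prime not containing f(g), that power can be cancelled. *)
Lemma transfer t (F : nat -> S) s (z : coch R^o t) (P : set R) :
  prime_ideal P -> ~ P (f g) -> kd (pw (fun i => f (F i)) s.+1) z = 0 ->
  (forall r, P r <-> exists m y, r *: ktr (pw (fun i => f (F i)) m) z =
    kd (pw (fun i => f (F i)) (s.+1 + m)) y) ->
  exists z' : coch T^o t, call (J : set T^o) (kd (pw (fun i => E (F i)) s.+1) z') /\
    forall r, P (f r) <-> kann J (fun i => E (F i)) s.+1 z' (E r).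
Proof.
move=> prP Pg dz hP; have [w ew] := cf_onto z.
have kf l (x : coch S^o t) : cf (kd l x) = kd (fun i => f (l i)) (cf x) by apply: cmap_kd.
have kE l (x : coch S^o t) : cE (kd l x) = kd (fun i => E (l i)) (cE x) by apply: cmap_kd.
have tf l (x : coch S^o t) : cf (ktr l x) = ktr (fun i => f (l i)) (cf x) by apply: cmap_ktr.
have tE l (x : coch S^o t) : cE (ktr l x) = ktr (fun i => E (l i)) (cE x) by apply: cmap_ktr.
have zf r (x : coch S^o t) : cf (r *: x) = f r *: cf x by apply: cmapZ.
have zE r (x : coch S^o t) : cE (r *: x) = E r *: cE x by apply: cmapZ.
have bf (x y : coch S^o t) : cf (x - y) = cf x - cf y by apply: cmapB.
have bE (x y : coch S^o t) : cE (x - y) = cE x - cE y by apply: cmapB.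
exists (cE w); split; first by rewrite -pwE -kE; apply: cfJ; rewrite kf pwf ew.
move=> r; split=> [/hP[m [y e]]|[m [Y hY]]].
  have [x ex] := cf_onto y; exists m, (cE x).
  rewrite -!pwE -tE -zE -kE -bE; apply: cfJ.
  by rewrite bf zf tf kf !pwf ew ex e subrr.
have [N [v hv]] := cJT Y; have [_ hD hZ] := call_sub t hJm.
have /cJf[M] : call (J : set T^o) (cE ((g ^+ N * r) *: ktr (pw F m) w - kd (pw F (s.+1 + m)) v)).
  rewrite bE zE tE kE !pwE rmorphM rmorphXn -scalerA.
  have := hD _ _ (hZ (E g ^+ N) _ hY) (call_kd (pw (fun i => E (F i)) (s.+1 + m)) hJm hv).
  have ek (L : nat -> T) : kd L (E g ^+ N *: Y - cE v) = E g ^+ N *: kd L Y - kd L (cE v).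
    by rewrite linearB linearZ.
  by rewrite ek scalerBr addrA subrK.
rewrite zf bf zf tf kf !pwf ew scalerBr => /eqP; rewrite subr_eq0 scalerA => /eqP e.
have : P (f (g ^+ M) * f (g ^+ N * r)) by apply/hP; exists m, (f (g ^+ M) *: cf v);
  rewrite e linearZ.
have [hPi P1 PM] := prP; have Pgn a : ~ P (f (g ^+ a)).
  elim: a => [|a IH]; first by rewrite expr0 rmorph1.
  by rewrite exprS rmorphM => /PM[].
by move=> /PM[/Pgn//|]; rewrite rmorphM => /PM[/Pgn//|].
Qed.

End Transfer.

(** [koszul_one_step] is applied from the last equation down; each equation removed becomes a
    generator, and the ideal ends up zero. *)
Lemma koszul_descent (T : comPzRingType) (H : nat -> T) (C : nat) :
  (forall i, (i < C)%N -> forall u, nspan H i (H i * u) -> nspan H i u) ->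
  (forall i, (i < C)%N -> forall mu, exists sigma : {rmorphism T -> T},
    (forall u, ideal_add (nspan H i) (H i) u ->
       ideal_add (nspan H i) (H i ^+ mu.+1) (sigma u)) /\
    (forall u, ideal_add (nspan H i) (H i) (sigma u - u))) ->
  (forall i, (i < C)%N -> H i != 0) ->
  forall t (F : nat -> T), (forall i, (i < t)%N -> F i != 0) ->
  exists t' (G : nat -> T), (forall i, (i < t')%N -> G i != 0) /\
    forall s (z : coch T^o t), call (nspan H C : set T^o) (kd (pw F s.+1) z) ->
    exists z' : coch T^o t', forall r, kann (nspan H C) F s.+1 z r <->
      exists m y, r *: ktr (pw G m) z' = kd (pw G (s.+1 + m)) y.
Proof.
elim: C => [|C IH] nzd sec H0 t F F0.
  exists t, F; split=> // s z _; exists z => r.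
  have h0 (x : coch T^o t) : call (nspan H 0 : set T^o) x <-> x = 0.
    elim: t x {F0 z} => [|t IHt] x.
      by split=> [[c]|->]; [rewrite big_ord0|exists (fun=> 0); rewrite big_ord0].
    case: x => x y /=; split=> [[/IHt -> /IHt ->]|[-> ->]] //; split; exact/IHt.
  split=> [[m [y /h0/eqP]]|[m [y e]]]; exists m, y; last by apply/h0; rewrite e subrr.
  by apply/eqP; rewrite -subr_eq0.
have [||||t' [G [G0 hG]]] := IH _ _ _ t.+1 (consf (H C) F).
- by move=> i iC; apply: nzd; apply: ltnW.
- by move=> i iC; apply: sec; apply: ltnW.
- by move=> i iC; apply: H0; apply: ltnW.
- by case=> [|i] it; [apply: H0|apply: F0].
exists t', G; split=> // s z.
have -> : nspan H C.+1 = ideal_add (nspan H C) (H C).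
  by apply/seteqP; split=> u /nspanS.
move=> hz; have [z1 [hz1 e1]] :=
  koszul_one_step (nspan_ideal H C) (nzd C (ltnSn C)) (sec C (ltnSn C)) hz.
by have [z' hz'] := hG s z1 hz1; exists z' => r; rewrite -hz' e1.
Qed.

(** * The Rabinowitsch trick *)

Section Rabinowitsch.
Variable n : nat.
Notation S := {mpoly int[n]}.
Notation T := {mpoly int[n.+1]}.

Definition incl : S -> T := psub (@mpolyC n.+1 int) (fun i => 'X_(lift ord0 i)).
HB.instance Definition _ := GRing.RMorphism.on incl.

Lemma inclC c : incl c%:MP = c%:MP. Proof. exact: psubC. Qed.
Lemma inclX i : incl 'X_i = 'X_(lift ord0 i). Proof. exact: psubX. Qed.

Let derivX (m : nat) (i j : 'I_m) : ('X_i : {mpoly int[m]})^`M(j) = (i == j)%:R.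
Proof.
rewrite mderivX mnm1E; case: eqP => [->|_]; last by rewrite scale0r.
rewrite scale1r; have -> : (U_(j) - U_(j))%MM = 0%MM :> 'X_{1..m} by apply/mnmP => l;
  rewrite mnmBE mnm0E subnn.
by rewrite mpolyX0.
Qed.

Lemma incl_deriv0 u : (incl u)^`M(ord0) = 0.
Proof.
elim/mpoly_subring_ind: u => [c|i|u v hu hv|u v hu hv].
- by rewrite inclC mderivC.
- by rewrite inclX derivX.
- by rewrite (rmorphD incl) mderivD hu hv addr0.
by rewrite (rmorphM incl) mderivM hu hv mul0r mulr0 addr0.
Qed.

Lemma incl_deriv u j : (incl u)^`M(lift ord0 j) = incl u^`M(j).
Proof.
elim/mpoly_subring_ind: u => [c|i|u v hu hv|u v hu hv].
- by rewrite inclC !mderivC (rmorph0 incl).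
- by rewrite inclX !derivX (inj_eq lift_inj) (rmorph_nat incl).
- by rewrite (rmorphD incl) !mderivD (rmorphD incl) hu hv.
by rewrite (rmorphM incl) !mderivM (rmorphD incl) !(rmorphM incl) hu hv.
Qed.

Variables (g : S) (h : nat -> S).
Hypothesis g0 : g != 0.
Notation y := ('X_ord0 : T).
Definition rab (i : nat) : T := if i is l.+1 then incl (h l) else y * incl g - 1.
Notation H := rab.

Lemma rabinowitsch_clear (x : T) : exists N v q, incl g ^+ N * x = incl v + q * H 0.
Proof.
elim/mpoly_subring_ind: x => [c|i|u v [N [a [q e]]] [N' [a' [q' e']]]|
   u v [N [a [q e]]] [N' [a' [q' e']]]].
- by exists 0%N, c%:MP, 0; rewrite inclC mul1r mul0r addr0.
- case: (unliftP ord0 i) => [j|] ->.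
    by exists 0%N, 'X_j, 0; rewrite inclX mul1r mul0r addr0.
  by exists 1%N, 1, 1; rewrite (rmorph1 incl) /= expr1; ring.
- exists (N + N')%N, (g ^+ N' * a + g ^+ N * a'), (incl g ^+ N' * q + incl g ^+ N * q').
  rewrite (rmorphD incl) !(rmorphM incl) !(rmorphXn incl) exprD.
  have -> : incl g ^+ N * incl g ^+ N' * (u + v) =
    incl g ^+ N' * (incl g ^+ N * u) + incl g ^+ N * (incl g ^+ N' * v) by ring.
  by rewrite e e'; ring.
exists (N + N')%N, (a * a'), (incl a * q' + q * incl a' + q * q' * H 0).
rewrite (rmorphM incl) exprD mulrACA e e'; ring.
Qed.

(** Substituting 1/g for [y] kills y g - 1 and embeds the polynomials in their fraction field. *)
Lemma rabinowitsch_incl0 w q : incl w = q * H 0 -> w = 0.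
Proof.
move=> e; pose psi : {rmorphism T -> {fraction S}} :=
  psub (@tofrac S \o @mpolyC n int) (fun i => if unlift ord0 i is Some j then tofrac 'X_j else (tofrac g)^-1).
have psiE u : psi (incl u) = tofrac u.
  apply: (mpoly_rmorph_eq (f := psi \o incl) (g := @tofrac S)) u => [c|i] /=.
    by rewrite inclC; apply: psubC.
  by rewrite inclX; apply: etrans (psubX _ _ _) _; rewrite liftK.
have psiy : psi y = (tofrac g)^-1 by apply: etrans (psubX _ _ _) _; rewrite unlift_none.
apply: tofrac_inj; rewrite -psiE e (rmorphM psi) /rab (rmorphB psi) (rmorphM psi) psiy psiE.
by rewrite mulVf ?(rmorph1 psi) ?subrr ?mulr0 ?tofrac0 // tofrac_eq0.
Qed.

Lemma incl_inj : injective incl.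
Proof.
move=> u v e; apply/eqP; rewrite -subr_eq0; apply/eqP/(rabinowitsch_incl0 (q := 0)).
by transitivity (incl u - incl v); [exact: rmorphB|rewrite e subrr mul0r].
Qed.

Lemma rab0_deriv0 : (H 0)^`M(ord0) = incl g.
Proof.
by rewrite /rab mderivB mderivM incl_deriv0 mulr0 addr0 derivX eqxx mul1r -mpolyC1 mderivC subr0.
Qed.

Lemma rab0_neq0 : H 0 != 0.
Proof.
apply: contraNneq g0 => e; apply/eqP/incl_inj.
by rewrite -rab0_deriv0 e linear0 (rmorph0 incl).
Qed.

Let idH l : is_ideal (nspan H l) := nspan_ideal H l.

Lemma rabinowitsch_span l x : nspan H l.+1 x ->
  exists N v q, nspan h l v /\ incl g ^+ N * x = incl v + q * H 0.
Proof.
have [J0 JD JM] := nspan_ideal h l.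
move: x; apply: nspan_sub.
  split; first by exists 0%N, 0, 0; rewrite (rmorph0 incl) mulr0 mul0r addr0.
    move=> u v [N [a [q [ha e]]]] [N' [a' [q' [ha' e']]]].
    exists (N + N')%N, (g ^+ N' * a + g ^+ N * a'), (incl g ^+ N' * q + incl g ^+ N * q').
    split; first by apply: JD; apply: JM.
    rewrite (rmorphD incl) !(rmorphM incl) !(rmorphXn incl) exprD.
    have -> : incl g ^+ N * incl g ^+ N' * (u + v) =
      incl g ^+ N' * (incl g ^+ N * u) + incl g ^+ N * (incl g ^+ N' * v) by ring.
    by rewrite e e'; ring.
  move=> r u [N [a [q [ha e]]]]; have [N' [a' [q' e']]] := rabinowitsch_clear r.
  exists (N' + N)%N, (a' * a), (incl a' * q + q' * incl a + q' * q * H 0).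
  by split; [exact: JM|rewrite (rmorphM incl) exprD mulrACA e e'; ring].
case=> [|j] jl; first by exists 0%N, 0, 1; rewrite (rmorph0 incl) expr0; split=> //; ring.
exists 0%N, (h j), 0; split; first exact: nspan_mem.
by rewrite expr0 mul1r mul0r addr0.
Qed.

Lemma rabinowitsch_spanV l N v q x : nspan h l v -> incl g ^+ N * x = incl v + q * H 0 ->
  nspan H l.+1 x.
Proof.
move=> hv e; have [J0 JD JM] := idH l.+1.
have HJ : nspan H l.+1 (H 0) by apply: nspan_mem.
have yg M : exists q', (y * incl g) ^+ M = 1 + q' * H 0.
  elim: M => [|M [q' eM]]; first by exists 0; rewrite mul0r addr0.
  by exists (1 + q' * H 0 + q'); rewrite exprS eM /rab; ring.
have [q' e'] := yg N.
have -> : x = y ^+ N * (incl v + q * H 0) - q' * x * H 0.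
  rewrite -e mulrA -exprMn e'; ring.
apply: idealB => //; last exact: JM.
apply: (JM); apply: (JD); last exact: JM.
have [c ->] := hv; rewrite (rmorph_sum incl); apply: ideal_sum => // j _.
rewrite (rmorphM incl); apply: JM; apply: (@nspan_mem _ H l.+1 j.+1).
by rewrite ltnS.
Qed.

Lemma rabinowitsch_incl l v : nspan H l.+1 (incl v) <-> exists N, nspan h l (g ^+ N * v).
Proof.
split=> [/rabinowitsch_span[N [w [q [hw e]]]]|[N hv]]; last first.
  by apply: (rabinowitsch_spanV (N := N) (q := 0) hv);
    rewrite (rmorphM incl) (rmorphXn incl) mul0r addr0.
exists N; have e' : g ^+ N * v - w = 0.
  apply: (rabinowitsch_incl0 (q := q)).
  by rewrite (rmorphB incl) (rmorphM incl) (rmorphXn incl) e addrC addKr.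
by move/eqP: e'; rewrite subr_eq0 => /eqP ->.
Qed.

Variable c : nat.
Hypothesis h_reg : forall i, (i < c)%N -> forall u, nspan h i (h i * u) -> nspan h i (g * u).

(** A power of [g] brings the relation down to the polynomials without [y], where [h_reg] costs one
    more factor [g]; all these factors are units modulo y g - 1. *)
Lemma rabinowitsch_regular i : (i < c.+1)%N -> forall u, nspan H i (H i * u) -> nspan H i u.
Proof.
case: i => [_ u|i ic u].
  move=> [d]; rewrite big_ord0 => /eqP; rewrite mulf_eq0 (negbTE rab0_neq0) /= => /eqP ->.
  by case: (idH 0).
rewrite ltnS in ic; have [N [v [q e]]] := rabinowitsch_clear u.
have [J0 JD JM] := idH i.+1; have HJ : nspan H i.+1 (H 0) by apply: nspan_mem.
move=> hu; have : nspan H i.+1 (incl (h i * v)).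
  have -> : incl (h i * v) = incl g ^+ N * (H i.+1 * u) - incl (h i) * q * H 0.
    by change (H i.+1) with (incl (h i)); rewrite mulrCA e (rmorphM incl); ring.
  by apply: idealB => //; apply: JM.
move=> /rabinowitsch_incl[M]; rewrite mulrCA => /(h_reg ic) hv.
apply: (rabinowitsch_spanV (N := (M.+1 + N)%N) (q := incl g ^+ M.+1 * q) hv).
by rewrite exprD -mulrA e !(rmorphM incl) (rmorphXn incl) exprS; ring.
Qed.

Variable nu : 'I_n -> nat -> S.
Hypothesis h_jac : forall l l', (l < c)%N -> (l' < c)%N ->
  \sum_j (h l)^`M(j) * nu j l' = (l == l')%:R * g.

Lemma rabinowitsch_sections i : (i < c.+1)%N -> forall mu, exists sigma : {rmorphism T -> T},
    (forall u, ideal_add (nspan H i) (H i) u ->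
       ideal_add (nspan H i) (H i ^+ mu.+1) (sigma u)) /\
    (forall u, ideal_add (nspan H i) (H i) (sigma u - u)).
Proof.
move=> ic; pose tau l' := \sum_j y * incl g^`M(j) * (y * incl (nu j l')).
(* The Jacobian matrix is block triangular, with [g] in the corner, the row y dg beside it and that
   of [h] below. [nu'] inverts it modulo y g - 1, with [y] for 1/g, and [tau] clears the row beside
   the corner. *)
pose nu' (k : 'I_n.+1) (l : nat) : T := if unlift ord0 k is Some j then
   (if l is l'.+1 then y * incl (nu j l') else 0) else (if l is l'.+1 then - y * tau l' else y).
apply: (@jacobian_section _ _ H i nu') => l l' li l'i.
apply/nspanS; have [J0 JD JM] := idH i.+1.
have HJ : nspan H i.+1 (H 0) by apply: nspan_mem.
rewrite big_ord_recl /nu' unlift_none.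
under eq_bigr do rewrite liftK.
case: l li => [|l] li.
  have dj j : (H 0)^`M(lift ord0 j) = y * incl g^`M(j).
    by rewrite /rab mderivB mderivM incl_deriv derivX mul0r add0r -mpolyC1 mderivC subr0.
  rewrite rab0_deriv0; under eq_bigr do rewrite dj.
  case: l' l'i => [|l'] l'i.
    rewrite big1 => [|j _]; last by rewrite mulr0.
    by have -> : incl g * y + 0 - (0%N == 0%N)%:R = H 0 by rewrite /rab /=; ring.
  have -> : incl g * (- y * tau l') + tau l' - (0%N == l'.+1)%:R = - tau l' * H 0 by rewrite /rab /=; ring.
  exact: JM.
rewrite incl_deriv0 mul0r add0r; under eq_bigr do rewrite incl_deriv.
case: l' l'i => [|l'] l'i.
  by rewrite big1 => [|j _]; [rewrite subrr|rewrite mulr0].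
under eq_bigr do rewrite mulrCA -(rmorphM incl).
rewrite -mulr_sumr -(rmorph_sum incl) h_jac; [|exact: leq_trans li ic|exact: leq_trans l'i ic].
rewrite (rmorphM incl) (rmorph_nat incl) eqSS.
have -> : y * ((l == l')%:R * incl g) - (l == l')%:R = (l == l')%:R * H 0 by rewrite /rab; ring.
exact: JM.
Qed.

End Rabinowitsch.

Theorem chart_finite (R : comPzRingType) n t (f : {rmorphism {mpoly int[n]} -> R})
    (F : nat -> {mpoly int[n]}) k (H : lmodType R) (g : {mpoly int[n]}) :
  acc R -> (forall y, exists x, f x = y) -> (forall i, (i < t)%N -> F i != 0) ->
  is_local_cohomology (nspan (fun i => f (F i)) t) k (R^o)%R H -> chart f g ->
  finite_set [set P | Ass H P /\ ~ P (f g)].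
Proof.
move=> accR fs F0 hH [c [h [nu [fh heq hjac hreg]]]].
have fspan l x : (l <= c)%N -> nspan h l x -> f x = 0.
  move=> lc; move: x; apply: nspan_sub; first exact: ker_ideal.
  by move=> i il; apply: fh; apply: leq_trans il lc.
have [fg0|fg0] := pselect (f g = 0).
  apply: (sub_finite_set _ (finite_set0 _)) => P [[[[P0 _ _] _ _] _] Pg].
  by case: Pg; rewrite fg0.
have g0 : g != 0 by apply/eqP => e; apply: fg0; rewrite e rmorph0.
have h0 l : (l < c)%N -> h l != 0.
  move=> lc; apply/eqP => e; apply: fg0; rewrite -[g]mulr1; apply: (fspan l); first exact: ltnW.
  by apply: hreg => //; rewrite e mul0r; case: (nspan_ideal h l).
have injE := incl_inj h g0.
have E0 (u : {mpoly int[n]}) : u != 0 -> incl u != 0.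
  move=> u0; apply/eqP => e; case/eqP: u0; apply: (injE u 0); rewrite e; apply/esym.
  exact: (rmorph0 (@incl n)).
have [||||t' [G [G0 hG]]] := @koszul_descent _ (rab g h) c.+1 _ _ _ t (fun i => incl (F i)).
- exact: rabinowitsch_regular g0 _ hreg.
- exact: rabinowitsch_sections hjac.
- by case=> [|i] ic; [apply: rab0_neq0|apply: E0; apply: h0].
- by move=> i it; apply: E0; apply: F0.
have accS : acc {mpoly int[n]} by apply: acc_mpoly; apply: acc_int.
(* As [f] is onto, [P] is the image of its preimage, and that preimage is one of the annihilators
   counted over the ambient ring. *)
apply: sub_finite_set (finite_image (fun Q => f @` Q) (koszul_primes_finite accS (@incl n) G0)).
move=> P [AssP Pg]; have [prP _] := AssP.
have [s [z [dz hP]]] := Ass_local_cohomology accR hH AssP.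
have HJ := nspan_ideal (rab g h) c.+1.
have [|||z' [hz' eP]] := @transfer R _ _ f (@incl n) g _ HJ fs _ _ _ t F s z P prP Pg dz hP.
- by move=> u fu; apply: (rabinowitsch_incl h g0 c u).2; exists 1%N; rewrite expr1; apply: heq.
- by move=> u hu; have [N hN] := (rabinowitsch_incl h g0 c u).1 hu; exists N; apply: (fspan c).
- move=> x; have [N [v [q e]]] := rabinowitsch_clear g h x; exists N, v.
  by rewrite e addrC addKr mulrC; apply: idealMr => //; apply: nspan_mem.
have [z2 hz2] := hG s z' hz'.
exists (f @^-1` P); last first.
  by apply/seteqP; split=> [_ [x Px <-]|x Px] //; have [w ew] := fs x; exists w;
    rewrite // /preimage /= ew.
split.
  have [[P0 PD PM] P1 Ppr] := prP; split; [split| |]; rewrite /preimage /=.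
  - by rewrite rmorph0.
  - by move=> x y hx hy; rewrite rmorphD; apply: PD.
  - by move=> r x hx; rewrite rmorphM; apply: PM.
  - by rewrite rmorph1.
  by move=> x y; rewrite rmorphM; apply: Ppr.
exists s, z2; apply/seteqP; split=> r; rewrite /preimage /kann0 /=.
  by move=> /eP/hz2.
by move=> hr; apply/eP/hz2.
Qed.

Theorem theorem1p2 (R : comPzRingType) (phi : {rmorphism int -> R})
    (hR : smooth phi) (a : set R) (ha : is_ideal a) (k : nat)
    (H : lmodType R) (hH : is_local_cohomology a k (R^o)%R H) :
  finite_set (Ass H).
Proof.
have [[n [f [fC fs _]]] _ _] := hR.
have accS : acc {mpoly int[n]} by apply: acc_mpoly; apply: acc_int.
have accR : acc R := acc_surj fs accS.
(* Generators are taken nonzero so that their lifts [F i] are nonzero and can serve as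
   denominators. *)
have [t [x [xa0 xspan]]] := acc_fg accR [set x | a x /\ x <> 0].
have [F hF] := choice (fun i => fs (x i)).
have ea : a = nspan (fun i => f (F i)) t.
  have -> : (fun i => f (F i)) = x by apply/funext => i; apply: hF.
  apply/seteqP; split; last by apply: nspan_sub => // i it; case: (xa0 i it).
  move=> u au; have [->|u0] := pselect (u = 0); first by case: (nspan_ideal x t).
  exact: xspan.
have F0 i : (i < t)%N -> F i != 0.
  move=> it; have [_ x0] := xa0 i it; apply/eqP => e; apply: x0.
  by rewrite -hF e rmorph0.
rewrite ea in hH.
(* Every f(g) of a chart lies in the ideal of finitely many of them; a prime containing those would
   contain all, against [chart_cover]. *)
have [N [b [hb bspan]]] := acc_fg accR [set y | exists2 g, chart f g & y = f g].
have hb' i : exists g, (i < N)%N -> chart f g /\ b i = f g.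
  by have [/hb[g hg e]|_] := ltnP i N; [exists g|exists 0].
have [g hg] := choice hb'.
have fin : finite_set (\bigcup_(i in [set i | (i < N)%N]) [set P | Ass H P /\ ~ P (f (g i))]).
  apply: bigcup_finite; first exact: finite_II.
  by move=> i iN; apply: (chart_finite accR fs F0 hH); have [] := hg i iN.
apply: sub_finite_set fin => P AP; have [prP _] := AP.
apply: contrapT => hno; have [hP P1 _] := prP.
have [g' Pg' cg'] := chart_cover hR fC fs prP.
apply: Pg'; have : nspan b N (f g') by apply: bspan; exists g'.
move: (f g'); apply: nspan_sub => // i iN; apply: contrapT => Pb.
by apply: hno; exists i => //; split=> //; have [_ <-] := hg i iN.
Qed.
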